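(* Let $p$ be a prime and $(A,I,\gamma)$ a PD-pair where $A$ is an $\mathbb{F}_p$-algebra. The Frobenius map $\varphi_A:A\to A$ factors through $A\twoheadrightarrow A/I$, giving rise to a natural map $\varphi_{(A,I)}:A/I\to A$. Then for every animated $A/I$-algebra $R$ and every $i\in\mathbb{N}$, the $(-i)$-th associated graded piece of the conjugate filtration on the derived crystalline cohomology of $R$ relative to $(A,I,\gamma)$ is, as a $\varphi_{(A,I)}^*(R)$-module spectrum, equivalent to $$\varphi_{(A,I)}^*\Bigl(\bigwedge\nolimits_R^i L_{R/(A/I)}\Bigr)[-i].$$
   Context: $\varphi_{(A,I)}^*(-)=(-)\otimes^{\mathbb{L}}_{A/I,\varphi_{(A,I)}}A$; $L$ is the cotangent complex and $\bigwedge^i_R$ the derived exterior power. For a small category $\mathcal{C}$ with finite coproducts, $\mathcal{P}_\Sigma(\mathcal{C})\subseteq\operatorname{Fun}(\mathcal{C}^{\mathrm{op}},\operatorname{An})$ is the full subcategory of finite-product-preserving functors; a functor from $\mathcal{C}$ to an $\infty$-category with filtered colimits and geometric realizations extends essentially uniquely to its left derived functor on $\mathcal{P}_\Sigma(\mathcal{C})$, preserving filtered colimits and geometric realizations. The same applies to any projectively generated $\infty$-category. Animated PD-pairs over $\mathbb{F}_p$: $\operatorname{Pair}^{\gamma,\mathrm{an}}_{\mathbb{F}_p}=\mathcal{P}_\Sigma(\operatorname{Pair}^{\gamma,\mathrm{st}}_{\mathbb{F}_p})$ with $\operatorname{Pair}^{\gamma,\mathrm{st}}_{\mathbb{F}_p}$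 the category of PD-pairs $\Gamma_{\mathbb{F}_p[X]}(Y)\twoheadrightarrow\mathbb{F}_p[X]$, $X,Y$ finite sets of variables; its objects $(A\twoheadrightarrow A'',\gamma)$ have an underlying surjection of animated $\mathbb{F}_p$-algebras, and classical PD-pairs $(A,I,\gamma)$ with $A$ an $\mathbb{F}_p$-algebra embed fully faithfully. An animated ring $R$ gives the animated PD-pair $(\operatorname{id}_R,0)$. The Frobenius of $A$ factors functorially as $A\twoheadrightarrow A''\to A$ for all animated PD-pairs over $\mathbb{F}_p$. For a map of PD-pairs $(A,I,\gamma)\to(B,J,\delta)$, $\Omega^1_{(B,J)/(A,I)}$ is the module of PD-differentials (universal $A$-derivation $\mathrm d$ with $\mathrm d\delta_n(x)=\delta_{n-1}(x)\mathrm dx$ for $x\in J,n\ge1$) and $(\Omega^*_{(B,J)/(A,I)},\mathrm d)$ is the PD-de Rham complex, $\Omega^i=\bigwedge_B^i\Omega^1$. The $\infty$-category $\operatorname{dRCon}_{\mathbb{F}_p}=\operatorname{Fun}(\Delta^1,\operatorname{Pair}^{\gamma,\mathrm{an}}_{\mathbb{F}_p})$ is projectively generated by the maps $(\Gamma_{\mathbb{F}_p[X]}(Y)\twoheadrightarrow\mathbb{F}_p[X])\to(\Gamma_{\mathbb{F}_p[X,X']}(Y,Y')\twoheadrightarrow\mathbb{F}_p[X,X'])$. Derived de Rham cohomology $\operatorname{dR}_{(B\twoheadrightarrow B'')/(A\twoheadrightarrow A'')}$ is the left derived functor of the functor sending such a generator to the $\mathbb{E}_\infty$-algebra of its PD-de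 Rham complex. Conjugate filtration: on a generator $(A,I,\gamma)\to(B,J,\delta)$ the PD-de Rham complex is $\varphi_{(A,I)}^*(B/J)$-linear, and one takes the exhaustive nonpositive decreasing filtration by the Whitehead tower, $\operatorname{Fil}^{n}_{\mathrm{conj}}=\tau_{\ge n}\operatorname{dR}_{(B,J)/(A,I)}$ for $n\le0$, together with the map of filtered $\mathbb{E}_\infty$-algebras from the trivially filtered $\varphi_{(A,I)}^*(B/J)$; in general it is the left derived functor of this. The derived crystalline cohomology of an animated $A''$-algebra $R$ relative to $(A\twoheadrightarrow A'',\gamma)$ is $\operatorname{dR}_{(\operatorname{id}_R,0)/(A\twoheadrightarrow A'',\gamma)}$, with its conjugate filtration and $\varphi_{A\twoheadrightarrow A''}^*(R)$-algebra structure. *)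

(* Defs.v *)
From HB Require Import structures.
From mathcomp Require Import all_boot all_order all_algebra.

(* The infinity-categorical notions are presented by their standard simplicial
   models.
   - Animated rings and animated PD-pairs are simplicial commutative rings and
     simplicial PD-pairs, up to weak equivalence.
   - A left derived functor is computed on a simplicial resolution by free
     objects: apply the functor in each simplicial degree; the geometric
     realization of the result is its value.
   - Module spectra over the animated ring presented by S are cochain complexes
     of simplicial S-modules, up to the maps inducing an isomorphism on the
     homology of the (direct sum) total complex, which computes the geometric
     realization.
   All rings are unital and may be zero, hence comPzRingType. Tensor products,
   free algebras, modules of differentials and exterior powers are specified by
   their universal properties. *)

Set Implicit Arguments.
Unset Strict Implicit.
Unset Printing Implicit Defensive.

Import Order.TTheory GRing.Theory Num.Theory.
Local Open Scope ring_scope.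

(** * The simplex category *)

Definition monob m n (f : {ffun 'I_m.+1 -> 'I_n.+1}) : bool :=
  [forall i : 'I_m.+1, forall j : 'I_m.+1, (i <= j)%N ==> (f i <= f j)%N].

Record simplexMap m n :=
  SimplexMap { sfun :> {ffun 'I_m.+1 -> 'I_n.+1}; smono : monob sfun }.

Lemma monobP m n (f : {ffun 'I_m.+1 -> 'I_n.+1}) :
  reflect (forall i j : 'I_m.+1, (i <= j)%N -> (f i <= f j)%N) (monob f).
Proof.
apply: (iffP forallP) => [H i j ij | H i].
  by move/forallP/(_ j)/implyP: (H i); apply.
by apply/forallP => j; apply/implyP; apply: H.
Qed.

Lemma simplex_id_subproof n : monob [ffun i : 'I_n.+1 => i].
Proof. by apply/monobP => i j; rewrite !ffunE. Qed.

Definition simplex_id n := SimplexMap (simplex_id_subproof n).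

Lemma simplex_comp_subproof l m n (t : simplexMap m n) (u : simplexMap l m) :
  monob [ffun i => t (u i)].
Proof.
apply/monobP => i j ij; rewrite !ffunE.
exact/(monobP _ (smono t))/(monobP _ (smono u)).
Qed.

Definition simplex_comp l m n (t : simplexMap m n) (u : simplexMap l m) :=
  SimplexMap (simplex_comp_subproof t u).

Lemma coface_subproof n (a : 'I_n.+2) : monob [ffun i : 'I_n.+1 => lift a i].
Proof. by apply/monobP => i j ij; rewrite !ffunE /= leq_bump2. Qed.

Definition coface n (a : 'I_n.+2) : simplexMap n n.+1 :=
  SimplexMap (coface_subproof a).

(** * Simplicial commutative rings *)

Record sring := SRing {
  sr :> nat -> comPzRingType;
  sr_map : forall m n, simplexMap m n -> {rmorphism sr n -> sr m};
  sr_map_id : forall n (x : sr n), sr_map (simplex_id n) x = x;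
  sr_map_comp : forall l m n (t : simplexMap m n) (u : simplexMap l m) x,
    sr_map (simplex_comp t u) x = sr_map u (sr_map t x) }.

Record srMor (R S : sring) := SRMor {
  srm :> forall n, {rmorphism R n -> S n};
  srm_nat : forall m n (t : simplexMap m n) x,
    srm m (sr_map R t x) = sr_map S t (srm n x) }.

(* Boundary of the unnormalized chain complex of a simplicial abelian group. *)
Definition bdry (X : nat -> zmodType)
    (act : forall m n, simplexMap m n -> X n -> X m) n (x : X n.+1) : X n :=
  \sum_(a < n.+2) act n n.+1 (coface a) x *~ (-1) ^+ a.

Definition sr_bdry (R : sring) n : R n.+1 -> R n :=
  @bdry (fun k => R k : zmodType) (fun m k t => sr_map R t) n.

Definition sr_cycle (R : sring) n : R n -> Prop :=
  match n with 0%N => fun _ => True | n'.+1 => fun x => sr_bdry x = 0 end.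

(* A map of simplicial rings that is bijective on all homotopy groups. *)
Definition sr_weq (R S : sring) (f : srMor R S) : Prop :=
  forall n,
    (forall x : R n, sr_cycle x -> (exists z, f n x = sr_bdry z) ->
       exists z, x = sr_bdry z)
    /\ (forall y : S n, sr_cycle y ->
       exists x, sr_cycle x /\ exists z, y = f n x + sr_bdry z).

(* Simplicial k-algebras, presenting animated k-algebras. *)
Record sAlg (k : comPzRingType) := SAlg {
  sa_ring :> sring;
  sa_in : forall n, {rmorphism k -> sa_ring n};
  sa_in_nat : forall m n (t : simplexMap m n) x,
    sr_map sa_ring t (sa_in n x) = sa_in m x }.

(** * Modules over simplicial rings *)

Record smod (S : sring) := SMod {
  sm :> forall n, lmodType (S n);
  sm_map : forall m n, simplexMap m n -> sm n -> sm m;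
  sm_mapD : forall m n (t : simplexMap m n) x y,
    sm_map t (x + y) = sm_map t x + sm_map t y;
  sm_mapZ : forall m n (t : simplexMap m n) a x,
    sm_map t (a *: x) = sr_map S t a *: sm_map t x;
  sm_map_id : forall n (x : sm n), sm_map (simplex_id n) x = x;
  sm_map_comp : forall l m n (t : simplexMap m n) (u : simplexMap l m) x,
    sm_map (simplex_comp t u) x = sm_map u (sm_map t x) }.

(* Cochain complexes of simplicial modules. Cohomological degrees are
   nonnegative; the simplicial direction supplies the homological degrees. *)
Record scpx (S : sring) := SCpx {
  sc :> nat -> smod S;
  sc_d : forall j n, {linear sc j n -> sc j.+1 n};
  sc_d_nat : forall j m n (t : simplexMap m n) (x : sc j n),
    sc_d j m (sm_map t x) = sm_map t (sc_d j n x);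
  sc_dd : forall j n (x : sc j n), sc_d j.+1 n (sc_d j n x) = 0 }.

Record scMor (S : sring) (C D : scpx S) := SCMor {
  scm :> forall j n, {linear C j n -> D j n};
  scm_nat : forall j m n (t : simplexMap m n) (x : C j n),
    scm j m (sm_map t x) = sm_map t (scm j n x);
  scm_d : forall j n (x : C j n), scm j.+1 n (sc_d C j n x) = sc_d D j n (scm j n x) }.

(* The total complex of C, graded by n - j: its elements are the finitely
   supported families. Since tot_d is homogeneous, the homology of the ungraded
   differential group below is the direct sum of the homology groups. *)
Definition tot_family (S : sring) (C : scpx S) := forall n j, C j n.

Definition tot_finsupp (S : sring) (C : scpx S) (x : tot_family C) : Prop :=
  exists N, forall n j, (N <= n)%N || (N <= j)%N -> x n j = 0.

Definition tot_d (S : sring) (C : scpx S) (x : tot_family C) : tot_family C :=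
  fun n j =>
    @bdry (fun k => C j k : zmodType) (@sm_map S (C j)) n (x n.+1 j)
    + match j return C j n with
      | 0%N => 0
      | j'.+1 => sc_d C j' n (x n j') *~ (-1) ^+ n
      end.

Definition tot_cycle (S : sring) (C : scpx S) (x : tot_family C) : Prop :=
  tot_finsupp x /\ forall n j, tot_d x n j = 0.

Definition sc_qis (S : sring) (C D : scpx S) (f : scMor C D) : Prop :=
  (forall x : tot_family C, tot_cycle x ->
     (exists z : tot_family D,
        tot_finsupp z /\ forall n j, f j n (x n j) = tot_d z n j) ->
     exists z : tot_family C, tot_finsupp z /\ forall n j, x n j = tot_d z n j)
  /\ (forall y : tot_family D, tot_cycle y ->
     exists x : tot_family C, tot_cycle x /\
     exists z : tot_family D, tot_finsupp z /\
       forall n j, y n j = f j n (x n j) + tot_d z n j).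

(* Equivalence of the presented module spectra: a zigzag of
   quasi-isomorphisms. *)
Inductive sc_equiv (S : sring) : scpx S -> scpx S -> Prop :=
| sc_equiv_refl C : sc_equiv C C
| sc_equiv_fwd C D E (f : scMor C D) : sc_qis f -> sc_equiv D E -> sc_equiv C E
| sc_equiv_bwd C D E (f : scMor D C) : sc_qis f -> sc_equiv D E -> sc_equiv C E.

(** ** Restriction of scalars *)

Definition res (S B : comPzRingType) (f : {rmorphism S -> B})
  (M : lmodType B) : Type := M.

Section Res.
Variables (S B : comPzRingType) (f : {rmorphism S -> B}) (M : lmodType B).
HB.instance Definition _ := GRing.Zmodule.on (res f M).
Definition res_scale (a : S) (x : res f M) : res f M := f a *: (x : M).
Fact res_scaleA a b x : res_scale a (res_scale b x) = res_scale (a * b) x.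
Proof. by rewrite /res_scale scalerA rmorphM. Qed.
Fact res_scale1 : left_id 1 res_scale.
Proof. by move=> x; rewrite /res_scale rmorph1 scale1r. Qed.
Fact res_scaleDr : right_distributive res_scale +%R.
Proof. by move=> a x y; rewrite /res_scale scalerDr. Qed.
Fact res_scaleDl x : {morph res_scale^~ x : a b / a + b}.
Proof. by move=> a b; rewrite /res_scale rmorphD scalerDl. Qed.
HB.instance Definition _ := GRing.Zmodule_isLmodule.Build S (res f M)
  res_scaleA res_scale1 res_scaleDr res_scaleDl.
End Res.

Section SMRes.
Variables (S B : sring) (f : srMor S B) (M : smod B).
Let rM n : lmodType (S n) := res (f n) (M n).
Let act m n (t : simplexMap m n) : rM n -> rM m := @sm_map B M m n t.
Fact sm_resZ m n (t : simplexMap m n) a (x : rM n) :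
  act t (a *: x) = sr_map S t a *: act t x.
Proof.
rewrite [RHS](_ : _ = f m (sr_map S t a) *: sm_map t (x : M n)) // srm_nat.
exact: sm_mapZ.
Qed.
Definition sm_res : smod S :=
  @SMod S rM act (@sm_mapD B M) sm_resZ (@sm_map_id B M) (@sm_map_comp B M).
End SMRes.

(** ** Subcomplexes *)

Record scSub (S : sring) (C : scpx S) := SCSub {
  ss : forall j n, pred (C j n);
  ss_closed : forall j n, submod_closed (@ss j n);
  ss_map : forall j m n (t : simplexMap m n) (x : C j n),
    ss x -> ss (sm_map t x);
  ss_d : forall j n (x : C j n), ss x -> ss (sc_d C j n x) }.

Section Subcomplex.
Variables (S : sring) (C : scpx S) (U : scSub C).

Section Component.
Variables (j n : nat).
Definition ss_pred : pred (C j n) := @ss S C U j n.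
HB.instance Definition _ :=
  GRing.isSubmodClosed.Build (S n) (C j n) ss_pred (ss_closed U j n).
Record ss_elt := SsElt { ss_val : C j n; ss_valP : ss_val \in ss_pred }.
HB.instance Definition _ := [isSub for ss_val].
HB.instance Definition _ := [Choice of ss_elt by <:].
HB.instance Definition _ := [SubChoice_isSubLmodule of ss_elt by <:].
End Component.

Definition ss_act j m n (t : simplexMap m n) (x : ss_elt j n) : ss_elt j m :=
  SsElt (@ss_map S C U j m n t (ss_val x) (ss_valP x)).

Fact ss_actD j m n (t : simplexMap m n) (x y : ss_elt j n) :
  ss_act t (x + y) = ss_act t x + ss_act t y.
Proof. by apply: val_inj; rewrite /= sm_mapD. Qed.
Fact ss_actZ j m n (t : simplexMap m n) a (x : ss_elt j n) :
  ss_act t (a *: x) = sr_map S t a *: ss_act t x.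
Proof. by apply: val_inj; rewrite /= sm_mapZ. Qed.
Fact ss_act_id j n (x : ss_elt j n) : ss_act (simplex_id n) x = x.
Proof. by apply: val_inj; rewrite /= sm_map_id. Qed.
Fact ss_act_comp j l m n (t : simplexMap m n) (u : simplexMap l m)
  (x : ss_elt j n) : ss_act (simplex_comp t u) x = ss_act u (ss_act t x).
Proof. by apply: val_inj; rewrite /= sm_map_comp. Qed.

Definition ss_mod j : smod S :=
  @SMod S (ss_elt j) (@ss_act j) (@ss_actD j) (@ss_actZ j)
    (@ss_act_id j) (@ss_act_comp j).

Definition ss_diff j n (x : ss_mod j n) : ss_mod j.+1 n :=
  SsElt (@ss_d S C U j n (ss_val x) (ss_valP x)).
Fact ss_diff_is_linear j n : linear (@ss_diff j n).
Proof. by move=> a x y; apply: val_inj; rewrite /= linearP. Qed.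
HB.instance Definition _ j n :=
  GRing.isLinear.Build (S n) (ss_mod j n) (ss_mod j.+1 n) *:%R
    (@ss_diff j n) (@ss_diff_is_linear j n).

Fact ss_diff_nat j m n (t : simplexMap m n) (x : ss_mod j n) :
  ss_diff (sm_map t x) = sm_map t (ss_diff x).
Proof. by apply: val_inj; rewrite /= sc_d_nat. Qed.
Fact ss_diff_diff j n (x : ss_mod j n) : ss_diff (ss_diff x) = 0.
Proof. by apply: val_inj; rewrite /= sc_dd. Qed.

Definition subcpx : scpx S :=
  @SCpx S ss_mod (fun j n => @ss_diff j n) ss_diff_nat ss_diff_diff.
End Subcomplex.

(** ** The Whitehead tower and its graded pieces *)

Section Whitehead.
Variables (S : sring) (C : scpx S) (n : int).

(* Cohomological degree j is homological degree - j. *)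
Definition whitehead_pred j k (x : C j k) : bool :=
  if (n < - j%:Z) then true
  else if n == - j%:Z then sc_d C j k x == 0
  else x == 0.

Fact whitehead_closed j k : submod_closed (@whitehead_pred j k).
Proof.
rewrite /whitehead_pred; split=> [|a x y]; rewrite !unfold_in.
  by case: ifP => // _; case: ifP => _; rewrite ?linear0 eqxx.
case: ifP => // _; case: ifP => _ /eqP Hx /eqP Hy.
  by rewrite linearP Hx Hy scaler0 addr0.
by rewrite Hx Hy scaler0 addr0.
Qed.

Fact sm_map0 (M : smod S) l m (t : simplexMap l m) :
  sm_map t (0 : M m) = 0.
Proof. by rewrite -(scale0r (0 : M m)) sm_mapZ rmorph0 scale0r. Qed.

Fact whitehead_map j l m (t : simplexMap l m) (x : C j m) :
  whitehead_pred x -> whitehead_pred (sm_map t x).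
Proof.
rewrite /whitehead_pred; case: ifP => // _; case: ifP => _ /eqP Hx.
  by rewrite sc_d_nat Hx sm_map0.
by rewrite Hx sm_map0.
Qed.

Fact whitehead_d j k (x : C j k) :
  whitehead_pred x -> whitehead_pred (sc_d C j k x).
Proof.
rewrite /whitehead_pred sc_dd eqxx.
case: (boolP (n < - j%:Z)) => [jn _ | _].
  have : n <= - j.+1%:Z.
    by rewrite -addn1 PoszD opprD lerBrDr lezD1.
  by rewrite le_eqVlt => /orP[] ->; rewrite ?if_same.
by case: ifP => _ /eqP Hx; rewrite Hx ?linear0 eqxx !if_same.
Qed.

(* tau_{>= n} C, taken in each simplicial degree. *)
Definition whitehead : scSub C :=
  SCSub whitehead_closed whitehead_map whitehead_d.
End Whitehead.

(* G = tau_{>= n} C / tau_{>= n+1} C in each simplicial degree; as the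
   inclusion is injective, this quotient is the cofiber. *)
Record whiteheadGr (S : sring) (C : scpx S) (n : int) := WhiteheadGr {
  wg_cpx :> scpx S;
  wg_proj : scMor (subcpx (whitehead C n)) wg_cpx;
  wg_surj : forall j k (y : wg_cpx j k), exists x, wg_proj j k x = y;
  wg_ker : forall j k (x : subcpx (whitehead C n) j k),
    wg_proj j k x = 0 <-> whitehead_pred (n + 1) (ss_val x) }.

(** ** A simplicial module placed in cohomological degree i *)

Section Shift.
Variables (S : sring) (M : smod S) (i : nat).

Fact const_cpx_nat (j m n : nat) (t : simplexMap m n) (x : M n) :
  (\0 : M m -> M m) (sm_map t x) = sm_map t ((\0 : M n -> M n) x).
Proof. by rewrite /= sm_map0. Qed.

Definition const_cpx : scpx S :=
  @SCpx S (fun _ => M) (fun j n => (\0 : {linear M n -> M n}))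
    const_cpx_nat (fun j n x => erefl).

Definition shift_pred j n (x : const_cpx j n) : bool := (j == i) || (x == 0).

Fact shift_closed j n : submod_closed (@shift_pred j n).
Proof.
rewrite /shift_pred; split=> [|a x y]; rewrite !unfold_in ?eqxx ?orbT //.
by case: (j == i) => //= /eqP -> /eqP ->; rewrite scaler0 addr0.
Qed.
Fact shift_map j m n (t : simplexMap m n) (x : const_cpx j n) :
  shift_pred x -> shift_pred (sm_map t x).
Proof.
by rewrite /shift_pred; case: (j == i) => //= /eqP ->; rewrite sm_map0.
Qed.
Fact shift_d j n (x : const_cpx j n) :
  shift_pred x -> shift_pred (sc_d const_cpx j n x).
Proof. by rewrite /shift_pred eqxx orbT. Qed.

(* M[-i]: the complex with M in degree i and 0 elsewhere. *)
Definition shift_cpx : scpx S := subcpx (SCSub shift_closed shift_map shift_d).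
End Shift.

(** * Universal constructions *)

(* T = L (x)_K M as a commutative ring. *)
Definition is_tensor (K L M T : comPzRingType)
    (i : {rmorphism K -> L}) (j : {rmorphism K -> M})
    (u : {rmorphism L -> T}) (v : {rmorphism M -> T}) : Prop :=
  (forall c, u (i c) = v (j c)) /\
  forall (W : comPzRingType) (f : {rmorphism L -> W}) (g : {rmorphism M -> W}),
    (forall c, f (i c) = g (j c)) ->
    exists2 h : {rmorphism T -> W},
      (forall x, h (u x) = f x) /\ (forall y, h (v y) = g y) &
      forall h' : {rmorphism T -> W},
        (forall x, h' (u x) = f x) -> (forall y, h' (v y) = g y) -> h' =1 h.

Definition is_polynomial (k Q : comPzRingType) (f : {rmorphism k -> Q}) : Prop :=
  exists (X : Type) (x : X -> Q),
    forall (W : comPzRingType) (g : {rmorphism k -> W}) (y : X -> W),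
    exists2 h : {rmorphism Q -> W},
      (forall c, h (f c) = g c) /\ (forall s, h (x s) = y s) &
      forall h' : {rmorphism Q -> W},
        (forall c, h' (f c) = g c) -> (forall s, h' (x s) = y s) -> h' =1 h.

(* D : B -> M is initial among the maps to B-modules with the property P. *)
Definition is_initial_map (B : comPzRingType)
    (P : forall M : lmodType B, (B -> M) -> Prop)
    (M : lmodType B) (D : B -> M) : Prop :=
  P M D /\ forall (N : lmodType B) (E : B -> N), P N E ->
    exists2 h : {linear M -> N}, forall x, h (D x) = E x &
      forall h' : {linear M -> N}, (forall x, h' (D x) = E x) -> h' =1 h.

Definition is_derivation (A B : comPzRingType) (f : {rmorphism A -> B})
    (M : lmodType B) (D : B -> M) : Prop :=
  [/\ forall x y, D (x + y) = D x + D y,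
      forall x y, D (x * y) = x *: D y + y *: D x &
      forall a, D (f a) = 0].

Section Exterior.
Variables (B : comPzRingType) (M : lmodType B) (i : nat).

Definition ff_upd (x : {ffun 'I_i -> M}) (k : 'I_i) (y : M) : {ffun 'I_i -> M} :=
  [ffun l => if l == k then y else x l].

Definition is_alternating (E : lmodType B) (w : {ffun 'I_i -> M} -> E) : Prop :=
  (forall x k a y z,
     w (ff_upd x k (a *: y + z)) = a *: w (ff_upd x k y) + w (ff_upd x k z)) /\
  (forall (x : {ffun 'I_i -> M}) k l, k != l -> x k = x l -> w x = 0).

Definition is_exterior_power (E : lmodType B) (w : {ffun 'I_i -> M} -> E) : Prop :=
  is_alternating w /\
  forall (N : lmodType B) (v : {ffun 'I_i -> M} -> N), is_alternating v ->
    exists2 h : {linear E -> N}, forall x, h (w x) = v x &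
      forall h' : {linear E -> N}, (forall x, h' (w x) = v x) -> h' =1 h.
End Exterior.

(* The i-th exterior power of a simplicial module; it computes the derived
   exterior power when M is levelwise free. *)
Record extPower (S : sring) (M : smod S) (i : nat) := ExtPower {
  ep_mod :> smod S;
  ep_w : forall n, {ffun 'I_i -> M n} -> ep_mod n;
  ep_univ : forall n, is_exterior_power (@ep_w n);
  ep_nat : forall m n (t : simplexMap m n) (x : {ffun 'I_i -> M n}),
    sm_map t (ep_w x) = ep_w [ffun k => sm_map t (x k)] }.

(* M (x)_S T; it computes the derived base change when M is levelwise free. *)
Record baseChange (S T : sring) (f : srMor S T) (M : smod S) := BaseChange {
  bc_mod :> smod T;
  bc_in : forall n, {linear M n -> res (f n) (bc_mod n)};
  bc_univ : forall n (N : lmodType (T n)) (g : {linear M n -> res (f n) N}),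
    exists2 h : {linear bc_mod n -> N}, forall x, h (bc_in n x) = g x &
      forall h' : {linear bc_mod n -> N},
        (forall x, h' (bc_in n x) = g x) -> h' =1 h;
  bc_nat : forall m n (t : simplexMap m n) (x : M n),
    bc_in m (sm_map t x) = sm_map t (bc_in n x : bc_mod n) }.

(** * PD-pairs over F_p *)

(* Berthelot's axioms; only the values of g on the ideal I matter. *)
Record is_pd_structure (A : comPzRingType) (I : A -> Prop) (g : nat -> A -> A) :
    Prop := IsPDStructure {
  pd_g0 : forall x, I x -> g 0%N x = 1;
  pd_g1 : forall x, I x -> g 1%N x = x;
  pd_gI : forall n x, I x -> I (g n.+1 x);
  pd_gD : forall n x y, I x -> I y ->
    g n (x + y) = \sum_(k < n.+1) g k x * g (n - k)%N y;
  pd_gZ : forall n a x, I x -> g n (a * x) = a ^+ n * g n x;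
  pd_gM : forall m n x, I x -> g m x * g n x = g (m + n)%N x *+ 'C(m + n, m);
  pd_gC : forall m n x, I x ->
    g m (g n.+1 x) =
      g (m * n.+1)%N x *+ ((m * n.+1)`! %/ (m`! * n.+1`! ^ m))%N }.

(* A PD-pair (A, I, gamma) is given by the surjection A ->> A/I. *)
Record pdPair (p : nat) := PDPair {
  pd_ring : comPzRingType;
  pd_quo : comPzRingType;
  pd_pi : {rmorphism pd_ring -> pd_quo};
  pd_surj : forall y, exists x, pd_pi x = y;
  pd_char : p%:R = 0 :> pd_ring;
  pd_gamma : nat -> pd_ring -> pd_ring;
  pd_gammaP : is_pd_structure (fun x => pd_pi x = 0) pd_gamma }.

Arguments pd_gamma {p} P n x : rename.

Record pdMor p (P Q : pdPair p) := PDMor {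
  pm_ring :> {rmorphism pd_ring P -> pd_ring Q};
  pm_quo : {rmorphism pd_quo P -> pd_quo Q};
  pm_pi : forall x, pm_quo (pd_pi P x) = pd_pi Q (pm_ring x);
  pm_gamma : forall n x, pd_pi P x = 0 ->
    pm_ring (pd_gamma P n x) = pd_gamma Q n (pm_ring x) }.

Fact char_expD (A : comPzRingType) p (x y : A) :
  prime p -> p%:R = 0 :> A -> (x + y) ^+ p = x ^+ p + y ^+ p.
Proof.
case: p => // q pr_q q0; rewrite exprDn big_ord_recr big_ord_recl /=.
rewrite subn0 subnn !expr0 bin0 binn !mulr1n mulr1 mul1r.
rewrite big1 ?addr0 // => i _; rewrite -mulr_natr.
have /dvdnP [r ->] : (q.+1 %| 'C(q.+1, bump 0 i))%N.
  by rewrite prime_dvd_bin // /bump /= add1n ltnS ltn_ord.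
by rewrite natrM q0 !mulr0.
Qed.

Section Frobenius.
Variables (p : nat) (p_pr : prime p) (P : pdPair p).
Local Notation A := (pd_ring P).
Local Notation pi := (pd_pi P).

Fact pd_lift_ex y : exists x, pi x == y.
Proof. by case: (pd_surj y) => x <-; exists x. Qed.

(* The Frobenius of A factored through A ->> A/I. *)
Definition pd_frob (y : pd_quo P) : A := xchoose (pd_lift_ex y) ^+ p.

Fact pd_exp_gamma x n : pi x = 0 -> x ^+ n = pd_gamma P n x *+ n`!.
Proof.
move=> Ix; have G := pd_gammaP P.
elim: n => [|n IHn]; first by rewrite (pd_g0 G).
rewrite exprS IHn -{1}(pd_g1 G Ix) mulrnAr (pd_gM G) // -mulrnA add1n bin1.
by rewrite factS mulnC.
Qed.

Fact pd_ideal_exp x : pi x = 0 -> x ^+ p = 0.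
Proof.
move=> /pd_exp_gamma ->; rewrite -mulr_natr.
have /dvdnP [q ->] : (p %| p`!)%N by rewrite dvdn_fact // prime_gt0 //=.
by rewrite natrM pd_char !mulr0.
Qed.

Fact pd_expD (x y : A) : (x + y) ^+ p = x ^+ p + y ^+ p.
Proof. exact/char_expD/pd_char. Qed.

Lemma pd_frobE x : pd_frob (pi x) = x ^+ p.
Proof.
rewrite /pd_frob; have /eqP := xchooseP (pd_lift_ex (pi x)).
set z := xchoose _ => zx; rewrite -[z](subrK x) pd_expD pd_ideal_exp ?add0r //.
by rewrite rmorphB zx subrr.
Qed.

Fact pd_frob_is_nmod : nmod_morphism pd_frob.
Proof.
split=> [|y z].
  by rewrite -(rmorph0 pi) pd_frobE expr0n eqn0Ngt prime_gt0.
case: (pd_surj y) (pd_surj z) => x <- [t <-].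
by rewrite -rmorphD !pd_frobE pd_expD.
Qed.
Fact pd_frob_is_monoid : monoid_morphism pd_frob.
Proof.
split=> [|y z]; first by rewrite -(rmorph1 pi) pd_frobE expr1n.
case: (pd_surj y) (pd_surj z) => x <- [t <-].
by rewrite -rmorphM !pd_frobE exprMn.
Qed.
HB.instance Definition _ :=
  GRing.isNmodMorphism.Build (pd_quo P) A pd_frob pd_frob_is_nmod.
HB.instance Definition _ :=
  GRing.isMonoidMorphism.Build (pd_quo P) A pd_frob pd_frob_is_monoid.
Definition pd_frobm : {rmorphism pd_quo P -> A} := pd_frob.
End Frobenius.

(* B is the free PD-pair over A on variables X in the ring and Y in the ideal:
   for A = (Gamma_k(Y0) ->> k) this is Gamma_{k[X]}(Y0, Y) ->> k[X]. *)
Definition is_pd_free_over p (A B : pdPair p) (f : pdMor A B) : Prop :=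
  exists (X Y : Type) (x : X -> pd_ring B) (y : Y -> pd_ring B),
  (forall s, pd_pi B (y s) = 0) /\
  forall (W : pdPair p) (g : pdMor A W)
         (x' : X -> pd_ring W) (y' : Y -> pd_ring W),
    (forall s, pd_pi W (y' s) = 0) ->
    exists2 h : pdMor B W,
      [/\ forall a, h (f a) = g a, forall s, h (x s) = x' s &
          forall s, h (y s) = y' s] &
      forall h' : pdMor B W,
        (forall a, h' (f a) = g a) -> (forall s, h' (x s) = x' s) ->
        (forall s, h' (y s) = y' s) -> h' =1 h.

(* B is Gamma_{F_p[X]}(Y) ->> F_p[X], the free PD-pair over F_p on X and Y. *)
Definition is_pd_free p (B : pdPair p) : Prop :=
  exists (X Y : Type) (x : X -> pd_ring B) (y : Y -> pd_ring B),
  (forall s, pd_pi B (y s) = 0) /\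
  forall (W : pdPair p) (x' : X -> pd_ring W) (y' : Y -> pd_ring W),
    (forall s, pd_pi W (y' s) = 0) ->
    exists2 h : pdMor B W,
      (forall s, h (x s) = x' s) /\ (forall s, h (y s) = y' s) &
      forall h' : pdMor B W,
        (forall s, h' (x s) = x' s) -> (forall s, h' (y s) = y' s) -> h' =1 h.

Definition is_pd_derivation p (A B : pdPair p) (f : pdMor A B)
    (M : lmodType (pd_ring B)) (D : pd_ring B -> M) : Prop :=
  is_derivation f D /\
  forall n x, pd_pi B x = 0 -> D (pd_gamma B n.+1 x) = pd_gamma B n x *: D x.

(* The PD-pair (id_R, 0). *)
Section Trivial.
Variables (p : nat) (R : comPzRingType) (Rp : p%:R = 0 :> R).
Fact pd_triv_surj (y : R) : exists x, (idfun : {rmorphism R -> R}) x = y.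
Proof. by exists y. Qed.
Fact pd_trivP :
  is_pd_structure (fun x => (idfun : {rmorphism R -> R}) x = 0)
    (fun n x => if n == 0%N then 1 else if n == 1%N then x else 0).
Proof.
split=> //=.
- by move=> [|n] x ->.
- move=> n x y -> ->; rewrite addr0 big_ord_recl /= big1 => [|i _].
    by rewrite addr0 mul1r subn0.
  by case: ifP => _; rewrite mul0r.
- move=> [|[|n]] a x ->; by rewrite ?expr0 ?mulr1 ?mulr0 ?expr1.
- move=> [|m] [|n] x -> //=.
  + by rewrite mulr1 bin0.
  + by rewrite mul1r add0n bin0.
  + by rewrite addn0 mulr1 binn.
  + by rewrite addSn addnS /=; case: ifP => _; rewrite mul0r mul0rn.
- move=> [|m] n x -> /=; first by rewrite mul0n expn0 fact0.
  by rewrite !if_same mul0rn.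
Qed.
Definition pd_triv : pdPair p := PDPair pd_triv_surj Rp pd_trivP.
End Trivial.

(** * Simplicial PD-pairs *)

Record sPDPair (p : nat) := SPDPair {
  sp :> nat -> pdPair p;
  sp_map : forall m n, simplexMap m n -> pdMor (sp n) (sp m);
  sp_map_id : forall n x, sp_map (simplex_id n) x = x;
  sp_map_comp : forall l m n (t : simplexMap m n) (u : simplexMap l m) x,
    sp_map (simplex_comp t u) x = sp_map u (sp_map t x) }.

Section SPDRings.
Variables (p : nat) (P : sPDPair p).
Definition sp_ring : sring :=
  @SRing (fun n => pd_ring (P n)) (fun m n t => sp_map P t)
    (@sp_map_id p P) (@sp_map_comp p P).
Fact sp_quo_id n x : pm_quo (sp_map P (simplex_id n)) x = x.
Proof. by case: (pd_surj x) => y <-; rewrite pm_pi sp_map_id. Qed.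
Fact sp_quo_comp l m n (t : simplexMap m n) (u : simplexMap l m) x :
  pm_quo (sp_map P (simplex_comp t u)) x
  = pm_quo (sp_map P u) (pm_quo (sp_map P t) x).
Proof. by case: (pd_surj x) => y <-; rewrite !pm_pi sp_map_comp. Qed.
Definition sp_quo : sring :=
  @SRing (fun n => pd_quo (P n)) (fun m n t => pm_quo (sp_map P t))
    sp_quo_id sp_quo_comp.
End SPDRings.

Record sPDMor p (P Q : sPDPair p) := SPDMor {
  spm :> forall n, pdMor (P n) (Q n);
  spm_nat : forall m n (t : simplexMap m n) x,
    spm m (sp_map P t x) = sp_map Q t (spm n x) }.

Section SPDMorRings.
Variables (p : nat) (P Q : sPDPair p) (f : sPDMor P Q).
Definition spm_ring : srMor (sp_ring P) (sp_ring Q) :=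
  @SRMor (sp_ring P) (sp_ring Q) (fun n => f n) (@spm_nat p P Q f).
Fact spm_quo_nat m n (t : simplexMap m n) x :
  pm_quo (f m) (pm_quo (sp_map P t) x) = pm_quo (sp_map Q t) (pm_quo (f n) x).
Proof. by case: (pd_surj x) => y <-; rewrite !pm_pi spm_nat. Qed.
Definition spm_quo : srMor (sp_quo P) (sp_quo Q) :=
  @SRMor (sp_quo P) (sp_quo Q) (fun n => pm_quo (f n)) spm_quo_nat.
End SPDMorRings.

Section Constant.
Variables (p : nat) (P : pdPair p).
Definition pd_id : pdMor P P :=
  @PDMor p P P idfun idfun (fun _ => erefl) (fun _ _ _ => erefl).
Definition spd_const : sPDPair p :=
  @SPDPair p (fun _ => P) (fun m n t => pd_id) (fun _ _ => erefl)
    (fun _ _ _ _ _ _ => erefl).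
(* The structure map of a simplicial A/I-algebra. *)
Definition sa_const_mor (R : sAlg (pd_quo P)) : srMor (sp_quo spd_const) R :=
  @SRMor (sp_quo spd_const) R (@sa_in _ R)
    (fun m n t x => esym (sa_in_nat R t x)).
Fact sa_char (R : sAlg (pd_quo P)) n : p%:R = 0 :> R n.
Proof. by rewrite -(rmorph_nat (sa_in R n)) -(rmorph_nat (pd_pi P)) pd_char !rmorph0. Qed.
End Constant.

Section STrivial.
Variables (p : nat) (R : sring) (Rp : forall n, p%:R = 0 :> R n).
Fact spd_triv_gamma m n (t : simplexMap m n) k x :
  pd_pi (pd_triv (Rp n)) x = 0 ->
  sr_map R t (pd_gamma (pd_triv (Rp n)) k x)
  = pd_gamma (pd_triv (Rp m)) k (sr_map R t x).
Proof. by move=> _ /=; case: k => [|[|k]] /=; rewrite ?rmorph1 ?rmorph0. Qed.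
Definition spd_triv_map m n (t : simplexMap m n) :
    pdMor (pd_triv (Rp n)) (pd_triv (Rp m)) :=
  @PDMor p (pd_triv (Rp n)) (pd_triv (Rp m)) (sr_map R t) (sr_map R t)
    (fun _ => erefl) (spd_triv_gamma t).
Definition spd_triv : sPDPair p :=
  @SPDPair p (fun n => pd_triv (Rp n)) spd_triv_map (@sr_map_id R)
    (@sr_map_comp R).
End STrivial.

Definition spd_weq p (P Q : sPDPair p) (f : sPDMor P Q) : Prop :=
  sr_weq (spm_ring f) /\ sr_weq (spm_quo f).

(** * Derived crystalline cohomology *)

(* A simplicial resolution of the map of animated PD-pairs
   (A ->> A/I, gamma) -> (id_R, 0) by free objects of dRCon. The sets of
   variables may be infinite: such free objects are the filtered colimits of
   the finite ones along inclusions of variables, which left derived functors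
   and the PD-de Rham complex both preserve. *)
Record crysResolution p (P : pdPair p) (R : sAlg (pd_quo P)) := CrysResolution {
  cr_base : sPDPair p;
  cr_tot : sPDPair p;
  cr_str : sPDMor cr_base cr_tot;
  cr_base_free : forall n, is_pd_free (cr_base n);
  cr_tot_free : forall n, is_pd_free_over (cr_str n);
  cr_base_aug : sPDMor cr_base (spd_const P);
  cr_tot_aug : sPDMor cr_tot (spd_triv (@sa_char p P R));
  cr_base_weq : spd_weq cr_base_aug;
  cr_tot_weq : spd_weq cr_tot_aug;
  cr_comm : forall n (a : pd_ring (cr_base n)),
    cr_tot_aug n (cr_str n a) = sa_in R n (pd_pi P (cr_base_aug n a)) }.

(* phi_{P}^* M = M (x)_{P'', phi} P, with its maps from P and M. *)
Record frobPullback p (p_pr : prime p) (P : sPDPair p) (M : sring)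
    (j : srMor (sp_quo P) M) := FrobPullback {
  fp_ring :> sring;
  fp_l : srMor (sp_ring P) fp_ring;
  fp_r : srMor M fp_ring;
  fp_tensor : forall n, is_tensor (pd_frobm p_pr (P n)) (j n) (fp_l n) (fp_r n) }.

(* The map phi_A^*(B/J) -> B that is the structure map on A and the Frobenius
   phi_{(B,J)} on B/J; PD-de Rham complexes are linear along it. *)
Record frobLinearization p (p_pr : prime p) (A B : sPDPair p) (f : sPDMor A B)
    (S : frobPullback p_pr (spm_quo f)) := FrobLinearization {
  fl_map :> srMor S (sp_ring B);
  fl_l : forall n a, fl_map n (fp_l S n a) = f n a;
  fl_r : forall n b, fl_map n (fp_r S n b) = pd_frob (P := B n) b }.

Definition ff_cons (T : Type) i (b : T) (t : {ffun 'I_i -> T}) :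
    {ffun 'I_i.+1 -> T} :=
  [ffun k => if unlift ord0 k is Some l then t l else b].

(* The PD-de Rham complex of a map of simplicial PD-pairs A -> B, taken in each
   simplicial degree, as a complex of modules over S along psi : S -> B.
   pr_dE determines the differential: d (b db_1 ... db_i) = db db_1 ... db_i. *)
Record pdDeRham p (A B : sPDPair p) (f : sPDMor A B) (S : sring)
    (psi : srMor S (sp_ring B)) := PDDeRham {
  pr_omega1 : smod (sp_ring B);
  pr_delta : forall n, pd_ring (B n) -> pr_omega1 n;
  pr_delta_univ : forall n,
    is_initial_map (@is_pd_derivation p (A n) (B n) (f n)) (@pr_delta n);
  pr_delta_nat : forall m n (t : simplexMap m n) b,
    pr_delta (sp_map B t b) = sm_map t (pr_delta b);
  pr_omega : forall i, extPower pr_omega1 i;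
  pr_d : forall i n, {linear sm_res psi (pr_omega i) n
                             -> sm_res psi (pr_omega i.+1) n};
  pr_dE : forall i n (b : pd_ring (B n)) (t : {ffun 'I_i -> pd_ring (B n)}),
    pr_d i n (b *: ep_w (pr_omega i) [ffun k => pr_delta (t k)])
    = ep_w (pr_omega i.+1) [ffun k => pr_delta (ff_cons b t k)];
  pr_d_nat : forall i m n (t : simplexMap m n) (x : sm_res psi (pr_omega i) n),
    pr_d i m (sm_map t x) = sm_map t (pr_d i n x);
  pr_dd : forall i n (x : sm_res psi (pr_omega i) n),
    pr_d i.+1 n (pr_d i n x) = 0 }.

Definition pr_cpx p (A B : sPDPair p) (f : sPDMor A B) (S : sring)
    (psi : srMor S (sp_ring B)) (W : pdDeRham f psi) : scpx S :=
  SCpx (@pr_d_nat p A B f S psi W) (@pr_dd p A B f S psi W).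

(** * The cotangent complex *)

(* A resolution Q of R by polynomial A/I-algebras, and a comparison with a
   resolution Z as above: the underlying map of quotient rings of Z resolves
   A/I -> R, so over R it compares with Q. *)
Record cotResolution p (P : pdPair p) (R : sAlg (pd_quo P))
    (Z : crysResolution R) := CotResolution {
  ct_alg :> sAlg (pd_quo P);
  ct_poly : forall n, is_polynomial (sa_in ct_alg n);
  ct_aug : srMor ct_alg R;
  ct_weq : sr_weq ct_aug;
  ct_aug_in : forall n a, ct_aug n (sa_in ct_alg n a) = sa_in R n a;
  ct_cmp : srMor (sp_quo (cr_tot Z)) ct_alg;
  ct_cmp_aug : forall n b, ct_aug n (ct_cmp n b) = pm_quo (cr_tot_aug Z n) b;
  ct_cmp_in : forall n a, ct_cmp n (pm_quo (cr_str Z n) a)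
    = sa_in ct_alg n (pm_quo (cr_base_aug Z n) a) }.

(* Kaehler differentials of Q over k in each simplicial degree: the cotangent
   complex when Q is levelwise polynomial. *)
Record kaehler (k : comPzRingType) (Q : sAlg k) := Kaehler {
  ka_mod :> smod Q;
  ka_d : forall n, Q n -> ka_mod n;
  ka_univ : forall n, is_initial_map (@is_derivation k (Q n) (sa_in Q n)) (@ka_d n);
  ka_nat : forall m n (t : simplexMap m n) x,
    ka_d (sr_map Q t x) = sm_map t (ka_d x) }.

(* The equivalence phi_A^*(R) ~ phi_A^*(R) between its two presentations, by
   the resolution Z and by the resolution Q. *)
Record frobComparison p (p_pr : prime p) (P : pdPair p) (R : sAlg (pd_quo P))
    (Z : crysResolution R) (Q : cotResolution Z)
    (S : frobPullback p_pr (spm_quo (cr_str Z)))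
    (T : frobPullback p_pr (sa_const_mor Q)) := FrobComparison {
  fc_map :> srMor S T;
  fc_l : forall n a, fc_map n (fp_l S n a) = fp_l T n (cr_base_aug Z n a);
  fc_r : forall n b, fc_map n (fp_r S n b) = fp_r T n (ct_cmp Q n b) }.

(* Main.v *)
(* In each simplicial degree the inverse Cartier operator
     a (x) b db_1 ... db_i |-> f(a) b^p b_1^(p-1) ... b_i^(p-1) db_1 ... db_i
   identifies phi_A^* Omega^i of the quotient ring with the i-th cohomology of
   the PD-de Rham complex: the divided power variables and the monomials whose
   exponents are not divisible by p contribute a contractible complex. Hence
   the graded piece is quasi-isomorphic to phi^* Omega^i of the resolution of
   the quotient rings, placed in degree i.
   It remains to compare the two polynomial resolutions of R. The functor
   (A, k, E) |-> A (x)_k Omega^i_{E/k} is resolved by its values on the iterated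
   free algebras k[E], k[k[E]], ..., which are functors of the simplicial
   F_p-modules A, k and E only; and every functor of simplicial F_p-modules
   preserves weak equivalences, since these factor through path objects into
   maps with simplicial homotopy inverses. *)
From HB Require Import structures.
From mathcomp Require Import all_boot all_order all_algebra.
From mathcomp Require Import boolp classical_sets.
From mathcomp Require Import perm generic_quotient finmap monalg.
From mathcomp Require Import zify ring.
Require Import Defs.
Set Implicit Arguments.
Unset Strict Implicit.
Unset Printing Implicit Defensive.
Import GRing.Theory.
Local Open Scope ring_scope.

(** The inverse Cartier operator is additive only modulo exact forms. A map of forms that realizes
    it depends on a choice of variables, which the faces and degeneracies of the resolution do not
    respect. The comparison map therefore runs the other way, from closed forms to forms on the
    quotient ring, and kills exact forms. The forms f(a) b^p b_1^(p-1) ... b_i^(p-1) db_1 ... db_i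
    with arbitrary b and b_l generate the closed forms modulo exact ones, and their images are given
    by a formula without variables; naturality and linearity over [S] are checked on them. The
    monomial basis behind the homotopy comes from an explicit model of the free PD-pairs, whose
    divided powers are obtained from torsion-free rings by reduction modulo p. For the change of
    resolution the functors are far from additive and need not preserve chain homotopies: what they
    preserve are sections and simplicial homotopies, whose axioms are equations between composites.
    These are built degree by degree, and the choices can be made additive because the groups are
    vector spaces over F_p. *)

Section MkMorphisms.

(** The proof of additivity is an argument of the alias, so that the structure instance can be keyed
    on its head constant. *)
Definition mkadd_of (U V : zmodType) (f : U -> V)
  (fD : {morph f : x y / x + y}) := f.
Fact mkadd_is_nmod (U V : zmodType) (f : U -> V) (fD : {morph f : x y / x + y}) :
  nmod_morphism (mkadd_of fD).
Proof.
split=> //; apply: (addIr (f 0)); by rewrite /mkadd_of -fD !add0r.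
Qed.
HB.instance Definition _ (U V : zmodType) (f : U -> V) (fD : {morph f : x y / x + y}) :=
  GRing.isNmodMorphism.Build U V (mkadd_of fD) (mkadd_is_nmod fD).
Definition mkadd (U V : zmodType) (f : U -> V) (fD : {morph f : x y / x + y}) :
  {additive U -> V} := mkadd_of fD.

End MkMorphisms.

(** * Chain complexes, quasi-isomorphisms and mapping cones *)

Section Chains.

Record chain := Chain {
  cg :> nat -> zmodType;
  cd : forall n, {additive cg n.+1 -> cg n};
  cdd : forall n x, cd n (cd n.+1 x) = 0 }.

Definition cyc (X : chain) n : X n -> Prop :=
  match n with 0%N => fun _ => True | m.+1 => fun x => cd X m x = 0 end.

Record chmap (X Y : chain) := ChMap {
  cm :> forall n, {additive X n -> Y n};
  cmd : forall n x, cm n (cd X n x) = cd Y n (cm n.+1 x) }.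

Definition hiso (X Y : chain) (f : chmap X Y) : Prop :=
  forall n,
    (forall x, cyc x -> (exists z, f n x = cd Y n z) -> exists z, x = cd X n z)
    /\ (forall y, cyc y -> exists x, cyc x /\ exists z, y = f n x + cd Y n z).

Definition acyclic (X : chain) : Prop :=
  forall n (x : X n), cyc x -> exists y, x = cd X n y.

Lemma cyc_map (X Y : chain) (f : chmap X Y) n (x : X n) : cyc x -> cyc (f n x).
Proof. by case: n x => // n x /= x0; rewrite -cmd x0 raddf0. Qed.

Lemma cyc_cd (X : chain) n (x : X n.+1) : cyc (cd X n x).
Proof. by case: n x => // n x; apply: cdd. Qed.

Lemma cycB (X : chain) n (x y : X n) : cyc x -> cyc y -> cyc (x - y).
Proof. by case: n x y => // n x y /= hx hy; rewrite raddfB /= hx hy subr0. Qed.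


Section TwoOfThree.
Variables (X Y Z : chain) (f : chmap X Y) (g : chmap Y Z) (h : chmap X Z).
Hypothesis hE : forall n x, h n x = g n (f n x).

Lemma hiso_comp : hiso f -> hiso g -> hiso h.
Proof.
move=> hf hg n; split=> [x xc [z]|y yc].
  rewrite hE => e; have [z' e'] := (hg n).1 _ (cyc_map f xc) (ex_intro _ z e).
  exact: (hf n).1 _ xc (ex_intro _ z' e').
have [x [xc [z ->]]] := (hg n).2 _ yc.
have [x' [xc' [z' ->]]] := (hf n).2 _ xc.
exists x'; split=> //; exists (g n.+1 z' + z).
by rewrite hE !raddfD /= cmd addrA.
Qed.

Lemma hiso_cancel_l : hiso h -> hiso g -> hiso f.
Proof.
move=> hh hg n; split=> [x xc [z e]|y yc].
  by apply: (hh n).1 xc _; exists (g n.+1 z); rewrite hE e cmd.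
have [x [xc [z e]]] := (hh n).2 _ (cyc_map g yc).
have [z'] : exists z', y - f n x = cd Y n z'.
  apply: (hg n).1; first exact/cycB/cyc_map.
  by exists z; rewrite raddfB /= e hE addrC addKr.
by move/eqP; rewrite subr_eq addrC => /eqP ->; exists x; split=> //; exists z'.
Qed.

Lemma hiso_cancel_r : hiso h -> hiso f -> hiso g.
Proof.
move=> hh hf n; split=> [y yc [z e]|y yc].
  have [x [xc [z' e']]] := (hf n).2 _ yc; rewrite e' in e *.
  have [|z1 ->] := (hh n).1 x xc.
    by exists (z - g n.+1 z'); rewrite hE raddfB /= -e raddfD /= cmd addrK.
  by exists (f n.+1 z1 + z'); rewrite raddfD /= cmd.
have [x [xc [z ->]]] := (hh n).2 _ yc.
by exists (f n x); split; [exact: cyc_map|exists z; rewrite hE].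
Qed.
End TwoOfThree.

Lemma hiso_bij (X Y : chain) (f : chmap X Y) :
  (forall n, exists2 g : Y n -> X n, cancel (f n) g & cancel g (f n)) -> hiso f.
Proof.
move=> fb n; have [g fg gf] := fb n; have [g1 fg1 gf1] := fb n.+1; split.
  move=> x _ [z e]; exists (g1 z); apply: (can_inj fg).
  by rewrite cmd gf1.
move=> y yc; exists (g y); split.
  case: n y g fg gf g1 fg1 gf1 yc => // n y g fg gf g1 fg1 gf1 /= yc.
  have [g0 fg0 _] := fb n.
  by apply: (can_inj fg0); rewrite raddf0 cmd gf yc.
by exists 0; rewrite raddf0 addr0 gf.
Qed.

Section Cone.
Variables (X Y : chain) (f : chmap X Y).

Definition cone_grp n : zmodType :=
  match n with 0%N => Y 0%N | m.+1 => (X m * Y m.+1)%type end.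
Definition cone_d n : cone_grp n.+1 -> cone_grp n :=
  match n with
  | 0%N => fun c => cd Y 0 c.2 + f 0%N c.1
  | m.+1 => fun c => (- cd X m c.1, cd Y m.+1 c.2 + f m.+1 c.1)
  end.
Fact cone_dD n : {morph @cone_d n : x y / x + y}.
Proof.
case: n => [|n] [x1 y1] [x2 y2] /=; first by rewrite !raddfD /= addrACA.
rewrite (raddfD (cd X n)) (raddfD (cd Y n.+1)) (raddfD (f n.+1)) opprD.
by rewrite [X in (_, X) = _]addrACA.
Qed.
Fact cone_dd n x : mkadd (@cone_dD n) (mkadd (@cone_dD n.+1) x) = 0.
Proof.
case: n x => [|n] [x y] /=; rewrite /mkadd_of /=.
  by rewrite raddfD raddfN /= cdd add0r cmd subrr.
congr (_, _); first by rewrite raddfN /= cdd !oppr0.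
by rewrite raddfD raddfN /= cdd add0r cmd subrr.
Qed.
Definition cone := Chain cone_dd.

(** A cycle (x, y) of the cone says that x is a cycle and that -y bounds f x. The injectivity clause
    of [hiso] in the degree of x and the surjectivity clause one degree higher are exactly what it
    takes to bound the pair. *)
Lemma hiso_cone : hiso f <-> acyclic cone.
Proof.
split=> [hf|hf n].
  case=> [|n] c /=.
    move=> _; have [x [_ [z ->]]] := (hf 0%N).2 c I.
    by exists (x, z); rewrite /= /mkadd_of /= addrC.
  case: c => x y cxy.
  have [xc fxy] : cyc x /\ f n x = cd Y n (- y).
    move: cxy; case: n x y => [|n] x y /=; rewrite /mkadd_of /=.
      by move/eqP; rewrite addrC addr_eq0 -raddfN => /eqP ->.
    move=> [/eqP]; rewrite oppr_eq0 => /eqP -> /eqP.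
    by rewrite addrC addr_eq0 -raddfN => /eqP ->.
  have [z xz] := (hf n).1 _ xc (ex_intro _ _ fxy).
  (* As x = d z, the element y + f z is a cycle. Surjectivity on homology replaces it by f x', and
     the first component of the bounding element is then x' - z. *)
  have [x' [/= xc' [w yw]]] : exists x' : X n.+1, cyc x' /\
      exists w, y + f n.+1 z = f n.+1 x' + cd Y n.+1 w.
    by apply: (hf n.+1).2; rewrite /= raddfD /= -cmd -xz fxy raddfN subrr.
  exists (x' - z, w); rewrite /= /mkadd_of /= (raddfB (cd X n)) (raddfB (f n.+1)) /= xc' sub0r opprK.
  by congr (_, _); rewrite ?xz // addrA [_ + f n.+1 x']addrC -yw addrK.
split=> [x xc [z e]|].
  have [|[u v]] := hf n.+1 (x, - z).
    case: n x xc z e => [|n] x xc z e /=; rewrite /mkadd_of /=.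
      by rewrite raddfN /= e addNr.
    rewrite (raddfN (cd Y n.+1)) /= e addNr (xc : cd X n x = 0).
    by congr (_, _); exact: oppr0.
  by rewrite /= /mkadd_of => -[-> _]; exists (- u); rewrite raddfN.
case: n => [|n] y yc.
  have [[u v]] := hf 0%N y I; rewrite /= /mkadd_of /= => ->.
  by exists u; split=> //; exists v; rewrite addrC.
have [|[u v]] := hf n.+1 (0, y).
  case: n y yc => [|n] y yc /=; rewrite /mkadd_of /=.
    by rewrite yc raddf0 addr0.
  by rewrite yc (raddf0 (cd X n)) (raddf0 (f n.+1)) addr0; congr (_, _); exact: oppr0.
rewrite /= /mkadd_of /= => -[/esym/eqP]; rewrite oppr_eq0 => /eqP uc ->.
by exists u; split=> //; exists v; rewrite addrC.
Qed.
End Cone.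

(** No double complex is formed. Induction on the degree n, for all m at once, shows that a cycle of
    C m in the image of C (m + 1) bounds an element of that image. The induction starts because the
    complexes vanish in negative degrees. *)
Lemma acyclic_resolution (C : nat -> chain)
    (e : forall m, chmap (C m.+1) (C m)) :
  (forall n (x : C 0%N n), exists y, e 0%N n y = x) ->
  (forall m n x, e m n (e m.+1 n x) = 0) ->
  (forall m n (x : C m.+1 n), e m n x = 0 -> exists y, e m.+1 n y = x) ->
  (forall m, acyclic (C m.+1)) -> acyclic (C 0%N).
Proof.
move=> e0 ee ex ac.
pose ker m n : C m n -> Prop :=
  match m with 0%N => fun _ => True | m'.+1 => fun x => e m' n x = 0 end.
have lift m n (x : C m n) : ker m n x -> exists y, e m n y = x.
  by case: m x => [|m] x kx; [exact: e0|exact: ex].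
have kere m n (x : C m.+1 n) : ker m n (e m n x) by case: m x => [|m] x //=; apply: ee.
suff H n : forall m (z : C m n), cyc z -> ker m n z ->
    exists y, ker m n.+1 y /\ z = cd (C m) n y.
  by move=> n x xc; have [y [_ ->]] := H n 0%N x xc I; exists y.
elim: n => [|n IHn] m z zc kz; have [c ec] := lift _ _ _ kz.
  have [d cd_] := ac m 0%N c I.
  by exists (e m 1%N d); rewrite -ec cd_ cmd; split; first exact: kere.
(* The boundary of the lift c is a cycle of lower degree in the next kernel. The correction y' turns
   c into a cycle without changing its image in C m. *)
have [|| y' [ky' yE]] := IHn m.+1 (cd _ n c); first exact: cyc_cd.
  by rewrite /ker cmd ec.
have [|d dE] := ac m n.+1 (c - y').
  by rewrite /= raddfB /= yE subrr.
exists (e m n.+2 d); split; first exact: kere.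
by rewrite -cmd -dE raddfB /= ec ky' subr0.
Qed.

(** The cones of the maps f m form a resolution of the cone of f 0, to which [acyclic_resolution]
    applies. *)
Lemma hiso_resolution (X Y : nat -> chain)
    (eX : forall m, chmap (X m.+1) (X m)) (eY : forall m, chmap (Y m.+1) (Y m))
    (f : forall m, chmap (X m) (Y m)) :
  (forall m n x, f m n (eX m n x) = eY m n (f m.+1 n x)) ->
  (forall n (x : X 0%N n), exists y, eX 0%N n y = x) ->
  (forall m n x, eX m n (eX m.+1 n x) = 0) ->
  (forall m n (x : X m.+1 n), eX m n x = 0 -> exists y, eX m.+1 n y = x) ->
  (forall n (x : Y 0%N n), exists y, eY 0%N n y = x) ->
  (forall m n x, eY m n (eY m.+1 n x) = 0) ->
  (forall m n (x : Y m.+1 n), eY m n x = 0 -> exists y, eY m.+1 n y = x) ->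
  (forall m, hiso (f m.+1)) -> hiso (f 0%N).
Proof.
move=> fe sX eeX xX sY eeY xY hf; apply/hiso_cone.
pose g m n : cone (f m.+1) n -> cone (f m) n :=
  match n with
  | 0%N => fun y => eY m 0%N y
  | n'.+1 => fun c => (eX m n' c.1, eY m n'.+1 c.2)
  end.
have gD : forall m n, {morph g m n : x y / x + y}.
  move=> m [|n] x y; rewrite /= ?raddfD //.
have gd m n x : mkadd (gD m n) (cd _ n x) = cd _ n (mkadd (gD m n.+1) x).
  case: n x => [|n] [x y]; rewrite /= /mkadd_of /= raddfD /= cmd fe //.
  by congr (_, _); rewrite raddfN /= cmd.
apply: (acyclic_resolution (C := fun m => cone (f m)) (e := fun m => ChMap (gd m))).
- case=> [|n] x /=; rewrite /mkadd_of /=; first exact: sY.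
  case: x => x y; have [x' <-] := sX _ x; have [y' <-] := sY _ y.
  by exists (x', y').
- by move=> m [|n] x /=; rewrite /mkadd_of /= ?eeX ?eeY.
- move=> m [|n] x /=; rewrite /mkadd_of /=; first exact: xY.
  case: x => x y /= [/xX [x' <-] /xY [y' <-]].
  by exists (x', y').
- by move=> m; apply/hiso_cone.
Qed.

End Chains.

(** * Semisimplicial groups and simplicial homotopies *)

Section SemisimplicialGroups.

(** Face indices are plain natural numbers: the identities are required in the meaningful range
    only, and inductions on indices need no casts. *)
Record ssgrp := SSGrp {
  ssg :> nat -> zmodType;
  fc : forall n, nat -> {additive ssg n.+1 -> ssg n};
  fcfc : forall n i j x, (i <= j)%N -> (j <= n.+1)%N ->
    fc n i (fc n.+1 j.+1 x) = fc n j (fc n.+1 i x) }.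

Definition altsum (X : ssgrp) n (x : X n.+1) : X n :=
  \sum_(i < n.+2) fc X n i x *~ (-1) ^+ i.

Fact altsumD (X : ssgrp) n : {morph @altsum X n : x y / x + y}.
Proof.
move=> x y; rewrite /altsum -big_split; apply: eq_bigr => i _ /=.
by rewrite raddfD mulrzDl.
Qed.

Fact altsum_is_nmod (X : ssgrp) n : nmod_morphism (@altsum X n).
Proof. exact: (mkadd_is_nmod (@altsumD X n)). Qed.
HB.instance Definition _ (X : ssgrp) n :=
  GRing.isNmodMorphism.Build (X n.+1) (X n) (@altsum X n) (@altsum_is_nmod X n).

Fact altsum_altsum (X : ssgrp) n x :
  mkadd (@altsumD X n) (mkadd (@altsumD X n.+1) x) = 0.
Proof.
rewrite /= /mkadd_of /altsum /=.
pose F i j := fc X n i (fc X n.+1 j x) *~ (-1) ^+ j *~ (-1) ^+ i.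
rewrite (eq_bigr (fun i : 'I_n.+2 => \sum_(j < n.+3) F i j)); last first.
  move=> i _; rewrite raddf_sum mulrz_suml; apply: eq_bigr => j _.
  by rewrite /F raddfMz.
rewrite (eq_bigr (fun i : 'I_n.+2 =>
  \sum_(j < n.+2) (if (j <= i)%N then F i j else 0)
  - \sum_(j < n.+2) (if (i <= j)%N then F j i else 0))); last first.
  move=> i _; rewrite (bigID (fun j : 'I_n.+3 => (j <= i)%N)) /=; congr (_ + _).
    rewrite big_mkcond big_ord_recr /= ifN ?addr0 //.
    by rewrite -ltnNge.
  rewrite big_mkcond big_ord_recl /= add0r -sumrN.
  apply: eq_bigr => j _; rewrite /bump /= add1n -ltnNge ltnS.
  case: ifP => [ij|_]; last by rewrite oppr0.
  rewrite /F fcfc //; last exact: leq_ord.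
  by rewrite exprS mulN1r mulrNz mulNrz mulrzAC.
by rewrite sumrB [X in _ - X]exchange_big /= subrr.
Qed.

Definition sschain (X : ssgrp) := Chain (@altsum_altsum X).

Record ssmap (X Y : ssgrp) := SSMap {
  smp :> forall n, {additive X n -> Y n};
  smpE : forall n i x, (i <= n.+1)%N -> smp n (fc X n i x) = fc Y n i (smp n.+1 x) }.

Fact sschmap_d (X Y : ssgrp) (f : ssmap X Y) n x :
  f n (cd (sschain X) n x) = cd (sschain Y) n (f n.+1 x).
Proof.
rewrite /= /mkadd_of /altsum raddf_sum; apply: eq_bigr => i _.
by rewrite raddfMz /= smpE // leq_ord.
Qed.
Definition sschmap (X Y : ssgrp) (f : ssmap X Y) : chmap (sschain X) (sschain Y) :=
  @ChMap (sschain X) (sschain Y) (smp f) (sschmap_d f).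

(** The face identities of a simplicial homotopy from the identity ([ht_0]) to g ([ht_last]). Each
    is an equation between composites, without sums, so that even a functor that is not additive
    carries a homotopy to a homotopy. *)
Record homotopy (X : ssgrp) (g : forall n, X n -> X n) := Homotopy {
  ht :> forall n, nat -> {additive X n -> X n.+1};
  ht_lt : forall n i j x, (i <= j)%N -> (j <= n)%N ->
    fc X n.+1 i (ht n.+1 j.+1 x) = ht n j (fc X n i x);
  ht_gt : forall n i j x, (j < i)%N -> (i <= n.+1)%N ->
    fc X n.+1 i.+1 (ht n.+1 j x) = ht n j (fc X n i x);
  ht_eq : forall n j x, (j < n)%N ->
    fc X n j.+1 (ht n j.+1 x) = fc X n j.+1 (ht n j x);
  ht_0 : forall n x, fc X n 0 (ht n 0 x) = x;
  ht_last : forall n x, fc X n n.+1 (ht n n x) = g n x }.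

Lemma signMz2 (V : zmodType) (v : V) j : v *~ (-1) ^+ j *~ (-1) ^+ j = v.
Proof. by rewrite -mulrzA -exprMn mulrNN mulr1 expr1n. Qed.

Lemma homotopy_altsum (X : ssgrp) g (h : homotopy g) n (x : X n) :
  cyc (X := sschain X) x -> exists y, x = g n x + altsum (X := X) y.
Proof.
move=> xc; exists (\sum_(j < n.+1) h n j x *~ (-1) ^+ j).
pose F i j := fc X n i (h n j x) *~ (-1) ^+ j *~ (-1) ^+ i.
have -> : altsum (X := X) (\sum_(j < n.+1) h n j x *~ (-1) ^+ j) =
    \sum_(i < n.+2) \sum_(j < n.+1) F i j.
  rewrite /altsum; apply: eq_bigr => i _.
  rewrite raddf_sum mulrz_suml; apply: eq_bigr => j _.
  by rewrite /F raddfMz.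
have FE i j : F i j = (if (i < j)%N then F i j else 0) +
    ((if i == j then F i j else 0) + (if i == j.+1 then F i j else 0)) +
    (if (j.+1 < i)%N then F i j else 0).
  by do 4! case: ifPn => ?; rewrite ?addr0 ?add0r //; exfalso; lia.
have -> : \sum_(i < n.+2) \sum_(j < n.+1) F i j =
   \sum_(i < n.+2) \sum_(j < n.+1) (if (i < j)%N then F i j else 0) +
   \sum_(i < n.+2) \sum_(j < n.+1) ((if i == j :> nat then F i j else 0)
                                   + (if i == j.+1 :> nat then F i j else 0)) +
   \sum_(i < n.+2) \sum_(j < n.+1) (if (j.+1 < i)%N then F i j else 0).
  rewrite -!big_split; apply: eq_bigr => i _; rewrite -!big_split.
  by apply: eq_bigr => j _; exact: FE.
have -> : \sum_(i < n.+2) \sum_(j < n.+1) ((if i == j :> nat then F i j else 0)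
        + (if i == j.+1 :> nat then F i j else 0)) = x - g n x.
  rewrite exchange_big /=.
  rewrite (eq_bigr (fun j : 'I_n.+1 =>
    fc X n j (h n j x) - fc X n j.+1 (h n j x))); last first.
    move=> j _; rewrite big_split /= -!big_mkcond /=.
    rewrite (big_pred1 (inord j : 'I_n.+2)); last first.
      by move=> i; apply/eqP/eqP => [e|->]; [apply: val_inj|];
         rewrite /= inordK // ltnS ltnW // ltn_ord.
    rewrite (big_pred1 (inord j.+1 : 'I_n.+2)); last first.
      by move=> i; apply/eqP/eqP => [e|->]; [apply: val_inj|];
         rewrite /= inordK // ltnS ltn_ord.
    have jn : (j.+1 < n.+2)%N by rewrite ltnS ltn_ord.
    rewrite !inordK // 1?ltnW //.
    by rewrite /F signMz2 [(-1) ^+ j.+1]exprS mulN1r mulrNz signMz2.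
  rewrite sumrB big_ord_recl big_ord_recr /= ht_0 ht_last opprD addrA.
  congr (_ - _); rewrite -addrA -sumrB big1 ?addr0 // => j _.
  by rewrite ht_eq ?subrr //; exact: ltn_ord.
suff -> : \sum_(i < n.+2) \sum_(j < n.+1) (if (i < j)%N then F i j else 0) =
  - \sum_(i < n.+2) \sum_(j < n.+1) (if (j.+1 < i)%N then F i j else 0).
  by rewrite addrAC addNr add0r addrCA subrr addr0.
(* In degree 0 both outer sums are empty. Above it their terms match one by one the terms of the
   homotopy applied to the zero boundary [Hc]. *)
move: @F FE; case: n x xc => [|n] x xc F FE.
  rewrite !big1 ?oppr0 // => i _; rewrite big1 // => j _; rewrite ?ord1 //=.
  by case: i => -[|[|i]].
have Hc : \sum_(i < n.+2) \sum_(j < n.+1)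
    h n j (fc X n i x) *~ (-1) ^+ j *~ (-1) ^+ i = 0.
  rewrite exchange_big big1 //= => j _.
  have e : h n j (altsum x) *~ (-1) ^+ j = 0.
    by rewrite (xc : altsum x = 0) raddf0 mul0rz.
  rewrite -[RHS]e /altsum raddf_sum mulrz_suml; apply: eq_bigr => i _.
  by rewrite raddfMz mulrzAC.
suff E : \sum_(i < n.+3) \sum_(j < n.+2) (if (i < j)%N then F i j else 0) +
   \sum_(i < n.+3) \sum_(j < n.+2) (if (j.+1 < i)%N then F i j else 0) =
   - \sum_(i < n.+2) \sum_(j < n.+1) h n j (fc X n i x) *~ (-1) ^+ j *~ (-1) ^+ i.
  by apply/eqP; rewrite -addr_eq0 E Hc oppr0.
rewrite big_ord_recr /= [X in _ + X + _]big1 ?addr0; last first.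
  by move=> j _; rewrite ltnNge -ltnS (leq_trans (ltn_ord j)).
rewrite [X in _ + X]big_ord_recl /= [X in _ + (X + _)]big1 ?add0r //.
rewrite -big_split -sumrN; apply: eq_bigr => i _ /=.
rewrite big_ord_recl /= add0r [X in _ + X]big_ord_recr /= [X in _ + (_ + X)]ifN ?addr0; last first.
  by have := ltn_ord i; rewrite /bump; lia.
rewrite -big_split -sumrN; apply: eq_bigr => j _ /=.
rewrite /bump /= !add1n !ltnS.
case: (leqP i j) => ij; rewrite ?addr0 ?add0r /F.
  rewrite ht_lt //; last exact: leq_ord.
  by rewrite exprS mulN1r mulrNz mulNrz.
rewrite ht_gt //; last exact: leq_ord.
by rewrite [(-1) ^+ i.+1]exprS mulN1r mulrNz.
Qed.

Lemma hiso_homotopy (X Y : ssgrp) (f : ssmap X Y) (s : ssmap Y X) :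
  (forall n y, f n (s n y) = y) -> homotopy (fun n x => s n (f n x)) ->
  hiso (sschmap f).
Proof.
move=> fs h n; split=> [x xc [z e]|y yc].
  have [y ->] := homotopy_altsum h xc.
  exists (s n.+1 z + y); rewrite raddfD; congr (_ + _).
  by rewrite [f n x]e; apply: (cmd (sschmap s)).
exists (s n y); split; first exact: (cyc_map (sschmap s)).
by exists 0; rewrite /= fs raddf0 addr0.
Qed.

End SemisimplicialGroups.

Lemma big_ord_pick (V : zmodType) n (F : nat -> V) j : (j < n)%N ->
  \sum_(i < n | i == j :> nat) F i = F j.
Proof. by move=> jn; rewrite (big_pred1 (Ordinal jn)). Qed.

(** * Simplicial groups and lifting along surjections with acyclic kernel *)

Section SimplicialGroups.

Record sgrp := SGrp {
  sgb :> ssgrp;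
  dg : forall n, nat -> {additive sgb n -> sgb n.+1};
  fcdg_lt : forall n i j x, (i <= j)%N -> (j <= n)%N ->
    fc sgb n.+1 i (dg n.+1 j.+1 x) = dg n j (fc sgb n i x);
  fcdg_eq : forall n i x, (i <= n)%N -> fc sgb n i (dg n i x) = x;
  fcdg_S : forall n i x, (i <= n)%N -> fc sgb n i.+1 (dg n i x) = x;
  fcdg_gt : forall n i j x, (j < i)%N -> (i <= n.+1)%N ->
    fc sgb n.+1 i.+1 (dg n.+1 j x) = dg n j (fc sgb n i x) }.

Record smap (X Y : sgrp) := SMap {
  smb :> ssmap X Y;
  smdg : forall n i x, (i <= n)%N -> smb n.+1 (dg X n i x) = dg Y n i (smb n x) }.

Section Fillers.
Variables (V W : sgrp) (q : smap V W).

Definition acyclic_kernel := forall n (x : V n), cyc (X := sschain V) x ->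
  q n x = 0 -> exists y : V n.+1, q n.+1 y = 0 /\ x = altsum y.

Hypothesis qac : acyclic_kernel.

(** Acyclicity only gives some y whose alternating sum is z up to sign. Replacing y by y - s_j d_j y
    for j = 0, ..., n kills the face d_j, keeps the earlier faces zero and leaves the alternating
    sum unchanged, so that in the end only the last face remains. *)
Lemma moore_kernel n (z : V n) : q n z = 0 ->
  match n return V n -> Prop with
  | 0%N => fun _ => True
  | m.+1 => fun z => forall i, (i <= m.+1)%N -> fc V m i z = 0
  end z ->
  exists u : V n.+1, [/\ q n.+1 u = 0, forall i, (i <= n)%N -> fc V n i u = 0
                      & fc V n n.+1 u = z].
Proof.
move=> qz fz.
(* The sign is the one that the last face carries in the alternating sum. *)
have [||y [qy zy]] := @qac n (z *~ (-1) ^+ n.+1).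
- case: n z qz fz => //= m z qz fz; rewrite /mkadd_of /altsum big1 // => i _.
  by rewrite raddfMz /= fz ?mul0rz // leq_ord.
- by rewrite raddfMz /= qz mul0rz.
suff H j : (j <= n.+1)%N -> exists y : V n.+1,
    [/\ q n.+1 y = 0, z *~ (-1) ^+ n.+1 = altsum y
      & forall i, (i < j)%N -> fc V n i y = 0].
  have [u [qu zu fu]] := H n.+1 (leqnn _).
  exists u; split=> //.
  move: zu; rewrite /altsum big_ord_recr /= big1 ?add0r => [|i _].
    by move/(congr1 (fun v => v *~ (-1) ^+ n.+1)); rewrite !signMz2.
  by rewrite fu ?mul0rz //; exact: ltn_ord.
elim: j => [|j IHj] jn; first by exists y.
move: (IHj (ltnW jn)) => {y qy zy IHj} [y [qy zy fy]].
exists (y - dg V n j (fc V n j y)); split.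
- have jn1 := ltnW jn.
  by rewrite raddfB /= qy smdg // smpE // qy !raddf0 ?subr0 ?addr0.
- rewrite raddfB /= -zy.
  (* The faces j and j + 1 of s_j d_j y cancel. The higher ones form s_j d_j of the tail of the
     alternating sum of y, and d_j kills that tail because it kills z and d_j d_j = d_j d_(j+1). *)
  suff -> : altsum (dg V n j (fc V n j y)) = 0 by rewrite subr0.
  case: n z qz fz y qy zy j jn fy => [|m] z qz fz y qy zy j jn fy.
    case: j jn {fy} => // _; rewrite /altsum big_ord_recl big_ord1 /=.
    by rewrite fcdg_eq // fcdg_S // expr1 mulrN1z subrr.
  set v := fc V m.+1 j y.
  have v0 i : (i < j)%N -> fc V m i v = 0.
    case: j jn @v fy => // j jn v fy ij.
    by rewrite /v fcfc ?fy ?raddf0 //; lia.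
  have vS i : (j <= i)%N -> (i <= m.+1)%N ->
      fc V m i v = fc V m j (fc V m.+1 i.+1 y).
    by move=> ji im; rewrite [RHS]fcfc.
  have E i : (i <= m.+2)%N -> fc V m.+1 i (dg V m.+1 j v) *~ (-1) ^+ i =
      (if i == j then v *~ (-1) ^+ i else 0) +
      (if i == j.+1 then v *~ (-1) ^+ i else 0) +
      (if (j.+1 < i)%N then dg V m j (fc V m j (fc V m.+1 i y)) *~ (-1) ^+ i
       else 0).
    move=> im; case: (ltngtP i j) => [ij|ij|->].
    - case: j jn @v {fy} v0 vS ij => // j jn v v0 vS ij.
      rewrite fcdg_lt ?v0 ?raddf0 ?mul0rz ?ifN ?addr0 //; lia.
    - case: (ltngtP i j.+1) => [||->]; first by lia.
        case: i im ij => // i im ij ji.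
        by rewrite fcdg_gt ?vS ?add0r //; lia.
      by rewrite fcdg_S ?add0r ?addr0 //; lia.
    - by rewrite fcdg_eq ?ifN ?addr0 //; lia.
  rewrite /altsum (eq_bigr _ (fun (i : 'I_m.+3) _ => E i (leq_ord i))).
  rewrite !big_split /= -!big_mkcond /=.
  rewrite (big_ord_pick (fun i => v *~ (-1) ^+ i)); last lia.
  rewrite (big_ord_pick (fun i => v *~ (-1) ^+ i)); last lia.
  rewrite exprS mulN1r mulrNz subrr add0r.
  have -> : \sum_(i < m.+3 | (j.+1 < i)%N)
      dg V m j (fc V m j (fc V m.+1 i y)) *~ (-1) ^+ i =
    dg V m j (fc V m j (\sum_(i < m.+3 | (j.+1 < i)%N) fc V m.+1 i y *~ (-1) ^+ i)).
    by rewrite !raddf_sum; apply: eq_bigr => i _; rewrite !raddfMz.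
  suff -> : \sum_(i < m.+3 | (j.+1 < i)%N) fc V m.+1 i y *~ (-1) ^+ i =
     altsum y - fc V m.+1 j y *~ (-1) ^+ j + fc V m.+1 j.+1 y *~ (-1) ^+ j.
    rewrite -zy raddfD raddfB /= !raddfMz /= fz ?mul0rz ?sub0r; last by lia.
    by rewrite fcfc ?mulNrz ?add0r ?addNr ?raddf0 //; lia.
  have E2 i : (i <= m.+2)%N -> fc V m.+1 i y *~ (-1) ^+ i =
      (if i == j then fc V m.+1 i y *~ (-1) ^+ i else 0) +
      (if i == j.+1 then fc V m.+1 i y *~ (-1) ^+ i else 0) +
      (if (j.+1 < i)%N then fc V m.+1 i y *~ (-1) ^+ i else 0).
    move=> im; case: (ltnP i j) => ij.
      by rewrite fy // mul0rz !if_same !addr0.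
    by do 3! case: ifPn => ?; rewrite ?addr0 ?add0r //; exfalso; lia.
  rewrite /altsum [X in _ = X - _ + _](eq_bigr _ (fun (i : 'I_m.+3) _ => E2 i (leq_ord i))).
  rewrite !big_split /= -!big_mkcond /=.
  rewrite (big_ord_pick (fun i => fc V m.+1 i y *~ (-1) ^+ i)); last lia.
  rewrite (big_ord_pick (fun i => fc V m.+1 i y *~ (-1) ^+ i)); last lia.
  rewrite [(-1) ^+ j.+1]exprS mulN1r mulrNz.
  set S := \sum_(_ < _ | _) _; set a := fc V m.+1 j y *~ _.
  set b := fc V m.+1 j.+1 y *~ _.
  by rewrite [_ + S]addrC -!addrA [- b + _]addrCA addNr addr0 subrr addr0.
- move=> i; rewrite ltnS leq_eqVlt => /orP[/eqP ->|ij].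
    by rewrite raddfB /= fcdg_eq ?subrr //; lia.
  rewrite raddfB /= fy // sub0r; apply/eqP; rewrite oppr_eq0; apply/eqP.
  case: n z qz fz y qy zy j jn fy ij => [|m] z qz fz y qy zy [|j] jn fy ij //.
  by rewrite fcdg_lt ?fcfc ?fy ?raddf0 //; lia.
Qed.

Definition compat n : (nat -> V n) -> Prop :=
  match n with
  | 0%N => fun _ => True
  | m.+1 => fun y => forall i j, (i <= j)%N -> (j <= m.+1)%N ->
      fc V m i (y j.+1) = fc V m j (y i)
  end.

Hypothesis q_surj : forall n (w : W n), exists v, q n v = w.

(** This is the right lifting property of a trivial Kan fibration. All faces but the last are
    corrected one at a time by degenerate elements; the defect of the last one is then a normalized
    cycle of the kernel, which [moore_kernel] removes without touching the others. *)
Lemma filler n (w : W n.+1) (y : nat -> V n) :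
  (forall i, (i <= n.+1)%N -> q n (y i) = fc W n i w) -> compat y ->
  exists x, q n.+1 x = w /\ forall i, (i <= n.+1)%N -> fc V n i x = y i.
Proof.
move=> qy cy.
have H j : (j <= n.+1)%N -> exists x, q n.+1 x = w /\
    forall i, (i < j)%N -> fc V n i x = y i.
  elim: j => [|j IHj] jn; first by have [x qx] := q_surj w; exists x.
  have [x [qx fx]] := IHj (ltnW jn).
  exists (x + dg V n j (y j - fc V n j x)); split.
    by rewrite raddfD /= smdg ?raddfB /= ?qy ?smpE ?qx ?subrr ?raddf0 ?addr0 //; lia.
  move=> i; rewrite ltnS leq_eqVlt => /orP[/eqP ->|ij].
    by rewrite raddfD /= fcdg_eq 1?addrC ?subrK //; lia.
  rewrite raddfD /= fx //.
  case: n w y qy cy x qx j jn {IHj} fx ij => [|m] w y qy cy x qx [|j] jn fx ij //.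
  by rewrite fcdg_lt ?raddfB /= ?cy ?fcfc ?fx ?subrr ?raddf0 ?addr0 //; lia.
have [x [qx fx]] := H n.+1 (leqnn _).
have [||u [qu fu fu1]] := @moore_kernel n (y n.+1 - fc V n n.+1 x).
- by rewrite raddfB /= qy ?smpE ?qx ?subrr.
- case: n w y qy cy x qx {H} fx => [|m] w y qy cy x qx fx //= i im.
  by rewrite raddfB /= cy ?fcfc ?fx ?subrr //; lia.
exists (x + u); split; first by rewrite raddfD /= qx qu addr0.
move=> i; rewrite leq_eqVlt => /orP[/eqP ->|].
  by rewrite raddfD /= fu1 addrC subrK.
by rewrite ltnS => ij; rewrite raddfD /= fu // addr0 fx.
Qed.

End Fillers.
End SimplicialGroups.

(** * Additive choices over the prime field *)

Section LinearLifting.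
Variables (p : nat) (p_pr : prime p) (U V : zmodType).
Hypotheses (Up : forall u : U, u *+ p = 0) (Vp : forall v : V, v *+ p = 0).
Variable R : U -> V -> Prop.
Hypotheses (R0 : R 0 0)
  (RB : forall u v u' v', R u v -> R u' v' -> R (u - u') (v - v'))
  (Rtot : forall u, exists v, R u v).

Let P : set (set (U * V)) := [set G |
  [/\ forall u v, G (u, v) -> R u v,
      forall u v v', G (u, v) -> G (u, v') -> v = v'
    & forall u v u' v', G (u, v) -> G (u', v') -> G (u - u', v - v')]].

Let mulrzp (W : zmodType) (w : W) (k : int) : (forall w : W, w *+ p = 0) ->
  (p %| k)%Z -> w *~ k = 0.
Proof. by move=> Wp /dvdzP [c ->]; rewrite mulrC mulrzA -pmulrn Wp mul0rz. Qed.

(* Zorn: a maximal additive partial selection of R is total, since R is a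
   relation between F_p-vector spaces. *)
Lemma additive_selection : exists s : {additive U -> V}, forall u, R u (s u).
Proof.
have [A [[AR Af AB] Amax]] : exists A, P A /\ forall B, (A `<` B)%classic -> ~ P B.
  apply: Zorn_bigcup => F FP Ft; split.
  - by move=> u v [G FG Guv]; have [GR _ _] := FP G FG; apply: GR.
  - move=> u v v' [G FG Guv] [G' FG' Guv'].
    have [GG'|G'G] := Ft _ _ FG FG'.
      by have [_ Gf _] := FP _ FG'; apply: Gf Guv'; apply: GG'.
    by have [_ Gf _] := FP _ FG; apply: Gf Guv _; apply: G'G.
  - move=> u v u' v' [G FG Guv] [G' FG' Guv'].
    have [GG'|G'G] := Ft _ _ FG FG'.
      exists G' => //; have [_ _ GB] := FP _ FG'.
      by apply: GB => //; apply: GG'.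
    exists G => //; have [_ _ GB] := FP _ FG.
    by apply: GB => //; apply: G'G.
have A0 : A (0, 0).
  have [[[u v] Auv]|/forallNP nA] := pselect (exists x, A x).
    by have := AB _ _ _ _ Auv Auv; rewrite !subrr.
  case: (Amax [set (0, 0)]%classic).
    split; first by move=> x /nA.
    by move=> /(_ (0, 0) erefl) /nA.
  split.
  - by move=> u v [-> ->].
  - by move=> u v v' [_ ->] [_ ->].
  - by move=> u v u' v' [-> ->] [-> ->]; rewrite !subrr.
have AN u v : A (u, v) -> A (- u, - v).
  by move=> /(AB _ _ _ _ A0); rewrite !sub0r.
have AD u v u' v' : A (u, v) -> A (u', v') -> A (u + u', v + v').
  by move=> Auv /AN /(AB _ _ _ _ Auv); rewrite !opprK.
have AM u v n : A (u, v) -> A (u *+ n, v *+ n).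
  by move=> Auv; elim: n => [|n IHn] //; rewrite !mulrS; apply: AD.
have RM u v (n : int) : R u v -> R (u *~ n) (v *~ n).
  move=> Ruv.
  have RN a b : R a b -> R (- a) (- b) by move=> /(RB R0); rewrite !sub0r.
  have RMn k : R (u *+ k) (v *+ k).
    elim: k => [|k IHk] //; have := RB Ruv (RN _ _ IHk).
    by rewrite !opprK -!mulrS.
  by case: n => n; rewrite ?NegzE ?mulrNz -!pmulrn; [|apply: RN]; apply: RMn.
have Adom u : exists v, A (u, v).
  apply: contrapT => /forallNP nu; have [v Ruv] := Rtot u.
  pose B : set (U * V) := fun x => exists a b (j : int),
    A (a, b) /\ x = (a + u *~ j, b + v *~ j).
  apply: (Amax B).
    split.
      by move=> [a b] Aab; exists a, b, 0; rewrite !mulr0z !addr0.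
    move=> /(_ (u, v)) BA; apply: (nu v); apply: BA.
    by exists 0, 0, 1; rewrite !add0r.
  split.
  - move=> _ _ [a [b [j [Aab [-> ->]]]]].
    have := RB (AR _ _ Aab) (RM _ _ (- j) Ruv).
    by rewrite !mulrNz !opprK.
  - move=> x y y' [a [b [j [Aab [-> ->]]]]] [a' [b' [j' [Aab' [e ->]]]]].
    have e1 : a - a' = u *~ (j' - j).
      rewrite mulrzBr; apply/eqP; rewrite subr_eq addrAC -subr_eq opprK e.
      by rewrite addrC.
    (* If p did not divide k, then u would be a multiple of k u modulo p, and k u lies in the domain
       of A; but u was chosen outside of it. *)
    have pk : (p %| j' - j)%Z.
      apply: contrapT => npk; set k := (j' - j)%R in e1 npk.
      have [c Hc] : exists c : nat, (p %| 1 + c * `|k|)%N.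
        have [c _] := @Bezoutl p `|k|%N (prime_gt0 p_pr).
        have /eqP -> : coprime p `|k|%N.
          by rewrite prime_coprime //; apply/negP => pk; apply: npk; rewrite dvdzE.
        by exists c.
      have uk : exists w, A (u *+ `|k|%N, w).
        have := AB _ _ _ _ Aab Aab'; rewrite e1 => Ak.
        case: (k) Ak => n; rewrite ?NegzE ?mulrNz -?pmulrn => Ak.
          by exists (b - b').
        by exists (- (b - b')); have := AN _ _ Ak; rewrite opprK abszN.
      case: uk => w Aw; apply: (nu (- (w *+ c))).
      have -> : u = - (u *+ `|k|%N *+ c).
        apply/eqP; rewrite -addr_eq0 -mulrnA -mulrS mulnC.
        by case/dvdnP: Hc => d; rewrite add1n => ->; rewrite mulnC mulrnA Up mul0rn.
      by apply/AN/AM.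
    have ab : a = a'.
      by apply/eqP; rewrite -subr_eq0 e1 mulrzp.
    have -> : b = b' by apply: Af Aab _; rewrite ab.
    congr (_ + _); apply/eqP; rewrite eq_sym -subr_eq0 -mulrzBr mulrzp //.
  - move=> _ _ _ _ [a [b [j [Aab [-> ->]]]]] [a' [b' [j' [Aab' [-> ->]]]]].
    exists (a - a'), (b - b'), (j - j'); split; first exact: AB.
    by rewrite !mulrzBr !opprD; congr (_, _); rewrite addrACA.
have [s sA] := choice Adom.
have sD : {morph s : x y / x + y}.
  by move=> x y; apply: Af (sA _) _; apply: AD.
by exists (mkadd sD) => u; apply: AR; apply: sA.
Qed.

End LinearLifting.

(** The type of a stage varies with n. [Q] collects what a stage must satisfy for the next one to
    exist, [R] what links the two. *)
Lemma dependent_choice (T : nat -> Type) (Q : forall n, T n -> Prop)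
    (R : forall n, T n -> T n.+1 -> Prop) :
  (exists x, Q 0%N x) ->
  (forall n x, Q n x -> exists y, Q n.+1 y /\ R n x y) ->
  exists f : forall n, T n, forall n, Q n (f n) /\ R n (f n) (f n.+1).
Proof.
move=> /cid [x0 Q0] H.
have step n (x : {x | Q n x}) : {y : {y | Q n.+1 y} | R n (sval x) (sval y)}.
  case: x => x Qx; have [y [Qy Ry]] := cid (H n x Qx).
  by exists (exist _ y Qy).
pose f := fix f n : {x | Q n x} :=
  if n is m.+1 then sval (step m (f m)) else exist _ x0 Q0.
exists (fun n => sval (f n)) => n; split; first exact: svalP (f n).
exact: svalP (step n (f n)).
Qed.

(** * Splitting a surjection with acyclic kernel up to homotopy *)

Section Splitting.
Variables (p : nat) (p_pr : prime p) (V W : sgrp) (q : smap V W).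
Hypotheses (Vp : forall n (v : V n), v *+ p = 0)
  (Wp : forall n (w : W n), w *+ p = 0).
Hypothesis qac : acyclic_kernel q.
Hypothesis q_surj : forall n (w : W n), exists v, q n v = w.

(** The elements over w whose faces are prescribed by the previous stage form an additive relation,
    total by [filler], in which [additive_selection] picks an additive function. Only faces are
    respected, which suffices because homology is computed from faces. *)
Lemma semisimplicial_section : exists s : ssmap W V, forall n w, q n (s n w) = w.
Proof.
(* The second clause, that the faces of a stage factor through an earlier map, yields the matching
   condition of [filler] for the next stage. *)
pose Q n (s : {additive W n -> V n}) := (forall w, q n (s w) = w) /\
  match n return {additive W n -> V n} -> Prop with
  | 0%N => fun _ => True
  | m.+1 => fun s => exists s' : {additive W m -> V m},
      forall i w, (i <= m.+1)%N -> fc V m i (s w) = s' (fc W m i w)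
  end s.
pose R n (s : {additive W n -> V n}) (s' : {additive W n.+1 -> V n.+1}) :=
  forall i w, (i <= n.+1)%N -> fc V n i (s' w) = s (fc W n i w).
have [||s sP] := @dependent_choice _ Q R.
- have [|||s sP] := @additive_selection p p_pr _ _ (@Wp 0%N) (@Vp 0%N)
    (fun w v => q 0%N v = w).
  + exact: raddf0.
  + by move=> u v u' v' /= <- <-; rewrite raddfB.
  + exact: q_surj.
  by exists s; split.
- move=> n s [qs fs].
  have [|||s' s'P] := @additive_selection p p_pr _ _ (@Wp n.+1) (@Vp n.+1)
    (fun w v => q n.+1 v = w /\
       forall i, (i <= n.+1)%N -> fc V n i v = s (fc W n i w)).
  + by split=> [|i _]; rewrite !raddf0.
  + move=> u v u' v' [<- f1] [<- f2]; split=> [|i im]; first by rewrite raddfB.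
    by rewrite !raddfB /= f1 ?f2.
  + move=> w; have [|||x [qx fx]] := @filler _ _ q qac _ n w (fun i => s (fc W n i w)).
    * exact: q_surj.
    * by move=> i _; rewrite qs.
    * case: n s qs fs w => //= m s qs [s0 fs] w i j ij jm.
      by rewrite !fs ?fcfc //; lia.
    by exists x.
  exists s'; split; last by move=> i w; exact: (s'P w).2.
  by split=> [w|]; [exact: (s'P w).1|exists s => i w; exact: (s'P w).2].
have sE n i x : (i <= n.+1)%N -> s n (fc W n i x) = fc V n i (s n.+1 x).
  by move=> im; rewrite (sP n).2.
by exists (SSMap sE) => n w; exact: (sP n).1.1.
Qed.

Variable s : ssmap W V.
Hypothesis qs : forall n w, q n (s n w) = w.
Let r n (x : V n) := x - s n (q n x).

(** [c] is an extra degeneracy in front of the others which contracts the kernel: its zeroth face is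
    the projection [r] = id - s q onto the kernel, and it commutes with the shifted faces. It is
    selected like the section, with [filler] over 0. *)
Lemma kernel_contraction : exists c : forall n, {additive V n -> V n.+1},
  [/\ forall n x, q n.+1 (c n x) = 0,
      forall n x, fc V n 0 (c n x) = r x,
      forall x, fc V 0 1 (c 0%N x) = 0
    & forall n i x, (i <= n.+1)%N -> fc V n.+1 i.+1 (c n.+1 x) = c n (fc V n i x)].
Proof.
pose Q n (c : {additive V n -> V n.+1}) :=
  [/\ forall x, q n.+1 (c x) = 0, forall x, fc V n 0 (c x) = r x
    & match n return {additive V n -> V n.+1} -> Prop with
      | 0%N => fun c => forall x, fc V 0 1 (c x) = 0
      | m.+1 => fun c => exists c' : {additive V m -> V m.+1},
          forall i x, (i <= m.+1)%N -> fc V m.+1 i.+1 (c x) = c' (fc V m i x)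
      end c].
pose R n (c : {additive V n -> V n.+1}) (c' : {additive V n.+1 -> V n.+2}) :=
  forall i x, (i <= n.+1)%N -> fc V n.+1 i.+1 (c' x) = c (fc V n i x).
have r0 n : r (0 : V n) = 0 by rewrite /r !raddf0 ?subrr ?addr0.
have rB n (x y : V n) : r (x - y) = r x - r y.
  by rewrite /r (raddfB (q n)) /= (raddfB (s n)) /= !opprD !opprK addrACA.
have qr n (x : V n) : q n (r x) = 0 by rewrite /r raddfB /= qs subrr.
have rf n i x : (i <= n.+1)%N -> fc V n i (r x) = r (fc V n i x).
  by move=> im; rewrite /r raddfB /= !smpE.
have [||c cP] := @dependent_choice _ Q R.
- have [|||c cP] := @additive_selection p p_pr _ _ (@Vp 0%N) (@Vp 1%N)
    (fun x v => [/\ q 1%N v = 0, fc V 0 0 v = r x & fc V 0 1 v = 0]).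
  + by rewrite !raddf0 r0.
  + move=> u v u' v' [q1 f1 g1] [q2 f2 g2].
    by rewrite !raddfB /= q1 q2 f1 f2 g1 g2 rB !subr0.
  + move=> x; have [|||y [qy fy]] := @filler _ _ q qac _ 0%N 0
      (fun i => if i == 0%N then r x else 0).
    * exact: q_surj.
    * by move=> i _; rewrite raddf0; case: ifP; rewrite ?raddf0.
    * by [].
    by exists y; rewrite !fy.
  by exists c; split=> x; have [] := cP x.
- move=> n c [qc c0 ct].
  have [|||c' c'P] := @additive_selection p p_pr _ _ (@Vp n.+1) (@Vp n.+2)
    (fun x v => [/\ q n.+2 v = 0, fc V n.+1 0 v = r x &
      forall i, (i <= n.+1)%N -> fc V n.+1 i.+1 v = c (fc V n i x)]).
  + by split=> [||i _]; rewrite !raddf0 ?r0.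
  + move=> u v u' v' [q1 f1 g1] [q2 f2 g2].
    split=> [||i im]; rewrite !raddfB /= ?q1 ?q2 ?f1 ?f2 ?rB ?subr0 //.
    by rewrite g1 ?g2.
  + move=> x; have [|||y [qy fy]] := @filler _ _ q qac _ n.+1 0
      (fun i => if i is i'.+1 then c (fc V n i' x) else r x).
    * exact: q_surj.
    * by move=> [|i] _; rewrite raddf0 ?qr ?qc.
    * move=> [|i] j ij jn /=; first by rewrite c0 rf.
      case: j ij jn => // j ij jn.
      case: n c qc c0 ct x jn => [|n] c qc c0 ct x jn.
        have {ij jn} [-> ->] : i = 0%N /\ j = 0%N by lia.
        by rewrite !ct.
      case: ct => c1 ct; rewrite !ct ?fcfc //; lia.
    by exists y; split=> // [|i im]; rewrite fy.
  exists c'; split; last by move=> i x im; have [_ _] := c'P x; apply.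
  split=> [x|x|]; try by have [] := c'P x.
  by exists c => i x im; have [_ _] := c'P x; apply.
exists c; split=> [n x|n x|x|n]; try by have [[]] := cP n.
by have [[_ _ /(_ x)]] := cP 0%N.
Qed.

(* The cone contraction c of the kernel gives the prism homotopy from the
   identity to s q: h_j = s_j s q + s_0^j c d_0^j. *)
Lemma splitting_homotopy : exists h : homotopy (fun n x => s n (q n x)), True.
Proof.
have [c [qc c0 c1 cS]] := kernel_contraction.
pose fix e n j : V n -> V n.+1 :=
  match j with
  | 0%N => c n
  | j'.+1 => match n return V n -> V n.+1 with
             | 0%N => fun _ => 0
             | m.+1 => fun x => dg V m.+1 0 (e m j' (fc V m 0 x))
             end
  end.
have eD n j : {morph e n j : x y / x + y}.
  elim: j n => [|j IHj] [|n] x y /=; rewrite ?raddfD ?addr0 //= ?IHj ?raddfD //.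
have e_lt n : forall i j x, (i <= j)%N -> (j <= n)%N ->
    fc V n.+1 i (e n.+1 j.+1 x) = e n j (fc V n i x).
  elim: n => [|n IHn] i j x ij jn.
    have [-> ->] : i = 0%N /\ j = 0%N by lia.
    by rewrite /= fcdg_eq.
  case: i ij => [|i] ij; first by rewrite /= fcdg_eq.
  case: i ij => [|i] ij.
    case: j ij jn => // j ij jn; rewrite [LHS]/= fcdg_S //.
    by rewrite [RHS]/= [in RHS]fcfc // /= fcdg_eq // !fcfc.
  case: j ij jn => // j ij jn; rewrite [LHS]/= fcdg_gt //; try lia.
  rewrite [RHS]/= fcfc //; try lia.
  by congr (dg V _ _ _); apply: IHn; lia.
have e_gt n : forall i j x, (j < i)%N -> (i <= n.+1)%N ->
    fc V n.+1 i.+1 (e n.+1 j x) = e n j (fc V n i x).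
  elim: n => [|n IHn] i [|j] x ji im /=; rewrite ?cS //.
    by exfalso; lia.
  case: i ji im => // i ji im; rewrite fcdg_gt //; try lia.
  by rewrite IHn ?fcfc //; lia.
have e_eq n : forall j x, (j < n)%N ->
    fc V n j.+1 (e n j.+1 x) = fc V n j.+1 (e n j x).
  elim: n => [|n IHn] // [|j] x jn.
    rewrite /= fcdg_S // cS //.
  case: n IHn x jn => [|n] IHn x jn; first by lia.
  rewrite [e n.+2 j.+2 x]/= [e n.+2 j.+1 x]/= [LHS]fcdg_gt; try lia.
  rewrite [RHS]fcdg_gt; try lia.
  by congr (dg V _ _ _); apply: IHn; lia.
have e_last n : forall x, fc V n n.+1 (e n n x) = 0.
  elim: n => [|n IHn] x; first exact: c1.
  by rewrite /= fcdg_gt // IHn raddf0.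
pose h n j (x : V n) := dg V n j (s n (q n x)) + e n j x.
have hD n j : {morph h n j : x y / x + y}.
  by move=> x y; rewrite /h eD !raddfD addrACA.
unshelve eexists (@Homotopy V _ (fun n j => mkadd (hD n j)) _ _ _ _ _) => //.
- move=> n i j x ij jn; rewrite /= /mkadd_of /h raddfD /= fcdg_lt // e_lt //.
  by rewrite !smpE //; lia.
- move=> n i j x ij jn; rewrite /= /mkadd_of /h raddfD /= fcdg_gt // e_gt //.
  by rewrite !smpE.
- move=> n j x jn; rewrite /= /mkadd_of /h !raddfD /= e_eq //.
  by rewrite fcdg_eq ?fcdg_S //; lia.
- by move=> n x; rewrite /= /mkadd_of /h raddfD /= fcdg_eq // c0 addrC subrK.
- by move=> n x; rewrite /= /mkadd_of /h raddfD /= fcdg_S // e_last addr0.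
Qed.

End Splitting.

(** * The path object of a map of simplicial groups *)

Section PathObject.
Variables (V W : sgrp) (f : smap V W).

(** Iterating the zeroth face leaves the last vertex of a simplex. *)
Fixpoint vertex n : W n -> W 0%N :=
  match n with 0%N => id | m.+1 => fun w => vertex (fc W m 0 w) end.

Fact vertexD n : {morph @vertex n : x y / x + y}.
Proof. by elim: n => [|n IHn] x y //=; rewrite raddfD IHn. Qed.

Lemma vertex_fc n i (w : W n.+2) : (i <= n.+1)%N ->
  vertex (fc W n.+1 i w) = vertex w.
Proof.
elim: n i w => [|n IHn] [|i] w im //=.
  by have -> : i = 0%N; [lia|rewrite fcfc].
have := IHn i (fc W n.+2 0 w) im; rewrite /= => <-.
by rewrite fcfc //; lia.
Qed.

Lemma vertex_dg_lt n i (w : W n.+1) : (i <= n)%N -> vertex (dg W n.+1 i w) = vertex w.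
Proof.
elim: n i w => [|n IHn] [|i] w im //=; try by rewrite fcdg_eq.
by rewrite fcdg_lt //; [apply: (IHn i (fc W n.+1 0 w))|]; lia.
Qed.

Lemma vertex_dg n (w : W n) : vertex (dg W n n w) = vertex w.
Proof.
elim: n w => [|n IHn] w; first by rewrite /= fcdg_eq.
by rewrite [LHS]/= fcdg_lt //; exact: IHn.
Qed.

Section Level.
Variable n : nat.
(** The second component lies in the decalage of W: an (n + 1)-simplex whose last face is forgotten,
    with last vertex 0. For groups a direct sum with V can replace the fibre product over W, and
    [path_ev] adds the contributions of the two summands. *)
Definition path_pred : pred (V n * W n.+1) := fun x => vertex x.2 == 0.
Fact path_zmod_closed : zmod_closed path_pred.
Proof.
have v0 : vertex (0 : W n.+1) = 0.
  by apply: (addIr (vertex (0 : W n.+1))); rewrite -vertexD !add0r.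
have vN (w : W n.+1) : vertex (- w) = - vertex w.
  by apply/eqP; rewrite -addr_eq0 -vertexD addNr v0.
split=> [|x y xP yP]; first exact/eqP/v0.
have e : vertex (x.2 - y.2) = 0.
  by rewrite vertexD vN (eqP xP : vertex x.2 = 0) (eqP yP : vertex y.2 = 0) subr0.
exact/eqP/e.
Qed.
HB.instance Definition _ := GRing.isZmodClosed.Build (V n * W n.+1)%type path_pred
  path_zmod_closed.
Record path_elt := PathElt { path_val : V n * W n.+1; path_valP : path_val \in path_pred }.
HB.instance Definition _ := [isSub for path_val].
HB.instance Definition _ := [Choice of path_elt by <:].
HB.instance Definition _ := [SubChoice_isSubZmodule of path_elt by <:].
End Level.

Lemma path_vertex n (x : path_elt n) : vertex (path_val x).2 = 0.
Proof. exact/eqP/(path_valP x). Qed.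

Definition mkpath n v (w : W n.+1) (w0 : vertex w = 0) : path_elt n :=
  @PathElt n (v, w) (introT eqP w0).

Lemma path_eq n (x y : path_elt n) : (path_val x).1 = (path_val y).1 ->
  (path_val x).2 = (path_val y).2 -> x = y.
Proof.
by move=> e1 e2; apply: val_inj => /=; case: (path_val x) (path_val y) e1 e2 => [? ?] [? ?] /= -> ->.
Qed.

Fact vertex0 n : vertex (0 : W n) = 0.
Proof. by elim: n => //= n IHn; rewrite raddf0. Qed.

(** At i = n + 2 the face of the second component is the forgotten one and would drop the base
    vertex; the default 0 keeps every index inside the subgroup. *)
Fact path_fc_subproof n i (x : path_elt n.+1) :
  vertex (if (i <= n.+1)%N then fc W n.+1 i (path_val x).2 else 0) = 0.
Proof.
by case: ifP => [im|_]; [rewrite vertex_fc // path_vertex|exact: vertex0].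
Qed.
Definition path_fc n i (x : path_elt n.+1) : path_elt n :=
  mkpath (fc V n i (path_val x).1) (path_fc_subproof i x).
Fact path_fcD n i : {morph @path_fc n i : x y / x + y}.
Proof.
by move=> x y; apply: path_eq; rewrite /= ?raddfD //; case: ifP; rewrite ?raddfD ?addr0.
Qed.
Fact path_fcfc n i j x : (i <= j)%N -> (j <= n.+1)%N ->
  mkadd (@path_fcD n i) (mkadd (@path_fcD n.+1 j.+1) x) =
  mkadd (@path_fcD n j) (mkadd (@path_fcD n.+1 i) x).
Proof.
move=> ij jn; apply: path_eq; rewrite /= ?fcfc //.
by rewrite !(ltnS, jn) !(leq_trans ij) ?(leq_trans jn) ?fcfc //; lia.
Qed.

Fact path_dg_subproof n i (x : path_elt n) :
  vertex (if (i <= n)%N then dg W n.+1 i (path_val x).2 else 0) = 0.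
Proof.
by case: ifP => [im|_]; [rewrite vertex_dg_lt // path_vertex|exact: vertex0].
Qed.
Definition path_dg n i (x : path_elt n) : path_elt n.+1 :=
  mkpath (dg V n i (path_val x).1) (path_dg_subproof i x).
Fact path_dgD n i : {morph @path_dg n i : x y / x + y}.
Proof.
by move=> x y; apply: path_eq; rewrite /= ?raddfD //; case: ifP; rewrite ?raddfD ?addr0.
Qed.

Definition path_ss := @SSGrp (fun n => path_elt n) (fun n i => mkadd (@path_fcD n i)) path_fcfc.

Program Definition path : sgrp := @SGrp path_ss (fun n i => mkadd (@path_dgD n i)) _ _ _ _.
Next Obligation.
apply: path_eq; rewrite /= ?fcdg_lt //.
by rewrite !ltnS H0 !(leq_trans H) ?fcdg_lt //; lia.
Qed.
Next Obligation.
apply: path_eq; rewrite /= ?fcdg_eq //.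
by rewrite H (leq_trans H) // fcdg_eq //; lia.
Qed.
Next Obligation.
apply: path_eq; rewrite /= ?fcdg_S //.
by rewrite ltnS H fcdg_S //; lia.
Qed.
Next Obligation.
apply: path_eq; rewrite /= ?fcdg_gt //.
by rewrite !ltnS !H0 !ifT ?fcdg_gt //; lia.
Qed.

Fact path_prD n : {morph (fun x : path n => (path_val x).1) : x y / x + y}.
Proof. by []. Qed.
Definition path_pr : smap path V.
Proof.
unshelve refine (@SMap path V (@SSMap path V (fun n => mkadd (@path_prD n)) _) _) => //.
Defined.

Fact path_sndD n : {morph (fun x : path n => (path_val x).2) : x y / x + y}.
Proof. by []. Qed.
Definition path_fst n := mkadd (@path_prD n).
Definition path_snd n := mkadd (@path_sndD n).

Fact path_evD n : {morph (fun x : path n => f n (path_val x).1 + fc W n n.+1 (path_val x).2)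
  : x y / x + y}.
Proof. by move=> x y /=; rewrite !raddfD addrACA. Qed.
Definition path_ev : smap path W.
Proof.
unshelve refine (@SMap path W (@SSMap path W (fun n => mkadd (@path_evD n)) _) _).
  move=> n i x im; rewrite /= /mkadd_of /= im smpE // raddfD; congr (_ + _).
  by rewrite -fcfc //; lia.
move=> n i x im; rewrite /= /mkadd_of /= im smdg // raddfD; congr (_ + _).
by rewrite fcdg_gt //; lia.
Defined.

Fact path_inD n : {morph (fun v : V n => @mkpath n v 0 (vertex0 n.+1)) : x y / x + y}.
Proof. by move=> x y; apply: path_eq; rewrite /= ?addr0. Qed.
Definition path_in : ssmap V path.
Proof.
unshelve refine (@SSMap V path (fun n => mkadd (@path_inD n)) _).
by move=> n i x im; apply: path_eq; rewrite /= ?im ?raddf0.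
Defined.

Lemma path_pr_surj n (v : V n) : exists x, path_pr n x = v.
Proof. by exists (path_in n v). Qed.

(** The degeneracy s_(n+1) contracts the second component: its face d_(n+1) is the last one that
    remains and gives back the simplex, while d_(n+2) is forgotten. The sign is that of this face in
    the alternating sum. *)
Lemma path_pr_acyclic : acyclic_kernel path_pr.
Proof.
move=> n x xc; rewrite /= /mkadd_of /= => x1.
have vd : vertex (dg W n.+1 n.+1 ((path_val x).2 *~ (-1) ^+ n.+1)) = 0.
  have vMz k (w : W k) (z : int) : vertex (w *~ z) = vertex w *~ z.
    exact: (raddfMz (mkadd (@vertexD k))).
  by rewrite vertex_dg vMz path_vertex mul0rz.
exists (mkpath 0 vd); split=> //.
apply: path_eq.
  rewrite -[RHS]/(path_fst n _) raddf_sum big1 // => i _.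
  by rewrite (raddfMz (path_fst n)) /= /mkadd_of /= raddf0 mul0rz.
rewrite -[RHS]/(path_snd n _) raddf_sum.
under eq_bigr => i _ do
  rewrite (raddfMz (path_snd n)) /= /mkadd_of /= -ltnS ltn_ord raddfMz.
rewrite big_ord_recr /= raddfMz /= fcdg_eq // signMz2.
suff -> : \sum_(i < n.+1) fc W n.+1 i (dg W n.+1 n.+1 (path_val x).2 *~ (-1) ^+ n.+1)
    *~ (-1) ^+ i = 0 by rewrite add0r.
case: n x xc x1 vd => [|n] x xc x1 vd.
  rewrite big_ord1 raddfMz /= fcdg_lt //.
  by have /= -> := path_vertex x; rewrite raddf0 !mul0rz.
have xc2 : path_snd n (altsum x) = 0 by rewrite (xc : altsum x = 0).
have xc3 : \sum_(i < n.+2) fc W n.+1 i (path_val x).2 *~ (-1) ^+ i = 0.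
  rewrite -[RHS]xc2 raddf_sum; apply: eq_bigr => i _.
  by rewrite (raddfMz (path_snd n)) /= /mkadd_of /= -ltnS ltn_ord.
have e : dg W n.+1 n.+1 ((\sum_(i < n.+2) fc W n.+1 i (path_val x).2 *~ (-1) ^+ i)
    *~ (-1) ^+ n.+2) = 0 by rewrite xc3 mul0rz raddf0.
rewrite -[RHS]e mulrz_suml raddf_sum; apply: eq_bigr => i _.
by rewrite !raddfMz /= fcdg_lt ?leq_ord // mulrzAC.
Qed.

Fixpoint degen (X : sgrp) n : X 0%N -> X n :=
  match n with 0%N => id | m.+1 => fun x => dg X m 0 (@degen X m x) end.

Lemma vertex_degen n (w : W 0%N) : vertex (degen n w) = w.
Proof. by elim: n => //= n IHn; rewrite fcdg_eq. Qed.

Lemma smap_degen (X Y : sgrp) (g : smap X Y) n x : g n (degen n x) = degen n (g 0%N x).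
Proof. by elim: n => //= n IHn; rewrite smdg // IHn. Qed.

(** After subtraction of the degenerate simplex on its last vertex, w becomes the last face of a
    based simplex, namely of its own last degeneracy. The vertex itself is reached because f is
    surjective on homology in degree 0. *)
Lemma path_ev_surj : hiso (sschmap f) -> forall n (w : W n), exists x, path_ev n x = w.
Proof.
move=> hf n w.
have [x0 x0E] : exists x0 : path 0%N, path_ev 0%N x0 = vertex w.
  have [v [_ [z]]] := (hf 0%N).2 (vertex w) I.
  rewrite /= /mkadd_of /altsum big_ord_recl big_ord1 /= expr0 expr1 mulr1z mulrN1z => wE.
  (* The edge s_0 d_0 z - z has last vertex 0, and its forgotten face is d_0 z - d_1 z. *)
  have z0 : vertex (dg W 0 0 (fc W 0 0 z) - z) = 0.
    by rewrite /= raddfB /= fcdg_eq // subrr.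
  exists (mkpath v z0); rewrite /= /mkadd_of /= wE raddfB /= fcdg_S //.
have v0 : vertex (dg W n n (w - degen n (vertex w))) = 0.
  have := raddfB (mkadd (@vertexD n)) w (degen n (vertex w)); rewrite /= /mkadd_of => e.
  by rewrite -[LHS]/(vertex (dg W n n _)) vertex_dg e vertex_degen subrr.
have e1 : path_ev n (degen n x0) = degen n (vertex w) by rewrite smap_degen x0E.
have e2 : path_ev n (mkpath 0 v0) = w - degen n (vertex w).
  by rewrite /= /mkadd_of /= raddf0 add0r fcdg_S.
exists (degen n x0 + mkpath 0 v0).
transitivity (path_ev n (degen n x0) + path_ev n (mkpath 0 v0)).
  exact: (raddfD (path_ev n)).
by rewrite e1 e2 addrC subrK.
Qed.
End PathObject.

Section AcyclicKernels.
Variables (V W : sgrp) (q : smap V W).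
Hypothesis q_surj : forall n (w : W n), exists v, q n v = w.

(** This is the long exact homology sequence of a surjection, chased on elements. *)
Lemma acyclic_kernel_hiso : acyclic_kernel q <-> hiso (sschmap q).
Proof.
split=> [qac n|hq n x xc qx].
  split=> [x xc [z e]|y yc].
    have [z' z'E] := q_surj z.
    have [||y [_ yE]] := qac n (x - altsum z').
    - by apply: (cycB (X := sschain V)) => //; apply: (cyc_cd (X := sschain V)).
    - rewrite raddfB /=; have -> : q n (altsum z') = altsum (q n.+1 z').
        exact: (cmd (sschmap q)).
      by rewrite z'E [q n x]e subrr.
    by exists (z' + y); rewrite raddfD /= /mkadd_of -yE addrC subrK.
  have [x xy] := q_surj y.
  case: n y yc x xy => [|n] y yc x xy.
    by exists x; split=> //; exists 0; rewrite raddf0 addr0.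
  have [||u [qu uE]] := qac n (altsum x).
  - exact: (cyc_cd (X := sschain V)).
  - by have -> : q n (altsum x) = altsum (q n.+1 x); [exact: (cmd (sschmap q))|rewrite xy].
  exists (x - u); split; first by rewrite /= /mkadd_of raddfB /= uE subrr.
  by exists 0; rewrite !raddf0 addr0 /= raddfB /= qu subr0.
have [|y yE] := (hq n).1 x xc.
  by exists 0; rewrite raddf0 /= qx.
have [|u [uc [w wE]]] := (hq n.+1).2 (q n.+1 y).
  have e := cmd (sschmap q) y; rewrite -yE in e; exact: (etrans (esym e) qx).
have [w' w'E] := q_surj w.
exists (y - u - altsum w'); split.
  rewrite !raddfB /=; have -> : q n.+1 (altsum w') = altsum (q n.+2 w').
    exact: (cmd (sschmap q)).
  by rewrite w'E wE [X in _ - X]/= -addrA -opprD subrr.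
rewrite !raddfB /= -[altsum y]yE (uc : altsum u = 0) subr0.
by have -> : altsum (altsum w') = 0; [exact: (cdd (c := sschain V))|rewrite subr0].
Qed.
End AcyclicKernels.

(** * Functors of three abelian groups and weak equivalences *)

Record functor3 := Functor3 {
  fo :> zmodType -> zmodType -> zmodType -> zmodType;
  fm : forall A A' B B' C C' : zmodType, {additive A -> A'} -> {additive B -> B'} ->
    {additive C -> C'} -> {additive fo A B C -> fo A' B' C'};
  fm_id : forall (A B C : zmodType) (a : {additive A -> A}) (b : {additive B -> B})
    (c : {additive C -> C}), a =1 id -> b =1 id -> c =1 id -> fm a b c =1 id;
  fm_comp : forall A A' A'' B B' B'' C C' C'' : zmodType,
  forall
    (a : {additive A -> A'}) (a' : {additive A' -> A''}) (a'' : {additive A -> A''})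
    (b : {additive B -> B'}) (b' : {additive B' -> B''}) (b'' : {additive B -> B''})
    (c : {additive C -> C'}) (c' : {additive C' -> C''}) (c'' : {additive C -> C''}),
    a'' =1 a' \o a -> b'' =1 b' \o b -> c'' =1 c' \o c ->
    forall x, fm a' b' c' (fm a b c x) = fm a'' b'' c'' x }.

Section Functor3.
Variable T : functor3.


Lemma fm_square (A A1 A2 A' B B1 B2 B' C C1 C2 C' : zmodType)
    (a : {additive A -> A1}) (a1 : {additive A1 -> A'})
    (a2 : {additive A -> A2}) (a3 : {additive A2 -> A'})
    (b : {additive B -> B1}) (b1 : {additive B1 -> B'})
    (b2 : {additive B -> B2}) (b3 : {additive B2 -> B'})
    (c : {additive C -> C1}) (c1 : {additive C1 -> C'})
    (c2 : {additive C -> C2}) (c3 : {additive C2 -> C'}) :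
  (forall x, a1 (a x) = a3 (a2 x)) -> (forall x, b1 (b x) = b3 (b2 x)) ->
  (forall x, c1 (c x) = c3 (c2 x)) ->
  forall x, fm T a1 b1 c1 (fm T a b c x) = fm T a3 b3 c3 (fm T a2 b2 c2 x).
Proof.
move=> ea eb ec x.
rewrite (fm_comp (a'' := a1 \o a) (b'' := b1 \o b) (c'' := c1 \o c)) //.
by rewrite (fm_comp (a'' := a1 \o a) (b'' := b1 \o b) (c'' := c1 \o c)).
Qed.

Section Objects.
Variables A B C : ssgrp.
Fact fun_fcfc n i j x : (i <= j)%N -> (j <= n.+1)%N ->
  fm T (fc A n i) (fc B n i) (fc C n i)
    (fm T (fc A n.+1 j.+1) (fc B n.+1 j.+1) (fc C n.+1 j.+1) x) =
  fm T (fc A n j) (fc B n j) (fc C n j)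
    (fm T (fc A n.+1 i) (fc B n.+1 i) (fc C n.+1 i) x).
Proof. by move=> ij jn; apply: fm_square => y; apply: fcfc. Qed.
Definition fun_ss : ssgrp :=
  @SSGrp (fun n => T (A n) (B n) (C n)) (fun n i => fm T (fc A n i) (fc B n i) (fc C n i))
    fun_fcfc.
End Objects.

Section Maps.
Variables (A A' B B' C C' : ssgrp) (a : ssmap A A') (b : ssmap B B') (c : ssmap C C').
Fact fun_map_fc n i x : (i <= n.+1)%N ->
  fm T (a n) (b n) (c n) (fc (fun_ss A B C) n i x) =
  fc (fun_ss A' B' C') n i (fm T (a n.+1) (b n.+1) (c n.+1) x).
Proof. by move=> im; apply: fm_square => y; apply: smpE. Qed.
Definition fun_map : ssmap (fun_ss A B C) (fun_ss A' B' C') :=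
  @SSMap (fun_ss A B C) (fun_ss A' B' C') (fun n => fm T (a n) (b n) (c n)) fun_map_fc.
End Maps.

Section Surjective.
Variables (p : nat) (p_pr : prime p) (A A' B B' C C' : sgrp).
Variables (a : smap A A') (b : smap B B') (c : smap C C').
Hypotheses (Ap : forall n (x : A n), x *+ p = 0) (A'p : forall n (x : A' n), x *+ p = 0)
  (Bp : forall n (x : B n), x *+ p = 0) (B'p : forall n (x : B' n), x *+ p = 0)
  (Cp : forall n (x : C n), x *+ p = 0) (C'p : forall n (x : C' n), x *+ p = 0).
Hypotheses (a_surj : forall n y, exists x, a n x = y)
  (b_surj : forall n y, exists x, b n x = y) (c_surj : forall n y, exists x, c n x = y).
Hypotheses (a_ac : acyclic_kernel a) (b_ac : acyclic_kernel b) (c_ac : acyclic_kernel c).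

(** The sections and homotopies of the three maps are families of additive maps subject to equations
    between composites; applying [T] to them degree by degree gives a section and a homotopy
    again. *)
Lemma fun_map_hiso_surj : hiso (sschmap (fun_map a b c)).
Proof.
have [sa saK] := semisimplicial_section p_pr Ap A'p a_ac a_surj.
have [sb sbK] := semisimplicial_section p_pr Bp B'p b_ac b_surj.
have [sc scK] := semisimplicial_section p_pr Cp C'p c_ac c_surj.
have [ha _] := splitting_homotopy p_pr Ap a_ac a_surj saK.
have [hb _] := splitting_homotopy p_pr Bp b_ac b_surj sbK.
have [hc _] := splitting_homotopy p_pr Cp c_ac c_surj scK.
apply: (hiso_homotopy (s := fun_map sa sb sc)).
  move=> n y /=; rewrite (fm_comp (a'' := idfun) (b'' := idfun) (c'' := idfun)).
  - by rewrite fm_id.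
  - by move=> x; rewrite /= saK.
  - by move=> x; rewrite /= sbK.
  - by move=> x; rewrite /= scK.
unshelve refine (@Homotopy (fun_ss A B C) _
  (fun n j => fm T (ha n j) (hb n j) (hc n j)) _ _ _ _ _).
- by move=> n i j x ij jn; apply: fm_square => y; apply: ht_lt.
- by move=> n i j x ij jn; apply: fm_square => y; apply: ht_gt.
- by move=> n j x jn; apply: fm_square => y; apply: ht_eq.
- move=> n x /=; rewrite (fm_comp (a'' := idfun) (b'' := idfun) (c'' := idfun)).
  + by rewrite fm_id.
  + by move=> y; rewrite /= ht_0.
  + by move=> y; rewrite /= ht_0.
  + by move=> y; rewrite /= ht_0.
- by move=> n x /=; apply: fm_square => y; apply: ht_last.
Qed.
End Surjective.

Lemma path_torsion p (V W : sgrp) : (forall n (x : V n), x *+ p = 0) ->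
  (forall n (x : W n), x *+ p = 0) -> forall n (x : path V W n), x *+ p = 0.
Proof.
move=> Vp Wp n x; apply: path_eq.
  by rewrite -[LHS]/(@path_fst V W n _) raddfMn Vp.
by rewrite -[LHS]/(@path_snd V W n _) raddfMn Wp.
Qed.

(* Factor each map as V -> path -> W: both projections of the path object are
   surjective with acyclic kernel. *)
Theorem fun_map_hiso p (A A' B B' C C' : sgrp)
    (a : smap A A') (b : smap B B') (c : smap C C') : prime p ->
  (forall n (x : A n), x *+ p = 0) -> (forall n (x : A' n), x *+ p = 0) ->
  (forall n (x : B n), x *+ p = 0) -> (forall n (x : B' n), x *+ p = 0) ->
  (forall n (x : C n), x *+ p = 0) -> (forall n (x : C' n), x *+ p = 0) ->
  hiso (sschmap a) -> hiso (sschmap b) -> hiso (sschmap c) ->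
  hiso (sschmap (fun_map a b c)).
Proof.
move=> p_pr Ap A'p Bp B'p Cp C'p ha hb hc.
have ev_ac V W (f : smap V W) : hiso (sschmap f) -> acyclic_kernel (path_ev f).
  move=> hf; apply/(acyclic_kernel_hiso (path_ev_surj hf)).
  have hi : hiso (sschmap (path_in V W)).
    have hpr : hiso (sschmap (path_pr V W)).
      exact/(acyclic_kernel_hiso (@path_pr_surj V W))/path_pr_acyclic.
    pose idm : ssmap V V := @SSMap V V (fun n => idfun) (fun _ _ _ _ => erefl).
    apply: (hiso_cancel_l (h := sschmap idm) (g := sschmap (path_pr V W))) => //.
    by apply: hiso_bij => n; exists id.
  apply: (hiso_cancel_r (h := sschmap f) (f := sschmap (path_in V W))) => // n x.
  by rewrite /= /mkadd_of /= raddf0 addr0.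
have Pp V W := @path_torsion p V W.
have hev : hiso (sschmap (fun_map (path_ev a) (path_ev b) (path_ev c))).
  by apply: (fun_map_hiso_surj p_pr) => //; try exact: Pp; try exact: path_ev_surj;
    apply: ev_ac.
have hpr : hiso (sschmap (fun_map (path_pr A A') (path_pr B B') (path_pr C C'))).
  by apply: (fun_map_hiso_surj p_pr) => //; try exact: Pp; try exact: path_pr_surj;
    apply: path_pr_acyclic.
have hin : hiso (sschmap (fun_map (path_in A A') (path_in B B') (path_in C C'))).
  pose idm : ssmap (fun_ss A B C) (fun_ss A B C) :=
    @SSMap _ _ (fun n => idfun) (fun _ _ _ _ => erefl).
  apply: (hiso_cancel_l (h := sschmap idm) _ _ hpr).
    move=> n x /=; rewrite (fm_comp (a'' := idfun) (b'' := idfun) (c'' := idfun)) //.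
    by rewrite fm_id.
  by apply: hiso_bij => n; exists id.
apply: (hiso_comp _ hin hev) => n x /=; apply/esym.
by apply: fm_comp => y; rewrite /= /mkadd_of /= raddf0 addr0.
Qed.

End Functor3.

(* Finitely supported functions K -> G. They are kept opaque: unfolding them
   makes unification diverge. *)
Record finsum_model (K : choiceType) (G : zmodType) := FinsumModel {
  fsm_mod : zmodType;
  fsm_U : G -> K -> fsm_mod;
  fsm_UD : forall k, {morph fsm_U^~ k : x y / x + y};
  fsm_ind : forall P : fsm_mod -> Prop, P 0 ->
    (forall x y, P x -> P y -> P (x + y)) -> (forall a k, P (fsm_U a k)) ->
    forall x, P x;
  fsm_lift : forall (N : zmodType) (f : K -> G -> N),
    (forall k, {morph f k : x y / x + y}) ->
    {F : {additive fsm_mod -> N} | forall k a, F (fsm_U a k) = f k a};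
  fsm_eq0 : forall x, (forall k (F : {additive fsm_mod -> G}),
    (forall a k', F (fsm_U a k') = if k == k' then a else 0) -> F x = 0) -> x = 0 }.

Lemma finsum_model_exists (K : choiceType) (G : zmodType) : finsum_model K G.
Proof.
apply: (@FinsumModel K G {malg G[K]} (fun a k => << a *g k >>)).
- by move=> k x y; rewrite monalgUD.
- move=> P P0 PD PU x; rewrite [x]monalgE; apply: big_ind => // k _; exact: PU.
2: { move=> x x0; apply/malgP => k; rewrite mcoeff0.
  by apply: (x0 k (mcoeff k)) => a k' /=; rewrite mcoeffU eq_sym; case: eqP. }
move=> N f fD; pose h (x : {malg G[K]}) := \sum_(k <- msupp x) f k x@_k.
have h_wide x (d : {fset K}) : fsubset (msupp x) d -> h x = \sum_(k <- d) f k x@_k.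
  move=> xd; rewrite /h (big_fset_incl _ xd) // => k _ kx.
  rewrite mcoeff_outdom //; exact: (raddf0 (mkadd (fD k))).
have hD : {morph h : x y / x + y}.
  move=> x y; pose d := fsetU (msupp x) (msupp y).
  rewrite (@h_wide x d) ?fsubsetUl // (@h_wide y d) ?fsubsetUr //.
  rewrite (@h_wide (x + y) d) ?msuppD_le // -big_split.
  by apply: eq_bigr => k _; rewrite mcoeffD fD.
exists (mkadd hD) => k a; rewrite /= /mkadd_of.
by rewrite (@h_wide _ [fset k]%fset) ?msuppU_le // big_seq_fset1 mcoeffUU.
Qed.

(** * Finitely supported functions and divided power polynomial rings *)

Section Finsum.
Variables (K : choiceType) (G : zmodType).
Definition finsum : zmodType := fsm_mod (finsum_model_exists K G).
Definition fsU (a : G) (k : K) : finsum := fsm_U (finsum_model_exists K G) a k.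
Lemma fsUD k : {morph fsU^~ k : x y / x + y}. Proof. exact: fsm_UD. Qed.
Lemma fs_ind (P : finsum -> Prop) : P 0 ->
  (forall x y, P x -> P y -> P (x + y)) -> (forall a k, P (fsU a k)) -> forall x, P x.
Proof. exact: fsm_ind. Qed.
Definition fslift (N : zmodType) (f : K -> G -> N) (fD : forall k, {morph f k : x y / x + y}) :
  {additive finsum -> N} := sval (fsm_lift (finsum_model_exists K G) fD).
Lemma fsliftU (N : zmodType) (f : K -> G -> N) (fD : forall k, {morph f k : x y / x + y}) k a :
  fslift fD (fsU a k) = f k a.
Proof. exact: (svalP (fsm_lift (finsum_model_exists K G) fD)). Qed.
Lemma fsUMn a k n : fsU (a *+ n) k = fsU a k *+ n.
Proof. exact: (raddfMn (mkadd (@fsUD k))). Qed.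
Lemma fs_ext (N : zmodType) (f g : {additive finsum -> N}) :
  (forall a k, f (fsU a k) = g (fsU a k)) -> f =1 g.
Proof.
move=> fg; apply: fs_ind => //; first by rewrite (raddf0 f) (raddf0 g).
by move=> x y fx fy; rewrite (raddfD f) (raddfD g) /= fx fy.
Qed.
Fact fscoef_add k k' : {morph (fun a : G => if k == k' :> K then a else 0) : x y / x + y}.
Proof. by move=> x y; case: ifP; rewrite ?addr0. Qed.
Definition fscoef k : {additive finsum -> G} := fslift (fscoef_add k).
Lemma fscoefU k a k' : fscoef k (fsU a k') = if k == k' then a else 0.
Proof. exact: fsliftU. Qed.
Lemma fs_eq x y : (forall k, fscoef k x = fscoef k y) -> x = y.
Proof.
move=> xy; apply/eqP; rewrite -subr_eq0; apply/eqP.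
apply: (@fsm_eq0 K G (finsum_model_exists K G)) => k F FU.
have -> : F (x - y) = fscoef k (x - y).
  by apply: fs_ext => a k'; rewrite fscoefU; exact: FU.
by rewrite raddfB /= xy subrr.
Qed.
End Finsum.

Section MkRing.
Variables (R S : pzRingType) (f : R -> S).
Hypotheses (fD : {morph f : x y / x + y}) (fM : {morph f : x y / x * y}) (f1 : f 1 = 1).
Definition mkrm_of : R -> S := f.
Fact mkrm_is_nmod : nmod_morphism mkrm_of.
Proof. exact: (mkadd_is_nmod fD). Qed.
Fact mkrm_is_monoid : monoid_morphism mkrm_of.
Proof. by []. Qed.
HB.instance Definition _ := GRing.isNmodMorphism.Build R S mkrm_of mkrm_is_nmod.
HB.instance Definition _ := GRing.isMonoidMorphism.Build R S mkrm_of mkrm_is_monoid.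
Definition mkrm : {rmorphism R -> S} := mkrm_of.
End MkRing.

(** The variables in [d] have divided powers, the others ordinary powers. The predicate affects only
    the multiplication, and the type carries it so that the ring structure can be attached. *)
Definition dpoly (X : choiceType) (d : pred X) (A : zmodType) : Type := finsum {cmonom X} A.
HB.instance Definition _ X d A := GRing.Zmodule.on (@dpoly X d A).

Section Monomials.
Variables (X : choiceType) (d : pred X).

Definition mcoc1 (k : X) a b : nat := if d k then 'C(a + b, a) else 1.
Lemma mcoc1C k a b : mcoc1 k a b = mcoc1 k b a.
Proof.
by rewrite /mcoc1; case: ifP => // _; rewrite addnC -[in LHS]bin_sub ?leq_addl // addnK.
Qed.
Lemma mcoc10 k b : mcoc1 k 0 b = 1%N.
Proof. by rewrite /mcoc1 bin0 if_same. Qed.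
(** For a divided power variable both sides are the trinomial coefficient (a + b + c)! / (a! b! c!),
    compared after multiplication by the denominators. *)
Lemma mcoc1A k a b c :
  (mcoc1 k a b * mcoc1 k (a + b) c)%N = (mcoc1 k b c * mcoc1 k a (b + c))%N.
Proof.
rewrite /mcoc1; case: ifP => // _.
have f0 n : (0 < n`!)%N := fact_gt0 n.
apply/eqP; rewrite -(eqn_pmul2r (f0 a)) -(eqn_pmul2r (f0 b)) -(eqn_pmul2r (f0 c)).
have e1 := bin_fact (leq_addr b a); have e2 := bin_fact (leq_addr c (a + b)).
have e3 := bin_fact (leq_addr c b); have e4 := bin_fact (leq_addr (b + c) a).
rewrite !addKn in e1 e2 e3 e4; rewrite addnA in e4.
apply/eqP; transitivity ((a + b + c)`!).
  rewrite -e2 -e1; ring.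
by rewrite addnA -e4 -e3; ring.
Qed.

(* The monomials e_m of the divided power ring in the variables d, polynomial
   in the others, multiply by e_m e_n = mcoc m n e_(m n). *)
Definition mcoc (m n : {cmonom X}) : nat :=
  (\prod_(k <- finsupp (mmul m n)) mcoc1 k (m k) (n k))%N.

Lemma cm_out (m : {cmonom X}) k : k \notin finsupp m -> m k = 0%N.
Proof. by rewrite -cmE_eq0 => /eqP. Qed.

Lemma mcoc_wide (m n : {cmonom X}) (s : {fset X}) : fsubset (finsupp m) s ->
  fsubset (finsupp n) s -> mcoc m n = (\prod_(k <- s) mcoc1 k (m k) (n k))%N.
Proof.
move=> ms ns; apply: big_fset_incl.
  by rewrite mdomD fsubUset ms ns.
move=> k _; rewrite mdomD in_fsetU negb_or => /andP[km kn].
by rewrite (cm_out km) (cm_out kn) mcoc10.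
Qed.

Lemma mcocC m n : mcoc m n = mcoc n m.
Proof.
rewrite /mcoc [mmul n m]mulmC; apply: eq_bigr => k _; exact: mcoc1C.
Qed.

Lemma mcoc1l n : mcoc mone n = 1%N.
Proof. by rewrite /mcoc big1 // => k _; rewrite cm1 mcoc10. Qed.

Lemma mcocA m n l : (mcoc m n * mcoc (mmul m n) l)%N = (mcoc n l * mcoc m (mmul n l))%N.
Proof.
pose s := finsupp (mmul m (mmul n l)).
have [ms ns ls] : [/\ fsubset (finsupp m) s, fsubset (finsupp n) s & fsubset (finsupp l) s].
  rewrite /s !mdomD; split; first exact: fsubsetUl.
    by apply: fsubset_trans (fsubsetUr _ _); exact: fsubsetUl.
  by apply: fsubset_trans (fsubsetUr _ _); exact: fsubsetUr.
rewrite (mcoc_wide ms ns) (mcoc_wide ns ls).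
rewrite (@mcoc_wide _ l s) ?mdomD ?fsubUset ?ms ?ns //.
rewrite (@mcoc_wide m _ s) ?mdomD ?fsubUset ?ls ?ns //.
rewrite -!big_split; apply: eq_bigr => k _ /=.
by rewrite !cmM mcoc1A.
Qed.

Section Evaluation.
Variables (R : comPzRingType) (u : X -> nat -> R).
Hypotheses (u0 : forall k, u k 0%N = 1)
  (uD : forall k a b, u k a * u k b = u k (a + b)%N *+ mcoc1 k a b).

Definition mprod (m : {cmonom X}) : R := \prod_(k <- finsupp m) u k (m k).

Lemma mprod_wide (m : {cmonom X}) (s : {fset X}) : fsubset (finsupp m) s ->
  mprod m = \prod_(k <- s) u k (m k).
Proof.
by move=> ms; apply: big_fset_incl => // k _ km; rewrite (cm_out km) u0.
Qed.

Lemma prodrMn_nat (s : seq X) (F : X -> R) (c : X -> nat) :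
  \prod_(k <- s) (F k *+ c k) = (\prod_(k <- s) F k) *+ (\prod_(k <- s) c k).
Proof.
elim: s => [|k s IHs]; first by rewrite !big_nil.
by rewrite !big_cons IHs mulrnAl mulrnAr -mulrnA mulnC.
Qed.

Lemma mprodM (m n : {cmonom X}) : mprod m * mprod n = mprod (mmul m n) *+ mcoc m n.
Proof.
have [ms ns] : fsubset (finsupp m) (finsupp (mmul m n)) /\
               fsubset (finsupp n) (finsupp (mmul m n)).
  by rewrite mdomD fsubsetUl fsubsetUr.
rewrite (mprod_wide ms) (mprod_wide ns) -big_split /= /mprod -prodrMn_nat.
by apply: eq_bigr => k _; rewrite uD cmM.
Qed.

Lemma mprod1 : mprod mone = 1.
Proof. by rewrite /mprod mdom1 big_seq_fset0. Qed.

Lemma mprod_ucm k : mprod (ucm k) = u k 1%N.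
Proof. by rewrite /mprod mdomU big_seq_fset1 cmUU. Qed.
End Evaluation.


Section Ring.
Variable A : comPzRingType.
Local Notation P := (dpoly d A).
Local Notation mU a m := (fsU a m : P).

Fact dmul_inD (m : {cmonom X}) (a : A) (n : {cmonom X}) :
  {morph (fun b => mU (a * b *+ mcoc m n) (mmul m n)) : x y / x + y}.
Proof. by move=> x y; rewrite mulrDr mulrnDl fsUD. Qed.
Fact dmul_outD (m : {cmonom X}) (g : P) :
  {morph (fun a => fslift (dmul_inD m a) g) : x y / x + y}.
Proof.
move=> x y; elim/fs_ind: g => [|g h IHg IHh|b n]; first by rewrite !raddf0 addr0.
  by rewrite !raddfD /= IHg IHh addrACA.
by rewrite !fsliftU mulrDl mulrnDl fsUD.
Qed.
Definition dmul (f g : P) : P := fslift (fun m => dmul_outD m g) f.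

Lemma dmulU a b m n : dmul (mU a m) (mU b n) = mU (a * b *+ mcoc m n) (mmul m n).
Proof. by rewrite /dmul !fsliftU. Qed.

Fact dmulDl : left_distributive dmul +%R.
Proof. by move=> f g h; rewrite /dmul raddfD. Qed.

Fact dmulDr : right_distributive dmul +%R.
Proof.
move=> f g h; elim/fs_ind: f => [|f f' IH IH'|a m].
- by rewrite ![dmul 0 _](raddf0 (fslift _)) addr0.
- by rewrite !dmulDl IH IH' addrACA.
- by rewrite /dmul !fsliftU raddfD.
Qed.

Fact dmul0l f : dmul 0 f = 0. Proof. exact: raddf0. Qed.
Fact dmul0r f : dmul f 0 = 0.
Proof. by apply: (addIr (dmul f 0)); rewrite -dmulDr !add0r. Qed.

Fact dmulC : commutative dmul.
Proof.
move=> f g; elim/fs_ind: f => [|f f' IH IH'|a m]; first by rewrite dmul0l dmul0r.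
  by rewrite dmulDl dmulDr IH IH'.
elim/fs_ind: g => [|f f' IH IH'|b n]; first by rewrite dmul0l dmul0r.
  by rewrite dmulDl dmulDr IH IH'.
by rewrite !dmulU mulrC mcocC [mmul n m]mulmC.
Qed.

Fact dmulA : associative dmul.
Proof.
move=> f g h; elim/fs_ind: f => [|f f' IH IH'|a m]; first by rewrite !dmul0l.
  by rewrite !dmulDl IH IH'.
elim/fs_ind: g => [|g g' IH IH'|b n]; first by rewrite !(dmul0l, dmul0r).
  by rewrite !(dmulDl, dmulDr) IH IH'.
elim/fs_ind: h => [|h h' IH IH'|c l]; first by rewrite !dmul0r.
  by rewrite !dmulDr IH IH'.
rewrite !dmulU mulmA; congr (fsU _ _).
by rewrite mulrnAr mulrnAl mulrA -!mulrnA mcocA.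
Qed.

Fact dmul1l : left_id (mU 1 mone) dmul.
Proof.
elim/fs_ind => [|g h IHg IHh|b n]; first by rewrite dmul0r.
  by rewrite dmulDr IHg IHh.
by rewrite dmulU mul1r mcoc1l mul1m.
Qed.

HB.instance Definition _ := GRing.Zmodule_isComPzRing.Build P dmulA dmulC dmul1l dmulDl.

Lemma dpolyM a b m n : mU a m * mU b n = mU (a * b *+ mcoc m n) (mmul m n).
Proof. exact: dmulU. Qed.

Fact dpolyC_morph : {morph (fun a => mU a mone) : x y / x * y}.
Proof. by move=> a b; rewrite dpolyM mcoc1l mul1m. Qed.
Fact dpolyC_add : {morph (fun a => mU a mone) : x y / x + y}.
Proof. by move=> a b; rewrite fsUD. Qed.
Definition dpolyC : {rmorphism A -> P} := mkrm dpolyC_add dpolyC_morph erefl.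
Definition dmon (m : {cmonom X}) : P := mU 1 m.

Lemma dpolyCM a m : dpolyC a * dmon m = mU a m.
Proof. by rewrite /= /mkrm_of dpolyM mulr1 mcoc1l mul1m. Qed.

Lemma dmonM m n : dmon m * dmon n = dmon (mmul m n) *+ mcoc m n.
Proof. by rewrite dpolyM mulr1 -fsUMn. Qed.

Section Hom.
Variables (W : comPzRingType) (g : {rmorphism A -> W}) (u : X -> nat -> W).
Hypotheses (u0 : forall k, u k 0%N = 1)
  (uD : forall k a b, u k a * u k b = u k (a + b)%N *+ mcoc1 k a b).

Fact dev_add m : {morph (fun a => g a * mprod u m) : x y / x + y}.
Proof. by move=> a b; rewrite rmorphD mulrDl. Qed.
(** [u k n] is the intended value of the n-th power of k, divided if [d k] holds. One formula thus
    gives the universal property for both kinds of variables. *)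
Definition dev_of : P -> W := fslift dev_add.
Fact dev_ofD : {morph dev_of : x y / x + y}. Proof. exact: raddfD. Qed.
Fact dev_ofM : {morph dev_of : x y / x * y}.
Proof.
have d0 : dev_of 0 = 0 by exact: raddf0.
move=> x y; elim/fs_ind: x => [|x x' IH IH'|a m]; first by rewrite mul0r d0 mul0r.
  by rewrite mulrDl !dev_ofD mulrDl IH IH'.
elim/fs_ind: y => [|y y' IH IH'|b n]; first by rewrite mulr0 d0 mulr0.
  by rewrite mulrDr !dev_ofD mulrDr IH IH'.
rewrite dpolyM /dev_of !fsliftU mulrACA mprodM // mulrnAr.
by rewrite rmorphMn rmorphM mulrnAl.
Qed.
Fact dev_of1 : dev_of 1 = 1.
Proof. by rewrite /dev_of [LHS]fsliftU rmorph1 mul1r mprod1. Qed.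
Definition dev : {rmorphism P -> W} := mkrm dev_ofD dev_ofM dev_of1.

Lemma devU a m : dev (mU a m) = g a * mprod u m.
Proof. exact: fsliftU. Qed.

Lemma dev_unique (h : {rmorphism P -> W}) : (forall a, h (dpolyC a) = g a) ->
  (forall m, h (dmon m) = mprod u m) -> h =1 dev.
Proof.
move=> hC hm x; elim/fs_ind: x => [|x y hx hy|a m].
- by rewrite (rmorph0 h) (rmorph0 dev).
- by rewrite (rmorphD h) (rmorphD dev) hx hy.
- by rewrite devU -dpolyCM rmorphM hm hC.
Qed.
End Hom.
End Ring.
End Monomials.

(** * Abelian groups by generators and relations, and coinduced modules *)

Section Presentation.
Variables (G : choiceType) (D : forall N : zmodType, (G -> N) -> Prop).

Fact fsgen_add (N : zmodType) (f : G -> N) : forall k, {morph (fun z : int => f k *~ z) : x y / x + y}.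
Proof. by move=> k x y; rewrite mulrzDr. Qed.
Definition fsgen (N : zmodType) (f : G -> N) : {additive finsum G int -> N} :=
  fslift (fsgen_add f).

(** The relations are not listed: an element is a relation when every map satisfying [D] kills it.
    That the generators satisfy [D] themselves is not automatic; for the equational conditions in
    use it is recovered clause by clause through [pres_rel]. *)
Definition pres_pred : pred (finsum G int) :=
  fun x => `[< forall (N : zmodType) (f : G -> N), D f -> fsgen f x = 0 >].
Fact pres_zmod_closed : zmod_closed pres_pred.
Proof.
split; first by apply/asboolP => N f _; rewrite raddf0.
move=> x y /asboolP x0 /asboolP y0; apply/asboolP => N f Df.
by rewrite raddfB /= x0 // y0 // subrr.
Qed.
Definition pres_closed : zmodClosed (finsum G int) :=
  HB.pack pres_pred (GRing.isZmodClosed.Build (finsum G int) pres_pred pres_zmod_closed).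
Local Notation pi := (\pi_(Quotient.quot pres_closed))%qT.

Record pres_model := PresModel {
  prm_mod : zmodType;
  prm_gen : G -> prm_mod;
  prm_lift : forall (N : zmodType) (f : G -> N), D f ->
    {h : {additive prm_mod -> N} | forall g, h (prm_gen g) = f g};
  prm_ext : forall (N : zmodType) (h h' : {additive prm_mod -> N}),
    (forall g, h (prm_gen g) = h' (prm_gen g)) -> h =1 h';
  prm_eq : forall c : finsum G int,
    (forall (N : zmodType) (f : G -> N), D f -> fsgen f c = 0) -> fsgen prm_gen c = 0 }.

Lemma pres_model_exists : pres_model.
Proof.
pose gen g := pi (fsU (1 : int) g).
have genE c : fsgen gen c = pi c.
  elim/fs_ind: c => [|y z hy hz|a k]; first by rewrite !raddf0.
    by rewrite !raddfD /= hy hz.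
  rewrite fsliftU /gen -raddfMz; congr (pi _).
  by rewrite -[in RHS](intz a); apply/esym/(raddfMz (mkadd (@fsUD G int k))).
apply: (@PresModel _ gen) => [N f Df|N h h' e x|c c0].
- pose h (x : Quotient.quot pres_closed) := fsgen f (repr x).
  have hpi x : h (pi x) = fsgen f x.
    apply/eqP; rewrite -subr_eq0 -raddfB; apply/eqP.
    have : repr (pi x) - x \in pres_closed by rewrite Quotient.idealrBE reprK.
    by move/asboolP; apply.
  have hD : {morph h : x y / x + y}.
    move=> x y; rewrite -[x]reprK -[y]reprK -raddfD /= !hpi raddfD //.
  by exists (mkadd hD) => g; rewrite /= /mkadd_of hpi fsliftU.
- rewrite -[x]reprK -genE; move: (repr x); apply: (fs_ind (P := fun c => _ = _)).
  + by rewrite !raddf0.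
  + by move=> y z hy hz; rewrite !raddfD /= hy hz.
  + by move=> a k; rewrite fsliftU !raddfMz /= e.
- rewrite genE -(raddf0 pi); apply/eqP; rewrite -Quotient.idealrBE subr0.
  by apply/asboolP.
Qed.

(* The abelian group generated by G subject to the relations that hold in
   every abelian group with a map from G satisfying D. *)
Definition pres : zmodType := prm_mod pres_model_exists.
Definition pgen (g : G) : pres := prm_gen pres_model_exists g.
Definition pres_lift (N : zmodType) (f : G -> N) (Df : D f) : {additive pres -> N} :=
  sval (prm_lift pres_model_exists Df).
Lemma pres_liftE (N : zmodType) (f : G -> N) (Df : D f) g : pres_lift Df (pgen g) = f g.
Proof. exact: (svalP (prm_lift pres_model_exists Df)). Qed.
Lemma pres_ext (N : zmodType) (h h' : {additive pres -> N}) :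
  (forall g, h (pgen g) = h' (pgen g)) -> h =1 h'.
Proof. exact: prm_ext. Qed.
Lemma pres_rel (c : finsum G int) :
  (forall (N : zmodType) (f : G -> N), D f -> fsgen f c = 0) -> fsgen pgen c = 0.
Proof. exact: prm_eq. Qed.

Lemma fsgenU (N : zmodType) (f : G -> N) g : fsgen f (fsU 1 g) = f g.
Proof. exact: fsliftU. Qed.
Lemma pres_rel3 (a b c : G) :
  (forall (N : zmodType) (f : G -> N), D f -> f a = f b + f c) -> pgen a = pgen b + pgen c.
Proof.
move=> H; have := @pres_rel (fsU 1 a - (fsU 1 b + fsU 1 c)).
rewrite (raddfB (fsgen pgen)) (raddfD (fsgen pgen)) /= !fsgenU => e; apply/eqP; rewrite -subr_eq0; apply/eqP/e.
by move=> N f Df; rewrite (raddfB (fsgen f)) (raddfD (fsgen f)) /= !fsgenU H // subrr.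
Qed.
Lemma pres_rel2 (a b : G) :
  (forall (N : zmodType) (f : G -> N), D f -> f a = f b) -> pgen a = pgen b.
Proof.
move=> H; have := @pres_rel (fsU 1 a - fsU 1 b).
rewrite raddfB /= !fsgenU => e; apply/eqP; rewrite -subr_eq0; apply/eqP/e.
by move=> N f Df; rewrite raddfB /= !fsgenU H // subrr.
Qed.
Lemma pres_relN (a b : G) :
  (forall (N : zmodType) (f : G -> N), D f -> f a = - f b) -> pgen a = - pgen b.
Proof.
move=> H; have := @pres_rel (fsU 1 a + fsU 1 b).
rewrite raddfD /= !fsgenU => e; apply/eqP; rewrite -addr_eq0; apply/eqP/e.
by move=> N f Df; rewrite raddfD /= !fsgenU H // addNr.
Qed.
Lemma pres_rel0 (a : G) :
  (forall (N : zmodType) (f : G -> N), D f -> f a = 0) -> pgen a = 0.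
Proof.
move=> H; rewrite -(@pres_rel (fsU 1 a)) ?fsgenU // => N f Df.
by rewrite fsgenU H.
Qed.
End Presentation.

Section Coinduced.
Variables (R : comPzRingType) (N : zmodType).
(** The coinduced module Hom(R, N), with R acting on the argument, is right adjoint to forgetting
    the module structure. It turns additive maps out of an R-module into R-linear ones, so that
    universal properties among modules yield universal properties among abelian groups. *)
Record coind := Coind { cofun :> R -> N; cofunD : {morph cofun : x y / x + y} }.
HB.instance Definition _ := gen_eqMixin coind.
HB.instance Definition _ := gen_choiceMixin coind.
Lemma coind_eq (f g : coind) : f =1 g -> f = g.
Proof.
case: f g => [f fD] [g gD] /= /funext e; case: g / e gD => gD.
by rewrite (Prop_irrelevance fD gD).
Qed.
Lemma cofun0 (f : coind) : f 0 = 0.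
Proof. exact: (raddf0 (mkadd (@cofunD f))). Qed.
Fact coind_zeroP : {morph (fun _ : R => 0 : N) : x y / x + y}.
Proof. by move=> x y; rewrite addr0. Qed.
Fact coind_oppP (f : coind) : {morph (fun x => - f x) : x y / x + y}.
Proof. by move=> x y; rewrite cofunD opprD. Qed.
Fact coind_addP (f g : coind) : {morph (fun x => f x + g x) : x y / x + y}.
Proof. by move=> x y; rewrite !cofunD addrACA. Qed.
Fact coind_scaleP a (f : coind) : {morph (fun x => f (x * a)) : x y / x + y}.
Proof. by move=> x y; rewrite mulrDl cofunD. Qed.
Fact coind_addA : associative (fun f g => Coind (coind_addP f g)).
Proof. by move=> f g h; apply: coind_eq => x /=; rewrite addrA. Qed.
Fact coind_addC : commutative (fun f g => Coind (coind_addP f g)).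
Proof. by move=> f g; apply: coind_eq => x /=; rewrite addrC. Qed.
Fact coind_add0 : left_id (Coind coind_zeroP) (fun f g => Coind (coind_addP f g)).
Proof. by move=> f; apply: coind_eq => x /=; rewrite add0r. Qed.
Fact coind_addN : left_inverse (Coind coind_zeroP) (fun f => Coind (coind_oppP f))
  (fun f g => Coind (coind_addP f g)).
Proof. by move=> f; apply: coind_eq => x /=; rewrite addNr. Qed.
HB.instance Definition _ := GRing.isZmodule.Build coind coind_addA coind_addC coind_add0 coind_addN.
Definition coind_scale a f := Coind (coind_scaleP a f).
Fact coind_scaleA a b f : coind_scale a (coind_scale b f) = coind_scale (a * b) f.
Proof. by apply: coind_eq => x /=; rewrite mulrA. Qed.
Fact coind_scale1 : left_id 1 coind_scale.
Proof. by move=> f; apply: coind_eq => x /=; rewrite mulr1. Qed.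
Fact coind_scaleDr : right_distributive coind_scale +%R.
Proof. by move=> a f g; apply: coind_eq. Qed.
Fact coind_scaleDl f : {morph coind_scale^~ f : a b / a + b}.
Proof. by move=> a b; apply: coind_eq => x /=; rewrite mulrDr cofunD. Qed.
HB.instance Definition _ := GRing.Zmodule_isLmodule.Build R coind
  coind_scaleA coind_scale1 coind_scaleDr coind_scaleDl.
Lemma coindN (f : coind) x : (- f) x = - f x. Proof. by []. Qed.
Lemma coind0 x : (0 : coind) x = 0. Proof. by []. Qed.
Lemma coindZ a (f : coind) x : (a *: f) x = f (x * a). Proof. by []. Qed.
End Coinduced.

Record submodule (R : pzRingType) (M : lmodType R) := Submodule {
  subm :> M -> Prop;
  subm0 : subm 0;
  submZD : forall a x y, subm x -> subm y -> subm (a *: x + y) }.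

Section SubmoduleType.
Variables (R : pzRingType) (M : lmodType R) (S : submodule M).
Definition sub_pred : pred M := fun x => `[< S x >].
Fact sub_closed : submod_closed sub_pred.
Proof.
split=> [|a x y /asboolP Sx /asboolP Sy]; apply/asboolP; first exact: subm0.
exact: submZD.
Qed.
HB.instance Definition _ := GRing.isSubmodClosed.Build R M sub_pred sub_closed.
Record sub_elt := SubElt { sub_val : M; sub_valP : sub_val \in sub_pred }.
HB.instance Definition _ := [isSub for sub_val].
HB.instance Definition _ := [Choice of sub_elt by <:].
HB.instance Definition _ := [SubChoice_isSubLmodule of sub_elt by <:].
Fact sub_val_linear : linear sub_val. Proof. by []. Qed.
HB.instance Definition _ := GRing.isLinear.Build R sub_elt M *:%R sub_val sub_val_linear.
Definition sub_incl : {linear sub_elt -> M} := sub_val.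
Lemma sub_inclP x : S (sub_incl x).
Proof. exact/asboolP/(sub_valP x). Qed.
Definition mksub x (Sx : S x) : sub_elt := @SubElt x (asboolT Sx).
End SubmoduleType.

Section MkLinear.
Variables (R : pzRingType) (M N : lmodType R) (f : M -> N) (fl : linear f).
Definition mklin_of : M -> N := f.
Fact mklin_of_linear : linear mklin_of. Proof. exact: fl. Qed.
HB.instance Definition _ := GRing.isLinear.Build R M N *:%R mklin_of mklin_of_linear.
Definition mklin : {linear M -> N} := mklin_of.
End MkLinear.

(** * Exterior powers of free modules through alternating functions on a basis *)

Section Alternating.

Definition swap (T : Type) i (k l : 'I_i) (t : {ffun 'I_i -> T}) : {ffun 'I_i -> T} :=
  [ffun j => t (tperm k l j)].

Definition alternates (X : Type) (N : zmodType) i (f : {ffun 'I_i -> X} -> N) : Prop :=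
  forall k l, k != l -> forall t : {ffun 'I_i -> X},
    (t k = t l -> f t = 0) /\ f (swap k l t) = - f t.

Definition fmap_ff (S T : Type) i (b : S -> T) (t : {ffun 'I_i -> S}) : {ffun 'I_i -> T} :=
  [ffun k => b (t k)].

Lemma swap_upd (R : comPzRingType) (M : lmodType R) i k l j (y : M) (t : {ffun 'I_i -> M}) :
  swap k l (ff_upd t j y) = ff_upd (swap k l t) (tperm k l j) y.
Proof.
apply/ffunP => j'; rewrite !ffunE; congr (if _ then _ else _).
by apply/eqP/eqP => [<-|->]; rewrite tpermK.
Qed.

Lemma ff_updE (R : comPzRingType) (M : lmodType R) i k (t : {ffun 'I_i -> M}) :
  ff_upd t k (t k) = t.
Proof. by apply/ffunP => j; rewrite ffunE; case: eqP => [->|]. Qed.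

Definition multilinear (R : comPzRingType) (M N : lmodType R) i
    (v : {ffun 'I_i -> M} -> N) : Prop :=
  forall x k a y z, v (ff_upd x k (a *: y + z)) =
    a *: v (ff_upd x k y) + v (ff_upd x k z).

Section Free.
Variables (R : comPzRingType) (X : Type) (M : lmodType R) (b : X -> M).

Definition free_on : Prop := forall (N : lmodType R) (f : X -> N),
  exists2 h : {linear M -> N}, forall x, h (b x) = f x &
    forall h' : {linear M -> N}, (forall x, h' (b x) = f x) -> h' =1 h.

Hypothesis bfree : free_on.

(** A basis given by its universal property spans: the lift of the basis into the submodule cut out
    by P, followed by the inclusion, is the identity by uniqueness. *)
Lemma free_ind (P : M -> Prop) : P 0 -> (forall a x y, P x -> P y -> P (a *: x + y)) ->
  (forall x, P (b x)) -> forall m, P m.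
Proof.
move=> P0 PZD Pb m; pose S := Submodule P0 PZD.
have [h hb _] := bfree (fun x => @mksub R M S _ (Pb x)).
have [g gb gu] := bfree b.
have -> : m = sub_incl S (h m).
  have e1 := gu idfun (fun x => erefl) m.
  have e2 : sub_incl S (h m) = g m.
    by apply: (gu (sub_incl S \o h)) => x /=; rewrite hb.
  by rewrite e2 -e1.
exact: (sub_inclP (h m)).
Qed.

(** The slots are reduced to basis elements one at a time. Restricting to the slots in [D] lets two
    other slots keep a common entry, as [multilinear_alternating] requires. *)
Lemma multi_ind i (D : pred 'I_i) (P : {ffun 'I_i -> M} -> Prop) :
  (forall t j, D j -> P (ff_upd t j 0)) ->
  (forall t j a x y, D j -> P (ff_upd t j x) -> P (ff_upd t j y) ->
     P (ff_upd t j (a *: x + y))) ->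
  (forall t : {ffun 'I_i -> M}, (forall j, D j -> exists x, t j = b x) -> P t) ->
  forall t, P t.
Proof.
move=> P0 PZD Pb.
suff H (s : seq 'I_i) : forall t : {ffun 'I_i -> M},
    (forall j, D j -> j \notin s -> exists x, t j = b x) -> P t.
  by move=> t; apply: (H (enum 'I_i)) => j _; rewrite mem_enum.
elim: s => [|j s IHs] t tb.
  by apply: Pb => j Dj; apply: tb.
have [Dj|nDj] := boolP (D j); last first.
  apply: IHs => j' Dj' js; apply: tb => //; rewrite inE negb_or js andbT.
  by apply: contraNneq nDj => <-.
rewrite -(ff_updE j t); move: (t j); apply: free_ind => //.
- exact: P0.
- by move=> a x y; apply: PZD.
move=> x; apply: IHs => j' Dj' js; rewrite ffunE.
have [_|nj] := eqVneq j' j; first by exists x.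
by apply: tb; rewrite // inE negb_or nj.
Qed.

Lemma multilinear0 (N : lmodType R) i (v : {ffun 'I_i -> M} -> N) t j :
  multilinear v -> v (ff_upd t j 0) = 0.
Proof.
move=> vl; have := vl t j 1 0 0; rewrite scaler0 addr0 scale1r => e.
by apply: (addIr (v (ff_upd t j 0))); rewrite add0r -e.
Qed.

Lemma multilinear_eq (N : lmodType R) i (v v' : {ffun 'I_i -> M} -> N) :
  multilinear v -> multilinear v' ->
  (forall t, v (fmap_ff b t) = v' (fmap_ff b t)) -> v =1 v'.
Proof.
move=> vl vl' e t; apply: (multi_ind (D := xpredT) (P := fun t => v t = v' t)).
- by move=> t' j _; rewrite !multilinear0.
- by move=> t' j a x y _ ex ey; rewrite vl vl' ex ey.
move=> t' tb; have [x xE] := choice (fun j => tb j isT).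
by suff -> : t' = fmap_ff b [ffun j => x j]; last by apply/ffunP => j; rewrite !ffunE xE.
Qed.

Lemma multilinear_exists i : forall (N : lmodType R) (f : {ffun 'I_i -> X} -> N),
  exists v : {ffun 'I_i -> M} -> N, multilinear v /\ forall t, v (fmap_ff b t) = f t.
Proof.
elim: i => [|i IHi] N f.
  have e0 (k : 'I_0) : X by case: k.
  exists (fun t => f [ffun k => e0 k]); split; first by move=> x [].
  by move=> t; congr f; apply/ffunP; case.
have LS (g : X -> N) : {h : {linear M -> N} | (forall x, h (b x) = g x) /\
    forall h' : {linear M -> N}, (forall x, h' (b x) = g x) -> h' =1 h}.
  by apply: cid; have [h h1 h2] := bfree g; exists h.
pose L g := sval (LS g).
have LE g : (forall x, L g (b x) = g x) /\ forall h' : {linear M -> N},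
  (forall x, h' (b x) = g x) -> h' =1 L g := svalP (LS g).
have [v vP] := choice (fun x : X => IHi N (fun t => f (ff_cons x t))).
pose tl (T : Type) (t : {ffun 'I_i.+1 -> T}) : {ffun 'I_i -> T} := [ffun k => t (lift ord0 k)].
exists (fun t => L (fun x => v x (tl _ t)) (t ord0)); split.
  move=> t k a y z; case: (unliftP ord0 k) => [k' ->|->].
    have tlu y' : tl _ (ff_upd t (lift ord0 k') y') = ff_upd (tl _ t) k' y'.
      by apply/ffunP => j; rewrite !ffunE (inj_eq lift_inj).
    rewrite !tlu !ffunE /=.
    pose h : {linear M -> N} := (a \*: L (fun x => v x (ff_upd (tl M t) k' y))
                                \+ L (fun x => v x (ff_upd (tl M t) k' z))).
    rewrite -[RHS]/(h (t ord0)); apply/esym; apply: (LE _).2 => x /=.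
    by rewrite !(LE _).1 (vP x).1.
  have tlu y' : tl _ (ff_upd t ord0 y') = tl _ t.
    by apply/ffunP => j; rewrite !ffunE.
  by rewrite !tlu !ffunE eqxx linearP.
move=> t; rewrite ffunE (LE _).1.
have -> : tl _ (fmap_ff b t) = fmap_ff b (tl _ t) by apply/ffunP => j; rewrite !ffunE.
rewrite (vP _).2; congr f; apply/ffunP => j; rewrite !ffunE.
by case: unliftP => [j' ->|->]; rewrite ?ffunE.
Qed.

(** The sign rule extends by multilinearity, but in characteristic 2 it does not imply vanishing on
    a repeated argument. That is shown by induction on the repeated argument: for a combination a x
    + y only the two cross terms remain, and the sign rule cancels them. *)
Lemma multilinear_alternating (N : lmodType R) i (v : {ffun 'I_i -> M} -> N) :
  multilinear v -> alternates (fun t => v (fmap_ff b t)) ->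
  forall (t : {ffun 'I_i -> M}) k l, k != l -> t k = t l -> v t = 0.
Proof.
move=> vl va.
have vs k l : k != l -> forall t, v (swap k l t) = - v t.
  move=> kl; apply: multilinear_eq.
  - by move=> x j a y z; rewrite !swap_upd vl.
  - by move=> x j a y z; rewrite vl opprD scalerN.
  move=> t; rewrite -((va k l kl t).2); congr v.
  by apply/ffunP => j; rewrite !ffunE.
move=> t k l kl tkl.
pose d (t : {ffun 'I_i -> M}) m := ff_upd (ff_upd t k m) l m.
suff H m t' : v (d t' m) = 0.
  suff <- : d t (t k) = t by exact: H.
  apply/ffunP => j; rewrite !ffunE; case: eqP => [->|_]; first by rewrite tkl.
  by case: eqP => [->|].
have lk : l != k by rewrite eq_sym.
have dC (x : {ffun 'I_i -> M}) y z : ff_upd (ff_upd x k y) l z = ff_upd (ff_upd x l z) k y.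
  apply/ffunP => j; rewrite !ffunE; case: eqP => [->|//]; by rewrite (negbTE lk).
have dD x y (s : {ffun 'I_i -> M}) :
    v (ff_upd (ff_upd s k x) l y) + v (ff_upd (ff_upd s k y) l x) = 0.
  apply/eqP; rewrite addr_eq0 -(vs k l kl); apply/eqP; congr v.
  apply/ffunP => j; rewrite !ffunE; case: tpermP => [->|->|/eqP/negbTE jk /eqP/negbTE jl].
  - by rewrite (negbTE kl) !eqxx.
  - by rewrite (negbTE kl) !eqxx.
  - by rewrite jk jl.
have e2 a x y z s : v (ff_upd (ff_upd s k (a *: x + y)) l z) =
    a *: v (ff_upd (ff_upd s k x) l z) + v (ff_upd (ff_upd s k y) l z).
  by rewrite !dC vl.
move: m t'; apply: free_ind => [t'|a x y hx hy t'|x].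
- exact: multilinear0.
- rewrite /d vl !e2 -/(d t' x) -/(d t' y) hx hy scaler0 add0r addr0 -scalerDr addrC.
  by rewrite dD scaler0.
have dj s j y : ~~ ((j == k) || (j == l)) ->
    d (ff_upd s j y) (b x) = ff_upd (d s (b x)) j y.
  rewrite negb_or => /andP[jk jl]; apply/ffunP => j'; rewrite !ffunE.
  case: (j' =P j) => [->|//].
  by rewrite (negbTE jk) (negbTE jl).
apply: (multi_ind (D := fun j => ~~ ((j == k) || (j == l)))
                  (P := fun t => v (d t (b x)) = 0)).
- by move=> s j Dj; rewrite dj // multilinear0.
- by move=> s j a y z Dj; rewrite !dj // vl => -> ->; rewrite scaler0 addr0.
move=> s sb.
have /choice [y yE] : forall j, exists y, d s (b x) j = b y.
  move=> j; rewrite !ffunE; case: eqP => [_|jl]; first by exists x.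
  case: eqP => [_|jk]; first by exists x.
  by apply: sb; apply/negP => /orP[] /eqP.
pose t0 := [ffun j => if (j == k) || (j == l) then x else y j].
have -> : d s (b x) = fmap_ff b t0.
  apply/ffunP => j; rewrite [in RHS]ffunE [in RHS]ffunE.
  case: ifP => [|_]; last by rewrite yE.
  by rewrite !ffunE => /orP[] /eqP ->; rewrite eqxx // if_same.
by apply: (va k l kl t0).1; rewrite !ffunE !eqxx orbT.
Qed.

Lemma alternating_extension (N : lmodType R) i (f : {ffun 'I_i -> X} -> N) :
  alternates f -> exists v : {ffun 'I_i -> M} -> N,
    is_alternating v /\ forall t, v (fmap_ff b t) = f t.
Proof.
move=> fa; have [v [vl vb]] := multilinear_exists f.
exists v; split=> //; split; first exact: vl.
move=> t k l; apply: multilinear_alternating => //.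
by have -> : (fun t => v (fmap_ff b t)) = f by apply: funext.
Qed.

Definition alt_universal i (L : lmodType R) (w : {ffun 'I_i -> X} -> L) : Prop :=
  alternates w /\ forall (N : lmodType R) (f : {ffun 'I_i -> X} -> N), alternates f ->
    exists2 h : {linear L -> N}, forall t, h (w t) = f t &
      forall h' : {linear L -> N}, (forall t, h' (w t) = f t) -> h' =1 h.

Lemma is_alternating_swap (N : lmodType R) i (v : {ffun 'I_i -> M} -> N) :
  is_alternating v -> alternates v.
Proof.
move=> [vl va] k l kl t; split; first exact: va.
have lk : l != k by rewrite eq_sym.
pose d x y := ff_upd (ff_upd t k x) l y.
have dC x y : d x y = ff_upd (ff_upd t l y) k x.
  by apply/ffunP => j; rewrite !ffunE; case: eqP => [->|//]; rewrite (negbTE lk).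
have d0 x : v (d x x) = 0.
  by apply: (va _ k l kl); rewrite !ffunE !eqxx (negbTE kl).
have vDl x y z : v (d (x + y) z) = v (d x z) + v (d y z).
  by have := vl (ff_upd t l z) k 1 x y; rewrite !scale1r !dC.
have vDr x y z : v (d z (x + y)) = v (d z x) + v (d z y).
  by have := vl (ff_upd t k z) l 1 x y; rewrite !scale1r.
have -> : swap k l t = d (t l) (t k).
  apply/ffunP => j; rewrite !ffunE; case: tpermP => [->|->|].
  - by rewrite (negbTE kl) eqxx.
  - by rewrite eqxx.
  - by move=> /eqP/negbTE -> /eqP/negbTE ->.
have -> : v t = v (d (t k) (t l)) by rewrite /d !ff_updE.
have := d0 (t k + t l); rewrite vDl !vDr !d0 add0r addr0 addrC => /eqP.
by rewrite addr_eq0 => /eqP.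
Qed.

Lemma exterior_alt_universal i (L : lmodType R) (w : {ffun 'I_i -> M} -> L) :
  is_exterior_power w -> alt_universal (fun t => w (fmap_ff b t)).
Proof.
move=> [wa wu]; split.
  move=> k l kl t; have [w0 ws] := is_alternating_swap wa kl (fmap_ff b t).
  split; first by move=> e; apply: w0; rewrite !ffunE e.
  by rewrite -ws; congr w; apply/ffunP => j; rewrite !ffunE.
move=> N f fa; have [v [va vb]] := alternating_extension fa.
have [h hw hu] := wu N v va; exists h; first by move=> t; rewrite hw vb.
move=> h' h'w; apply: hu => t; apply: (multilinear_eq (v := h' \o w)).
- by move=> x k a y z; rewrite /= wa.1 linearP.
- exact: va.1.
- by move=> t'; rewrite /= h'w vb.
Qed.
End Free.
End Alternating.

(** * Groups of forms as universal alternating data *)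

Section UniversalData.

(** E is the direct sum of copies of A indexed by K, with [g a k] the element a of the copy k. *)
Definition additive_basis (A : zmodType) (K : Type) (E : zmodType) (g : A -> K -> E) : Prop :=
  [/\ forall k, {morph g^~ k : x y / x + y},
      forall (N : zmodType) (f : A -> K -> N), (forall k, {morph f^~ k : x y / x + y}) ->
        exists F : {additive E -> N}, forall a k, F (g a k) = f a k
    & forall (N : zmodType) (F F' : {additive E -> N}),
        (forall a k, F (g a k) = F' (g a k)) -> F =1 F'].

Lemma finsum_additive_basis (K : choiceType) (A : zmodType) : additive_basis (@fsU K A).
Proof.
split; first exact: fsUD.
  move=> N f fD; exists (fslift (f := fun k a => f a k) fD) => a k; exact: fsliftU.
by move=> N F F'; apply: fs_ext.
Qed.

(** Read [t a k x] as the value at the form a e_k dx_1 ... dx_i, with k a monomial and x a tuple of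
    variables. The universal datum is the additive group of such forms, and ring structures no
    longer enter. *)
Record alt_datum (A : zmodType) (K X : Type) (N : zmodType) i
    (t : A -> K -> {ffun 'I_i -> X} -> N) : Prop := AltDatum {
  ad_add : forall k x, {morph (fun a => t a k x) : a b / a + b};
  ad_alt : forall a k, alternates (t a k) }.

Definition alt_datum_universal (A : zmodType) (K X : Type) (L : zmodType) i
    (g : A -> K -> {ffun 'I_i -> X} -> L) : Prop :=
  [/\ alt_datum g,
      forall (N : zmodType) (t : A -> K -> {ffun 'I_i -> X} -> N), alt_datum t ->
        exists h : {additive L -> N}, forall a k x, h (g a k x) = t a k x
    & forall (N : zmodType) (h h' : {additive L -> N}),
        (forall a k x, h (g a k x) = h' (g a k x)) -> h =1 h'].

(** An alternating datum in N is the same as an alternating function with values in [coind E N],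
    once E is a direct sum of copies of A. Existence and uniqueness are transported through this
    correspondence. *)
Lemma alt_universal_datum (A : zmodType) (K X : Type) (E : comPzRingType) (L : lmodType E) i
    (g : A -> K -> E) (w : {ffun 'I_i -> X} -> L) :
  additive_basis g -> alt_universal w ->
  alt_datum_universal (fun a k x => g a k *: w x).
Proof.
move=> [gD gl gu] [wa wu]; split.
- split=> [k x a b|a k k1 l kl x]; first by rewrite gD scalerDl.
  split=> [e|]; first by rewrite ((wa _ _ kl x).1 e) scaler0.
  by rewrite (wa _ _ kl x).2 scalerN.
- move=> N t [tD ta].
  have /choice [f0 f0E] : forall x, exists F : {additive E -> N},
      forall a k, F (g a k) = t a k x by move=> x; apply: gl => k; apply: tD.
  pose f x : coind E N := Coind (raddfD (f0 x)).
  have fa : alternates f.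
    move=> k l kl x; split=> [e|]; apply: coind_eq => b.
      pose z : {additive E -> N} := mkadd (@coind_zeroP E N).
      rewrite -[RHS]/(z b) -[LHS]/(f0 x b); apply: gu => a m.
      by rewrite f0E ((ta _ _ _ _ kl x).1 e).
    pose F' : {additive E -> N} := mkadd (coind_oppP (f x)).
    rewrite -[RHS]/(F' b) -[LHS]/(f0 _ b); apply: gu => a m.
    by rewrite f0E (ta _ _ _ _ kl x).2 -f0E.
  have [h hw _] := wu _ f fa.
  have hD : {morph (fun y => h y 1) : y z / y + z} by move=> y z; rewrite raddfD.
  exists (mkadd hD) => a k x.
  by rewrite /= /mkadd_of linearZ hw coindZ mul1r /= f0E.
- move=> N h h' hh' y.
  have hP (h0 : {additive L -> N}) z : {morph (fun b : E => h0 (b *: z)) : b c / b + c}.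
    by move=> b c; rewrite scalerDl raddfD.
  have hl (h0 : {additive L -> N}) : linear (fun z => Coind (hP h0 z)).
    move=> a u v; apply: coind_eq => b /=.
    by rewrite scalerDr scalerA raddfD.
  have : mklin (hl h) =1 mklin (hl h').
    have [|k kw ku] := wu _ (fun x => mklin (hl h') (w x)).
      move=> k l kl x; split=> [e|]; first by rewrite ((wa _ _ kl x).1 e) linear0.
      by rewrite (wa _ _ kl x).2 linearN.
    move=> z; transitivity (k z); last by apply/esym; apply: ku.
    apply: ku => x.
    apply: coind_eq => b; pose F h0 := mkadd (hP h0 (w x)).
    by rewrite -[LHS]/(F h b) -[RHS]/(F h' b); apply: gu => a m; apply: hh'.
  move/(_ y)/(congr1 (fun c : coind E N => c 1)).
  by rewrite /= /mklin_of /= !scale1r.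
Qed.

Lemma base_change_alt_universal (S T : comPzRingType) (f : {rmorphism S -> T}) (X : Type) i
    (L : lmodType S) (w : {ffun 'I_i -> X} -> L) (L' : lmodType T)
    (e : {linear L -> res f L'}) : alt_universal w ->
  (forall (N : lmodType T) (g : {linear L -> res f N}),
    exists2 h : {linear L' -> N}, forall x, h (e x) = g x &
      forall h' : {linear L' -> N}, (forall x, h' (e x) = g x) -> h' =1 h) ->
  alt_universal (fun x => e (w x) : L').
Proof.
move=> [wa wu] eu; split.
  move=> k l kl x; split=> [e1|]; first by rewrite ((wa _ _ kl x).1 e1) linear0.
  by rewrite (wa _ _ kl x).2 linearN.
move=> N t ta; have [|h hw hu] := wu (res f N) t; first exact: ta.
have [k ke ku] := eu N h; exists k => [x|k' k'w]; first by rewrite ke hw.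
apply: ku => x.
have k'l : linear (fun y => k' (e y) : res f N).
  by move=> a u v; rewrite linearP linearP.
by apply: (hu (mklin k'l)) => y; apply: k'w.
Qed.

Section Model.
Variables (A : zmodType) (K X : choiceType) (i : nat).
Let G : choiceType := (A * K * {ffun 'I_i -> X})%type.
Let D (N : zmodType) (f : G -> N) : Prop := alt_datum (fun a k x => f (a, k, x)).
Definition alt_model : zmodType := pres D.
Definition alt_gen a k x : alt_model := pgen D (a, k, x).
Lemma alt_gen_datum : alt_datum alt_gen.
Proof.
split=> [k x a b|a k l1 l2 l12 x].
  by apply: pres_rel3 => N f Df; apply: (ad_add Df).
split=> [e|].
  by apply: pres_rel0 => N f Df; apply: (ad_alt Df a k l12 x).1.
by apply: pres_relN => N f Df; apply: (ad_alt Df a k l12 x).2.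
Qed.
Definition alt_lift (N : zmodType) (t : A -> K -> {ffun 'I_i -> X} -> N) (td : alt_datum t) :
  {additive alt_model -> N} := pres_lift (D := D) (f := fun g => t g.1.1 g.1.2 g.2) td.
Lemma alt_liftE (N : zmodType) (t : A -> K -> {ffun 'I_i -> X} -> N) (td : alt_datum t) a k x :
  alt_lift td (alt_gen a k x) = t a k x.
Proof. exact: pres_liftE. Qed.
Lemma alt_model_ext (N : zmodType) (h h' : {additive alt_model -> N}) :
  (forall a k x, h (alt_gen a k x) = h' (alt_gen a k x)) -> h =1 h'.
Proof. by move=> e; apply: pres_ext => -[[a k] x]; apply: e. Qed.
Lemma alt_model_universal : alt_datum_universal alt_gen.
Proof.
split; first exact: alt_gen_datum.
  by move=> N t td; exists (alt_lift td) => a k x; rewrite alt_liftE.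
by move=> N h h'; apply: alt_model_ext.
Qed.
End Model.
End UniversalData.

(** * Square-zero extensions, polynomial rings and their differentials *)

Section SquareZero.
Variables (Q : comPzRingType) (N : lmodType Q).
Definition sqz : Type := (Q * N)%type.
HB.instance Definition _ := GRing.Zmodule.on sqz.
Definition sqz_mul (x y : sqz) : sqz := (x.1 * y.1, x.1 *: y.2 + y.1 *: x.2).
Fact sqz_mulA : associative sqz_mul.
Proof.
move=> [a x] [b y] [c z]; congr (_, _); rewrite /= ?mulrA //.
by rewrite !scalerDr !scalerA addrA [c * a]mulrC [c * b]mulrC.
Qed.
Fact sqz_mulC : commutative sqz_mul.
Proof. by move=> [a x] [b y]; congr (_, _); rewrite /= 1?mulrC 1?addrC. Qed.
Fact sqz_mul1 : left_id (1, 0) sqz_mul.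
Proof. by move=> [a x]; congr (_, _); rewrite /= ?mul1r // scale1r scaler0 addr0. Qed.
Fact sqz_mulDl : left_distributive sqz_mul +%R.
Proof.
move=> [a x] [b y] [c z]; congr (_, _); rewrite /= ?mulrDl //.
by rewrite scalerDl scalerDr addrACA.
Qed.
HB.instance Definition _ := GRing.Zmodule_isComPzRing.Build sqz sqz_mulA sqz_mulC sqz_mul1 sqz_mulDl.
Lemma sqzM (x y : sqz) : x * y = (x.1 * y.1, x.1 *: y.2 + y.1 *: x.2) :> sqz. Proof. by []. Qed.
Lemma sqzD (x y : sqz) : x + y = (x.1 + y.1, x.2 + y.2) :> sqz. Proof. by []. Qed.
Lemma sqz1 : 1 = (1, 0) :> sqz. Proof. by []. Qed.
Fact sqz_fst_is_add : {morph (fst : sqz -> Q) : x y / x + y}. Proof. by []. Qed.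
Fact sqz_fst_is_mul : {morph (fst : sqz -> Q) : x y / x * y}. Proof. by []. Qed.
Definition sqz_fst : {rmorphism sqz -> Q} := mkrm sqz_fst_is_add sqz_fst_is_mul erefl.
Fact sqz_in_add : {morph (fun a => (a, 0) : sqz) : x y / x + y}.
Proof. by move=> a b; rewrite sqzD addr0. Qed.
Fact sqz_in_mul : {morph (fun a => (a, 0) : sqz) : x y / x * y}.
Proof. by move=> a b; rewrite sqzM /= !scaler0 addr0. Qed.
Definition sqz_in : {rmorphism Q -> sqz} := mkrm sqz_in_add sqz_in_mul erefl.

Section OfDerivation.
Variables (B : comPzRingType) (g : {rmorphism B -> Q}) (D : B -> N).
Hypotheses (DD : {morph D : x y / x + y}) (DM : forall x y, D (x * y) = g x *: D y + g y *: D x).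
Fact sqz_graph_add : {morph (fun b => (g b, D b) : sqz) : x y / x + y}.
Proof. by move=> a b; rewrite sqzD rmorphD DD. Qed.
Fact sqz_graph_mul : {morph (fun b => (g b, D b) : sqz) : x y / x * y}.
Proof. by move=> a b; rewrite sqzM rmorphM DM. Qed.
Fact sqz_graph_1 : (g 1, D 1) = 1 :> sqz.
Proof.
rewrite rmorph1 sqz1; congr (_, _).
have := DM 1 1; rewrite mulr1 rmorph1 !scale1r => e.
by apply: (addIr (D 1)); rewrite -e add0r.
Qed.
Definition sqz_graph : {rmorphism B -> sqz} := mkrm sqz_graph_add sqz_graph_mul sqz_graph_1.
End OfDerivation.
End SquareZero.

Notation mpoly X k := (@dpoly X xpred0 k).

Section Polynomials.

Definition poly_on (k Q : comPzRingType) (f : {rmorphism k -> Q}) (X : Type) (x : X -> Q) : Prop :=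
  forall (W : comPzRingType) (g : {rmorphism k -> W}) (y : X -> W),
    exists2 h : {rmorphism Q -> W},
      (forall c, h (f c) = g c) /\ (forall s, h (x s) = y s) &
      forall h' : {rmorphism Q -> W},
        (forall c, h' (f c) = g c) -> (forall s, h' (x s) = y s) -> h' =1 h.

Section MonomialProducts.
Variables (X : choiceType) (d : pred X) (k : comPzRingType).
Definition kexp (s : X) (n : nat) : {cmonom X} := iter n (mmul (ucm s)) mone.
Lemma kexpE s n j : kexp s n j = (if s == j then n else 0)%N.
Proof.
elim: n => [|n IHn]; first by rewrite cm1 if_same.
by rewrite /= cmM IHn cmU; case: eqP.
Qed.
Lemma cm_eq (m n : {cmonom X}) : (forall j, m j = n j) -> m = n.
Proof. by move=> e; apply/eqP/cmP. Qed.
Lemma dmon_kexp s a b : dmon d k (kexp s a) * dmon d k (kexp s b) =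
  dmon d k (kexp s (a + b)) *+ mcoc1 d s a b.
Proof.
rewrite dmonM; congr (_ *+ _).
  by congr dmon; apply: cm_eq => j; rewrite cmM !kexpE; case: ifP.
rewrite (@mcoc_wide _ _ _ _ [fset s]%fset) ?big_seq_fset1 ?kexpE ?eqxx //.
  by apply/fsubsetP => j; rewrite -cmE_neq0 kexpE in_fset1; case: (s =P j) => [->|] //; rewrite eqxx.
by apply/fsubsetP => j; rewrite -cmE_neq0 kexpE in_fset1; case: (s =P j) => [->|] //; rewrite eqxx.
Qed.
Lemma dmon_prod m : dmon d k m = mprod (fun s n => dmon d k (kexp s n)) m.
Proof.
pose r (s : seq X) := \big[mmul/mone]_(j <- s) kexp j (m j).
have rE s j : uniq s -> r s j = if j \in s then m j else 0%N.
  elim: s => [|j' s IHs] /=; first by rewrite /r big_nil cm1.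
  move=> /andP[js us]; rewrite /r big_cons cmM [X in (_ + X)%N]IHs // kexpE inE.
  by rewrite eq_sym; case: eqP => [->|_] /=; [rewrite (negbTE js) addn0|rewrite add0n].
suff H s : uniq s -> \prod_(j <- s) dmon d k (kexp j (m j)) = dmon d k (r s).
  rewrite /mprod H ?fset_uniq //; congr dmon; apply: cm_eq => j.
  by rewrite rE ?fset_uniq //; case: ifP => // /negbT; rewrite -cmE_eq0 => /eqP.
elim: s => [|j s IHs] /=; first by rewrite /r !big_nil.
move=> /andP[js us]; rewrite /r !big_cons IHs // dmonM /mcoc big1 ?mulr1n // => l _.
rewrite rE // kexpE; case: eqP => [<-|_]; last by rewrite mcoc10.
by rewrite (negbTE js) mcoc1C mcoc10.
Qed.
End MonomialProducts.

Section MPoly.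
Variables (X : choiceType) (k : comPzRingType).
Definition pX (s : X) : mpoly X k := dmon xpred0 k (ucm s).
Lemma dmon_kexp1 s n : dmon xpred0 k (kexp s n) = pX s ^+ n.
Proof.
elim: n => [|n IHn]; first by [].
have := dmon_kexp xpred0 k s 1 n; rewrite IHn exprS mulr1n => <-.
by congr (_ * _); congr dmon; rewrite /kexp /= mulm1.
Qed.
Section Eval.
Variables (W : comPzRingType) (g : {rmorphism k -> W}) (y : X -> W).
Definition pow_fam (s : X) n := y s ^+ n.
Fact pow_fam0 s : pow_fam s 0 = 1. Proof. by []. Qed.
Fact pow_famD s a b : pow_fam s a * pow_fam s b = pow_fam s (a + b)%N *+ mcoc1 xpred0 s a b.
Proof. by rewrite /pow_fam exprD. Qed.
Definition peval : {rmorphism mpoly X k -> W} := dev g pow_fam0 pow_famD.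
Lemma pevalC c : peval (dpolyC xpred0 k c) = g c.
Proof. by rewrite [LHS]devU mprod1 mulr1. Qed.
Lemma peval_mon m : peval (dmon xpred0 k m) = mprod pow_fam m.
Proof. by rewrite [LHS]devU rmorph1 mul1r. Qed.
Lemma pevalX s : peval (pX s) = y s.
Proof. by rewrite peval_mon mprod_ucm. Qed.
Lemma rmorph_mprod (V V' : comPzRingType) (h : {rmorphism V -> V'}) (u : X -> nat -> V) m :
  h (mprod u m) = mprod (fun s n => h (u s n)) m.
Proof. exact: rmorph_prod. Qed.
Lemma peval_unique (h : {rmorphism mpoly X k -> W}) :
  (forall c, h (dpolyC xpred0 k c) = g c) -> (forall s, h (pX s) = y s) -> h =1 peval.
Proof.
move=> hC hX; apply: dev_unique => // m.
rewrite dmon_prod rmorph_mprod; apply: eq_bigr => s _.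
by rewrite dmon_kexp1 rmorphXn /= hX.
Qed.
End Eval.
Lemma mpoly_poly_on : poly_on (dpolyC xpred0 k) pX.
Proof.
move=> W g y; exists (peval g y); first by split=> [c|s]; rewrite ?pevalC ?pevalX.
by move=> h; apply: peval_unique.
Qed.
End MPoly.

Section PolyOn.
Variables (X : choiceType) (k Q : comPzRingType) (f : {rmorphism k -> Q}) (x : X -> Q).
Hypothesis Qp : poly_on f x.

Lemma poly_on_ext (W : comPzRingType) (h h' : {rmorphism Q -> W}) :
  (forall c, h (f c) = h' (f c)) -> (forall s, h (x s) = h' (x s)) -> h =1 h'.
Proof.
move=> hf hx; have [g _ gu] := Qp (h' \o f) (h' \o x).
by move=> q; transitivity (g q); [apply: gu|apply/esym; apply: gu].
Qed.

Lemma poly_on_iso : exists2 toP : {rmorphism Q -> mpoly X k},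
  (forall c, toP (f c) = dpolyC xpred0 k c) /\ (forall s, toP (x s) = pX k s) &
  cancel toP (peval f x) /\ cancel (peval f x) toP.
Proof.
have [toP [tf tx] _] := Qp (dpolyC xpred0 k) (@pX X k).
exists toP => //; split=> q.
  apply: (poly_on_ext (h := peval f x \o toP) (h' := idfun)) => s /=.
    by rewrite tf pevalC.
  by rewrite tx pevalX.
have [g _ gu] := mpoly_poly_on (X := X) (dpolyC xpred0 k) (@pX X k).
transitivity (g q); last by apply/esym; apply: (gu idfun).
apply: (gu (toP \o peval f x)) => s /=.
  by rewrite pevalC tf.
by rewrite pevalX tx.
Qed.

Definition pmon (m : {cmonom X}) : Q := mprod (fun s n => x s ^+ n) m.

Lemma poly_on_basis : additive_basis (fun c m => f c * pmon m).
Proof.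
have [toP [tf tx] [K K']] := poly_on_iso.
have pE c m : peval f x (fsU c m) = f c * pmon m by exact: devU.
split.
- by move=> m a b; rewrite rmorphD mulrDl.
- move=> N t tD; have [_ bl _] := finsum_additive_basis {cmonom X} k.
  have [F FE] := bl N t tD; have hD : {morph (fun q => F (toP q)) : u v / u + v}.
    by move=> u v; rewrite rmorphD raddfD.
  by exists (mkadd hD) => a m; rewrite /= /mkadd_of -pE K' FE.
- move=> N F F' e q; rewrite -[q]K; move: (toP q).
  apply: (fs_ind (P := fun p => F (peval f x p) = F' (peval f x p))).
  + by rewrite (rmorph0 (peval f x)) !raddf0.
  + by move=> u v hu hv; rewrite (rmorphD (peval f x)) !raddfD /= hu hv.
  + by move=> a m; rewrite pE e.
Qed.

Lemma poly_on_ind (P : Q -> Prop) : (forall u v, P u -> P v -> P (u + v)) ->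
  (forall u v, P u -> P v -> P (u * v)) -> (forall c, P (f c)) -> (forall s, P (x s)) ->
  forall q, P q.
Proof.
move=> PD PM Pf Px q; have [toP _ [K _]] := poly_on_iso; rewrite -[q]K; move: (toP q).
apply: (fs_ind (P := fun p => P (peval f x p))).
- by rewrite (rmorph0 (peval f x)) -(rmorph0 f).
- by move=> u v hu hv; rewrite (rmorphD (peval f x)); apply: PD.
move=> c m; rewrite [peval f x _]devU; apply: (PM) => //.
apply: big_ind; [by rewrite -(rmorph1 f)|exact: PM|].
move=> s _; rewrite /pow_fam; elim: (m s) => [|n IHn]; first by rewrite expr0 -(rmorph1 f).
by rewrite exprS; apply: PM.
Qed.

(** A derivation is the second component of a ring map into a square-zero extension. The universal
    property of the polynomial ring provides the map, and uniqueness makes its first component the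
    identity. *)
Lemma poly_derivation (N : lmodType Q) (t : X -> N) :
  exists D : Q -> N, is_derivation f D /\ forall s, D (x s) = t s.
Proof.
have [h [hf hx] _] := Qp (sqz_in N \o f) (fun s => (x s, t s) : sqz N).
have h1 q : (h q).1 = q.
  by apply: (poly_on_ext (h := sqz_fst N \o h) (h' := idfun)) => s /=; rewrite ?hf ?hx.
exists (fun q => (h q).2); split; last by move=> s; rewrite hx.
split=> [u v|u v|c]; first by rewrite rmorphD.
  by rewrite rmorphM sqzM /= !h1.
by rewrite hf.
Qed.

Lemma derivation_ext (N : lmodType Q) (D D' : Q -> N) : is_derivation f D ->
  is_derivation f D' -> (forall s, D (x s) = D' (x s)) -> D =1 D'.
Proof.
move=> [DD DM Df] [DD' DM' Df'] e; apply: poly_on_ind => //.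
- by move=> u v eu ev; rewrite DD DD' eu ev.
- by move=> u v eu ev; rewrite DM DM' eu ev.
- by move=> c; rewrite Df Df'.
Qed.

Lemma initial_derivation_free (M : lmodType Q) (D : Q -> M) :
  is_initial_map (@is_derivation k Q f) D -> free_on (fun s => D (x s)).
Proof.
move=> [Dd Du] N t; have [D' [D'd D't]] := poly_derivation t.
have [h hD hu] := Du N D' D'd; exists h => [s|h' h't]; first by rewrite hD.
apply: hu => q; apply: (derivation_ext (D := h' \o D)) => //.
  by case: Dd => DD DM Df; split=> [u v|u v|c] /=;
    rewrite ?DD ?DM ?Df ?linearD ?linearZ ?linear0.
by move=> s; rewrite /= h't D't.
Qed.
End PolyOn.
End Polynomials.

Section FreeModule.
Variables (R : comPzRingType) (X : choiceType).
Definition fsmod : Type := finsum X R.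
HB.instance Definition _ := GRing.Zmodule.on fsmod.
Fact fs_scale_add a (k : X) : {morph (fun r => fsU (a * r) k : fsmod) : x y / x + y}.
Proof. by move=> x y; rewrite mulrDr fsUD. Qed.
Definition fs_scale a (f : fsmod) : fsmod := fslift (fs_scale_add a) f.
Fact fs_scaleDr a : {morph fs_scale a : f g / f + g}. Proof. exact: raddfD. Qed.
Fact fs_scaleU a r k : fs_scale a (fsU r k) = fsU (a * r) k. Proof. exact: fsliftU. Qed.
Fact fs_scale0 a : fs_scale a 0 = 0. Proof. exact: raddf0. Qed.
Fact fs_scaleA a b f : fs_scale a (fs_scale b f) = fs_scale (a * b) f.
Proof.
elim/fs_ind: f => [|f g hf hg|r k]; first by rewrite !fs_scale0.
  by rewrite !fs_scaleDr hf hg.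
by rewrite !fs_scaleU mulrA.
Qed.
Fact fs_scale1 : left_id 1 fs_scale.
Proof.
elim/fs_ind=> [|f g hf hg|r k]; first by rewrite !fs_scale0.
  by rewrite !fs_scaleDr hf hg.
by rewrite !fs_scaleU mul1r.
Qed.
Fact fs_scaleDl f : {morph fs_scale^~ f : a b / a + b}.
Proof.
move=> a b; elim/fs_ind: f => [|f g hf hg|r k]; first by rewrite !fs_scale0 addr0.
  by rewrite !fs_scaleDr hf hg addrACA.
by rewrite !fs_scaleU mulrDl fsUD.
Qed.
HB.instance Definition _ := GRing.Zmodule_isLmodule.Build R fsmod
  fs_scaleA fs_scale1 fs_scaleDr fs_scaleDl.

Lemma fsmod_free : free_on (fun k => fsU 1 k : fsmod).
Proof.
move=> N f.
have fD k : {morph (fun r => r *: f k) : x y / x + y} by move=> x y; rewrite scalerDl.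
have hU r k : fslift fD (fsU r k) = r *: f k by exact: fsliftU.
have hl : linear (fslift fD : fsmod -> N).
  suff hZ a u : fslift fD (fs_scale a u) = a *: fslift fD u.
    by move=> a u v; rewrite raddfD [X in X + _]hZ.
  elim/fs_ind: u => [|x y hx hy|r k]; first by rewrite fs_scale0 !raddf0.
    by rewrite fs_scaleDr !(raddfD (fslift fD)) /= hx hy scalerDr.
  by rewrite fs_scaleU !hU scalerA.
exists (mklin hl) => [k|h' h'E]; first by rewrite [LHS]hU scale1r.
apply: fs_ind => [|x y hx hy|r k]; first by rewrite !raddf0.
  by rewrite !raddfD /= hx hy.
have -> : fsU r k = r *: (fsU 1 k : fsmod) by rewrite [RHS]fs_scaleU mulr1.
by rewrite !linearZ h'E /= [mklin hl _]hU scale1r.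
Qed.
End FreeModule.

(** * The group of Frobenius-twisted forms as a functor of three rings *)

Section UniversalDifferentials.

Definition upd (T : Type) i (t : {ffun 'I_i -> T}) k y := [ffun j => if j == k then y else t j].

Lemma updE (T : Type) i (t : {ffun 'I_i -> T}) k : upd t k (t k) = t.
Proof. by apply/ffunP => j; rewrite ffunE; case: eqP => [->|]. Qed.

Lemma fmap_upd (S T : Type) i (f : S -> T) (t : {ffun 'I_i -> S}) k y :
  fmap_ff f (upd t k y) = upd (fmap_ff f t) k (f y).
Proof. by apply/ffunP => j; rewrite !ffunE (fun_if f). Qed.

Lemma fmap_ff_comp (S T U : Type) i (f : S -> T) (g : T -> U) (t : {ffun 'I_i -> S}) :
  fmap_ff g (fmap_ff f t) = fmap_ff (g \o f) t.
Proof. by apply/ffunP => j; rewrite !ffunE. Qed.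

Lemma eq_fmap_ff (S T : Type) i (f g : S -> T) (t : {ffun 'I_i -> S}) :
  f =1 g -> fmap_ff f t = fmap_ff g t.
Proof. by move=> e; apply/ffunP => j; rewrite !ffunE e. Qed.

Lemma coord_ind (T X : Type) (x : X -> T) i (P : {ffun 'I_i -> T} -> Prop) :
  (forall t, P (fmap_ff x t)) ->
  (forall t j, (forall s, P (upd t j (x s))) -> forall y, P (upd t j y)) -> forall t, P t.
Proof.
move=> Px Pu.
suff H (s : seq 'I_i) : forall t : {ffun 'I_i -> T},
    (forall j, j \notin s -> exists y, t j = x y) -> P t.
  by move=> t; apply: (H (enum 'I_i)) => j; rewrite mem_enum.
elim: s => [|j s IHs] t tb.
  have [y yE] := choice (fun j => tb j isT).
  by suff -> : t = fmap_ff x [ffun j => y j]; last by apply/ffunP => j; rewrite !ffunE yE.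
rewrite -(updE t j); apply: Pu => z; apply: IHs => j' js; rewrite ffunE.
have [_|nj] := eqVneq j' j; first by exists z.
by apply: tb; rewrite // inE negb_or nj.
Qed.

(** The calculation rules of a (x) b dx_1 ... dx_i in purely additive form. The universal group then
    makes sense for all rings A, k, E and is functorial in the three at once, as is needed to
    compare resolutions over different bases. *)
Record fdatum (A k E : comPzRingType) (phi : k -> A) (iota : k -> E) i (N : zmodType)
    (mu : A -> E -> {ffun 'I_i -> E} -> N) : Prop := FDatum {
  fdDa : forall b x, {morph (fun a => mu a b x) : u v / u + v};
  fdDb : forall a x, {morph (fun b => mu a b x) : u v / u + v};
  fd_bal : forall c a b x, mu (phi c * a) b x = mu a (iota c * b) x;
  fdD : forall a b x j, {morph (fun y => mu a b (upd x j y)) : u v / u + v};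
  fdM : forall a b x j y z,
    mu a b (upd x j (y * z)) = mu a (b * y) (upd x j z) + mu a (b * z) (upd x j y);
  fdC : forall a b x j c, mu a b (upd x j (iota c)) = 0;
  fd_alt : forall a b (x : {ffun 'I_i -> E}) l m, l != m -> x l = x m -> mu a b x = 0 }.

(** In the application [tphi] is the factored Frobenius of a PD-pair and [tio] the structure map of
    an algebra over its quotient ring. *)
Record triple := Triple {
  tA : comPzRingType; tk : comPzRingType; tE : comPzRingType;
  tphi : {rmorphism tk -> tA}; tio : {rmorphism tk -> tE} }.

Record tmor (s t : triple) := TMor {
  mA : {rmorphism tA s -> tA t}; mk : {rmorphism tk s -> tk t}; mE : {rmorphism tE s -> tE t};
  mphi : forall c, mA (tphi s c) = tphi t (mk c);
  mio : forall c, mE (tio s c) = tio t (mk c) }.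

Lemma fdatum_pull s t (f : tmor s t) i (N : zmodType)
    (mu : tA t -> tE t -> {ffun 'I_i -> tE t} -> N) :
  fdatum (tphi t) (tio t) mu ->
  fdatum (tphi s) (tio s) (fun a b x => mu (mA f a) (mE f b) (fmap_ff (mE f) x)).
Proof.
case=> Da Db bal D M C alt; split.
- by move=> b x u v; rewrite rmorphD Da.
- by move=> a x u v; rewrite rmorphD Db.
- by move=> c a b x; rewrite !rmorphM mphi mio bal.
- by move=> a b x j u v; rewrite !fmap_upd rmorphD D.
- by move=> a b x j u v; rewrite !fmap_upd !rmorphM M.
- by move=> a b x j c; rewrite fmap_upd mio C.
- by move=> a b x l m lm e; apply: (alt _ _ _ l m) => //; rewrite !ffunE e.
Qed.

(* The abelian group A (x)_{k,phi} Omega^i_{E/k}, where the generator (a, b, x)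
   stands for a (x) b dx_1 ... dx_i. *)
Section Omega.
Variable i : nat.

Section Model.
Variable t : triple.
Let G : choiceType := (tA t * tE t * {ffun 'I_i -> tE t})%type.
Let D (N : zmodType) (f : G -> N) : Prop := fdatum (tphi t) (tio t) (fun a b x => f (a, b, x)).
Definition Om : zmodType := pres D.
Definition om a b x : Om := pgen D (a, b, x).
Lemma om_datum : fdatum (tphi t) (tio t) om.
Proof.
split.
- by move=> b x u v; apply: pres_rel3 => N f Df; exact: (fdDa Df).
- by move=> a x u v; apply: pres_rel3 => N f Df; exact: (fdDb Df).
- by move=> c a b x; apply: pres_rel2 => N f Df; exact: (fd_bal Df).
- by move=> a b x j u v; apply: pres_rel3 => N f Df; exact: (fdD Df).
- by move=> a b x j u v; apply: pres_rel3 => N f Df; exact: (fdM Df).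
- by move=> a b x j c; apply: pres_rel0 => N f Df; exact: (fdC Df).
- by move=> a b x l m lm e; apply: pres_rel0 => N f Df; apply: (fd_alt Df a b lm e).
Qed.
Definition om_lift (N : zmodType) (mu : tA t -> tE t -> {ffun 'I_i -> tE t} -> N)
  (muP : fdatum (tphi t) (tio t) mu) : {additive Om -> N} :=
  pres_lift (D := D) (f := fun g => mu g.1.1 g.1.2 g.2) muP.
Lemma om_liftE (N : zmodType) (mu : tA t -> tE t -> {ffun 'I_i -> tE t} -> N)
  (muP : fdatum (tphi t) (tio t) mu) a b x : om_lift muP (om a b x) = mu a b x.
Proof. exact: pres_liftE. Qed.
Lemma om_ext (N : zmodType) (h h' : {additive Om -> N}) :
  (forall a b x, h (om a b x) = h' (om a b x)) -> h =1 h'.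
Proof. by move=> e; apply: pres_ext => -[[a b] x]; apply: e. Qed.

Lemma om_alternates a b : alternates (om a b).
Proof.
have [_ _ _ D0 _ _ alt] := om_datum => j l jl y; split; first exact: alt.
have lj : l != j by rewrite eq_sym.
pose w u v := om a b (upd (upd y j u) l v).
have wD u v z : w u (v + z) = w u v + w u z by exact: D0.
have updC (u v : tE t) : upd (upd y j u) l v = upd (upd y l v) j u.
  by apply/ffunP => q; rewrite !ffunE; case: (q =P l) => [->|//]; rewrite (negbTE lj).
have wD' u v z : w (u + v) z = w u z + w v z by rewrite /w !updC D0.
have jy u : w u u = 0.
  by apply: (alt _ _ _ j l jl); rewrite !ffunE !eqxx (negbTE jl).
have := jy (y j + y l); rewrite wD' !wD !jy add0r addr0 addrC => /eqP; rewrite addr_eq0 => /eqP e.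
have -> : swap j l y = upd (upd y j (y l)) l (y j).
  apply/ffunP => q; rewrite !ffunE; case: tpermP => [->|->|].
  + by rewrite (negbTE jl) eqxx.
  + by rewrite eqxx.
  + by move=> /eqP/negbTE -> /eqP/negbTE ->.
rewrite -/(w _ _) e; congr (- om _ _ _); apply/ffunP => q; rewrite !ffunE.
by case: eqP => [->|_] //; case: eqP => [->|].
Qed.

Section Polynomial.
Variables (X : choiceType) (x : X -> tE t) (xP : poly_on (tio t) x).

Lemma om_poly_ext (N : zmodType) (h h' : {additive Om -> N}) :
  (forall a m y, h (om a (pmon x m) (fmap_ff x y)) = h' (om a (pmon x m) (fmap_ff x y))) ->
  h =1 h'.
Proof.
have [Da Db bal D0 M C alt] := om_datum => e; apply: om_ext => a b y.
elim/(coord_ind (x := x)): y a b => [y|y j IH z] a b.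
  have [_ _ bu] := poly_on_basis xP.
  have hD (g : {additive Om -> N}) :
    {morph (fun b => g (om a b (fmap_ff x y))) : u v / u + v}.
    by move=> u v; rewrite Db raddfD.
  by apply: (bu _ (mkadd (hD h)) (mkadd (hD h'))) => c m; rewrite /= /mkadd_of -!bal e.
elim/(poly_on_ind xP): z a b => [u v hu hv|u v hu hv|c|s] a b; last exact: IH.
- by rewrite D0 !raddfD /= hu hv.
- by rewrite M !raddfD /= hu hv.
- by rewrite C !raddf0.
Qed.

(** To extend a datum u from monomials to all forms, let W = A[X]. The functions u(-, -, y) are
    elements of the coinduced module of W; they extend to an alternating map on the free W-module on
    X. It is evaluated at the images of the x_j under the derivation [de], and the result at a times
    the image of b in W. *)
Lemma om_poly_universal : alt_datum_universal (fun a m y => om a (pmon x m) (fmap_ff x y)).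
Proof.
have [Da Db bal D0 M C alt] := om_datum; split; last exact: om_poly_ext.
  split=> [m y u v|a m j l jl y]; first by rewrite Da.
  have [h1 h2] := om_alternates a (pmon x m) jl (fmap_ff x y).
  split=> [e|]; first by apply: h1; rewrite !ffunE e.
  by rewrite -h2; congr om; apply/ffunP => q; rewrite !ffunE.
move=> N u [uD ua]; pose W : comPzRingType := mpoly X (tA t).
have [ev [evC evX] _] := xP (dpolyC xpred0 (tA t) \o tphi t) (@pX X (tA t)).
have [de [deP dex]] := poly_derivation xP (fun s => fsU 1 s : res ev (fsmod W X)).
have f0D y m : {morph (fun a => u a m y) : v w / v + w} by move=> v w; rewrite uD.
have f0W y : {morph (fslift (f0D y) : W -> N) : b b' / b + b'} by move=> b b'; rewrite raddfD.
pose f0 y : coind W N := Coind (f0W y).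
have f0U y a m : f0 y (fsU a m : W) = u a m y by exact: fsliftU.
have f0a : alternates f0.
  move=> j l jl y; split=> [e|]; apply: coind_eq => b.
    rewrite coind0; elim/fs_ind: b => [|v w hv hw|a m]; first by rewrite cofun0.
      by rewrite (cofunD (f0 y)) hv hw addr0.
    by rewrite f0U ((ua _ _ _ _ jl y).1 e).
  rewrite coindN; elim/fs_ind: b => [|v w hv hw|a m]; first by rewrite !cofun0 oppr0.
    by rewrite !cofunD hv hw opprD.
  by rewrite !f0U (ua _ _ _ _ jl y).2.
have [v [[vl va] vb]] := alternating_extension (fsmod_free (R := W) (X := X)) f0a.
pose mu a b (y : {ffun 'I_i -> tE t}) : N :=
  v (fmap_ff (de : tE t -> fsmod W X) y) (dpolyC xpred0 (tA t) a * ev b).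
have mvZD c y j z z' b : v (upd y j (c *: z + z')) b = v (upd y j z) (b * c) + v (upd y j z') b.
  by rewrite [v _](vl y j c z z').
have mv0 y j b : v (upd y j 0) b = 0.
  have := mvZD 1 y j 0 0 b; rewrite scaler0 addr0 mulr1 => e.
  by apply: (addIr (v (upd y j 0) b)); rewrite add0r -e.
have mvD y j z z' b : v (upd y j (z + z')) b = v (upd y j z) b + v (upd y j z') b.
  by rewrite -{1}[z]scale1r mvZD mulr1.
have mvZ c y j z b : v (upd y j (c *: z)) b = v (upd y j z) (b * c).
  by rewrite -{1}[c *: z]addr0 mvZD mv0 addr0.
have muP : fdatum (tphi t) (tio t) mu.
  have [DD DM DC] := deP; split.
  - by move=> b y a a'; rewrite /mu rmorphD mulrDl cofunD.
  - by move=> a y b b'; rewrite /mu rmorphD mulrDr cofunD.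
  - by move=> c a b y; rewrite /mu !rmorphM evC /= mulrCA mulrA.
  - by move=> a b y j z z'; rewrite /mu !fmap_upd DD; apply: mvD.
  - move=> a b y j z z'; rewrite /mu !fmap_upd DM !rmorphM !mulrA.
    rewrite [LHS]mvD; congr (_ + _); [exact: (mvZ (ev z))|exact: (mvZ (ev z'))].
  - by move=> a b y j c; rewrite /mu fmap_upd DC; apply: mv0.
  - by move=> a b y j l jl e; rewrite /mu (va _ j l jl) ?coind0 // !ffunE e.
exists (om_lift muP) => a m y; rewrite om_liftE /mu.
have -> : fmap_ff (de : tE t -> fsmod W X) (fmap_ff x y) = fmap_ff (fun s => fsU 1 s : fsmod W X) y.
  by apply/ffunP => q; rewrite !ffunE dex.
rewrite vb -f0U; congr (f0 y _).
have -> : ev (pmon x m) = dmon xpred0 (tA t) m.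
  rewrite dmon_prod rmorph_mprod; apply: eq_bigr => s _.
  by rewrite rmorphXn /= evX dmon_kexp1.
exact: dpolyCM.
Qed.
End Polynomial.
End Model.

Definition Omap s t (f : tmor s t) : {additive Om s -> Om t} :=
  om_lift (fdatum_pull f (om_datum t)).
Lemma OmapE s t (f : tmor s t) a b x :
  Omap f (om a b x) = om (mA f a) (mE f b) (fmap_ff (mE f) x).
Proof. exact: om_liftE. Qed.
End Omega.
End UniversalDifferentials.

(** * Simplicial objects and functors of triples *)

Section SimplicialActions.

Lemma simplexMap_eq m n (t u : simplexMap m n) : (forall j, t j = u j :> nat) -> t = u.
Proof.
case: t u => [t tm] [u um] /= e.
have tu : t = u by apply/ffunP => j; apply/val_inj/e.
by case: u / tu um e => um _; rewrite (bool_irrelevance tm um).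
Qed.

Definition cofc n i : simplexMap n n.+1 := coface (inord i).
Lemma cofcE n i (j : 'I_n.+1) : (i <= n.+1)%N -> cofc n i j = bump i j :> nat.
Proof. by move=> im; rewrite ffunE /= inordK. Qed.

(** The truncation at n takes effect only for an index i > n, where the map has no meaning. *)
Fact codg_subproof n i :
  monob [ffun j : 'I_n.+2 => inord (minn n (unbump i j)) : 'I_n.+1].
Proof.
apply/monobP => j l jl; rewrite !ffunE !inordK ?ltnS ?geq_minl // /unbump; lia.
Qed.
Definition codg n i : simplexMap n.+1 n := SimplexMap (codg_subproof n i).
Lemma codgE n i (j : 'I_n.+2) : (i <= n)%N -> codg n i j = unbump i j :> nat.
Proof.
move=> im; rewrite ffunE inordK ?ltnS ?geq_minl //.
have := ltn_ord j; rewrite /unbump; lia.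
Qed.
Lemma compE l m n (t : simplexMap m n) (u : simplexMap l m) j :
  simplex_comp t u j = t (u j).
Proof. by rewrite ffunE. Qed.

Record sact := SAct {
  sab :> nat -> zmodType;
  sac : forall m n, simplexMap m n -> {additive sab n -> sab m};
  sac_id : forall n x, sac (simplex_id n) x = x;
  sac_comp : forall l m n (t : simplexMap m n) (u : simplexMap l m) x,
    sac (simplex_comp t u) x = sac u (sac t x) }.

Section Group.
Variable X : sact.

Lemma sac_sq l m m' n (t : simplexMap m n) (u : simplexMap l m)
    (t' : simplexMap m' n) (u' : simplexMap l m') (x : X n) :
  (forall j, t (u j) = t' (u' j) :> nat) -> sac X u (sac X t x) = sac X u' (sac X t' x).
Proof.
by move=> e; rewrite -!sac_comp; congr (sac X _ _); apply: simplexMap_eq => j; rewrite !compE.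
Qed.

Fact sact_fcfc n i j x : (i <= j)%N -> (j <= n.+1)%N ->
  sac X (cofc n i) (sac X (cofc n.+1 j.+1) x) = sac X (cofc n j) (sac X (cofc n.+1 i) x).
Proof. by move=> ij jn; apply: sac_sq => l; rewrite !cofcE ?ltnS //; rewrite /bump; lia. Qed.
Definition sact_ss : ssgrp := SSGrp (fc := fun n i => sac X (cofc n i)) sact_fcfc.

Fact sact_lt n i j x : (i <= j)%N -> (j <= n)%N ->
  sac X (cofc n.+1 i) (sac X (codg n.+1 j.+1) x) = sac X (codg n j) (sac X (cofc n i) x).
Proof.
by move=> ij jn; apply: sac_sq => l; rewrite !(cofcE, codgE); rewrite /bump /unbump; lia.
Qed.
Fact sact_gt n i j x : (j < i)%N -> (i <= n.+1)%N ->
  sac X (cofc n.+1 i.+1) (sac X (codg n.+1 j) x) = sac X (codg n j) (sac X (cofc n i) x).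
Proof.
by move=> ij jn; apply: sac_sq => l; rewrite !(cofcE, codgE); rewrite /bump /unbump; lia.
Qed.
Fact sact_eq n i j x : (i <= n)%N -> (i == j) || (i.+1 == j) ->
  sac X (cofc n j) (sac X (codg n i) x) = x.
Proof.
move=> im ij; rewrite -sac_comp -[RHS]sac_id; congr (sac X _ _).
apply: simplexMap_eq => l; rewrite compE codgE // cofcE ?ffunE //; rewrite /bump /unbump; lia.
Qed.
Definition sact_sgrp : sgrp.
Proof.
apply: (@SGrp sact_ss (fun n i => sac X (codg n i)) sact_lt _ _ sact_gt).
- by move=> n i x im; apply: sact_eq; rewrite ?eqxx.
- by move=> n i x im; apply: sact_eq; rewrite ?eqxx ?orbT.
Defined.
End Group.

Record samor (X Y : sact) := SAMor {
  sam :> forall n, {additive X n -> Y n};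
  samE : forall m n (t : simplexMap m n) x, sam m (sac X t x) = sac Y t (sam n x) }.

Definition samor_smap (X Y : sact) (f : samor X Y) : smap (sact_sgrp X) (sact_sgrp Y) :=
  @SMap (sact_sgrp X) (sact_sgrp Y)
    (@SSMap (sact_sgrp X) (sact_sgrp Y) f (fun n i x _ => samE f (cofc n i) x))
    (fun n i x _ => samE f (codg n i) x).
End SimplicialActions.

Section Triples.

(** Morphisms of triples bundle proofs, so all functor laws are stated up to pointwise equality. *)
Definition teq s t (f g : tmor s t) : Prop :=
  [/\ mA f =1 mA g, mk f =1 mk g & mE f =1 mE g].
Definition tidm t : tmor t t :=
  @TMor t t idfun idfun idfun (fun _ => erefl) (fun _ => erefl).
Fact tcmp_phi r s t (f : tmor r s) (g : tmor s t) c :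
  (mA g \o mA f) (tphi r c) = tphi t ((mk g \o mk f) c).
Proof. by rewrite /= !mphi. Qed.
Fact tcmp_io r s t (f : tmor r s) (g : tmor s t) c :
  (mE g \o mE f) (tio r c) = tio t ((mk g \o mk f) c).
Proof. by rewrite /= !mio. Qed.
Definition tcmp r s t (f : tmor r s) (g : tmor s t) : tmor r t :=
  TMor (tcmp_phi f g) (tcmp_io f g).

Lemma teq_trans s t (f g h : tmor s t) : teq f g -> teq g h -> teq f h.
Proof. by move=> [a b c] [a' b' c']; split=> x; rewrite ?a ?b ?c. Qed.
Lemma teq_sym s t (f g : tmor s t) : teq f g -> teq g f.
Proof. by move=> [a b c]; split=> x. Qed.

Record striple := STriple {
  st :> nat -> triple;
  st_map : forall m n, simplexMap m n -> tmor (st n) (st m);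
  st_id : forall n, teq (st_map (simplex_id n)) (tidm (st n));
  st_comp : forall l m n (t : simplexMap m n) (u : simplexMap l m),
    teq (st_map (simplex_comp t u)) (tcmp (st_map t) (st_map u)) }.

Record stmor (X Y : striple) := STMor {
  stm :> forall n, tmor (X n) (Y n);
  stmE : forall m n (t : simplexMap m n),
    teq (tcmp (st_map X t) (stm m)) (tcmp (stm n) (st_map Y t)) }.

Record tfun := TFun {
  tf :> triple -> zmodType;
  tfm : forall s t, tmor s t -> {additive tf s -> tf t};
  tfm_eq : forall s t (f g : tmor s t), teq f g -> tfm f =1 tfm g;
  tfm_id : forall t x, tfm (tidm t) x = x;
  tfm_comp : forall r s t (f : tmor r s) (g : tmor s t) x, tfm (tcmp f g) x = tfm g (tfm f x) }.

Lemma tfm_sq (T : tfun) r s s' t (f : tmor r s) (g : tmor s t) (f' : tmor r s') (g' : tmor s' t) x :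
  teq (tcmp f g) (tcmp f' g') -> tfm T g (tfm T f x) = tfm T g' (tfm T f' x).
Proof. by move=> e; rewrite -!tfm_comp; apply: tfm_eq. Qed.

Definition tf_sact (T : tfun) (X : striple) : sact.
Proof.
apply: (@SAct (fun n => T (X n)) (fun m n t => tfm T (st_map X t))).
- by move=> n x; rewrite (tfm_eq (st_id X n)) tfm_id.
- by move=> l m n t u x; rewrite (tfm_eq (st_comp X t u)) tfm_comp.
Defined.

Section Apply.
Variables (T : tfun) (X Y : striple) (f : stmor X Y).
Definition tf_samor : samor (tf_sact T X) (tf_sact T Y) :=
  @SAMor (tf_sact T X) (tf_sact T Y) (fun n => tfm T (f n))
    (fun m n t x => tfm_sq (T := T) x (stmE f t)).
Definition tf_hiso : Prop := hiso (sschmap (samor_smap tf_samor)).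
End Apply.

Lemma tf_hiso_iso (T T' : tfun) (u : forall t, {additive T t -> T' t}) X Y (f : stmor X Y) :
  (forall t, bijective (u t)) -> (forall s t (g : tmor s t) x, u t (tfm T g x) = tfm T' g (u s x)) ->
  tf_hiso T' f -> tf_hiso T f.
Proof.
move=> ub un hf.
pose U X : samor (tf_sact T X) (tf_sact T' X) :=
  @SAMor (tf_sact T X) (tf_sact T' X) (fun n => u (X n)) (fun m n t x => un _ _ (st_map X t) x).
have hU X' : hiso (sschmap (samor_smap (U X'))) by apply: hiso_bij => n; have [g gK Kg] := ub (X' n); exists g.
have hD n : {morph (fun x => u (Y n) (tfm T (f n) x)) : x y / x + y}.
  by move=> x y; rewrite !raddfD.
have hN m n (t : simplexMap m n) x : mkadd (hD m) (tfm T (st_map X t) x) =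
    tfm T' (st_map Y t) (mkadd (hD n) x).
  by rewrite /= /mkadd_of !un; apply: tfm_sq; apply: stmE.
pose h : samor (tf_sact T X) (tf_sact T' Y) :=
  @SAMor (tf_sact T X) (tf_sact T' Y) (fun n => mkadd (hD n)) hN.
have hh : hiso (sschmap (samor_smap h)).
  by apply: (hiso_comp _ (hU X) hf) => n x; rewrite /= /mkadd_of un.
exact: (hiso_cancel_l (g := sschmap (samor_smap (U Y))) _ hh (hU Y)).
Qed.

Definition tfA : tfun := @TFun (fun t => tA t) (fun s t f => mA f)
  (fun s t f g '(And3 a b c) => a) (fun _ _ => erefl) (fun _ _ _ _ _ _ => erefl).
Definition tfk : tfun := @TFun (fun t => tk t) (fun s t f => mk f)
  (fun s t f g '(And3 a b c) => b) (fun _ _ => erefl) (fun _ _ _ _ _ _ => erefl).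
Definition tfE : tfun := @TFun (fun t => tE t) (fun s t f => mE f)
  (fun s t f g '(And3 a b c) => c) (fun _ _ => erefl) (fun _ _ _ _ _ _ => erefl).

Definition tfOm (i : nat) : tfun.
Proof.
apply: (@TFun (fun t => Om i t) (fun s t f => Omap i f)).
- move=> s t f g [a b c]; apply: om_ext => x y z; rewrite !OmapE a c.
  by rewrite (eq_fmap_ff _ c).
- move=> t; apply: (om_ext (h' := idfun)) => a b x; rewrite OmapE /=; congr om.
  by apply/ffunP => j; rewrite ffunE.
- move=> r s t f g.
  apply: (om_ext (h' := Omap i g \o Omap i f)) => a b x.
  by rewrite /= !OmapE /= fmap_ff_comp.
Defined.

Definition tf3 (F : functor3) (a b c : tfun) : tfun.
Proof.
apply: (@TFun (fun t => F (a t) (b t) (c t)) (fun s t f => fm F (tfm a f) (tfm b f) (tfm c f))).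
- move=> s t f g e x; rewrite -[RHS](fm_id (a := idfun) (b := idfun) (c := idfun)) //.
  by apply/esym/fm_comp => y; rewrite /= (tfm_eq e).
- by move=> t; apply: fm_id => x; rewrite tfm_id.
- by move=> r s t f g x; apply/esym/fm_comp => y; rewrite /= tfm_comp.
Defined.

Section Torsion.
Variables (p : nat) (p_pr : prime p).
Definition ttorsion t : Prop := [/\ p%:R = 0 :> tA t, p%:R = 0 :> tk t & p%:R = 0 :> tE t].
Definition tf_torsion (T : tfun) : Prop := forall t, ttorsion t -> forall x : T t, x *+ p = 0.

Lemma tf3_hiso (F : functor3) (a b c : tfun) X Y (f : stmor X Y) :
  (forall n, ttorsion (X n)) -> (forall n, ttorsion (Y n)) ->
  tf_torsion a -> tf_torsion b -> tf_torsion c ->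
  tf_hiso a f -> tf_hiso b f -> tf_hiso c f -> tf_hiso (tf3 F a b c) f.
Proof.
move=> tX tY ta tb tc ha hb hc.
apply: (fun_map_hiso F (a := samor_smap (tf_samor a f)) (b := samor_smap (tf_samor b f))
  (c := samor_smap (tf_samor c f)) p_pr) => // n x.
- exact: ta (tX n) x.
- exact: ta (tY n) x.
- exact: tb (tX n) x.
- exact: tb (tY n) x.
- exact: tc (tX n) x.
- exact: tc (tY n) x.
Qed.
Lemma tfA_torsion : tf_torsion tfA.
Proof. by move=> t [h _ _] x; rewrite -mulr_natr h mulr0. Qed.
Lemma tfk_torsion : tf_torsion tfk.
Proof. by move=> t [_ h _] x; rewrite -mulr_natr h mulr0. Qed.
Lemma tfE_torsion : tf_torsion tfE.
Proof. by move=> t [_ _ h] x; rewrite -mulr_natr h mulr0. Qed.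
End Torsion.
End Triples.

Local Notation mdom m := (finsupp (cmonom_val m)).

(** * Polynomial rings and their forms as functors of underlying groups *)

Section MonomialMap.
Variables (X Y : choiceType) (c : X -> Y).
Definition cmmap (m : {cmonom X}) : {cmonom Y} :=
  \big[mmul/mone]_(s <- mdom m) kexp (c s) (m s).
Lemma cmmap_wide (m : {cmonom X}) (D : {fset X}) j : (mdom m `<=` D)%fset ->
  cmmap m j = (\sum_(s <- D) if c s == j then m s else 0)%N.
Proof.
move=> mD; transitivity (\sum_(s <- mdom m) if c s == j then m s else 0)%N.
  rewrite /cmmap; elim: (enum_fset _) => [|s r IHr]; first by rewrite !big_nil cm1.
  by rewrite !big_cons cmM IHr kexpE.
rewrite [RHS](big_fsetID _ (fun s => s \in mdom m)) /= [X in (_ + X)%N]big1_fset ?addn0.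
  apply: eq_fbig => // s; rewrite !inE /= andbC.
  by case: (boolP (s \in mdom m)) => // /(fsubsetP mD) ->.
by move=> s; rewrite !inE /= => /andP[_]; rewrite -cmE_eq0 => /eqP -> _; rewrite if_same.
Qed.
End MonomialMap.

Lemma eq_cmmap (X Y : choiceType) (c d : X -> Y) : c =1 d -> cmmap c =1 cmmap d.
Proof. by move=> e m; apply: eq_bigr => s _; rewrite e. Qed.

Lemma cmmap_id (X : choiceType) (m : {cmonom X}) : cmmap id m = m.
Proof.
apply: cm_eq => j; rewrite (cmmap_wide _ _ (fsubset_refl _)).
have [jm|jm] := boolP (j \in mdom m).
  rewrite (big_fsetD1 j) //= eqxx big1_fset ?addn0 // => s.
  by rewrite !inE => /andP[/negbTE ->].
rewrite big1_fset => [|s sm _].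
  by move: jm; rewrite -cmE_eq0 => /eqP ->.
by case: eqP sm jm => [->->|].
Qed.

Lemma cmmap_comp (X Y W : choiceType) (c : X -> Y) (d : Y -> W) (m : {cmonom X}) :
  cmmap d (cmmap c m) = cmmap (d \o c) m.
Proof.
pose D := [fset c s | s in mdom m]%fset.
apply: cm_eq => j.
have cD : (mdom (cmmap c m) `<=` D)%fset.
  apply/fsubsetP => l; rewrite -cmE_neq0 (cmmap_wide _ _ (fsubset_refl _)).
  apply: contraNT => lD; rewrite big1_fset // => s sm _; case: eqP => // e.
  by case/negP: lD; rewrite -e; apply: in_imfset.
rewrite (cmmap_wide _ _ cD) [RHS](cmmap_wide _ _ (fsubset_refl _)).
under eq_bigr => l _ do rewrite (cmmap_wide _ _ (fsubset_refl _)).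
transitivity (\sum_(l <- D) \sum_(s <- mdom m)
    if (d l == j) && (c s == l) then m s else 0)%N.
  apply: eq_bigr => l _; case: eqP => [_|_]; first by apply: eq_bigr.
  by rewrite big1.
rewrite exchange_big /=; apply: eq_fbigr => s sm.
rewrite (big_fsetD1 (c s)) ?in_imfset //= eqxx andbT big1_fset ?addn0 // => l.
by rewrite !inE => /andP[/negbTE ls _] _; rewrite eq_sym in ls; rewrite ls andbF.
Qed.

Section PolynomialMap.
Variables (X Y : choiceType) (k k' : comPzRingType) (f : {rmorphism k -> k'}) (c : X -> Y).
Definition pmap_ring : {rmorphism mpoly X k -> mpoly Y k'} :=
  peval (dpolyC xpred0 k' \o f) (fun s => pX k' (c s)).
Lemma dmonM0 (m n : {cmonom Y}) : dmon xpred0 k' (mmul m n) = dmon xpred0 k' m * dmon xpred0 k' n.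
Proof.
rewrite dmonM /mcoc big1 // => s _; by rewrite /mcoc1.
Qed.
Lemma pmap_mon m : pmap_ring (dmon xpred0 k m) = dmon xpred0 k' (cmmap c m).
Proof.
rewrite peval_mon /mprod /cmmap; elim: (enum_fset _) => [|s r IHr]; first by rewrite !big_nil.
by rewrite !big_cons IHr dmonM0 dmon_kexp1.
Qed.
Lemma pmapU a m : pmap_ring (fsU a m : mpoly X k) = fsU (f a) (cmmap c m).
Proof. by rewrite [LHS]devU -dpolyCM -pmap_mon peval_mon. Qed.
End PolynomialMap.

Section PolynomialGroups.
Fact pfun_add (k k' : zmodType) (f : {additive k -> k'}) (X Y : choiceType) (c : X -> Y) m :
  {morph (fun a => fsU (f a) (cmmap c m)) : x y / x + y}.
Proof. by move=> x y; rewrite raddfD fsUD. Qed.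
Definition pfun (k k' : zmodType) (f : {additive k -> k'}) (X Y : choiceType) (c : X -> Y) :
  {additive finsum {cmonom X} k -> finsum {cmonom Y} k'} := fslift (pfun_add f c).
Lemma pfunU (k k' : zmodType) (f : {additive k -> k'}) (X Y : choiceType) (c : X -> Y) a m :
  pfun f c (fsU a m) = fsU (f a) (cmmap c m).
Proof. exact: fsliftU. Qed.

(** Additively, k[E] depends on the group k and on the mere set E, hence functorially on the two
    groups. It is not additive in E. *)
Definition poly_functor : functor3.
Proof.
apply: (@Functor3 (fun _ k E => finsum {cmonom E} k) (fun _ _ _ _ _ _ _ f c => pfun f c)).
- move=> _ B C _ b c _ b1 c1; apply: (fs_ext (g := idfun)) => r m.
  by rewrite pfunU b1 (eq_cmmap c1) cmmap_id.
- move=> _ _ _ B B' B'' C C' C'' _ _ _ b b' b'' c c' c'' _ bE cE.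
  apply: (fs_ext (f := pfun b' c' \o pfun b c)) => r m.
  by rewrite /= !pfunU bE (eq_cmmap cE) cmmap_comp.
Defined.

Section Alt.
Variable i : nat.
Fact alt_fun_datum (A A' C C' : zmodType) (a : {additive A -> A'}) (c : {additive C -> C'}) :
  alt_datum (fun x m y => @alt_gen A' {cmonom C'} C' i (a x) (cmmap c m) (fmap_ff c y)).
Proof.
have [gD ga] := @alt_gen_datum A' {cmonom C'} C' i; split=> [m y u v|x m k l kl y].
  by rewrite raddfD gD.
have [h1 h2] := ga (a x) (cmmap c m) k l kl (fmap_ff c y); split=> [e|].
  by apply: h1; rewrite !ffunE e.
by rewrite -h2; congr alt_gen; apply/ffunP => j; rewrite !ffunE.
Qed.
(** These are the forms of k[E] with coefficients in A: the monomials and the differentials of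
    variables come from the set E alone. *)
Definition alt_functor : functor3.
Proof.
apply: (@Functor3 (fun A _ C => alt_model A {cmonom C} C i)
  (fun _ _ _ _ _ _ a _ c => alt_lift (alt_fun_datum a c))).
- move=> A _ C a _ c a1 _ c1; apply: (alt_model_ext (h' := idfun)) => x m y.
  rewrite alt_liftE a1 (eq_cmmap c1) cmmap_id /=; congr alt_gen.
  by apply/ffunP => j; rewrite ffunE c1.
- move=> A A' A'' _ _ _ C C' C'' a a' a'' _ _ _ c c' c'' aE _ cE.
  apply: (alt_model_ext (h := alt_lift (alt_fun_datum a' c') \o alt_lift (alt_fun_datum a c))).
  move=> x m y; rewrite /= !alt_liftE aE (eq_cmmap cE) cmmap_comp fmap_ff_comp.
  by rewrite (eq_fmap_ff _ cE).
Defined.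
End Alt.

Lemma alt_datum_universal_bij (A : zmodType) (K X : Type) i (L L' : zmodType)
    (g : A -> K -> {ffun 'I_i -> X} -> L) (g' : A -> K -> {ffun 'I_i -> X} -> L') :
  alt_datum_universal g -> alt_datum_universal g' ->
  exists2 h : {additive L -> L'}, bijective h & forall a k x, h (g a k x) = g' a k x.
Proof.
move=> [gd gl gu] [gd' gl' gu'].
have [h hE] := gl _ _ gd'; have [h' h'E] := gl' _ _ gd.
exists h => //; exists h' => x.
  by apply: (gu _ (h' \o h) idfun) => a k y; rewrite /= hE h'E.
by apply: (gu' _ (h \o h') idfun) => a k y; rewrite /= h'E hE.
Qed.
End PolynomialGroups.

(** * The free algebra cotriple and its resolution *)

Section Cotriple.

Definition Gt (t : triple) : triple := Triple (tphi t) (dpolyC (X := tE t) xpred0 (tk t)).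
Section Gmap.
Variables (s t : triple) (f : tmor s t).
Definition Gmor_E : {rmorphism mpoly (tE s) (tk s) -> mpoly (tE t) (tk t)} :=
  pmap_ring (mk f) (mE f).
Fact Gmor_io c : Gmor_E (dpolyC xpred0 (tk s) c) = dpolyC xpred0 (tk t) (mk f c).
Proof. exact: pevalC. Qed.
Definition Gmor : tmor (Gt s) (Gt t) := @TMor (Gt s) (Gt t) (mA f) (mk f) Gmor_E (mphi f) Gmor_io.
Lemma GmorX x : mE Gmor (pX (tk s) x) = pX (tk t) (mE f x).
Proof. exact: pevalX. Qed.
End Gmap.

Definition evalt t : tmor (Gt t) t :=
  @TMor (Gt t) t idfun idfun (peval (tio t) id) (fun _ => erefl) (fun c => pevalC _ _ c).
Lemma evaltX t x : mE (evalt t) (pX (tk t) x) = x.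
Proof. exact: pevalX. Qed.

Lemma teq_G s t (f g : tmor (Gt s) t) : mA f =1 mA g -> mk f =1 mk g ->
  (forall x, mE f (pX (tk s) x) = mE g (pX (tk s) x)) -> teq f g.
Proof.
move=> a b e; split=> //; apply: (poly_on_ext (@mpoly_poly_on (tE s) (tk s))) => // c.
by rewrite (mio f) (mio g) b.
Qed.

Lemma Gmor_eq s t (f g : tmor s t) : teq f g -> teq (Gmor f) (Gmor g).
Proof. by move=> [a b c]; apply: (teq_G (f := Gmor f) (g := Gmor g) a b) => x; rewrite !GmorX c. Qed.
Lemma Gmor_id t : teq (Gmor (tidm t)) (tidm (Gt t)).
Proof.
by apply: (teq_G (f := Gmor (tidm t)) (g := tidm (Gt t)) (frefl _) (frefl _)) => x; apply: GmorX.
Qed.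
Lemma Gmor_cmp r s t (f : tmor r s) (g : tmor s t) :
  teq (Gmor (tcmp f g)) (tcmp (Gmor f) (Gmor g)).
Proof.
apply: (teq_G (f := Gmor (tcmp f g)) (g := tcmp (Gmor f) (Gmor g)) (frefl _) (frefl _)) => x.
by rewrite GmorX -[RHS]/(mE (Gmor g) (mE (Gmor f) _)) !GmorX.
Qed.
Lemma Gmor_sq r s s' t (f : tmor r s) (g : tmor s t) (f' : tmor r s') (g' : tmor s' t) :
  teq (tcmp f g) (tcmp f' g') -> teq (tcmp (Gmor f) (Gmor g)) (tcmp (Gmor f') (Gmor g')).
Proof.
move=> e; apply: teq_trans (teq_sym (Gmor_cmp _ _)) _.
exact: teq_trans (Gmor_eq e) (Gmor_cmp _ _).
Qed.
Lemma eval_nat s t (f : tmor s t) : teq (tcmp (Gmor f) (evalt t)) (tcmp (evalt s) f).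
Proof.
apply: (teq_G (f := tcmp (Gmor f) (evalt t)) (g := tcmp (evalt s) f) (frefl _) (frefl _)) => x.
rewrite -[LHS]/(mE (evalt t) (mE (Gmor f) _)) -[RHS]/(mE f (mE (evalt s) _)).
by rewrite GmorX !evaltX.
Qed.

Definition Gn m t : triple := iter m Gt t.
(** Index 0 evaluates the outermost polynomial ring, index m the innermost one. *)
Fixpoint face m t j : tmor (Gn m.+1 t) (Gn m t) :=
  match m, j with
  | m'.+1, j'.+1 => Gmor (face m' t j')
  | m', _ => evalt (Gn m' t)
  end.
Fixpoint Gnmor m s t (f : tmor s t) : tmor (Gn m s) (Gn m t) :=
  match m with 0%N => f | m'.+1 => Gmor (Gnmor m' f) end.
(** A section e of the evaluation, inserted at the innermost place: an extra degeneracy that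
    commutes with all faces but the last, which it splits. *)
Fixpoint extra t (e : tmor t (Gt t)) m : tmor (Gn m t) (Gn m.+1 t) :=
  match m with 0%N => e | m'.+1 => Gmor (extra e m') end.


Lemma face_face m t i j : (i <= j)%N -> (j <= m)%N ->
  teq (tcmp (face m.+1 t j.+1) (face m t i)) (tcmp (face m.+1 t i) (face m t j)).
Proof.
elim: m i j => [|m IHm] [|i] [|j] ij jm; try by exfalso; lia.
- exact: (eval_nat (evalt t)).
- exact: (eval_nat (face m.+1 t 0)).
- exact: (eval_nat (face m.+1 t j.+1)).
- exact: (Gmor_sq (IHm i j ij jm)).
Qed.

Lemma face_nat m s t (f : tmor s t) j :
  teq (tcmp (face m s j) (Gnmor m f)) (tcmp (Gnmor m.+1 f) (face m t j)).
Proof.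
elim: m j => [|m IHm] [|j].
- exact: (teq_sym (eval_nat f)).
- exact: (teq_sym (eval_nat f)).
- exact: (teq_sym (eval_nat (Gnmor m.+1 f))).
- exact: (Gmor_sq (IHm j)).
Qed.

Lemma Gnmor_eq m s t (f g : tmor s t) : teq f g -> teq (Gnmor m f) (Gnmor m g).
Proof. by move=> e; elim: m => [|m IHm]; [exact: e|exact: Gmor_eq IHm]. Qed.
Lemma Gnmor_id m t : teq (Gnmor m (tidm t)) (tidm (Gn m t)).
Proof.
elim: m => [|m IHm]; first by split.
exact: teq_trans (Gmor_eq IHm) (Gmor_id _).
Qed.
Lemma Gnmor_cmp m r s t (f : tmor r s) (g : tmor s t) :
  teq (Gnmor m (tcmp f g)) (tcmp (Gnmor m f) (Gnmor m g)).
Proof.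
elim: m => [|m IHm]; first by split.
exact: teq_trans (Gmor_eq IHm) (Gmor_cmp _ _).
Qed.

Section Extra.
Variables (t : triple) (e : tmor t (Gt t)) (eK : teq (tcmp e (evalt t)) (tidm t)).
Lemma face_extra_lt m j : (j <= m)%N ->
  teq (tcmp (extra e m.+1) (face m.+1 t j)) (tcmp (face m t j) (extra e m)).
Proof.
elim: m j => [|m IHm] [|j] jm; try by exfalso; lia.
- exact: (eval_nat e).
- exact: (eval_nat (extra e m.+1)).
- exact: (Gmor_sq (IHm j jm)).
Qed.
Lemma face_extra_eq m : teq (tcmp (extra e m) (face m t m)) (tidm (Gn m t)).
Proof.
elim: m => [|m IHm]; first exact: eK.
apply: teq_trans (teq_sym (Gmor_cmp _ _)) _.
exact: teq_trans (Gmor_eq IHm) (Gmor_id _).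
Qed.
End Extra.

(** A polynomial algebra is a retract of the free algebra on its underlying set: each variable goes
    to the symbol that it names there. *)
Lemma extra_exists t (X : choiceType) (x : X -> tE t) : poly_on (tio t) x ->
  exists e : tmor t (Gt t), teq (tcmp e (evalt t)) (tidm t).
Proof.
move=> xP; have [h [hC hX] _] := xP _ (dpolyC xpred0 (tk t)) (fun s => pX (tk t) (x s)).
exists (@TMor t (Gt t) idfun idfun h (fun _ => erefl) hC); split=> //=.
apply: (poly_on_ext xP (h := peval (tio t) id \o h) (h' := idfun)) => s /=.
  by rewrite hC pevalC.
by rewrite hX pevalX.
Qed.

Definition tfG (T : tfun) (m : nat) : tfun.
Proof.
apply: (@TFun (fun t => T (Gn m t)) (fun s t f => tfm T (Gnmor m f))).
- by move=> s t f g e; apply/tfm_eq/Gnmor_eq.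
- by move=> t x; rewrite (tfm_eq (Gnmor_id m t)) tfm_id.
- by move=> r s t f g x; rewrite (tfm_eq (Gnmor_cmp m f g)) tfm_comp.
Defined.
End Cotriple.

Section CotripleResolution.

Section Differential.
Variable T : tfun.
Definition gd m t (x : T (Gn m.+1 t)) : T (Gn m t) :=
  \sum_(j < m.+1) tfm T (face m t j) x *~ (-1) ^+ j.
Fact gdD m t : {morph @gd m t : x y / x + y}.
Proof.
move=> x y; rewrite /gd -big_split; apply: eq_bigr => j _ /=.
by rewrite raddfD mulrzDl.
Qed.
Lemma gd_nat m s t (f : tmor s t) x :
  tfm T (Gnmor m f) (gd x) = gd (tfm T (Gnmor m.+1 f) x).
Proof.
rewrite /gd raddf_sum; apply: eq_bigr => j _; rewrite raddfMz /=; congr (_ *~ _).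
exact: tfm_sq (face_nat m f j).
Qed.
Lemma gd_gd m t x : gd (m := m) (gd (m := m.+1) (t := t) x) = 0.
Proof.
case: m x => [|m] x.
  rewrite {1}/gd big_ord1 /gd big_ord_recl big_ord1 /= mulr1z raddfD /= !raddfMz /=.
  have := tfm_sq (T := T) x (face_face (m := 0) t (leqnn 0) (leqnn 0)); rewrite /= => ->.
  by rewrite -mulrzDr expr0 expr1 subrr.
have ff n i j (y : T (Gn n.+3 t)) : (i <= j)%N -> (j <= n.+1)%N ->
    tfm T (face n.+1 t i) (tfm T (face n.+2 t j.+1) y) =
    tfm T (face n.+1 t j) (tfm T (face n.+2 t i) y).
  by move=> ij jn; apply: tfm_sq; apply: face_face.
pose C : ssgrp := @SSGrp (fun n => T (Gn n.+1 t)) (fun n i => tfm T (face n.+1 t i)) ff.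
exact: (@altsum_altsum C m x).
Qed.
Variables (t : triple) (e : tmor t (Gt t)) (eK : teq (tcmp e (evalt t)) (tidm t)).
Lemma gd_extra m x : gd (tfm T (extra e m.+1) x) =
  tfm T (extra e m) (gd x) + x *~ (-1) ^+ m.+1.
Proof.
rewrite /gd big_ord_recr /=; congr (_ + _ *~ _); last first.
  by rewrite -tfm_comp (tfm_eq (face_extra_eq eK m.+1)) tfm_id.
rewrite raddf_sum; apply: eq_bigr => j _; rewrite raddfMz /=; congr (_ *~ _).
by apply: tfm_sq; apply: face_extra_lt; rewrite -ltnS.
Qed.
(** The extra degeneracy is a contraction up to the sign (-1)^(m+1). It depends on the chosen
    variables and need not be compatible with the simplicial structure, but exactness is needed only
    in each simplicial degree separately. *)
Lemma gd_exact m (x : T (Gn m.+1 t)) : gd x = 0 -> exists y, gd (m := m.+1) y = x.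
Proof.
move=> x0; exists (tfm T (extra e m.+1) x *~ (-1) ^+ m.+1).
rewrite -[gd _]/(mkadd (@gdD m.+1 t) _) raddfMz /= /mkadd_of gd_extra x0 raddf0 add0r.
exact: signMz2.
Qed.
Lemma gd_surj x : exists y, gd (m := 0) (t := t) y = x.
Proof.
exists (tfm T e x); rewrite /gd big_ord1 /= mulr1z.
by rewrite -tfm_comp (tfm_eq eK) tfm_id.
Qed.
End Differential.

Section Chains.
Variables (T : tfun) (X : striple) (m : nat).
Definition gd_sam : samor (tf_sact (tfG T m.+1) X) (tf_sact (tfG T m) X) :=
  @SAMor (tf_sact (tfG T m.+1) X) (tf_sact (tfG T m) X) (fun n => mkadd (@gdD T m (X n)))
    (fun l n t x => esym (gd_nat (st_map X t) x)).
End Chains.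

Lemma pmon_pX (X : choiceType) (k : comPzRingType) m : pmon (@pX X k) m = dmon xpred0 k m.
Proof. by rewrite dmon_prod; apply: eq_bigr => s _; rewrite dmon_kexp1. Qed.

Lemma Om_alt_model i s : {h : {additive Om i (Gt s) -> alt_model (tA s) {cmonom tE s} (tE s) i} |
  bijective h /\ forall a m y, h (om (t := Gt s) a (dmon xpred0 (tk s) m) (fmap_ff (@pX _ (tk s)) y)) =
    alt_gen a m y}.
Proof.
apply: cid.
have U := om_poly_universal i (t := Gt s) (@mpoly_poly_on (tE s) (tk s)).
have [h hb hE] := alt_datum_universal_bij U (@alt_model_universal (tA s) {cmonom tE s} (tE s) i).
by exists h; split=> // a m y; rewrite -hE pmon_pX.
Qed.

Section Torsion.
Variables (p : nat) (p_pr : prime p).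
Lemma ttorsion_G t : ttorsion p t -> ttorsion p (Gt t).
Proof.
by move=> [h1 h2 h3]; split=> //; rewrite -(rmorph_nat (dpolyC xpred0 (tk t))) h2 rmorph0.
Qed.
Lemma ttorsion_Gn m t : ttorsion p t -> ttorsion p (Gn m t).
Proof. by move=> h; elim: m => [|m IHm]; [exact: h|exact: ttorsion_G IHm]. Qed.
Lemma tf_torsion_G T m : tf_torsion p T -> tf_torsion p (tfG T m).
Proof. by move=> h t tt x; apply: (h (Gn m t)); apply: ttorsion_Gn. Qed.

Variables (X Y : striple) (f : stmor X Y).
Hypotheses (tX : forall n, ttorsion p (X n)) (tY : forall n, ttorsion p (Y n)).
Hypotheses (hA : tf_hiso tfA f) (hk : tf_hiso tfk f) (hE : tf_hiso tfE f).

Lemma tf_hiso_G0 (T : tfun) : tf_hiso T f <-> tf_hiso (tfG T 0) f.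
Proof.
by split; [apply: (tf_hiso_iso (T := tfG T 0) (T' := T) (u := fun t => idfun))|
  apply: (tf_hiso_iso (T := T) (T' := tfG T 0) (u := fun t => idfun))] => // t; exists id.
Qed.
Lemma tf_hiso_GA m : tf_hiso (tfG tfA m) f.
Proof.
elim: m => [|m IHm]; first exact/tf_hiso_G0.
apply: (tf_hiso_iso (T := tfG tfA m.+1) (T' := tfG tfA m) (u := fun t => idfun)) IHm => // t.
by exists id.
Qed.
Lemma tf_hiso_Gk m : tf_hiso (tfG tfk m) f.
Proof.
elim: m => [|m IHm]; first exact/tf_hiso_G0.
apply: (tf_hiso_iso (T := tfG tfk m.+1) (T' := tfG tfk m) (u := fun t => idfun)) IHm => // t.
by exists id.
Qed.
(** Each further iterate is [poly_functor] of the groups of the previous one, so [fun_map_hiso]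
    carries the induction through functors that are not additive. *)
Lemma tf_hiso_GE m : tf_hiso (tfG tfE m) f.
Proof.
elim: m => [|m IHm]; first exact/tf_hiso_G0.
have h : tf_hiso (tf3 poly_functor (tfG tfA m) (tfG tfk m) (tfG tfE m)) f.
  apply: (tf3_hiso p_pr) => //; try exact: tf_torsion_G (@tfA_torsion p);
    try exact: tf_torsion_G (@tfk_torsion p); try exact: tf_torsion_G (@tfE_torsion p).
  - exact: tf_hiso_GA.
  - exact: tf_hiso_Gk.
apply: (tf_hiso_iso (T := tfG tfE m.+1)
  (T' := tf3 poly_functor (tfG tfA m) (tfG tfk m) (tfG tfE m))
  (u := fun t => @mkadd (tfG tfE m.+1 t) (tf3 poly_functor (tfG tfA m) (tfG tfk m) (tfG tfE m) t)
     id (fun _ _ => erefl))) h; first by move=> t; exists id.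
move=> s t g x /=.
apply: (fs_ext (f := mE (Gmor (Gnmor m g)))) => a z.
by rewrite pfunU; apply: pmapU.
Qed.

(** The forms of a free algebra k[E] no longer see the multiplication of E. They are [alt_functor]
    of the underlying groups, naturally in the triple, and [fun_map_hiso] applies. *)
Lemma Om_G_hiso i m : tf_hiso (tfG (tfOm i) m.+1) f.
Proof.
have h : tf_hiso (tf3 (alt_functor i) (tfG tfA m) (tfG tfk m) (tfG tfE m)) f.
  apply: (tf3_hiso p_pr) => //; try exact: tf_torsion_G (@tfA_torsion p);
    try exact: tf_torsion_G (@tfk_torsion p); try exact: tf_torsion_G (@tfE_torsion p).
  - exact: tf_hiso_GA.
  - exact: tf_hiso_Gk.
  - exact: tf_hiso_GE.
pose T' := tf3 (alt_functor i) (tfG tfA m) (tfG tfk m) (tfG tfE m).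
pose u t : {additive tfG (tfOm i) m.+1 t -> T' t} := sval (Om_alt_model i (Gn m t)).
apply: (tf_hiso_iso (T := tfG (tfOm i) m.+1) (T' := T') (u := u)) h.
  by move=> t; case: (svalP (Om_alt_model i (Gn m t))).
move=> s t g; rewrite /u /=; move: (Gn m s) (Gn m t) (Gnmor m g) => s' t' g' x.
have [_ hs] := svalP (Om_alt_model i s'); have [_ ht] := svalP (Om_alt_model i t').
pose h1 : {additive Om i (Gt s') -> _} := sval (Om_alt_model i t') \o Omap i (Gmor g').
pose h2 : {additive Om i (Gt s') -> _} :=
  alt_lift (alt_fun_datum i (mA g') (mE g')) \o sval (Om_alt_model i s').
move: x; suff : h1 =1 h2 by [].
apply: (om_poly_ext (t := Gt s') (@mpoly_poly_on (tE s') (tk s'))) => a z y.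
rewrite /h1 /h2 pmon_pX /= hs alt_liftE OmapE; rewrite [mE (Gmor g') _]pmap_mon fmap_ff_comp.
have -> : fmap_ff (mE (Gmor g') \o pX (tk s')) y = fmap_ff (pX (tk t')) (fmap_ff (mE g') y).
  by rewrite fmap_ff_comp; apply: eq_fmap_ff => w; apply: pevalX.
exact: ht.
Qed.

Definition levelwise_poly (X : striple) : Prop :=
  forall n, exists (V : choiceType) (x : V -> tE (X n)), poly_on (tio (X n)) x.

(** Over a polynomial algebra the augmented cotriple complex is exact. All its stages beyond the
    augmentation are settled by [Om_G_hiso], and [hiso_resolution] passes to the augmentation. *)
Theorem Om_hiso i : levelwise_poly X -> levelwise_poly Y -> tf_hiso (tfOm i) f.
Proof.
move=> pX pY.
have exact_at (Z : striple) : levelwise_poly Z -> forall n, exists e : tmor (Z n) (Gt (Z n)),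
    teq (tcmp e (evalt (Z n))) (tidm (Z n)).
  by move=> pZ n; have [V [x xP]] := pZ n; apply: extra_exists xP.
pose T := tfOm i.
apply/tf_hiso_G0; pose C (Z : striple) m := sschain (sact_sgrp (tf_sact (tfG T m) Z)).
pose D (Z : striple) m : chmap (C Z m.+1) (C Z m) := sschmap (samor_smap (gd_sam T Z m)).
apply: (@hiso_resolution (C X) (C Y) (D X) (D Y)
  (fun m => sschmap (samor_smap (tf_samor (tfG T m) f)))).
- by move=> m n x; apply: gd_nat.
- by move=> n x; have [e eK] := exact_at X pX n; apply: gd_surj eK x.
- by move=> m n x; apply: gd_gd.
- by move=> m n x x0; have [e eK] := exact_at X pX n; apply: (@gd_exact T (X n) e eK m x x0).
- by move=> n x; have [e eK] := exact_at Y pY n; apply: gd_surj eK x.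
- by move=> m n x; apply: gd_gd.
- by move=> m n x x0; have [e eK] := exact_at Y pY n; apply: (@gd_exact T (Y n) e eK m x x0).
- by move=> m; apply: Om_G_hiso.
Qed.
End Torsion.
End CotripleResolution.

(** * Divided powers by reduction from torsion-free rings *)

Section PDFactors.

(** The coefficient (m (N+1))! / (m! (N+1)!^m) of the composition axiom as a product of binomial
    coefficients, which makes its integrality evident. *)
Fixpoint pdc N m : nat := if m is m'.+1 then (pdc N m' * 'C(m' * N.+1 + N, N))%N else 1%N.

Lemma pdc_bin N m : (m.+1 * 'C(m * N.+1 + N, N) = 'C(m * N.+1 + N.+1, N.+1))%N.
Proof.
have e := mul_bin_diag (m * N.+1 + N).+1 N; rewrite /= in e.
apply/eqP; rewrite -(eqn_pmul2l (ltn0Sn N)) addnS -e mulnA; apply/eqP.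
by congr (_ * _)%N; rewrite -addnS -mulSnr mulnC.
Qed.

Lemma pdcE N m : (m`! * N.+1`! ^ m * pdc N m = (m * N.+1)`!)%N.
Proof.
elim: m => [|m IHm]; first by rewrite mul0n.
rewrite [RHS](_ : _ = (m * N.+1 + N.+1)`!); last by rewrite mulSn addnC.
rewrite -(bin_fact (leq_addl (m * N.+1) N.+1)) addnK -IHm -pdc_bin expnS factS /=.
ring.
Qed.

Lemma pdc_divn N m : ((m * N.+1)`! %/ (m`! * N.+1`! ^ m))%N = pdc N m.
Proof. by rewrite -pdcE mulKn // muln_gt0 fact_gt0 expn_gt0 fact_gt0. Qed.
End PDFactors.

Section TorsionFree.
Variables (R Q : comPzRingType) (pi : {rmorphism R -> Q}).
Hypotheses (tR : forall (x : R) n, x *+ n.+1 = 0 -> x = 0)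
  (tQ : forall (x : Q) n, x *+ n.+1 = 0 -> x = 0)
  (nilI : forall x, pi x = 0 -> forall n, exists y, x ^+ n = y *+ n`!).

Definition dpow n (x : R) : R :=
  if pselect (exists y, x ^+ n = y *+ n`!) is left e then sval (cid e) else 0.
Lemma dpowP n x : pi x = 0 -> x ^+ n = dpow n x *+ n`!.
Proof.
move=> x0; rewrite /dpow; case: pselect => [e|]; first exact: svalP (cid e).
by case; apply: nilI.
Qed.
Lemma tf_inj (V : zmodType) (x y : V) n : (forall (x : V) n, x *+ n.+1 = 0 -> x = 0) ->
  (0 < n)%N -> x *+ n = y *+ n -> x = y.
Proof.
move=> tV; case: n => // n _ e; apply/eqP; rewrite -subr_eq0; apply/eqP.
by apply: (tV _ n); rewrite mulrnBl e subrr.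
Qed.
Lemma dpow_uniq n x y : pi x = 0 -> x ^+ n = y *+ n`! -> dpow n x = y.
Proof.
by move=> x0 e; apply: (tf_inj tR (fact_gt0 n)); rewrite -dpowP.
Qed.
Lemma dpow_ideal n x : pi x = 0 -> pi (dpow n.+1 x) = 0.
Proof.
move=> x0; apply: (tf_inj tQ (fact_gt0 n.+1)).
by rewrite -rmorphMn -dpowP // rmorphXn /= x0 exprS mul0r mul0rn.
Qed.

(** Every axiom becomes an identity between ordinary powers after multiplication by factorials,
    which can be cancelled as neither ring has torsion. *)
Lemma dpow_pd : is_pd_structure (fun x => pi x = 0) dpow.
Proof.
split.
- by move=> x x0; apply: dpow_uniq => //; rewrite expr0 mulr1n.
- by move=> x x0; apply: dpow_uniq => //; rewrite expr1 mulr1n.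
- by move=> n x; apply: dpow_ideal.
- move=> n x y x0 y0; apply: dpow_uniq; first by rewrite rmorphD x0 y0 addr0.
  rewrite addrC exprDn -sumrMnl; apply: eq_bigr => k _.
  have kn : (k <= n)%N by rewrite -ltnS.
  rewrite [y ^+ _]dpowP // [x ^+ _]dpowP // mulrnAl mulrnAr -!mulrnA mulrC; congr (_ *+ _).
  rewrite -(bin_fact kn); ring.
- move=> n a x x0; apply: dpow_uniq; first by rewrite rmorphM x0 mulr0.
  by rewrite exprMn [x ^+ n]dpowP // mulrnAr.
- move=> m n x x0; apply: (tf_inj tR (n := (m`! * n`!)%N)); first by rewrite muln_gt0 !fact_gt0.
  transitivity ((dpow m x *+ m`!) * (dpow n x *+ n`!)).
    by rewrite mulrnAl mulrnAr -mulrnA mulnC.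
  rewrite -!dpowP // -exprD dpowP // -mulrnA; congr (_ *+ _).
  by rewrite -(bin_fact (leq_addr n m)) addKn mulnA.
- move=> m n x x0; rewrite pdc_divn; apply: dpow_uniq; first exact: dpow_ideal.
  apply: (tf_inj tR (n := (n.+1`! ^ m)%N)); first by rewrite expn_gt0 fact_gt0.
  transitivity ((dpow n.+1 x *+ n.+1`!) ^+ m).
    by rewrite -mulr_natr natrX -exprMn mulr_natr.
  rewrite -dpowP // -exprM mulnC dpowP // -!mulrnA; congr (_ *+ _).
  by rewrite -pdcE; ring.
Qed.

Section Reduction.
Variables (p : nat) (Rb Qb : comPzRingType) (pib : {rmorphism Rb -> Qb})
  (rho : {rmorphism R -> Rb}) (sig : {rmorphism Q -> Qb}).
Hypotheses (comm : forall x, pib (rho x) = sig (pi x))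
  (pi_surj : forall y, exists x, pi x = y) (rho_surj : forall y, exists x, rho x = y)
  (rho_ker : forall x, rho x = 0 -> exists y, x = y *+ p)
  (sig_ker : forall x, sig x = 0 -> exists y, x = y *+ p) (p0 : p%:R = 0 :> Rb) (p_gt0 : (0 < p)%N).

Definition dpowb n (x : Rb) : Rb :=
  if pselect (exists z, rho z = x /\ pi z = 0) is left e then rho (dpow n (sval (cid e))) else 0.

Lemma dpow_lift x : pib x = 0 -> exists z, rho z = x /\ pi z = 0.
Proof.
case: (rho_surj x) => z <-; rewrite comm => /sig_ker[y].
case: (pi_surj y) => y' <- e; exists (z - y' *+ p); split.
  by rewrite rmorphB rmorphMn -mulr_natr p0 mulr0 subr0.
by rewrite rmorphB rmorphMn e subrr.
Qed.

(** Two lifts in the ideal differ by p v, and v lies in the ideal because Q has no torsion. The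
    divided powers of positive degree of p v are multiples of p, so the addition formula leaves only
    the term of x. *)
Lemma dpowbE n x : pi x = 0 -> dpowb n (rho x) = rho (dpow n x).
Proof.
move=> x0; rewrite /dpowb; case: pselect => [e|]; last by case; exists x.
case: (cid e) => z /= [zx z0].
have [v vE] : exists v, z - x = v *+ p by apply: rho_ker; rewrite rmorphB zx subrr.
have v0 : pi v = 0.
  by apply: (tf_inj tQ p_gt0); rewrite -rmorphMn -vE rmorphB x0 z0 subrr mul0rn.
have -> : z = x + p%:R * v by rewrite mulr_natl -vE addrC subrK.
have pv : pi (p%:R * v) = 0 by rewrite rmorphM v0 mulr0.
rewrite (pd_gD dpow_pd) // big_ord_recr /= subnn (pd_g0 dpow_pd) // mulr1 rmorphD.
rewrite rmorph_sum big1 ?add0r // => k _; rewrite (pd_gZ dpow_pd) //.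
have -> : (n - k = (n - k).-1.+1)%N by have := ltn_ord k; lia.
by rewrite exprS !rmorphM rmorph_nat p0 !(mul0r, mulr0).
Qed.

Lemma dpowb_pd : is_pd_structure (fun x => pib x = 0) dpowb.
Proof.
have G := dpow_pd; split.
- by move=> x /dpow_lift[z [<- z0]]; rewrite dpowbE // (pd_g0 G) // rmorph1.
- by move=> x /dpow_lift[z [<- z0]]; rewrite dpowbE // (pd_g1 G).
- by move=> n x /dpow_lift[z [<- z0]]; rewrite dpowbE // comm (pd_gI G) // rmorph0.
- move=> n x y /dpow_lift[z [<- z0]] /dpow_lift[t [<- t0]].
  rewrite -rmorphD dpowbE ?rmorphD ?z0 ?t0 ?addr0 // (pd_gD G) // rmorph_sum.
  by apply: eq_bigr => k _; rewrite rmorphM !dpowbE.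
- move=> n a x /dpow_lift[z [<- z0]]; have [b <-] := rho_surj a.
  by rewrite -rmorphM !dpowbE ?rmorphM ?z0 ?mulr0 // (pd_gZ G) // rmorphM rmorphXn.
- by move=> m n x /dpow_lift[z [<- z0]]; rewrite !dpowbE // -rmorphM (pd_gM G) // rmorphMn.
- move=> m n x /dpow_lift[z [<- z0]]; rewrite !dpowbE //; last exact: (pd_gI G).
  by rewrite (pd_gC G) // rmorphMn.
Qed.
End Reduction.
End TorsionFree.

Section CoefficientMap.
Variables (K : choiceType).

Lemma fs_support (G : zmodType) (f : finsum K G) :
  exists2 s : seq K, uniq s & f = \sum_(k <- s) fsU (fscoef _ k f) k.
Proof.
have [s us sf] : exists2 s : seq K, uniq s & forall k, k \notin s -> fscoef _ k f = 0.
  elim/fs_ind: f => [|f g [s us sf] [t ut tg]|a k].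
  - by exists [::] => // k _; rewrite raddf0.
  - exists (undup (s ++ t)); first exact: undup_uniq.
    move=> k; rewrite mem_undup mem_cat negb_or => /andP[ks kt].
    by rewrite raddfD /= sf // tg // addr0.
  - by exists [:: k] => // k'; rewrite inE fscoefU => /negbTE ->.
exists s => //; apply: fs_eq => k; rewrite raddf_sum /=.
have [ks|ks] := boolP (k \in s).
  rewrite (bigD1_seq k) //= fscoefU eqxx big1 ?addr0 // => j jk.
  by rewrite fscoefU eq_sym (negbTE jk).
rewrite sf // big_seq big1 // => j js; rewrite fscoefU.
by case: eqP => // e; rewrite -e (negbTE ks) in js.
Qed.

Section Map.
Variables (G G' : zmodType) (F : {additive finsum K G -> finsum K G'}) (a : {additive G -> G'}).
Hypothesis FU : forall x k, F (fsU x k) = fsU (a x) k.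
Lemma fscoef_map k f : fscoef _ k (F f) = a (fscoef _ k f).
Proof.
apply: (fs_ext (f := fscoef _ k \o F) (g := a \o fscoef _ k)) => x j /=.
by rewrite FU !fscoefU; case: ifP => // _; rewrite raddf0.
Qed.
Lemma fs_map_surj : (forall y, exists x, a x = y) -> forall g, exists f, F f = g.
Proof.
move=> as_; apply: fs_ind; first by exists 0; rewrite raddf0.
  by move=> x y [u <-] [v <-]; exists (u + v); rewrite raddfD.
by move=> y k; have [x <-] := as_ y; exists (fsU x k); rewrite FU.
Qed.
Lemma fs_map_ker (P : finsum K G -> Prop) : P 0 -> (forall x y, P x -> P y -> P (x + y)) ->
  (forall x k, a x = 0 -> P (fsU x k)) -> forall f, F f = 0 -> P f.
Proof.
move=> P0 PD PU f f0; have [s _ ->] := fs_support f.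
by apply: big_ind => // k _; apply: PU; rewrite -fscoef_map f0 raddf0.
Qed.
End Map.

Lemma fs_torsion_free (G : zmodType) : (forall (x : G) n, x *+ n.+1 = 0 -> x = 0) ->
  forall (f : finsum K G) n, f *+ n.+1 = 0 -> f = 0.
Proof.
move=> tG f n f0; apply: fs_eq => k; rewrite raddf0; apply: (tG _ n).
by rewrite -raddfMn f0 raddf0.
Qed.
End CoefficientMap.

Section DPMap.
Variables (X : choiceType) (d : pred X) (R S : comPzRingType) (al : {rmorphism R -> S}).
Fact dmap0 s : dmon d S (kexp s 0) = 1. Proof. by []. Qed.
Definition dmap : {rmorphism dpoly d R -> dpoly d S} :=
  dev (dpolyC d S \o al) (u := fun s n => dmon d S (kexp s n)) dmap0
    (fun s a b => dmon_kexp d S s a b).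
Lemma dmapU a m : dmap (fsU a m : dpoly d R) = fsU (al a) m.
Proof. by rewrite [LHS]devU -dmon_prod -dpolyCM. Qed.
End DPMap.

Lemma dmapC (X : choiceType) (d : pred X) (R S : comPzRingType) (al : {rmorphism R -> S}) a :
  dmap d al (dpolyC d R a) = dpolyC d S (al a).
Proof. exact: dmapU. Qed.
Lemma dmapX (X : choiceType) (R S : comPzRingType) (al : {rmorphism R -> S}) (s : X) n :
  dmap xpred0 al (pX R s ^+ n) = pX S s ^+ n.
Proof. by rewrite rmorphXn; congr (_ ^+ n); rewrite [LHS]dmapU rmorph1. Qed.

Section Step.
Variables (X Y : choiceType).
Let Z : choiceType := (X + Y)%type.
Definition isY (z : Z) : bool := if z is inr _ then true else false.
Local Notation dp R := (@dpoly Z isY R).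

Section Projection.
Variables (R Q : comPzRingType) (al : {rmorphism R -> Q}).
Definition proj_fam (z : Z) n : mpoly X Q :=
  match z with inl s => pX Q s ^+ n | inr _ => (n == 0%N)%:R end.
Fact proj0 z : proj_fam z 0 = 1. Proof. by case: z. Qed.
Fact projD z a b : proj_fam z a * proj_fam z b = proj_fam z (a + b)%N *+ mcoc1 isY z a b.
Proof.
case: z => z; first by rewrite /mcoc1 /= exprD.
rewrite /proj_fam /mcoc1 /=; case: a b => [|a] [|b]; rewrite ?mul0r ?mulr0 ?mul0rn //=.
by rewrite mulr1 binn.
Qed.
Definition proj : {rmorphism dp R -> mpoly X Q} := dev (dpolyC xpred0 Q \o al) proj0 projD.
Lemma projU a m : proj (fsU a m : dp R) = dpolyC xpred0 Q (al a) * mprod proj_fam m.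
Proof. exact: devU. Qed.

Definition incl : {rmorphism mpoly X R -> dp R} :=
  peval (dpolyC isY R) (fun s => dmon isY R (ucm (inl s : Z))).

Lemma inclX s n : incl (pX R s ^+ n) = dmon isY R (ucm (inl s : Z)) ^+ n.
Proof. by rewrite rmorphXn; congr (_ ^+ n); apply: pevalX. Qed.

Lemma dmonX s n : dmon isY R (ucm (inl s : Z)) ^+ n = dmon isY R (kexp (inl s : Z) n).
Proof.
elim: n => [|n IHn]; first by [].
have := dmon_kexp isY R (inl s : Z) 1 n; rewrite mulr1n exprS IHn => <-.
by congr (_ * _); congr dmon; rewrite /kexp /= mulm1.
Qed.
End Projection.

Lemma mprod_proj0 (Q : comPzRingType) (m : {cmonom Z}) (y : Y) : (0 < m (inr y : Z))%N -> mprod (proj_fam Q) m = 0.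
Proof.
move=> my; rewrite /mprod (bigD1_seq (inr y : Z)) ?fset_uniq //=.
  by rewrite (negbTE (lt0n_neq0 my)) mul0r.
by rewrite -cmE_neq0 -lt0n.
Qed.

(** An induction principle for the kernel. Modulo the positive divided powers an element comes from
    R[X], and an element of R[X] with zero image in Q[X] has its coefficients in the kernel of
    [al]. *)
Lemma proj_ker (R Q : comPzRingType) (al : {rmorphism R -> Q}) (P : dp R -> Prop) :
  (forall f g, P f -> P g -> P (f + g)) -> (forall f g, P f -> P (f * g)) ->
  (forall a, al a = 0 -> P (dpolyC isY R a)) ->
  (forall y n, P (dmon isY R (kexp (inr y : Z) n.+1))) ->
  forall f, proj al f = 0 -> P f.
Proof.
move=> PD PM PC PY f f0; have P0 : P 0 by rewrite -(rmorph0 (dpolyC isY R)); apply: PC; rewrite rmorph0.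
pose q : {rmorphism dp R -> mpoly X R} := proj (idfun : {rmorphism R -> R}).
have qP g : P (g - incl R (q g)).
  elim/fs_ind: g => [|g h hg hh|a m].
  - by rewrite (rmorph0 q) (rmorph0 (incl R)) subr0.
  - by rewrite (rmorphD q) (rmorphD (incl R)) opprD addrACA; apply: (PD).
  have [[y my]|ny] := pselect (exists y : Y, (0 < m (inr y : Z))%N).
    rewrite [q _]projU (mprod_proj0 R my) mulr0 (rmorph0 (incl R)) subr0 -dpolyCM mulrC.
    rewrite dmon_prod /mprod (bigD1_seq (inr y : Z)) ?fset_uniq //=; last first.
      by rewrite -cmE_neq0 -lt0n.
    by apply/PM/PM; case: (m (inr y)) my.
  suff -> : incl R (q (fsU a m)) = fsU a m by rewrite subrr.
  rewrite [q _]projU rmorphM pevalC -dpolyCM; congr (_ * _).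
  rewrite dmon_prod rmorph_mprod; apply: eq_bigr => -[s|y] _ /=.
    by rewrite inclX dmonX.
  have -> : m (inr y) = 0%N by apply/eqP; rewrite -leqn0 leqNgt; apply/negP => h; apply: ny; exists y.
  by rewrite (rmorph1 (incl R)).
have e : dmap xpred0 al (q f) = 0.
  rewrite -[RHS]f0; move: {f0} f.
  apply: (fs_ext (f := dmap xpred0 al \o q) (g := proj al)) => a m.
  rewrite [RHS]projU -[LHS]/(dmap xpred0 al (q (fsU a m))) [q _]projU rmorphM; congr (_ * _).
    exact: dmapC.
  rewrite rmorph_mprod; apply: eq_bigr => -[s|y] _; first exact: dmapX.
  exact: (rmorph_nat (dmap xpred0 _)).
rewrite -[f](subrK (incl R (q f))); apply: (PD) => //.
apply: (fs_map_ker (F := dmap xpred0 al) (a := al) (dmapU xpred0 al)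
  (P := fun g => P (incl R g))) e.
- by rewrite (rmorph0 (incl R)).
- by move=> g h hg hh; rewrite (rmorphD (incl R)); apply: PD.
- move=> a m a0; rewrite [incl R _]devU; apply: PM; exact: PC.
Qed.

Lemma proj_surj (R Q : comPzRingType) (al : {rmorphism R -> Q}) :
  (forall y, exists x, al x = y) -> forall y, exists x, proj al x = y.
Proof.
move=> as_ y; have [f <-] := fs_map_surj (dmapU xpred0 al) as_ y.
exists (incl R f); move: f; apply: (fs_ext (f := proj al \o incl R) (g := dmap xpred0 al)) => a m.
rewrite [RHS]dmapU -[LHS]/(proj al (incl R _)) [incl R _]devU rmorphM; rewrite [proj al _]projU mprod1 mulr1 -dpolyCM.
congr (_ * _); rewrite dmon_prod rmorph_mprod; apply: eq_bigr => s _.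
by rewrite rmorphXn dmon_kexp1; congr (_ ^+ _); rewrite [LHS]projU rmorph1 mul1r mprod_ucm.
Qed.

Lemma dmon_kexp_exp (R : comPzRingType) (y : Y) N n :
  dmon isY R (kexp (inr y : Z) N.+1) ^+ n =
  dmon isY R (kexp (inr y : Z) (n * N.+1)) *+ pdc N n *+ n`!.
Proof.
elim: n => [|n IHn]; first by rewrite expr0.
rewrite exprSr IHn mulrnAl mulrnAl dmon_kexp /mcoc1 /= [(n * N.+1 + _)%N]addnC -mulSn -!mulrnA.
congr (_ *+ _); have -> : 'C(n.+1 * N.+1, n * N.+1) = (n.+1 * 'C(n * N.+1 + N, N))%N.
  rewrite pdc_bin mulSn addnC -[LHS]bin_sub ?leq_addr //.
  by rewrite addKn.
by rewrite factS /=; ring.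
Qed.

(** The elements whose n-th powers are divisible by n! for all n are stable under sums and
    multiples, by the binomial formula. Hence the generators of [proj_ker] suffice. *)
Lemma proj_nil (R Q : comPzRingType) (al : {rmorphism R -> Q}) :
  (forall x, al x = 0 -> forall n, exists y, x ^+ n = y *+ n`!) ->
  forall f, proj al f = 0 -> forall n, exists g, f ^+ n = g *+ n`!.
Proof.
move=> nilI; apply: (proj_ker (P := fun f => forall n, exists g, f ^+ n = g *+ n`!)).
- move=> f g /choice[f' fE] /choice[g' gE] n.
  exists (\sum_(i < n.+1) f' (n - i)%N * g' i); rewrite exprDn -sumrMnl.
  apply: eq_bigr => i _; have il : (i <= n)%N by rewrite -ltnS.
  rewrite fE gE mulrnAl mulrnAr -!mulrnA; congr (_ *+ _).
  by rewrite -(bin_fact il); ring.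
- by move=> f g /[swap] n /(_ n)[h hE]; exists (h * g ^+ n); rewrite exprMn hE mulrnAl.
- move=> a a0 n; have [b e] := nilI a a0 n.
  by exists (dpolyC isY R b); rewrite -rmorphXn e rmorphMn.
- by move=> y N n; exists (dmon isY R (kexp (inr y : Z) (n * N.+1)) *+ pdc N n); apply: dmon_kexp_exp.
Qed.
End Step.

(** A PD-pair over F_p, [lpib], together with a torsion-free lift [lpi] whose ideal has divided
    powers. Z over F_p is an example, and [liftStep] shows that adjoining free variables of both
    kinds preserves the structure. *)
Record pdLift (p : nat) := PDLift {
  lR : comPzRingType; lQ : comPzRingType; lRb : comPzRingType; lQb : comPzRingType;
  lpi : {rmorphism lR -> lQ}; lpib : {rmorphism lRb -> lQb};
  lrho : {rmorphism lR -> lRb}; lsig : {rmorphism lQ -> lQb};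
  lcomm : forall x, lpib (lrho x) = lsig (lpi x);
  ltR : forall (x : lR) n, x *+ n.+1 = 0 -> x = 0;
  ltQ : forall (x : lQ) n, x *+ n.+1 = 0 -> x = 0;
  lnil : forall x, lpi x = 0 -> forall n, exists y, x ^+ n = y *+ n`!;
  lpi_surj : forall y, exists x, lpi x = y;
  lrho_surj : forall y, exists x, lrho x = y;
  lsig_surj : forall y, exists x, lsig x = y;
  lrho_ker : forall x, lrho x = 0 -> exists y, x = y *+ p;
  lsig_ker : forall x, lsig x = 0 -> exists y, x = y *+ p;
  lchar : p%:R = 0 :> lRb }.

Section LiftPair.
Variables (p : nat) (p_gt0 : (0 < p)%N) (D : pdLift p).
Lemma lpib_surj y : exists x, lpib D x = y.
Proof.
by have [z <-] := lsig_surj y; have [x <-] := lpi_surj z; exists (lrho D x); rewrite lcomm.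
Qed.
Definition liftPair : pdPair p :=
  PDPair lpib_surj (lchar D) (dpowb_pd (@ltR p D) (@ltQ p D) (@lnil p D) (@lcomm p D)
    (@lpi_surj p D) (@lrho_surj p D) (@lrho_ker p D) (@lsig_ker p D) (lchar D) p_gt0).
Lemma liftPair_gamma n x : lpi D x = 0 ->
  pd_gamma liftPair n (lrho D x) = lrho D (dpow n x).
Proof. exact: (dpowbE (@ltR p D) (@ltQ p D) (@lnil p D) (@lrho_ker p D) (lchar D) p_gt0). Qed.
End LiftPair.

Section LiftStep.
Variables (p : nat) (D : pdLift p) (X Y : choiceType).
Let Z : choiceType := (X + Y)%type.
Local Notation dp R := (@dpoly Z (@isY X Y) R).

Fact step_comm x : @proj X Y _ _ (lpib D) (dmap (@isY X Y) (lrho D) x) =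
  dmap xpred0 (lsig D) (@proj X Y _ _ (lpi D) x).
Proof.
move: x; apply: (fs_ext (f := @proj X Y _ _ (lpib D) \o dmap (@isY X Y) (lrho D))
  (g := dmap xpred0 (lsig D) \o @proj X Y _ _ (lpi D))) => a m.
rewrite -[LHS]/(@proj X Y _ _ _ (dmap _ _ _)) -[RHS]/(dmap _ _ (@proj X Y _ _ _ _)) [dmap _ _ (fsU _ _)]dmapU !projU rmorphM.
congr (_ * _).
  by rewrite [LHS]/= [in LHS]lcomm; apply/esym; apply: dmapC.
rewrite rmorph_mprod; apply: eq_bigr => -[s|y] _; first exact/esym/dmapX.
exact/esym/(rmorph_nat (dmap xpred0 _)).
Qed.
Fact step_ker (V : choiceType) (d : pred V) (R S : comPzRingType) (al : {rmorphism R -> S}) :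
  (forall x, al x = 0 -> exists y, x = y *+ p) ->
  forall x : dpoly d R, dmap d al x = 0 -> exists y, x = y *+ p.
Proof.
move=> ak; apply: (fs_map_ker (dmapU d al)).
- by exists 0; rewrite mul0rn.
- by move=> x y [u ->] [v ->]; exists (u + v); rewrite mulrnDl.
- by move=> x k /ak[y ->]; exists (fsU y k); rewrite fsUMn.
Qed.
Definition liftStep : pdLift p.
Proof.
apply: (@PDLift p (dp (lR D)) (mpoly X (lQ D)) (dp (lRb D)) (mpoly X (lQb D))
  (@proj X Y _ _ (lpi D)) (@proj X Y _ _ (lpib D)) (dmap (@isY X Y) (lrho D)) (dmap xpred0 (lsig D)) step_comm).
- exact: fs_torsion_free (@ltR p D).
- exact: fs_torsion_free (@ltQ p D).
- exact: proj_nil (@lnil p D).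
- exact: proj_surj (@lpi_surj p D).
- exact: fs_map_surj (dmapU _ _) (@lrho_surj p D).
- exact: fs_map_surj (dmapU _ _) (@lsig_surj p D).
- exact: step_ker (@lrho_ker p D).
- exact: step_ker (@lsig_ker p D).
- by rewrite -(rmorph_nat (dpolyC (@isY X Y) (lRb D))) lchar rmorph0.
Defined.
End LiftStep.

Lemma kexp1 (X : choiceType) (s : X) : kexp s 1 = ucm s.
Proof. by rewrite /kexp /= mulm1. Qed.

(** * Explicit free PD-pairs and their monomial bases *)

Section PDFreeModels.
Variable p : nat.

Lemma pd_gamma0 (W : pdPair p) n : pd_gamma W n 0 = (n == 0%N)%:R.
Proof.
have G := pd_gammaP W; case: n => [|n]; first by rewrite (pd_g0 G) ?rmorph0.
by rewrite -(mul0r 0) (pd_gZ G) ?rmorph0 // exprS !mul0r.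
Qed.

Fact pdcomp_pi (A B C : pdPair p) (f : pdMor A B) (g : pdMor B C) x :
  (pm_quo g \o pm_quo f) (pd_pi A x) = pd_pi C ((pm_ring g \o pm_ring f) x).
Proof. by rewrite /= !pm_pi. Qed.
Fact pdcomp_gamma (A B C : pdPair p) (f : pdMor A B) (g : pdMor B C) n x : pd_pi A x = 0 ->
  (pm_ring g \o pm_ring f) (pd_gamma A n x) = pd_gamma C n ((pm_ring g \o pm_ring f) x).
Proof. by move=> x0; rewrite /= !pm_gamma // -pm_pi x0 rmorph0. Qed.
Definition pdcomp (A B C : pdPair p) (f : pdMor A B) (g : pdMor B C) : pdMor A C :=
  PDMor (pdcomp_pi f g) (@pdcomp_gamma A B C f g).

Definition pd_free_on (A B : pdPair p) (f : pdMor A B) (X Y : Type)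
    (x : X -> pd_ring B) (y : Y -> pd_ring B) : Prop :=
  (forall s, pd_pi B (y s) = 0) /\
  forall (W : pdPair p) (g : pdMor A W) (x' : X -> pd_ring W) (y' : Y -> pd_ring W),
    (forall s, pd_pi W (y' s) = 0) ->
    exists2 h : pdMor B W,
      [/\ forall a, h (f a) = g a, forall s, h (x s) = x' s & forall s, h (y s) = y' s] &
      forall h' : pdMor B W, (forall a, h' (f a) = g a) -> (forall s, h' (x s) = x' s) ->
        (forall s, h' (y s) = y' s) -> h' =1 h.

Lemma pd_free_ext (A B : pdPair p) (f : pdMor A B) X Y (x : X -> pd_ring B) (y : Y -> pd_ring B)
    (W : pdPair p) (h h' : pdMor B W) : pd_free_on f x y ->
  (forall a, h (f a) = h' (f a)) -> (forall s, h (x s) = h' (x s)) ->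
  (forall s, h (y s) = h' (y s)) -> h =1 h'.
Proof.
move=> [y0 U] ea ex ey.
have [|k _ ku] := U W (pdcomp f h') (fun s => h' (x s)) (fun s => h' (y s)).
  by move=> s; rewrite -pm_pi y0 rmorph0.
by move=> b; rewrite (ku h) // -(ku h').
Qed.

Section Step.
Variables (p_gt0 : (0 < p)%N) (D : pdLift p) (X Y : choiceType).
Let Z : choiceType := (X + Y)%type.
Local Notation iY := (@isY X Y).
Local Notation M := (liftPair p_gt0 D).
Local Notation M' := (liftPair p_gt0 (liftStep D X Y)).

Fact stepMor_pi x : dpolyC xpred0 (lQb D) (pd_pi M x) = pd_pi M' (dpolyC iY (lRb D) x).
Proof. by rewrite [RHS]projU mprod1 mulr1. Qed.
Fact stepMor_gamma n x : pd_pi M x = 0 ->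
  dpolyC iY (lRb D) (pd_gamma M n x) = pd_gamma M' n (dpolyC iY (lRb D) x).
Proof.
move=> /(dpow_lift (@lcomm p D) (@lpi_surj p D) (@lrho_surj p D) (@lsig_ker p D) (lchar D)).
case=> z [<- z0]; rewrite [pd_gamma M _ _]liftPair_gamma //.
rewrite -[in RHS](dmapC iY (lrho D)) [RHS](@liftPair_gamma p p_gt0 (liftStep D X Y)); last first.
  by rewrite [LHS]projU /= z0 (rmorph0 (dpolyC xpred0 (lQ D))) mul0r.
rewrite -[LHS](dmapC iY (lrho D)); congr (dmap _ _ _); apply/esym.
apply: (dpow_uniq (@ltR p (liftStep D X Y)) (@lnil p (liftStep D X Y))).
  by rewrite [LHS]projU /= z0 (rmorph0 (dpolyC xpred0 (lQ D))) mul0r.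
by rewrite -rmorphXn [in LHS](dpowP (@lnil p D)) // rmorphMn.
Qed.
Definition stepMor : pdMor M M' :=
  @PDMor p M M' (dpolyC iY (lRb D)) (dpolyC xpred0 (lQb D)) stepMor_pi stepMor_gamma.

Definition modX (s : X) : pd_ring M' := dmon iY (lRb D) (ucm (inl s : Z)).
Definition modY (s : Y) : pd_ring M' := dmon iY (lRb D) (ucm (inr s : Z)).

Lemma modY_gamma n s : pd_gamma M' n (modY s) = dmon iY (lRb D) (kexp (inr s : Z) n).
Proof.
have e m : dmon iY (lRb D) m = dmap iY (lrho D) (dmon iY (lR D) m).
  by rewrite [RHS]dmapU rmorph1.
have p0 : @proj X Y _ _ (lpi D) (dmon iY (lR D) (ucm (inr s : Z))) = 0.
  by rewrite [LHS]projU (mprod_proj0 (lQ D) (y := s)) ?mulr0 // cmUU.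
rewrite /modY e [LHS](@liftPair_gamma p p_gt0 (liftStep D X Y)) // e; congr (dmap _ _ _).
apply: (dpow_uniq (@ltR p (liftStep D X Y)) (@lnil p (liftStep D X Y))) => //.
rewrite -[ucm _]kexp1 [LHS]dmon_kexp_exp muln1; congr (_ *+ _).
have -> : pdc 0 n = 1%N by elim: n => //= n ->; rewrite bin0.
by rewrite mulr1n.
Qed.
Lemma modY_pi s : pd_pi M' (modY s) = 0.
Proof. by rewrite [LHS]projU (mprod_proj0 (lQb D) (y := s)) ?mulr0 // cmUU. Qed.

Section Universal.
Variables (W : pdPair p) (g : pdMor M W) (x' : X -> pd_ring W) (y' : Y -> pd_ring W).
Hypothesis y'0 : forall s, pd_pi W (y' s) = 0.
Definition pd_fam (z : Z) n : pd_ring W :=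
  match z with inl s => x' s ^+ n | inr s => pd_gamma W n (y' s) end.
Fact pd_fam0 z : pd_fam z 0 = 1.
Proof. by case: z => //= s; rewrite (pd_g0 (pd_gammaP W)). Qed.
Fact pd_famD z a b : pd_fam z a * pd_fam z b = pd_fam z (a + b)%N *+ mcoc1 iY z a b.
Proof.
case: z => s; rewrite /mcoc1 /=; first by rewrite exprD.
exact: (pd_gM (pd_gammaP W)).
Qed.
Definition model_ev : {rmorphism pd_ring M' -> pd_ring W} := dev (pm_ring g) pd_fam0 pd_famD.
Definition model_evq : {rmorphism pd_quo M' -> pd_quo W} :=
  peval (pm_quo g) (fun s => pd_pi W (x' s)).
Lemma model_evU a m : model_ev (fsU a m : dpoly iY (lRb D)) = g a * mprod pd_fam m.
Proof. exact: devU. Qed.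
Lemma model_evC a : model_ev (dpolyC iY (lRb D) a) = g a.
Proof. by rewrite [LHS]model_evU mprod1 mulr1. Qed.
Lemma model_ev_kexp z n : model_ev (dmon iY (lRb D) (kexp z n)) = pd_fam z n.
Proof.
rewrite [LHS]model_evU rmorph1 mul1r /mprod.
have [n0|n0] := eqVneq n 0%N.
  by rewrite n0 pd_fam0 big1 // => s _; rewrite kexpE if_same pd_fam0.
rewrite (bigD1_seq z) ?fset_uniq //=; last by rewrite -cmE_neq0 kexpE eqxx.
rewrite kexpE eqxx big1 ?mulr1 // => s sz.
by rewrite kexpE eq_sym (negbTE sz) pd_fam0.
Qed.

Fact model_ev_pi f : model_evq (pd_pi M' f) = pd_pi W (model_ev f).
Proof.
move: f; apply: (fs_ext (f := model_evq \o pd_pi M') (g := pd_pi W \o model_ev)) => a m.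
rewrite -[LHS]/(model_evq (pd_pi M' _)) -[RHS]/(pd_pi W (model_ev _)).
rewrite model_evU [pd_pi M' _]projU !rmorphM pevalC; congr (_ * _); first exact: (pm_pi g a).
rewrite !rmorph_mprod; apply: eq_bigr => -[s|s] _.
  by rewrite -[proj_fam _ _ _]/(pX _ s ^+ _) !rmorphXn; congr (_ ^+ _); apply: pevalX.
rewrite -[proj_fam _ _ _]/(_%:R) (rmorph_nat model_evq) -[pd_fam _ _]/(pd_gamma W _ _).
case: (m (inr s)) => [|n]; first by rewrite (pd_g0 (pd_gammaP W)) // rmorph1.
by rewrite (pd_gI (pd_gammaP W)).
Qed.

(** The elements of the ideal on which evaluation commutes with all divided powers are stable under
    sums and multiples. By [proj_ker] there remain the ideal of the base and the divided powers of
    the variables in Y, for which the composition axiom holds on both sides. *)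
Fact model_ev_gamma n f : pd_pi M' f = 0 -> model_ev (pd_gamma M' n f) = pd_gamma W n (model_ev f).
Proof.
have G := pd_gammaP M'; have GW := pd_gammaP W.
pose P f := pd_pi M' f = 0 /\ forall n, model_ev (pd_gamma M' n f) = pd_gamma W n (model_ev f).
have ev0 h : pd_pi M' h = 0 -> pd_pi W (model_ev h) = 0.
  by move=> h0; rewrite -model_ev_pi h0 rmorph0.
suff H h : pd_pi M' h = 0 -> P h by move=> /H[].
apply: (proj_ker (P := P)) => {h n f} [f h [f0 fg] [h0 hg]|f h [f0 fg]|a a0|s N].
- split=> [|n]; first by rewrite rmorphD f0 h0 addr0.
  rewrite (pd_gD G) // rmorphD (pd_gD GW) ?ev0 // rmorph_sum; apply: eq_bigr => k _.
  by rewrite rmorphM fg hg.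
- split=> [|n]; first by rewrite rmorphM f0 mul0r.
  by rewrite mulrC (pd_gZ G) // !rmorphM rmorphXn fg (pd_gZ GW) // ev0.
- split=> [|n]; first by rewrite -[LHS]stepMor_pi [pd_pi M a]a0 rmorph0.
  by rewrite -stepMor_gamma // !model_evC pm_gamma.
- rewrite -modY_gamma; split=> [|n]; first by rewrite (pd_gI G) // modY_pi.
  rewrite (pd_gC G) ?modY_pi // rmorphMn !modY_gamma !model_ev_kexp /=.
  by rewrite (pd_gC GW).
Qed.
Definition model_mor : pdMor M' W := @PDMor p M' W model_ev model_evq model_ev_pi model_ev_gamma.
End Universal.

Lemma model_free : pd_free_on stepMor modX modY.
Proof.
split; first exact: modY_pi.
move=> W g x' y' y'0; exists (model_mor g x' y'0).
  split=> [a|s|s]; first exact: model_evC.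
    rewrite -[modX s]/(dmon iY (lRb D) (ucm (inl s : Z))) -kexp1.
    exact: etrans (model_ev_kexp g x' y'0 (inl s) 1) (expr1 _).
  rewrite -[modY s]/(dmon iY (lRb D) (ucm (inr s : Z))) -kexp1.
  exact: etrans (model_ev_kexp g x' y'0 (inr s) 1) (pd_g1 (pd_gammaP W) (y'0 s)).
move=> h' ha hx hy; apply: dev_unique => // m.
rewrite [dmon _ _ _]dmon_prod (rmorph_mprod h'); apply: eq_bigr => -[s|s] _ /=.
  by rewrite -dmonX rmorphXn -hx.
by rewrite -modY_gamma pm_gamma ?modY_pi // hy.
Qed.
End Step.

Section Base.
Hypothesis p_pr : prime p.

Section Init.
Variables (R : comPzRingType) (Rp : p%:R = 0 :> R).
Definition fp_fun (x : 'F_p) : R := (x : nat)%:R.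
Lemma modn_natr n : (n %% p)%:R = n%:R :> R.
Proof. by rewrite [in RHS](divn_eq n p) natrD natrM Rp mulr0 add0r. Qed.
Fact fp_funD : {morph fp_fun : x y / x + y}.
Proof.
move=> x y; rewrite /fp_fun -natrD -[RHS]modn_natr; congr ((_ %% _)%N)%:R; exact: Fp_cast.
Qed.
Fact fp_funM : {morph fp_fun : x y / x * y}.
Proof.
move=> x y; rewrite /fp_fun -natrM -[RHS]modn_natr; congr ((_ %% _)%N)%:R; exact: Fp_cast.
Qed.
Fact fp_fun1 : fp_fun 1 = 1.
Proof.
by rewrite /fp_fun -[RHS](modn_natr 1); congr ((_ %% _)%N)%:R; exact: Fp_cast.
Qed.
Definition fp_in : {rmorphism 'F_p -> R} := mkrm fp_funD fp_funM fp_fun1.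
Lemma fp_in_unique (h : {rmorphism 'F_p -> R}) x : h x = fp_in x.
Proof. by rewrite -[x in LHS]natr_Zp rmorph_nat. Qed.
End Init.

Fact fp_base_ker (x : int) : (intr x : 'F_p) = 0 -> exists y, x = y *+ p.
Proof.
move=> x0; suff /dvdzP[y ->] : (p %| x)%Z by exists y; rewrite -mulr_natr natz.
have H (n : nat) : n%:R = 0 :> 'F_p -> (p %| n)%N.
  by move=> n0; have := pchar_Fp p_pr => /andP[_ _]; rewrite (dvdn_pcharf (pchar_Fp p_pr)) n0.
case: x x0 => n n0; first exact: H.
apply: (H n.+1); move: n0; rewrite NegzE rmorphN => /eqP; rewrite oppr_eq0 => /eqP.
by [].
Qed.
Definition baseLift : pdLift p.
Proof.
apply: (@PDLift p int int 'F_p 'F_p idfun idfun intr intr (fun _ => erefl)).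
- by move=> x n; lia.
- by move=> x n; lia.
- by move=> x /= -> [|n]; [exists 1|exists 0]; rewrite // exprS !mul0r mul0rn.
- by move=> y; exists y.
- by move=> y; exists (y : nat)%:Z; rewrite -[RHS]natr_Zp.
- by move=> y; exists (y : nat)%:Z; rewrite -[RHS]natr_Zp.
- exact: fp_base_ker.
- exact: fp_base_ker.
- exact: pchar_Fp_0.
Defined.
End Base.
End PDFreeModels.

Section BaseMor.
Variables (p : nat) (p_pr : prime p).
Let p_gt0 : (0 < p)%N := prime_gt0 p_pr.
Local Notation M0 := (liftPair p_gt0 (baseLift p_pr)).

Lemma quo_char (W : pdPair p) : p%:R = 0 :> pd_quo W.
Proof. by rewrite -(rmorph_nat (pd_pi W)) pd_char rmorph0. Qed.
Fact base_pi (W : pdPair p) x : fp_in p_pr (quo_char W) (pd_pi M0 x) = pd_pi W (fp_in p_pr (pd_char W) x).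
Proof. exact/esym/(fp_in_unique p_pr (quo_char W) (pd_pi W \o fp_in p_pr (pd_char W))). Qed.
Fact base_gamma (W : pdPair p) n x : pd_pi M0 x = 0 ->
  fp_in p_pr (pd_char W) (pd_gamma M0 n x) = pd_gamma W n (fp_in p_pr (pd_char W) x).
Proof.
move=> x0; have -> : x = 0 by [].
by rewrite pd_gamma0 (rmorph_nat (fp_in _ _)) (rmorph0 (fp_in _ _)) pd_gamma0.
Qed.
Definition baseMor (W : pdPair p) : pdMor M0 W :=
  @PDMor p M0 W (fp_in p_pr (pd_char W)) (fp_in p_pr (quo_char W)) (base_pi W) (@base_gamma W).
Lemma baseMor_unique (W : pdPair p) (g g' : pdMor M0 W) : g =1 g'.
Proof.
by move=> x; rewrite (fp_in_unique p_pr (pd_char W) g) (fp_in_unique p_pr (pd_char W) g').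
Qed.

Section Compare.
Variables (A B : pdPair p) (f : pdMor A B).
Variables (X Y : choiceType) (x : X -> pd_ring B) (y : Y -> pd_ring B).
Hypotheses (Afree : is_pd_free A) (Bfree : pd_free_on f x y).

Definition gmon (m : {cmonom (X + Y)%type}) : pd_ring B :=
  mprod (fun z n => match z with inl s => x s ^+ n | inr s => pd_gamma B n (y s) end) m.

(** Uniqueness in the universal properties identifies A with one [liftStep] over F_p and B with a
    second step over it; the monomial basis is read off from that model. *)
Lemma pd_free_basis : additive_basis (fun a m => f a * gmon m).
Proof.
case: Afree => [X0 [Y0 [x0 [y0 [y00 AU]]]]].
pose D1 := liftStep (baseLift p_pr) {classic X0} {classic Y0}.
pose M1 := liftPair p_gt0 D1; pose M2 := liftPair p_gt0 (liftStep D1 X Y).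
have F1 := model_free p_gt0 (baseLift p_pr) {classic X0} {classic Y0}.
have F2 := model_free p_gt0 D1 X Y.
pose st := stepMor p_gt0 D1 X Y.
pose st0 := stepMor p_gt0 (baseLift p_pr) {classic X0} {classic Y0}.
have [hA [hAx hAy] _] := AU M1 (modX p_gt0 (baseLift p_pr) {classic Y0} (X := {classic X0}))
  (modY p_gt0 (baseLift p_pr) {classic X0} (Y := {classic Y0})) F1.1.
have [hA' [_ hA'x hA'y] _] := F1.2 A (baseMor A) x0 y0 y00.
have hK a : hA' (hA a) = a.
  have [k _ ku] := AU A x0 y0 y00.
  transitivity (k a); first by apply: (ku (pdcomp hA hA')) => s /=; rewrite ?hAx ?hAy ?hA'x ?hA'y.
  by apply/esym/(ku (pd_id A)).
have hK' a : hA (hA' a) = a.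
  apply: (pd_free_ext (h := pdcomp hA' hA) (h' := pd_id M1) F1) => s.
  - exact: (baseMor_unique (pdcomp st0 (pdcomp hA' hA)) (pdcomp st0 (pd_id M1)) s).
  - by rewrite /= hA'x hAx.
  - by rewrite /= hA'y hAy.
have [v [va vx vy] _] := Bfree.2 M2 (pdcomp hA st) 
  (modX p_gt0 D1 Y (X := X)) (modY p_gt0 D1 X (Y := Y)) F2.1.
have [v' [v'a v'x v'y] _] := F2.2 B (pdcomp hA' f) x y Bfree.1.
have vK b : v' (v b) = b.
  apply: (pd_free_ext (h := pdcomp v v') (h' := pd_id B) Bfree) => s /=.
  - by rewrite va /= v'a /= hK.
  - by rewrite vx v'x.
  - by rewrite vy v'y.
have vK' b : v (v' b) = b.
  apply: (pd_free_ext (h := pdcomp v' v) (h' := pd_id M2) F2) => s /=.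
  - by rewrite v'a /= va /= hK'.
  - by rewrite v'x vx.
  - by rewrite v'y vy.
have v'U a m : v' (fsU a m : dpoly (@isY X Y) (lRb D1)) = f (hA' a) * gmon m.
  rewrite -dpolyCM rmorphM [v' (dpolyC _ _ _)]v'a; congr (_ * _).
  rewrite dmon_prod (rmorph_mprod v'); apply: eq_bigr => -[s|s] _.
    by rewrite -dmonX rmorphXn; congr (_ ^+ _); apply: v'x.
  rewrite -[dmon _ _ _](modY_gamma p_gt0 D1) pm_gamma ?modY_pi //.
  by congr (pd_gamma _ _ _); apply: v'y.
have [gD gl gu] := finsum_additive_basis {cmonom (X + Y)%type} (lRb D1).
split.
- by move=> m a b; rewrite rmorphD mulrDl.
- move=> N t tD.
  have t'D m : {morph (fun a => t (hA' a) m) : a b / a + b}.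
    by move=> a b; rewrite rmorphD tD.
  have [F FE] := gl N (fun a m => t (hA' a) m) t'D.
  have hD : {morph (fun b => F (v b)) : b c / b + c} by move=> b c; rewrite rmorphD raddfD.
  exists (mkadd hD) => a m; rewrite /= /mkadd_of -{1}(hK a) -v'U vK'.
  by rewrite [LHS]FE hK.
- move=> N F F' e b; rewrite -(vK b); move: (v b).
  have hD (G : {additive pd_ring B -> N}) : {morph (fun c : pd_ring M2 => G (v' c)) : b c / b + c}.
    by move=> c c'; rewrite rmorphD raddfD.
  by apply: (gu N (mkadd (hD F)) (mkadd (hD F'))) => a m; rewrite /= /mkadd_of v'U e.
Qed.

(** The universal property of B is tested on the PD-pairs (id_W, 0), with the variables of the ideal
    sent to 0: morphisms into such a pair are ring maps out of the quotient ring. *)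
Lemma pd_free_quo : poly_on (pm_quo f) (fun s => pd_pi B (x s)).
Proof.
move=> W g y'.
have Wp : p%:R = 0 :> W by rewrite -(rmorph_nat g) quo_char rmorph0.
pose T := pd_triv Wp.
have tg (V : pdPair p) (u : {rmorphism pd_quo V -> W}) n b : pd_pi V b = 0 ->
    (u \o pd_pi V) (pd_gamma V n b) = pd_gamma T n ((u \o pd_pi V) b).
  have G := pd_gammaP V; move=> b0; rewrite /= b0 rmorph0.
  case: n => [|[|n]] /=; first by rewrite (pd_g0 G) // !rmorph1.
    by rewrite (pd_g1 G) // b0 rmorph0.
  by rewrite (pd_gI G) // rmorph0.
pose mor (V : pdPair p) (u : {rmorphism pd_quo V -> W}) : pdMor V T :=
  @PDMor p V T (u \o pd_pi V) u (fun _ => erefl) (@tg V u).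
have [h [ha hx hy] hu] := Bfree.2 T (mor A g) y' (fun _ => 0) (fun _ => erefl).
exists (pm_quo h); first split=> [c|s].
- by have [a <-] := pd_surj c; rewrite !pm_pi [LHS]ha.
- by rewrite pm_pi [LHS]hx.
move=> h' h'a h'x b; have [c <-] := pd_surj b; rewrite pm_pi.
apply: (hu (mor B h')) => s /=.
- by rewrite -pm_pi h'a.
- exact: h'x.
- by rewrite Bfree.1 rmorph0.
Qed.
End Compare.
End BaseMor.

(** * PD-derivations and PD-differentials of free PD-pairs *)

Section PDSquareZero.
Variables (p : nat) (B : pdPair p) (N : lmodType (pd_ring B)).
Local Notation W := (sqz N).
Local Notation G := (pd_gammaP B).
Definition sq_pi : {rmorphism W -> pd_quo B} := pd_pi B \o sqz_fst N.
Fact sq_surj y : exists x, sq_pi x = y.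
Proof. by have [b <-] := pd_surj y; exists (b, 0). Qed.
Fact sq_char : p%:R = 0 :> W.
Proof. by rewrite -(rmorph_nat (sqz_in N)) pd_char rmorph0. Qed.
Definition gpred n (b : pd_ring B) : pd_ring B := if n is n'.+1 then pd_gamma B n' b else 0.
(** The addition formula for b + x, with x in N having no divided powers beyond the first, gives
    gamma_n(b) + gamma_(n-1)(b) x. With this structure PD-derivations into N become second
    components of PD-morphisms. *)
Definition sq_gamma n (w : W) : W := (pd_gamma B n w.1, gpred n w.1 *: w.2).
Lemma sqz_eq (u v : W) : u.1 = v.1 -> u.2 = v.2 -> u = v.
Proof. by case: u v => [a b] [c e] /= -> ->. Qed.
Lemma sqz_fstMn (u : W) n : (u *+ n).1 = u.1 *+ n.
Proof. exact: (raddfMn (sqz_fst N)). Qed.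
Lemma sqz_sndMn (u : W) n : (u *+ n).2 = u.2 *+ n.
Proof. by elim: n => // n IHn; rewrite !mulrS -IHn. Qed.
Lemma sqz_fstX (u : W) n : (u ^+ n).1 = u.1 ^+ n.
Proof. exact: (rmorphXn (sqz_fst N)). Qed.
Lemma sqz_sndX (u : W) n : (u ^+ n).2 = (u.1 ^+ n.-1 *+ n) *: u.2.
Proof.
elim: n => [|n IHn]; first by rewrite mulr0n scale0r.
rewrite exprS sqzM /= IHn sqz_fstX scalerA mulrnAr -exprS -scalerDl.
by case: n {IHn} => [|n]; rewrite ?mulr0n ?add0r ?expr0 // -mulrSr.
Qed.
Lemma gamma_mul b n : pd_pi B b = 0 -> b * gpred n b = pd_gamma B n b *+ n.
Proof.
move=> b0; case: n => [|n]; first by rewrite mulr0.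
by rewrite /= -{1}(pd_g1 G b0) (pd_gM G) // add1n bin1.
Qed.
Fact sq_pd : is_pd_structure (fun w => sq_pi w = 0) sq_gamma.
Proof.
split.
- by move=> w w0; apply: sqz_eq; rewrite /= ?scale0r // (pd_g0 G).
- by move=> w w0; apply: sqz_eq; rewrite /= ?(pd_g1 G) ?(pd_g0 G) ?scale1r.
- by move=> n w w0; rewrite /sq_pi /= (pd_gI G).
- move=> n u v u0 v0; apply: sqz_eq.
    have fst_sum (F : 'I_n.+1 -> W) : (\sum_(k < n.+1) F k).1 = \sum_(k < n.+1) (F k).1.
      exact: (raddf_sum (sqz_fst N)).
    by rewrite fst_sum /= (pd_gD G).
  have snd_sum (F : 'I_n.+1 -> W) : (\sum_(k < n.+1) F k).2 = \sum_(k < n.+1) (F k).2.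
    by apply: (big_ind2 (fun (a : W) b => a.2 = b)) => // a b c e <- <-.
  rewrite snd_sum /=; case: n {snd_sum} => [|n].
    by rewrite big_ord1 /= !scale0r !scaler0 addr0.
  rewrite big_split /= big_ord_recr /= subnn scale0r scaler0 addr0.
  rewrite [\sum_(i < n.+2) _]big_ord_recl /= scale0r scaler0 add0r (pd_gD G) // scaler_suml.
  rewrite -big_split /=; apply: eq_bigr => k _.
  have kn : (k <= n)%N by rewrite -ltnS.
  by rewrite subSn // /bump /= add1n subSS add0n !scalerA scalerDr addrC [_ * pd_gamma B k _]mulrC.
- move=> n a w w0; apply: sqz_eq; first by rewrite /= sqz_fstX (pd_gZ G).
  rewrite /= sqz_fstX sqz_sndX; case: n => [|n].
    by rewrite /= ?mulr0n !(scale0r, scaler0, addr0).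
  rewrite /= (pd_gZ G) // scalerDr !scalerA; congr (_ *: _ + _ *: _).
    by rewrite exprSr mulrAC.
  by rewrite -mulrA [X in _ * X]mulrC (gamma_mul n.+1) // mulrnAr mulrnAr mulrC.
- move=> m n w w0; apply: sqz_eq; first by rewrite sqz_fstMn /= (pd_gM G).
  rewrite sqz_sndMn /= !scalerA -scalerDl scalerMnl; congr (_ *: _).
  case: m n => [|m] [|n].
  - by rewrite !mulr0 addr0 mul0rn.
  - by rewrite mulr0 addr0 (pd_g0 G) // mul1r bin0 mulr1n.
  - by rewrite mulr0 add0r (pd_g0 G) // mul1r addn0 binn mulr1n.
  rewrite /= !(pd_gM G) // addnS addSn [(n.+1 + m)%N]addnC addnS -mulrnDr.
  have -> : 'C((m + n).+1, n.+1) = 'C((m + n).+1, m).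
    by rewrite -[RHS]bin_sub; [congr 'C(_, _); lia|lia].
  by rewrite addSn addnS [in RHS]binS.
- move=> m n w w0; apply: sqz_eq; first by rewrite sqz_fstMn /= (pd_gC G).
  rewrite sqz_sndMn /= scalerA scalerMnl pdc_divn; congr (_ *: _).
  case: m => [|m]; first by rewrite mul0r mulr1n.
  rewrite [(m.+1 * _)%N]mulSn addSn /= (pd_gC G) // pdc_divn mulrnAl (pd_gM G) // -mulrnA.
  rewrite [(n + _)%N]addnC; congr (_ *+ _); rewrite mulnC; congr (_ * _)%N.
  by rewrite -[LHS]bin_sub ?leq_addr // addKn.
Qed.
Definition sq_pair : pdPair p := PDPair sq_surj sq_char sq_pd.

Section Derivations.
Variables (A : pdPair p) (f : pdMor A B) (X Y : Type) (x : X -> pd_ring B) (y : Y -> pd_ring B).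
Hypothesis Bfree : pd_free_on f x y.

Section Graph.
Variables (D : pd_ring B -> N) (DP : is_pd_derivation f D).
Let DD : {morph D : u v / u + v}. Proof. by case: DP => -[]. Qed.
Let DM u v : D (u * v) = u *: D v + v *: D u. Proof. by case: DP => -[]. Qed.
Definition pd_graph_ring : {rmorphism pd_ring B -> W} := sqz_graph (g := idfun) DD DM.
Fact pd_graph_gamma n b : pd_pi B b = 0 ->
  pd_graph_ring (pd_gamma B n b) = sq_gamma n (pd_graph_ring b).
Proof.
move=> b0; apply: sqz_eq => //=; rewrite /mkrm_of /=.
case: n => [|n] /=; last by case: DP => _; apply.
rewrite (pd_g0 G) // scale0r; have := DM 1 1; rewrite mulr1 !scale1r => e.
by apply: (addIr (D 1)); rewrite -e add0r.
Qed.
Definition pd_graph : pdMor B sq_pair :=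
  @PDMor p B sq_pair pd_graph_ring idfun (fun _ => erefl) pd_graph_gamma.
End Graph.

Lemma pd_derivation_ext (D D' : pd_ring B -> N) : is_pd_derivation f D -> is_pd_derivation f D' ->
  (forall s, D (x s) = D' (x s)) -> (forall s, D (y s) = D' (y s)) -> D =1 D'.
Proof.
move=> DP DP' ex ey b.
have /(_ b)/(congr1 (fun w : W => w.2)) : pd_graph DP =1 pd_graph DP'; last by [].
have [[_ _ D0] _] := DP; have [[_ _ D0'] _] := DP'.
apply: (pd_free_ext Bfree) => s; apply: sqz_eq => //=; rewrite /mkrm_of /= ?ex ?ey //.
by rewrite D0 D0'.
Qed.

Lemma pd_derivation_exists (t : X + Y -> N) : exists D : pd_ring B -> N,
  [/\ is_pd_derivation f D, forall s, D (x s) = t (inl s) & forall s, D (y s) = t (inr s)].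
Proof.
have sg n a : pd_pi A a = 0 -> (sqz_in N \o f) (pd_gamma A n a) = sq_gamma n ((sqz_in N \o f) a).
  move=> a0; apply: sqz_eq; rewrite /= /mkrm_of /=; first exact: pm_gamma.
  by rewrite scaler0.
pose g : pdMor A sq_pair := @PDMor p A sq_pair (sqz_in N \o f) (pm_quo f) (@pm_pi _ _ _ f) sg.
have y'0 s : pd_pi sq_pair ((y s, t (inr s)) : W) = 0 by apply: Bfree.1.
have [h [ha hx hy] _] := Bfree.2 sq_pair g (fun s => (x s, t (inl s)) : W)
  (fun s => (y s, t (inr s)) : W) y'0.
pose fs : pdMor sq_pair B := @PDMor p sq_pair B (sqz_fst N) idfun (fun _ => erefl) (fun _ _ _ => erefl).
have h1 b : (h b).1 = b.
  apply: (pd_free_ext (h := pdcomp h fs) (h' := pd_id B) Bfree) => s /=.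
  - by rewrite ha.
  - by rewrite hx.
  - by rewrite hy.
exists (fun b => (h b).2); split; last 2 first.
- by move=> s; rewrite hx.
- by move=> s; rewrite hy.
split; first split=> [u v|u v|a].
- by rewrite rmorphD.
- by rewrite rmorphM [h u * h v]sqzM /= !h1.
- by rewrite ha.
- move=> n b b0; have := pm_gamma h n.+1 b0; move/(congr1 (fun w : W => w.2)) => /= ->.
  by rewrite h1.
Qed.
End Derivations.
End PDSquareZero.

Lemma pd_differentials_free p (A B : pdPair p) (f : pdMor A B) X Y (x : X -> pd_ring B)
    (y : Y -> pd_ring B) (M : lmodType (pd_ring B)) (D : pd_ring B -> M) : pd_free_on f x y ->
  is_initial_map (@is_pd_derivation p A B f) D ->
  free_on (fun z : X + Y => D (match z with inl s => x s | inr s => y s end)).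
Proof.
move=> Bf [DP Du] N t; have [D' [D'P D'x D'y]] := pd_derivation_exists Bf t.
have [h hD hu] := Du N D' D'P; exists h => [[s|s]|h' h't]; rewrite ?hD //.
apply: hu => b; apply: (pd_derivation_ext (D := h' \o D) Bf) => //.
- case: DP => -[DD DM D0] Dg; split; first split=> [u v|u v|a] /=.
  + by rewrite DD linearD.
  + by rewrite DM linearD !linearZ.
  + by rewrite D0 linear0.
  by move=> n c c0; rewrite /= Dg // linearZ.
- by move=> s; rewrite /= D'x -(h't (inl s)).
- by move=> s; rewrite /= D'y -(h't (inr s)).
Qed.

Fact zaddD (U V : zmodType) : {morph (fun _ : U => 0 : V) : x y / x + y}.
Proof. by move=> x y; rewrite addr0. Qed.
Definition zadd (U V : zmodType) : {additive U -> V} := mkadd (@zaddD U V).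

Lemma alt_datum_lift (A : zmodType) (K X : Type) i (L N : zmodType)
    (g : A -> K -> {ffun 'I_i -> X} -> L) (t : A -> K -> {ffun 'I_i -> X} -> N) :
  alt_datum_universal g -> alt_datum t ->
  {h : {additive L -> N} | forall a k x, h (g a k x) = t a k x}.
Proof. by move=> [_ gl _] td; apply: cid; apply: gl. Qed.

Section Cons.
Variable T : Type.
Definition ff_tl i (t : {ffun 'I_i.+1 -> T}) : {ffun 'I_i -> T} := [ffun k => t (lift ord0 k)].
Lemma ff_cons0 i z (t : {ffun 'I_i -> T}) : ff_cons z t ord0 = z.
Proof. by rewrite ffunE unlift_none. Qed.
Lemma ff_consS i z (t : {ffun 'I_i -> T}) k : ff_cons z t (lift ord0 k) = t k.
Proof. by rewrite ffunE liftK. Qed.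
Lemma ff_tl_cons i z (t : {ffun 'I_i -> T}) : ff_tl (ff_cons z t) = t.
Proof. by apply/ffunP => k; rewrite ffunE ff_consS. Qed.
Lemma ff_cons_eta i (t : {ffun 'I_i.+1 -> T}) : t = ff_cons (t ord0) (ff_tl t).
Proof.
apply/ffunP => k; case: (unliftP ord0 k) => [j|] ->; last by rewrite ff_cons0.
by rewrite ff_consS ffunE.
Qed.
Lemma ff_cons_swap i z k l (t : {ffun 'I_i -> T}) :
  ff_cons z (swap k l t) = swap (lift ord0 k) (lift ord0 l) (ff_cons z t).
Proof.
apply/ffunP => j; rewrite [RHS]ffunE; case: (unliftP ord0 j) => [j'|] ->.
  rewrite ff_consS ffunE -(inj_tperm _ _ _ (@lift_inj _ ord0)) ff_consS //.
by rewrite tpermD ?ff_cons0 // eq_sym neq_lift.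
Qed.
Lemma ff_cons_cons_swap i z z' (t : {ffun 'I_i -> T}) :
  swap ord0 (lift ord0 ord0) (ff_cons z (ff_cons z' t)) = ff_cons z' (ff_cons z t).
Proof.
apply/ffunP => j; rewrite [LHS]ffunE.
case: (unliftP ord0 j) => [j'|] ->; last by rewrite tpermL ff_consS !ff_cons0.
case: (unliftP ord0 j') => [j''|] ->; last by rewrite tpermR ff_consS !ff_cons0.
by rewrite tpermD ?neq_lift ?(inj_eq lift_inj) ?neq_lift // !ff_consS.
Qed.

Variable N : zmodType.
Lemma alternates_consl i (f : {ffun 'I_i.+1 -> T} -> N) z :
  alternates f -> alternates (fun t => f (ff_cons z t)).
Proof.
move=> fa k l kl t; have kl' : lift ord0 k != lift ord0 l by rewrite (inj_eq lift_inj).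
split=> [e|]; first by apply: (fa _ _ kl' _).1; rewrite !ff_consS.
by rewrite ff_cons_swap (fa _ _ kl' _).2.
Qed.

(** The transposition of the first slot with slot l is conjugate, by one that fixes the first slot,
    to its transposition with slot 1; so only the first two slots need a direct check. The slot [o]
    is quantified through its value because it does not exist for i = 0. *)
Lemma alternates_cons i (f : {ffun 'I_i.+1 -> T} -> N) :
  (forall z, alternates (fun t : {ffun 'I_i -> T} => f (ff_cons z t))) ->
  (forall o : 'I_i.+1, o = 1%N :> nat -> forall t : {ffun 'I_i.+1 -> T},
     (t ord0 = t o -> f t = 0) /\ f (swap ord0 o t) = - f t) -> alternates f.
Proof.
move=> f1 f2.
have Ht k l (t : {ffun 'I_i.+1 -> T}) : k != ord0 -> l != ord0 -> k != l ->
    (t k = t l -> f t = 0) /\ f (swap k l t) = - f t.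
  case: (unliftP ord0 k) => [k'|] -> k0 l0; last by rewrite eqxx in k0.
  case: (unliftP ord0 l) l0 => [l'|] -> l0 kl; last by rewrite eqxx in l0.
  rewrite (inj_eq lift_inj) in kl; rewrite [t]ff_cons_eta -ff_cons_swap !ff_consS.
  exact: (f1 _ _ _ kl _).
have H l (t : {ffun 'I_i.+1 -> T}) : l != ord0 ->
    (t ord0 = t l -> f t = 0) /\ f (swap ord0 l t) = - f t.
  move=> l0; have l1 : (0 < l)%N by rewrite lt0n; apply: contraNneq l0 => l0; apply/eqP/val_inj.
  have i1 : (1 < i.+1)%N by apply: leq_ltn_trans l1 _.
  pose o : 'I_i.+1 := Ordinal i1; have o0 : o != ord0 by [].
  have [lo|lo] := eqVneq o l; first by rewrite -lo; apply: f2.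
  have [o0' l0'] : ord0 != o /\ ord0 != l by rewrite ![ord0 == _]eq_sym.
  split=> [e|].
    apply/eqP; rewrite -oppr_eq0 -(Ht o l t o0 l0 lo).2; apply/eqP; apply: (f2 o erefl _).1.
    by rewrite !ffunE tpermL tpermD // eq_sym.
  have -> : swap ord0 l t = swap o l (swap ord0 o (swap o l t)).
    apply/ffunP => q; rewrite !ffunE; congr (t _).
    have := tpermJ o ord0 (tperm o l).
    rewrite tpermL tpermD ?(eq_sym _ ord0) // => /(congr1 (fun s : {perm 'I_i.+1} => s q)).
    by rewrite /conjg tpermV !permM => e; rewrite [in LHS]tpermC -e [tperm o ord0]tpermC.
  by rewrite (Ht o l _ o0 l0 lo).2 (f2 o erefl _).2 (Ht o l _ o0 l0 lo).2 opprK.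
move=> k l kl t; case: (k =P ord0) kl => [->|/eqP k0] kl; first by apply: H; rewrite eq_sym.
case: (l =P ord0) kl => [->|/eqP l0] kl; last exact: Ht.
have [h1 h2] := H k t k0; split=> [e|]; first by apply: h1.
by rewrite -h2; congr f; apply/ffunP => j; rewrite !ffunE tpermC.
Qed.
End Cons.

(** * The Cartier homotopy on monomial forms *)

Section CartierHomotopy.
Variables (p : nat) (p_pr : prime p) (A : zmodType) (X Y : choiceType).
Let Z : choiceType := (X + Y)%type.
Variables (L : nat -> zmodType) (g : forall i, A -> {cmonom Z} -> {ffun 'I_i -> Z} -> L i).
Hypotheses (gU : forall i, alt_datum_universal (@g i)) (Lp : forall i (x : L i), x *+ p = 0).
Variable d : forall i, {additive L i -> L i.+1}.

(** The coefficient of e_(m-z) dz in d e_m: the exponent n for a polynomial variable, and 1 for a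
    divided power variable that occurs. *)
Definition cz (z : Z) (n : nat) : nat := if z is inl _ then n else (0 < n)%N.
Definition cmsub (m : {cmonom Z}) (z : Z) : {cmonom Z} :=
  \big[mmul/mone]_(j <- finsupp m) kexp j (m j - (z == j))%N.
Lemma cmfunE (m : {cmonom Z}) (F : Z -> nat) j :
  (\big[mmul/mone]_(z <- finsupp m) kexp z (F z)) j = if m j == 0%N then 0%N else F j.
Proof.
have H (s : seq Z) : uniq s ->
    (\big[mmul/mone]_(z <- s) kexp z (F z)) j = if j \in s then F j else 0%N.
  elim: s => [|z s IHs] /=; first by rewrite big_nil cm1.
  move=> /andP[zs us]; rewrite big_cons cmM kexpE IHs // inE [j == z]eq_sym.
  by case: (z =P j) => [<-|_] /=; rewrite ?(negbTE zs) ?addn0.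
by rewrite H ?fset_uniq // -cmE_neq0; case: (m j == 0%N).
Qed.
Lemma cmsubE m z j : cmsub m z j = (m j - (z == j))%N.
Proof. by rewrite cmfunE; case: eqP => [->|]. Qed.

Hypothesis dE : forall i a m (t : {ffun 'I_i -> Z}), d i (g a m t) =
  \sum_(z <- finsupp m) g a (cmsub m z) (ff_cons z t) *+ cz z (m z).

Lemma gD i m (t : {ffun 'I_i -> Z}) : {morph (fun a => g a m t) : x y / x + y}.
Proof. by case: (gU i) => -[]. Qed.
Lemma ga i a m : alternates (@g i a m). Proof. by case: (gU i) => -[]. Qed.
Lemma g_ext i (N : zmodType) (h h' : {additive L i -> N}) :
  (forall a m t, h (g a m t) = h' (g a m t)) -> h =1 h'.
Proof. by case: (gU i) => _ _; apply. Qed.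

Fact W_datum i z : alt_datum (fun a m (t : {ffun 'I_i -> Z}) => g a m (ff_cons z t)).
Proof. by split=> [m t|a m]; [exact: gD|exact/alternates_consl/ga]. Qed.
Definition W i z : {additive L i -> L i.+1} := sval (alt_datum_lift (gU i) (W_datum i z)).
Lemma WE i z a m (t : {ffun 'I_i -> Z}) : W i z (g a m t) = g a m (ff_cons z t).
Proof. exact: (svalP (alt_datum_lift (gU i) (W_datum i z))). Qed.
Lemma WW i z z' x : W i.+1 z (W i z' x) = - W i.+1 z' (W i z x).
Proof.
have hD : {morph (fun x => - W i.+1 z' (W i z x)) : u v / u + v}.
  by move=> u v; rewrite !raddfD.
apply: (g_ext (h := W i.+1 z \o W i z') (h' := mkadd hD)) => a m t.
rewrite /= /mkadd_of !WE; have n0 : ord0 != lift ord0 ord0 :> 'I_i.+2 by rewrite neq_lift.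
by have := (ga a m n0 (ff_cons z' (ff_cons z t))).2; rewrite ff_cons_cons_swap.
Qed.
Lemma WW0 i z a m (t : {ffun 'I_i -> Z}) : g a m (ff_cons z (ff_cons z t)) = 0.
Proof.
have n0 : ord0 != lift ord0 ord0 :> 'I_i.+2 by rewrite neq_lift.
by apply: (ga a m n0 _).1; rewrite ff_consS !ff_cons0.
Qed.
Lemma W_self i z x : W i.+1 z (W i z x) = 0.
Proof.
by apply: (g_ext (h := W i.+1 z \o W i z) (h' := zadd _ _)) => a m t; rewrite /= !WE WW0.
Qed.
Lemma dW i z x : d i.+1 (W i z x) = - W i.+1 z (d i x).
Proof.
have hD : {morph (fun x => - W i.+1 z (d i x)) : u v / u + v}.
  by move=> u v; rewrite !raddfD.
apply: (g_ext (h := d i.+1 \o W i z) (h' := mkadd hD)) => a m t.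
rewrite /= /mkadd_of WE !dE raddf_sum -sumrN; apply: eq_bigr => z' _.
by rewrite raddfMn /= WE -!WE WW mulNrn.
Qed.

Section Contraction.
Variable z0 : Z.
Let up (m : {cmonom Z}) : {cmonom Z} := mmul m (ucm z0).
Definition ihead i a m (t : {ffun 'I_i.+1 -> Z}) : L i :=
  if t ord0 == z0 then g a (up m) (ff_tl t) else 0.
(** The default allows the recursion [Iz] to be written before its data are known to be alternating;
    [F_datum] shows afterwards that they are. *)
Definition lift0 i (N : zmodType) (t : A -> {cmonom Z} -> {ffun 'I_i -> Z} -> N) :
  {additive L i -> N} := if pselect (alt_datum t) is left e then sval (alt_datum_lift (gU i) e) else zadd _ _.
Lemma lift0E i (N : zmodType) (t : A -> {cmonom Z} -> {ffun 'I_i -> Z} -> N) a m x :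
  alt_datum t -> lift0 t (g a m x) = t a m x.
Proof.
by move=> td; rewrite /lift0; case: pselect => [e|//]; apply: (svalP (alt_datum_lift (gU i) e)).
Qed.
(** The differential dz0 is removed, with the sign of its position, and the index of the monomial in
    z0 is raised by one. For a polynomial variable this is contraction with the Euler field x d/dx,
    for a divided power variable it is integration. Raising the index, rather than multiplying by
    z0, treats both alike. *)
Fixpoint Iz i : {additive L i.+1 -> L i} :=
  match i with
  | 0%N => lift0 (fun a m t => ihead a m t)
  | j.+1 => lift0 (fun a m t => ihead a m t - W j (t ord0) (Iz j (g a m (ff_tl t))))
  end.
Definition Kz i z : {additive L i -> L i} :=
  match i with 0%N => zadd _ _ | j.+1 => W j z \o Iz j end.
Definition dI i : {additive L i -> L i} :=
  match i with 0%N => zadd _ _ | j.+1 => d j \o Iz j end.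
Lemma Kz0 z x : Kz 0 z x = 0. Proof. by []. Qed.
Lemma Kz_anti i z z' x : W i z (Kz i z' x) = - W i z' (Kz i z x).
Proof.
case: i x => [|i] x; last exact: WW.
by rewrite !Kz0 !(raddf0 (W 0 _)) oppr0.
Qed.
Lemma Kz_self i z x : W i z (Kz i z x) = 0.
Proof. by case: i x => [|i] x; [rewrite Kz0 raddf0|exact: W_self]. Qed.
Lemma d_Kz i z x : d i (Kz i z x) = - W i z (dI i x).
Proof.
case: i x => [|i] x; last exact: dW.
by rewrite Kz0 (raddf0 (d 0)) ?(raddf0 (W 0 z)) ?oppr0.
Qed.

Let F i a m (t : {ffun 'I_i.+1 -> Z}) : L i := ihead a m t - Kz i (t ord0) (g a m (ff_tl t)).
Lemma Iz_F i a m (t : {ffun 'I_i.+1 -> Z}) : alt_datum (@F i) -> Iz i (g a m t) = F a m t.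
Proof.
rewrite /F; case: i t => [|i] t Fd /=; last by rewrite (lift0E _ _ _ Fd).
rewrite lift0E ?subr0 //; have [FD Fa] := Fd; split=> [m' t' u v|a' m' k l kl t'].
  by have := FD m' t' u v; rewrite !Kz0 !subr0.
by have := Fa a' m' k l kl t'; rewrite !Kz0 !subr0.
Qed.
(** By [alternates_cons] and induction only the first two entries matter. [FE] expands the value in
    terms of them, and the result is visibly antisymmetric and zero on equal entries. *)
Lemma F_datum i : alt_datum (@F i).
Proof.
elim: i => [|i IHi].
all: split=> [m t u v|a m].
- rewrite /F /ihead /= !subr0; case: ifP; rewrite ?addr0 // => _; exact: gD.
- by move=> k l; rewrite !ord1 eqxx.
- rewrite /F /ihead !gD raddfD opprD addrACA; congr (_ + _); case: ifP; rewrite ?addr0 // => _.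
- apply: alternates_cons => [z k l kl t|o o1 t].
    rewrite /F /ihead !ff_cons0 !ff_tl_cons; split=> [e|].
      by rewrite ((ga a m kl t).1 e) ((ga a (up m) kl t).1 e) raddf0 subr0 if_same.
    rewrite !(ga a _ kl t).2 raddfN opprD; congr (_ + _); case: ifP => _ //; by rewrite oppr0.
  have -> : o = lift ord0 ord0 by apply: val_inj.
  have FE w w' (t' : {ffun 'I_i -> Z}) : F a m (ff_cons w (ff_cons w' t')) =
      (if w == z0 then W i w' (g a (up m) t') else 0) -
      (if w' == z0 then W i w (g a (up m) t') else 0) + W i w (Kz i w' (g a m t')).
    rewrite {1}/F /ihead !ff_cons0 !ff_tl_cons /= Iz_F // /F /ihead ff_cons0 ff_tl_cons.
    rewrite (raddfB (W i w)) opprB [in RHS]addrAC WE -addrA; congr (_ + _).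
    rewrite (fun_if (W i w)) (raddf0 (W i w)); exact: erefl.
  rewrite [t]ff_cons_eta [ff_tl t]ff_cons_eta ff_cons_cons_swap ff_consS !ff_cons0.
  split=> [->|]; rewrite !FE.
    by rewrite subrr add0r Kz_self.
  by rewrite opprD opprB Kz_anti.
Qed.

Lemma Iz_cons i a m z (t : {ffun 'I_i -> Z}) : Iz i (g a m (ff_cons z t)) =
  (if z == z0 then g a (up m) t else 0) - Kz i z (g a m t).
Proof. by rewrite Iz_F; [rewrite /F /ihead ff_cons0 ff_tl_cons|exact: F_datum]. Qed.

Lemma cmU_E (z j : Z) : ucm z j = (z == j)%N :> nat.
Proof. by rewrite cmU; case: (z == j). Qed.

Lemma up_cmsub (m : {cmonom Z}) : m z0 <> 0%N -> up (cmsub m z0) = m.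
Proof.
move=> m0; apply: cm_eq => j; rewrite cmM cmsubE cmU_E.
by case: (z0 =P j) => [<-|_] /=; rewrite ?subn0 ?addn0 // subnK // lt0n; apply/eqP.
Qed.

Lemma Iz_d i a m (t : {ffun 'I_i -> Z}) : Iz i (d i (g a m t)) =
  g a m t *+ cz z0 (m z0) -
  \sum_(z <- finsupp m) Kz i z (g a (cmsub m z) t) *+ cz z (m z).
Proof.
rewrite dE raddf_sum /=.
under eq_bigr => z _ do rewrite raddfMn /= Iz_cons mulrnBl.
rewrite sumrB; congr (_ - _).
have [m0|m0] := eqVneq (m z0) 0%N.
  rewrite m0 big_seq big1 => [|z zm]; first by case: (z0).
  by case: eqP => [e|]; [rewrite e m0; case: (z0)|rewrite mul0rn].
rewrite (bigD1_seq z0) ?fset_uniq //=; last by rewrite -cmE_neq0.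
rewrite eqxx up_cmsub; last exact/eqP.
by rewrite big1 ?addr0 // => z /negbTE ->; rewrite mul0rn.
Qed.

Lemma d_up i a m (t : {ffun 'I_i -> Z}) : d i (g a (up m) t) -
    \sum_(z <- finsupp m) W i z (g a (up (cmsub m z)) t) *+ cz z (m z) =
  g a m (ff_cons z0 t) *+ cz z0 (m z0).+1 - g a m (ff_cons z0 t) *+ cz z0 (m z0).
Proof.
have upE z : up m z = (m z + (z0 == z))%N by rewrite cmM cmU_E.
have z0u : z0 \in finsupp (up m) by rewrite -cmE_neq0 upE eqxx addn1.
have mD : (finsupp m `<=` finsupp (up m))%fset.
  by apply/fsubsetP => z; rewrite -!cmE_neq0 upE addn_eq0 negb_and => ->.
rewrite dE (big_fset_incl _ mD) => [|z _ zm]; last first.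
  have -> : m z = 0%N by apply/eqP; rewrite cmE_eq0.
  by case: z {zm} => z.
rewrite -sumrB (bigD1_seq z0) ?fset_uniq //= upE eqxx addn1.
have -> : cmsub (up m) z0 = m by apply: cm_eq => j; rewrite cmsubE upE addnK.
have -> : W i z0 (g a (up (cmsub m z0)) t) *+ cz z0 (m z0) =
    g a m (ff_cons z0 t) *+ cz z0 (m z0).
  have [m0|m0] := eqVneq (m z0) 0%N; first by rewrite m0; case: (z0).
  by rewrite up_cmsub ?WE //; apply/eqP.
rewrite big1 ?addr0 // => z zz0; rewrite upE eq_sym (negbTE zz0) addn0 WE.
have [m0|m0] := eqVneq (m z) 0%N; first by rewrite m0; case: z {zz0 m0} => z; rewrite subrr.
suff -> : cmsub (up m) z = up (cmsub m z) by rewrite subrr.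
apply: cm_eq => j; rewrite cmsubE upE cmM cmsubE cmU_E.
have [<-|_] := eqVneq z j; last by rewrite !subn0.
by rewrite eq_sym (negbTE zz0) !addn0.
Qed.

Definition cnt i (t : {ffun 'I_i -> Z}) z : nat := (\sum_(j < i) (t j == z))%N.
Definition wt i (m : {cmonom Z}) (t : {ffun 'I_i -> Z}) z : nat := (m z + cnt t z)%N.
Lemma cnt_cons i z (t : {ffun 'I_i -> Z}) z1 : cnt (ff_cons z t) z1 = ((z == z1) + cnt t z1)%N.
Proof.
rewrite /cnt big_ord_recl ff_cons0; congr (_ + _)%N; apply: eq_bigr => j _.
by rewrite ff_consS.
Qed.
Lemma cnt_eq0 i (t : {ffun 'I_i -> Z}) z : (forall j, t j <> z) -> cnt t z = 0%N.
Proof. by move=> tz; rewrite /cnt big1 // => j _; case: eqP (tz j). Qed.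

(** This is Cartan's formula: the eigenvalue is given by the weight, the exponent of z0 plus the
    number of factors dz0. In the induction U and V are the two terms for the form without its first
    differential; what remains, [Dd] - [S], appears only when that differential is dz0. *)
Lemma contraction_homotopy i a m (t : {ffun 'I_i -> Z}) :
  Iz i (d i (g a m t)) + dI i (g a m t) = g a m t *+ cz z0 (wt m t z0).
Proof.
elim: i m t => [|i IHi] m t.
  rewrite Iz_d big1 ?subr0 => [|z _]; last by rewrite Kz0 mul0rn.
  by rewrite /wt /cnt big_ord0 addn0 -[RHS]addr0.
rewrite [t]ff_cons_eta; move: (t ord0) (ff_tl t) => z {}t.
rewrite Iz_d; set a0 := _ *+ cz z0 (m z0).
pose U := W i z (Iz i (d i (g a m t))); pose V := W i z (dI i (g a m t)).
pose S := if z == z0 then \sum_(z1 <- finsupp m) W i z1 (g a (up (cmsub m z1)) t) *+ cz z1 (m z1)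
  else 0.
pose Dd := if z == z0 then d i (g a (up m) t) else 0.
have -> : dI i.+1 (g a m (ff_cons z t)) = Dd + V.
  rewrite -[LHS]/(d i (Iz i _)) Iz_cons (raddfB (d i)) d_Kz opprK; congr (_ + _).
  by rewrite /Dd (fun_if (d i)) (raddf0 (d i)).
have -> : \sum_(z1 <- finsupp m) Kz i.+1 z1 (g a (cmsub m z1) (ff_cons z t)) *+ cz z1 (m z1) =
    S + (a0 - U).
  transitivity (S + W i z (\sum_(z1 <- finsupp m) Kz i z1 (g a (cmsub m z1) t) *+ cz z1 (m z1))).
    rewrite raddf_sum /S; have [zz|zz] := eqVneq z z0.
      rewrite -big_split; apply: eq_bigr => z1 _ /=.
      by rewrite Iz_cons zz eqxx (raddfB (W i z1)) Kz_anti opprK raddfMn mulrnDl.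
    rewrite add0r; apply: eq_bigr => z1 _ /=.
    by rewrite Iz_cons (negbTE zz) sub0r (raddfN (W i z1)) Kz_anti opprK raddfMn.
  congr (_ + _); rewrite /U Iz_d (raddfB (W i z)) raddfMn /= WE opprB.
  by rewrite -/a0 addrC subrK.
have -> : a0 - (S + (a0 - U)) + (Dd + V) = U + V + (Dd - S).
  have -> : a0 - (S + (a0 - U)) = U - S.
    by apply/eqP; rewrite subr_eq addrA subrK addrCA subrr addr0.
  by rewrite [Dd + V]addrC addrACA [- S + Dd]addrC.
have -> : U + V = g a m (ff_cons z t) *+ cz z0 (wt m t z0).
  by rewrite -(raddfD (W i z)) IHi raddfMn /= WE.
rewrite /Dd /S /wt cnt_cons; have [->|zz] := eqVneq z z0; last by rewrite subr0 addr0 add0n.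
rewrite d_up; have [[j tj]|nt] := pselect (exists j, t j = z0).
  have -> : g a m (ff_cons z0 t) = 0.
    by apply: (ga a m (neq_lift ord0 j) _).1; rewrite ff_cons0 ff_consS.
  by rewrite !mul0rn subr0 addr0.
rewrite cnt_eq0 ?addn0 => [|j tj]; last by apply: nt; exists j.
by rewrite addrCA subrr addr0 addn1.
Qed.
End Contraction.

(** These are the weights n for which [cz z n] is invertible modulo p. *)
Definition badz (z : Z) (n : nat) : bool := if z is inl _ then ~~ (p %| n)%N else n != 0%N.
(** The choice depends on the weight function alone. As d preserves weights, a form and all terms of
    its differential use the same variable. *)
Definition pz (w : Z -> nat) : option Z :=
  if pselect (exists z, badz z (w z)) is left e then Some (sval (cid e)) else None.
Lemma pzP w : if pz w is Some z then is_true (badz z (w z)) else forall z, ~~ badz z (w z).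
Proof.
rewrite /pz; case: pselect => [e|ne]; first exact: (svalP (cid e)).
by move=> z; apply/negP => zb; apply: ne; exists z.
Qed.
(** An inverse of [cz z n] modulo p for bad n, from the Bezout relation. *)
Definition cinv (z : Z) (n : nat) : nat := if z is inl _ then (egcdn n p).1 else 1.
Lemma cinvP i (x : L i) z n : badz z n -> x *+ cz z n *+ cinv z n = x.
Proof.
case: z => z /= zn; last by rewrite lt0n zn.
have n0 : (0 < n)%N by rewrite lt0n; apply: contra zn => /eqP ->.
case: (egcdnP p n0) => /= u v e _.
have cop : gcdn n p = 1%N by apply/eqP; rewrite -/(coprime n p) coprime_sym prime_coprime.
by rewrite -mulrnA mulnC e cop addn1 mulrS mulnC mulrnA Lp mul0rn addr0.
Qed.

Lemma wt_swap i m k l (t : {ffun 'I_i -> Z}) : wt m (swap k l t) = wt m t.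
Proof.
apply: funext => z; congr (_ + _)%N.
by rewrite /cnt [RHS](reindex_inj (@perm_inj _ (tperm k l))); apply: eq_bigr => j _; rewrite ffunE.
Qed.
Lemma wt_cmsub i (m : {cmonom Z}) z (t : {ffun 'I_i -> Z}) : z \in finsupp m ->
  wt (cmsub m z) (ff_cons z t) = wt m t.
Proof.
rewrite -cmE_neq0 => m0; apply: funext => j; rewrite /wt cmsubE cnt_cons.
by case: (z =P j) m0 => [->|_] m0 /=; rewrite ?subn0 ?add0n // addnA subnK // lt0n.
Qed.

Definition h_fun i a m (t : {ffun 'I_i.+1 -> Z}) : L i :=
  if pz (wt m t) is Some z then Iz z i (g a m t) *+ cinv z (wt m t z) else 0.
Lemma h_datum i : alt_datum (@h_fun i).
Proof.
split=> [m t a b|a m k l kl t]; rewrite /h_fun ?wt_swap; case: (pz _) => [z|].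
- by rewrite gD raddfD mulrnDl.
- by rewrite addr0.
- split=> [e|]; first by rewrite ((ga a m kl t).1 e) raddf0 mul0rn.
  by rewrite (ga a m kl t).2 raddfN mulNrn.
- by rewrite oppr0.
Qed.
Definition hh i : {additive L i.+1 -> L i} := lift0 (@h_fun i).
Lemma hhE i a m (t : {ffun 'I_i.+1 -> Z}) : hh i (g a m t) = h_fun a m t.
Proof. exact: lift0E (h_datum i). Qed.
Definition dh i : {additive L i -> L i} :=
  match i with 0%N => zadd _ _ | j.+1 => d j \o hh j end.

(** Cartan's formula for the chosen variable, divided by its weight. The division commutes with d
    because both the variable and the divisor depend only on the weights. *)
Lemma cartier_homotopy i a m (t : {ffun 'I_i -> Z}) : hh i (d i (g a m t)) + dh i (g a m t) =
  if pz (wt m t) is Some _ then g a m t else 0.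
Proof.
have -> : hh i (d i (g a m t)) =
    if pz (wt m t) is Some z then Iz z i (d i (g a m t)) *+ cinv z (wt m t z) else 0.
  rewrite !dE raddf_sum big_seq.
  rewrite (eq_bigr (fun z => (if pz (wt m t) is Some z1 then
      Iz z1 i (g a (cmsub m z) (ff_cons z t)) *+ cinv z1 (wt m t z1) else 0) *+ cz z (m z))); last first.
    by move=> z zm; rewrite raddfMn /= hhE /h_fun wt_cmsub.
  rewrite -big_seq; case: (pz _) => [z|]; last by rewrite big1 // => z _; rewrite mul0rn.
  rewrite raddf_sum -sumrMnl; apply: eq_bigr => z1 _.
  by rewrite raddfMn /= -!mulrnA mulnC.
have -> : dh i (g a m t) = if pz (wt m t) is Some z then dI z i (g a m t) *+ cinv z (wt m t z) else 0.
  case: i t => [|i] t; first by case: (pz _) => [z|] //; rewrite mul0rn.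
  rewrite -[LHS]/(d i (hh i _)) hhE /h_fun; case: (pz _) => [z|]; last by rewrite raddf0.
  by rewrite raddfMn.
have := pzP (wt m t); case: (pz _) => [z zb|_]; last by rewrite addr0.
by rewrite -mulrnDl contraction_homotopy cinvP.
Qed.

Section Cartier.
Variables (V : nat -> zmodType) (nu : forall i, A -> {cmonom Z} -> {ffun 'I_i -> Z} -> V i).
Hypotheses (Vp : forall i (x : V i), x *+ p = 0) (nud : forall i, alt_datum (@nu i))
  (nuY : forall i a (m : {cmonom Z}) (t : {ffun 'I_i -> Z}) y, m (inr y : Z) <> 0%N -> nu a m t = 0)
  (nut : forall i a (m : {cmonom Z}) (t : {ffun 'I_i -> Z}) j y, t j = inr y -> nu a m t = 0).
(** The exponents of the inverse Cartier image: p times those of m, and p - 1 more for each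
    differential in t. *)
Definition frm i (m : {cmonom Z}) (t : {ffun 'I_i -> Z}) : {cmonom Z} :=
  mmul (\big[mmul/mone]_(z <- finsupp m) kexp z (p * m z)%N)
    (\big[mmul/mone]_(j < i) kexp (t j) p.-1).
Lemma frmE i m (t : {ffun 'I_i -> Z}) z : frm m t z = (p * m z + p.-1 * cnt t z)%N.
Proof.
rewrite cmM cmfunE; congr (_ + _)%N; first by case: eqP => [->|//]; rewrite muln0.
rewrite (big_morph (fun u : {cmonom Z} => u z) (id1 := 0%N) (op1 := addn)); last 2 first.
- by move=> u v; rewrite cmM.
- by rewrite cm1.
rewrite /cnt big_distrr; apply: eq_bigr => j _ /=; rewrite kexpE.
by case: eqP; rewrite ?muln1 ?muln0.
Qed.
Variable s : forall i, {additive V i -> L i}.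
Hypothesis sE : forall i a (m : {cmonom Z}) (t : {ffun 'I_i -> Z}), (forall y, m (inr y : Z) = 0%N) ->
  (forall j y, t j <> inr y) -> s i (nu a m t) = g a (frm m t) t.

(** Inverse to [frm]: when the weight of z is p q, the exponent is q if dz is absent and q - 1 if it
    occurs once. *)
Definition vq i (m : {cmonom Z}) (t : {ffun 'I_i -> Z}) : {cmonom Z} :=
  \big[mmul/mone]_(z <- finsupp m) kexp z ((wt m t z) %/ p - cnt t z)%N.
Lemma vqE i m (t : {ffun 'I_i -> Z}) z :
  vq m t z = if m z == 0%N then 0%N else ((wt m t z) %/ p - cnt t z)%N.
Proof. exact: cmfunE. Qed.
Definition theta_fun i a m (t : {ffun 'I_i -> Z}) : V i :=
  if `[< forall z, (p %| wt m t z)%N >] then nu a (vq m t) t else 0.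
Lemma theta_datum i : alt_datum (@theta_fun i).
Proof.
have [nD na] := nud i; split=> [m t a b|a m k l kl t]; rewrite /theta_fun.
  by case: ifP => _; rewrite ?nD ?addr0.
have -> : vq m (swap k l t) = vq m t.
  apply: cm_eq => z; rewrite !vqE wt_swap.
  have := congr1 (fun w => w z) (wt_swap m k l t); rewrite /wt => /addnI -> //.
rewrite wt_swap; case: ifP => _; last by rewrite oppr0.
exact: na.
Qed.
Definition theta i : {additive L i -> V i} := lift0 (@theta_fun i).
Lemma thetaE i a m (t : {ffun 'I_i -> Z}) : theta i (g a m t) = theta_fun a m t.
Proof. exact: lift0E (theta_datum i). Qed.

Lemma theta_frm i a m (t : {ffun 'I_i -> Z}) : theta i (g a (frm m t) t) = nu a m t.
Proof.
have wE z : wt (frm m t) t z = (p * (m z + cnt t z))%N.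
  by rewrite /wt frmE mulnDr -addnA -mulSnr prednK ?prime_gt0.
rewrite thetaE /theta_fun asboolT => [|z]; last by rewrite wE dvdn_mulr.
congr (nu _ _ t); apply: cm_eq => z; rewrite vqE wE mulKn ?prime_gt0 // addnK frmE.
case: eqP => // /eqP; rewrite addn_eq0 muln_eq0 -leqn0 leqNgt prime_gt0 //=.
by move=> /andP[/eqP ->].
Qed.

(** A term of the differential counts only if all weights are divisible by p. Then dz is the
    differential of a divided power variable and is killed, or it is repeated, or its coefficient,
    the exponent of z, is divisible by p. *)
Lemma theta_d i x : theta i.+1 (d i x) = 0.
Proof.
apply: (g_ext (h := theta i.+1 \o d i) (h' := zadd _ _)) => a m t.
rewrite -[LHS]/(theta i.+1 (d i _)) dE raddf_sum big_seq big1 // => z zm.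
rewrite raddfMn /= thetaE /theta_fun wt_cmsub //; case: asboolP => [pw|_]; last by rewrite mul0rn.
case: z zm => [x0|y] zm; last by rewrite (nut _ _ (ff_cons0 (inr y : Z) t)) mul0rn.
have [[j tj]|nt] := pselect (exists j, t j = inl x0).
  have [_ na] := nud i.+1.
  rewrite (na _ _ _ _ (neq_lift ord0 j) _).1 ?mul0rn //.
  by rewrite ff_cons0 ff_consS.
have /dvdnP[q qE] : (p %| m (inl x0))%N.
  by have := pw (inl x0); rewrite /wt cnt_eq0 ?addn0 // => j tj; apply: nt; exists j.
by rewrite /cz qE mulnC mulrnA Vp mul0rn.
Qed.

(** At a bad variable either the weight is not divisible by p, or a divided power variable survives
    in the exponent or in t, and [nu] vanishes. At good weights [frm] undoes [vq] unless a
    differential is repeated, in which case both sides are zero. *)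
Lemma s_theta i a m (t : {ffun 'I_i -> Z}) :
  s i (theta i (g a m t)) = if pz (wt m t) is Some _ then 0 else g a m t.
Proof.
rewrite thetaE /theta_fun; have := pzP (wt m t); case: (pz _) => [z zb|good].
  case: asboolP => [pw|_]; last by rewrite raddf0.
  case: z zb => [z|y] /= zb; first by rewrite pw in zb.
  have [[j tj]|nt] := pselect (exists j, t j = inr y); first by rewrite (nut _ _ tj) raddf0.
  suff vy : vq m t (inr y) <> 0%N by rewrite (nuY _ _ vy) raddf0.
  rewrite vqE /wt cnt_eq0; last by move=> j tj; apply: nt; exists j.
  move: zb (pw (inr y)); rewrite /wt cnt_eq0; last by move=> j tj; apply: nt; exists j.
  rewrite addn0 subn0 => /[dup] my /negbTE -> /dvdnP[q qE]; rewrite qE mulnK ?prime_gt0 //.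
  by move=> q0; rewrite qE q0 in my.
have wY y : wt m t (inr y) = 0%N by have := good (inr y); rewrite /= negbK => /eqP.
have pw z : (p %| wt m t z)%N by case: z => [x0|y]; [have := good (inl x0); rewrite /= negbK|rewrite wY].
rewrite asboolT; last exact: pw.
have tY j y : t j <> inr y.
  by move=> tj; have := wY y; rewrite /wt /cnt (bigD1 j) //= tj eqxx addnCA.
rewrite sE //; last by move=> y; rewrite vqE; have := wY y; rewrite /wt => /eqP; rewrite addn_eq0 => /andP[->].
have [[j [l [jl tjl]]]|inj] := pselect (exists j l, j != l /\ t j = t l).
  by rewrite ((ga a _ jl t).1 tjl) ((ga a m jl t).1 tjl).
congr (g a _ t); apply: cm_eq => z; rewrite frmE vqE.
have c1 : (cnt t z <= 1)%N.
  have [[j tj]|nt] := pselect (exists j, t j = z); last first.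
    by rewrite cnt_eq0 // => j tj; apply: nt; exists j.
  rewrite /cnt (bigD1 j) //= tj eqxx big1 // => l lj; apply/eqP; rewrite eqb0; apply/eqP => tl.
  by apply: inj; exists l, j; rewrite lj tl tj.
have /dvdnP[q qE] := pw z; have p1 := prime_gt1 p_pr; rewrite qE mulnK ?prime_gt0 //.
move: qE; rewrite /wt; case: (m z) (cnt t z) c1 q p p1 => [|n] [|[|//]] _ [|q] [|[|r]] //= _; nia.
Qed.

Theorem cartier_decomposition i x : x = s i (theta i x) + (hh i (d i x) + dh i x).
Proof.
have hD : {morph (fun x => s i (theta i x) + (hh i (d i x) + dh i x)) : u v / u + v}.
  by move=> u v; rewrite !raddfD [RHS]addrACA; congr (_ + _); rewrite [RHS]addrACA.
apply: (g_ext (h := idfun) (h' := mkadd hD)) => a m t; rewrite /= /mkadd_of.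
by rewrite s_theta cartier_homotopy; case: (pz _) => [z|]; rewrite ?add0r ?addr0.
Qed.
End Cartier.
End CartierHomotopy.

Lemma fmap_cons (S T : Type) i (f : S -> T) z (t : {ffun 'I_i -> S}) :
  fmap_ff f (ff_cons z t) = ff_cons (f z) (fmap_ff f t).
Proof.
apply/ffunP => j; rewrite ffunE; case: (unliftP ord0 j) => [j'|] ->.
  by rewrite !ff_consS ffunE.
by rewrite !ff_cons0.
Qed.
Lemma upd_cons (T : Type) i (t : {ffun 'I_i -> T}) z z' : upd (ff_cons z t) ord0 z' = ff_cons z' t.
Proof.
apply/ffunP => j; rewrite ffunE; case: (unliftP ord0 j) => [j'|] ->.
  by rewrite !ff_consS eq_sym (negbTE (neq_lift _ _)).
by rewrite eqxx !ff_cons0.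
Qed.

Lemma pmon_cmmap (k Q : comPzRingType) (f : {rmorphism k -> Q}) (X Z : choiceType) (c : X -> Z)
    (x : Z -> Q) m : pmon x (cmmap c m) = pmon (x \o c) m.
Proof.
rewrite -[LHS](peval_mon f) -[RHS](peval_mon f).
have := @pmap_mon X Z k k idfun c m; move=> <-.
apply: (peval_unique (g := f) (y := x \o c) (h := peval f x \o pmap_ring idfun c)) => s /=.
  by rewrite pevalC [LHS]pevalC.
by rewrite pevalX [LHS]pevalX.
Qed.

Lemma ff_congr (T N : Type) i (F : {ffun 'I_i -> T} -> N) (R : T -> T -> Prop) :
  (forall t j u v, R u v -> F (upd t j u) = F (upd t j v)) ->
  forall t t' : {ffun 'I_i -> T}, (forall j, R (t j) (t' j)) -> F t = F t'.
Proof.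
move=> FR t t' tt'; pose mix (s : seq 'I_i) : {ffun 'I_i -> T} := [ffun j => if j \in s then t' j else t j].
have H (s : seq 'I_i) : F (mix s) = F t.
  elim: s => [|j s <-]; first by congr F; apply/ffunP => j; rewrite ffunE.
  have [js|js] := boolP (j \in s).
    by congr F; apply/ffunP => l; rewrite !ffunE inE; case: eqP => [->|] //; rewrite js.
  rewrite -[in RHS](updE (mix s) j) [mix s j]ffunE (negbTE js) (FR _ j _ _ (tt' j)); congr F.
  by apply/ffunP => l; rewrite !ffunE inE; case: eqP => [->|].
by rewrite -(H (enum 'I_i)); congr F; apply/ffunP => j; rewrite ffunE mem_enum.
Qed.

Lemma pmonM (Q : comPzRingType) (X : choiceType) (x : X -> Q) u v :
  pmon x (mmul u v) = pmon x u * pmon x v.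
Proof.
have E m : pmon x m = peval (idfun : {rmorphism Q -> Q}) x (dmon xpred0 Q m).
  by rewrite peval_mon.
by rewrite !E dmonM0 rmorphM.
Qed.
Lemma pmon1 (Q : comPzRingType) (X : choiceType) (x : X -> Q) : pmon x mone = 1.
Proof. exact: mprod1. Qed.
Lemma pmon_kexp (Q : comPzRingType) (X : choiceType) (x : X -> Q) s n : pmon x (kexp s n) = x s ^+ n.
Proof.
elim: n => [|n IHn]; first exact: pmon1.
by rewrite exprS -IHn -[kexp s n.+1]/(mmul (ucm s) (kexp s n)) pmonM [pmon x (ucm s)]mprod_ucm.
Qed.
Lemma cmmap_inl (X Y : choiceType) (q : {cmonom X}) (z : X + Y) :
  cmmap (inl : X -> X + Y) q z = if z is inl s then q s else 0%N.
Proof.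
rewrite (cmmap_wide _ _ (fsubset_refl _)); case: z => [s|s]; last by rewrite big1.
have [sq|sq] := boolP (s \in finsupp q).
  by rewrite (big_fsetD1 s) //= eqxx big1_fset ?addn0 // => l; rewrite !inE => /andP[ls _] _;
    rewrite (inj_eq (@inl_inj _ _)) (negbTE ls).
rewrite big1_fset => [|l lq _]; first by apply/esym/eqP; rewrite cmE_eq0.
by rewrite (inj_eq (@inl_inj _ _)); case: eqP => // e; rewrite e (negbTE sq) in lq.
Qed.

(** * The Cartier isomorphism in one simplicial degree *)

Section Level.
Variables (p : nat) (p_pr : prime p) (A B : pdPair p) (f : pdMor A B) (X Y : choiceType).
Let Z : choiceType := (X + Y)%type.
Variables (x : X -> pd_ring B) (y : Y -> pd_ring B).
Hypotheses (Afree : is_pd_free A) (Bfree : pd_free_on f x y).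
Variables (M : lmodType (pd_ring B)) (del : pd_ring B -> M).
Hypothesis delU : is_initial_map (@is_pd_derivation p A B f) del.
Variables (Wm : nat -> lmodType (pd_ring B)) (w : forall i, {ffun 'I_i -> M} -> Wm i).
Hypothesis wU : forall i, is_exterior_power (@w i).
Variable d : forall i, {additive Wm i -> Wm i.+1}.
Hypothesis dw : forall i b (t : {ffun 'I_i -> pd_ring B}),
  d i (b *: w (fmap_ff del t)) = w (fmap_ff del (ff_cons b t)).
Local Notation G := (pd_gammaP B).

Definition gen (z : Z) : pd_ring B := match z with inl s => x s | inr s => y s end.
Definition fam (z : Z) n : pd_ring B :=
  match z with inl s => x s ^+ n | inr s => pd_gamma B n (y s) end.
Local Notation dz := (fun z => del (gen z)).

Lemma delD : {morph del : u v / u + v}. Proof. by case: delU => -[[]]. Qed.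
Lemma delM u v : del (u * v) = u *: del v + v *: del u. Proof. by case: delU => -[[]]. Qed.
Lemma delC a : del (f a) = 0. Proof. by case: delU => -[[]]. Qed.
Lemma delG n b : pd_pi B b = 0 -> del (pd_gamma B n.+1 b) = pd_gamma B n b *: del b.
Proof. by case: delU => -[_ dg] _; apply: dg. Qed.
Lemma del1 : del 1 = 0. Proof. by rewrite -(rmorph1 f) delC. Qed.
Lemma delMn u n : del (u *+ n) = del u *+ n. Proof. exact: (raddfMn (mkadd delD)). Qed.
Lemma del_sum (I : Type) (r : seq I) (P : pred I) (F : I -> pd_ring B) :
  del (\sum_(i <- r | P i) F i) = \sum_(i <- r | P i) del (F i).
Proof. exact: (raddf_sum (mkadd delD)). Qed.
Lemma delX u n : del (u ^+ n) = (u ^+ n.-1 *+ n) *: del u.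
Proof.
elim: n => [|n IHn]; first by rewrite expr0 del1 mulr0n scale0r.
rewrite exprS delM IHn scalerA mulrnAr -exprS -scalerDl.
by case: n {IHn} => [|n]; rewrite ?mulr0n ?add0r ?expr0 // -mulrSr.
Qed.

Lemma del_prod (s : seq Z) (u : Z -> pd_ring B) : uniq s ->
  del (\prod_(z <- s) u z) = \sum_(z <- s) (\prod_(z' <- s | z' != z) u z') *: del (u z).
Proof.
elim: s => [|z s IHs] /=; first by rewrite !big_nil del1.
move=> /andP[zs us]; rewrite !big_cons delM IHs // eqxx /= addrC; congr (_ + _).
  congr (_ *: _); rewrite [RHS]big_seq_cond [LHS]big_seq; apply: eq_bigl => z'.
  by case: (boolP (z' \in s)) => //= z's; case: eqP z's => // ->; rewrite (negbTE zs).
rewrite scaler_sumr big_seq [RHS]big_seq; apply: eq_bigr => z1 z1s.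
rewrite scalerA big_cons ifT //; by apply: contraNneq zs => ->.
Qed.

Lemma fam0 z : fam z 0 = 1.
Proof. by case: z => //= s; rewrite (pd_g0 G) // Bfree.1. Qed.
Lemma del_fam z n : del (fam z n) = (fam z n.-1 *+ cz z n) *: dz z.
Proof.
case: z => z /=; first exact: delX.
case: n => [|n] /=; first by rewrite (pd_g0 G) ?Bfree.1 // del1 mulr0n scale0r.
by rewrite delG // Bfree.1.
Qed.
Lemma del_gmon m : del (gmon x y m) =
  \sum_(z <- finsupp m) (gmon x y (cmsub m z) *+ cz z (m z)) *: dz z.
Proof.
rewrite [LHS](del_prod (fun z => fam z (m z))) ?fset_uniq // big_seq [RHS]big_seq.
apply: eq_bigr => z zm; rewrite del_fam scalerA mulrnAr; congr ((_ *+ _) *: _).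
have sm : (finsupp (cmsub m z) `<=` finsupp m)%fset.
  by apply/fsubsetP => j; rewrite -!cmE_neq0 cmsubE -!lt0n => h; apply: leq_trans h (leq_subr _ _).
rewrite [RHS](mprod_wide fam0 sm) [RHS](bigD1_seq z) ?fset_uniq //= mulrC.
rewrite cmsubE eqxx subn1; congr (_ * _); apply: eq_bigr => j jz.
by rewrite cmsubE eq_sym (negbTE jz) subn0.
Qed.

Section WCons.
Variables (i : nat) (T : {ffun 'I_i.+1 -> M}) (j : 'I_i.+1).
Fact wupd_linear : linear (fun v => w (upd T j v)).
Proof. by move=> a u v; apply: (wU i.+1).1.1. Qed.
Definition wupd : {linear M -> Wm i.+1} := mklin wupd_linear.
End WCons.
Lemma w_alt i (T : {ffun 'I_i -> M}) k l : k != l -> T k = T l -> w T = 0.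
Proof. exact: (wU i).1.2. Qed.

Definition gform i a m (t : {ffun 'I_i -> Z}) : Wm i := (f a * gmon x y m) *: w (fmap_ff dz t).
Lemma gform_universal i : alt_datum_universal (@gform i).
Proof.
apply: alt_universal_datum; first exact: (pd_free_basis p_pr Afree Bfree).
have := exterior_alt_universal (pd_differentials_free Bfree delU) (wU i).
by congr alt_universal; apply: funext => t; congr w; apply: eq_fmap_ff; case.
Qed.
Lemma form_torsion i (v : Wm i) : v *+ p = 0.
Proof. by rewrite -scaler_nat pd_char scale0r. Qed.

Lemma d_gform i a m (t : {ffun 'I_i -> Z}) : d i (gform a m t) =
  \sum_(z <- finsupp m) gform a (cmsub m z) (ff_cons z t) *+ cz z (m z).
Proof.
rewrite /gform -(fmap_ff_comp gen) dw fmap_cons delM delC scaler0 addr0 del_gmon.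
set T := fmap_ff del _; pose wu := wupd (ff_cons 0 T) ord0.
have wuZ c v : wu (c *: v) = c *: wu v by apply: linearZ.
rewrite -(upd_cons T 0) -[LHS]/(wu _) wuZ (raddf_sum wu) scaler_sumr.
apply: eq_bigr => z _; rewrite [X in f a *: X](wuZ _ _) scalerA mulrnAr -scalerMnl; congr (_ *: _ *+ _).
by rewrite -[LHS]/(w _) upd_cons fmap_cons /T fmap_ff_comp.
Qed.

Definition ltriple : triple := Triple (pd_frobm p_pr A) (pm_quo f).
Definition xb (z : Z) : pd_quo B := pd_pi B (gen z).
Lemma xb_inr s : xb (inr s) = 0. Proof. exact: Bfree.1. Qed.
Definition nu i a m (t : {ffun 'I_i -> Z}) : Om i ltriple :=
  om (t := ltriple) a (pmon xb m) (fmap_ff xb t).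

Lemma Om_torsion i (v : Om i ltriple) : v *+ p = 0.
Proof.
have hD : {morph (fun v : Om i ltriple => v *+ p) : u v / u + v} by move=> u v'; rewrite mulrnDl.
apply: (om_ext (h := mkadd hD) (h' := zadd _ _)) => a b t; rewrite /= /mkadd_of.
have aD : {morph (fun a => om (t := ltriple) a b t) : u v / u + v} by exact: (fdDa (om_datum i ltriple)).
by rewrite -[LHS](raddfMn (mkadd aD)) -mulr_natr pd_char mulr0 [LHS]raddf0.
Qed.
Lemma om_b0 i a (t : {ffun 'I_i -> pd_quo B}) : om (t := ltriple) a 0 t = 0.
Proof. exact: (raddf0 (mkadd (fdDb (om_datum i ltriple) a t))). Qed.
Lemma nu_datum i : alt_datum (@nu i).
Proof.
split=> [m t a b|a m k l kl t]; first exact: (fdDa (om_datum i ltriple)).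
have [h1 h2] := @om_alternates i ltriple a (pmon xb m) k l kl (fmap_ff xb t); split=> [e|].
  by apply: h1; rewrite !ffunE e.
by rewrite -h2; congr om; apply/ffunP => q; rewrite !ffunE.
Qed.
Lemma nu_Y i a (m : {cmonom Z}) (t : {ffun 'I_i -> Z}) s : m (inr s : Z) <> 0%N -> nu a m t = 0.
Proof.
move=> /eqP m0; rewrite /nu [pmon xb m](_ : _ = 0) ?om_b0 //.
rewrite /pmon /mprod (bigD1_seq (inr s : Z)) ?fset_uniq //=; last by rewrite -cmE_neq0.
by rewrite xb_inr expr0n (negbTE m0) mul0r.
Qed.
Lemma nu_t i a (m : {cmonom Z}) (t : {ffun 'I_i -> Z}) j s : t j = inr s -> nu a m t = 0.
Proof.
move=> tj; rewrite /nu -(updE (fmap_ff xb t) j) ffunE tj xb_inr -(rmorph0 (pm_quo f)).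
exact: (fdC (om_datum i ltriple)).
Qed.

Definition inX (m : {cmonom Z}) : {cmonom X} :=
  \big[mmul/mone]_(z <- finsupp m) (if z is inl s then kexp s (m z) else mone).
Lemma inXK (m : {cmonom Z}) : (forall s, m (inr s : Z) = 0%N) -> cmmap (inl : X -> Z) (inX m) = m.
Proof.
move=> mY; pose c := cmmap (inl : X -> Z).
have cM (u v : {cmonom X}) : c (mmul u v) = mmul (c u) (c v).
  have D (q : {cmonom X}) (e : {fset X}) j : (finsupp q `<=` e)%fset ->
      c q j = (\sum_(s <- e) if (inl s : Z) == j then q s else 0)%N by exact: cmmap_wide.
  apply: cm_eq => j; pose e := (finsupp u `|` finsupp v `|` finsupp (mmul u v))%fset.
  rewrite cmM (D u e) ?(D v e) ?(D _ e) ?fsubsetUr //.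
  - by rewrite -big_split; apply: eq_bigr => s _ /=; case: ifP => // _; rewrite cmM.
  - by rewrite /e -fsetUA fsubsetU // fsubsetUl orbT.
  - by rewrite /e -fsetUA fsubsetUl.
have c1 : c mone = mone by apply: cm_eq => j; rewrite /c /cmmap mdom1 big_seq_fset0.
have ck s n : c (kexp s n) = kexp (inl s : Z) n.
  apply: cm_eq => j; rewrite /c (@cmmap_wide X Z inl (kexp s n) [fset s]%fset j).
    by rewrite big_seq_fset1 !kexpE eqxx.
  apply/fsubsetP => l; rewrite -cmE_neq0 kexpE in_fset1.
  by case: (s =P l) => [->|] //; rewrite eqxx.
rewrite -/c /inX (big_morph c cM c1).
transitivity (\big[mmul/mone]_(z <- finsupp m) kexp z (m z)).
  by apply: eq_bigr => -[s|s] _; rewrite ?ck // c1 mY.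
by apply: cm_eq => j; rewrite cmfunE; case: eqP.
Qed.

Definition toX i (t : {ffun 'I_i -> X}) : {ffun 'I_i -> Z} := fmap_ff inl t.
Fact s_datum i : alt_datum (fun a v (t : {ffun 'I_i -> X}) =>
  gform a (frm p (cmmap (inl : X -> Z) v) (toX t)) (toX t)).
Proof.
have [[gD ga] _ _] := gform_universal i; split=> [m t a b|a m k l kl t]; first exact: gD.
have tE : toX (swap k l t) = swap k l (toX t) by apply/ffunP => q; rewrite !ffunE.
rewrite tE; have -> : frm p (cmmap (inl : X -> Z) m) (swap k l (toX t)) = frm p (cmmap inl m) (toX t).
  apply: cm_eq => z; rewrite !frmE; congr (_ + _ * _)%N.
  by have := congr1 (fun u => u z) (wt_swap mone k l (toX t)); rewrite /wt => /addnI.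
have [h1 h2] := ga a (frm p (cmmap inl m) (toX t)) k l kl (toX t).
by split=> // e; apply: h1; rewrite !ffunE e.
Qed.
Lemma xb_poly : poly_on (tio ltriple) (fun s : X => xb (inl s)).
Proof. exact: (pd_free_quo Bfree). Qed.
(** The inverse Cartier operator in the chosen variables: sending monomial forms to [frm] forms is
    additive in the coefficient, so it defines a map of forms and not only of cohomology classes. *)
Lemma s_exists i : {s : {additive Om i ltriple -> Wm i} | forall a v t,
  s (nu a (cmmap (inl : X -> Z) v) (toX t)) = gform a (frm p (cmmap (inl : X -> Z) v) (toX t)) (toX t)}.
Proof.
have [s sE] := alt_datum_lift (om_poly_universal i xb_poly) (s_datum i).
exists s => a v t; rewrite -sE /nu (pmon_cmmap (pm_quo f)); congr (s (om _ _ _)).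
by rewrite fmap_ff_comp.
Qed.
Definition sec i := sval (s_exists i).
Lemma secE i a (m : {cmonom Z}) (t : {ffun 'I_i -> Z}) : (forall s, m (inr s : Z) = 0%N) ->
  (forall j s, t j <> inr s) -> sec i (nu a m t) = gform a (frm p m t) t.
Proof.
move=> mY tY; have /choice[t' t'E] : forall j, exists s, t j = inl s.
  by move=> j; case E: (t j) => [s|s]; [exists s|case: (tY j s)].
have -> : t = toX [ffun j => t' j] by apply/ffunP => j; rewrite !ffunE t'E.
by rewrite -(inXK mY); apply: (svalP (s_exists i)).
Qed.

(** The Cartier operator, set to 0 on forms with a weight not divisible by p. Its construction uses
    the variables; its values on closed forms do not depend on them, by [cartier_std], since [Th]
    kills exact forms. *)
Definition Th i : {additive Wm i -> Om i ltriple} := theta p gform_universal nu i.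
Lemma Th_d i v : Th i.+1 (d i v) = 0.
Proof. exact: (theta_d gform_universal d_gform Om_torsion nu_datum nu_t). Qed.
Definition dhl i : {additive Wm i -> Wm i} := dh p gform_universal d i.
Lemma Th_closed i v : d i v = 0 -> v = sec i (Th i v) + dhl i v.
Proof.
move=> v0; have := cartier_decomposition p_pr gform_universal form_torsion d_gform nu_datum
  nu_Y nu_t (s := sec) secE v.
by rewrite v0 (raddf0 (hh _ _ _)) add0r.
Qed.

(** The inverse Cartier formula for arbitrary elements of B in place of variables. *)
Definition std i a b0 (b : {ffun 'I_i -> pd_ring B}) : Wm i :=
  (f a * b0 ^+ p * \prod_(l < i) b l ^+ p.-1) *: w (fmap_ff del b).

Lemma sec_std i a v (t : {ffun 'I_i -> X}) :
  sec i (om (t := ltriple) a (pmon (fun s => xb (inl s)) v) (fmap_ff (fun s => xb (inl s)) t)) =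
  std a (pmon x v) (fmap_ff x t).
Proof.
have := svalP (s_exists i) a v t; rewrite /nu (pmon_cmmap (pm_quo f)) fmap_ff_comp => ->.
rewrite /gform /std !fmap_ff_comp -mulrA; congr ((_ * _) *: _).
pose q := mmul (iter p (mmul v) mone) (\big[mmul/mone]_(j < i) kexp (t j) p.-1).
have itE n j : iter n (mmul v) mone j = (n * v j)%N.
  by elim: n => [|n IHn]; [rewrite cm1|rewrite cmM IHn mulSn].
have -> : frm p (cmmap (inl : X -> Z) v) (toX t) = cmmap (inl : X -> Z) q.
  apply: cm_eq => z; rewrite frmE !cmmap_inl; case: z => [s|s].
    rewrite cmM itE; congr (_ + _)%N.
    rewrite (big_morph (fun u : {cmonom X} => u s) (id1 := 0%N) (op1 := addn)); last 2 first.
    - by move=> u u'; rewrite cmM.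
    - by rewrite cm1.
    rewrite /cnt big_distrr; apply: eq_bigr => j _ /=; rewrite kexpE ffunE.
    by rewrite (inj_eq (@inl_inj _ _)); case: eqP; rewrite ?muln1 ?muln0.
  by rewrite muln0 cnt_eq0 ?muln0 // => j; rewrite ffunE.
have -> : gmon x y (cmmap (inl : X -> Z) q) = pmon gen (cmmap (inl : X -> Z) q).
  apply: eq_bigr => -[s|s] _ //; by rewrite cmmap_inl expr0 (pd_g0 G) // Bfree.1.
rewrite (pmon_cmmap (pm_ring f)) pmonM (big_morph _ (pmonM (gen \o inl)) (pmon1 (gen \o inl))).
congr (_ * _); last by apply: eq_bigr => j _; rewrite pmon_kexp ffunE.
have H n : pmon (gen \o inl) (iter n (mmul v) mone) = pmon x v ^+ n.
  by elim: n => [|n IHn]; [exact: pmon1|rewrite exprS -IHn -pmonM].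
exact: H.
Qed.

Lemma Th_sec i v : Th i (sec i v) = v.
Proof.
apply: (om_poly_ext xb_poly (h := Th i \o sec i) (h' := idfun)) => a m t /=.
have := svalP (s_exists i) a m t; rewrite /nu (pmon_cmmap (pm_quo f)) fmap_ff_comp => ->.
rewrite [Th _ _](theta_frm p_pr gform_universal nu_datum) /nu (pmon_cmmap (pm_quo f)).
by rewrite fmap_ff_comp.
Qed.

(** The differential of the coefficient is a combination of the db_l, since d kills the image of A
    and p-th powers; next to db_1 ... db_i each of them is repeated. *)
Lemma w_del_std i a b0 (b : {ffun 'I_i -> pd_ring B}) :
  w (ff_cons (del (f a * b0 ^+ p * \prod_(l < i) b l ^+ p.-1)) (fmap_ff del b)) = 0.
Proof.
pose T := fmap_ff del b; pose wu := wupd (ff_cons 0 T) ord0.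
have wuE v : w (ff_cons v T) = wu v by rewrite -(upd_cons T 0).
have wuZ c v : wu (c *: v) = c *: wu v by apply: linearZ.
have wuD u v : wu (u + v) = wu u + wu v by apply: raddfD.
pose Q u := wu (del u) = 0.
have QM u v : Q u -> Q v -> Q (u * v).
  by move=> hu hv; rewrite /Q delM wuD !wuZ hu hv !scaler0 addr0.
have Q0 u : del u = 0 -> Q u by rewrite /Q => ->; exact: (raddf0 wu).
rewrite wuE; apply: (QM); first apply: (QM).
- by apply/Q0/delC.
- by apply: Q0; rewrite delX -mulr_natr pd_char mulr0 scale0r.
apply: (big_ind Q); [by apply/Q0/del1|exact: QM|].
move=> l _; rewrite /Q delX wuZ -wuE (w_alt (k := ord0) (l := lift ord0 l)) ?neq_lift ?scaler0 //.
by rewrite ff_cons0 ff_consS ffunE.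
Qed.
Lemma d_std i a b0 (b : {ffun 'I_i -> pd_ring B}) : d i (std a b0 b) = 0.
Proof. by rewrite dw fmap_cons w_del_std. Qed.
Lemma d_sec i v : d i (sec i v) = 0.
Proof.
apply: (om_poly_ext xb_poly (h := d i \o sec i) (h' := zadd _ _)) => a m t.
by rewrite /= [sec _ _](sec_std a m t) d_std.
Qed.
(** As standard forms are closed, the argument is the differential of P times a standard form, and
    [Th] kills differentials. *)
Lemma std_exact0 i a b0 (b : {ffun 'I_i -> pd_ring B}) P :
  Th i.+1 ((f a * b0 ^+ p * \prod_(l < i) b l ^+ p.-1) *: w (ff_cons (del P) (fmap_ff del b))) = 0.
Proof.
set C := _ * _; pose T := fmap_ff del b; pose wu := wupd (ff_cons 0 T) ord0.
have wuE v : w (ff_cons v T) = wu v by rewrite -(upd_cons T 0).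
have wuZ c v : wu (c *: v) = c *: wu v by apply: linearZ.
have wuD u v : wu (u + v) = wu u + wu v by apply: raddfD.
rewrite -[RHS](Th_d ((C * P) *: w T)) dw fmap_cons delM; congr (Th _ _).
by rewrite !wuE wuD !wuZ -!wuE w_del_std scaler0 addr0.
Qed.

Definition Ps i a b0 (b : {ffun 'I_i -> pd_ring B}) j v : Om i ltriple :=
  Th i ((f a * b0 ^+ p * \prod_(l < i | l != j) b l ^+ p.-1) *: w (upd (fmap_ff del b) j v)).
Lemma PsD i a b0 (b : {ffun 'I_i -> pd_ring B}) j : {morph Ps a b0 b j : u v / u + v}.
Proof.
case: i b j => [|i] b j u v; first by case: j.
pose wu := wupd (fmap_ff del b) j.
by rewrite /Ps -[w (upd _ _ (u + v))]/(wu (u + v)) (raddfD wu) scalerDr raddfD.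
Qed.
(** For the first slot this is [std_exact0]; any other slot is moved there by a transposition, at
    the cost of a sign. *)
Lemma Ps_del i a b0 (b : {ffun 'I_i -> pd_ring B}) j P : Ps a b0 b j (del P) = 0.
Proof.
case: i b j => [|i] b j; first by case: j.
have H0 (c : {ffun 'I_i.+1 -> pd_ring B}) : Ps a b0 c ord0 (del P) = 0.
  rewrite /Ps [fmap_ff del c]ff_cons_eta upd_cons big_mkcond big_ord_recl /= mul1r.
  rewrite -[RHS](std_exact0 a b0 (ff_tl c) P); congr (Th _ (_ *: w (ff_cons _ _))).
    by congr (_ * _); apply: eq_bigr => l _; rewrite ffunE.
  by apply/ffunP => l; rewrite !ffunE.
have [->|j0] := eqVneq j ord0; first exact: H0.
rewrite -oppr0 -(H0 (swap ord0 j b)) /Ps -raddfN -scalerN; congr (Th _ (_ *: _)).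
  congr (_ * _); rewrite (reindex_inj (@perm_inj _ (tperm ord0 j))).
  apply: eq_big => [l|l _]; last by rewrite ffunE.
  by rewrite -[X in _ != X](tpermL ord0 j) (inj_eq perm_inj).
have j0' : ord0 != j by rewrite eq_sym.
rewrite -(is_alternating_swap (wU _).1 j0' _).2; congr w; apply/ffunP => l; rewrite !ffunE tpermK.
have -> : (tperm ord0 j l == ord0) = (l == j) by rewrite -(inj_eq (@perm_inj _ (tperm ord0 j)) l j) tpermR.
by [].
Qed.

Definition Phi i a b0 (b : {ffun 'I_i -> pd_ring B}) := Th i (std a b0 b).
Lemma Phi_Ps i a b0 (b : {ffun 'I_i -> pd_ring B}) j u :
  Phi a b0 (upd b j u) = Ps a b0 b j (u ^+ p.-1 *: del u).
Proof.
case: i b j => [|i] b j; first by case: j.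
pose wu := wupd (fmap_ff del b) j; have wuZ c v : wu (c *: v) = c *: wu v by apply: linearZ.
rewrite /Phi /Ps /std -[w (upd _ j (_ *: _))]/(wu _) wuZ scalerA fmap_upd; congr (Th _ (_ *: _)).
rewrite (bigD1 j) //= ffunE eqxx [u ^+ _ * _]mulrC mulrA; congr (_ * _ * _).
by apply: eq_bigr => l lj; rewrite ffunE (negbTE lj).
Qed.

(** The form (u + v)^(p-1) d(u + v) differs from u^(p-1) du + v^(p-1) dv by dP, where P is the
    integral polynomial ((u + v)^p - u^p - v^p) / p; its coefficients are the [c k]. Exact entries
    are killed by [Ps_del]. *)
Lemma PhiDj i a b0 (b : {ffun 'I_i -> pd_ring B}) j : {morph (fun u => Phi a b0 (upd b j u)) : u v / u + v}.
Proof.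
move=> u v; rewrite !Phi_Ps.
have [P ->] : exists P, (u + v) ^+ p.-1 *: del (u + v) =
    u ^+ p.-1 *: del u + v ^+ p.-1 *: del v + del P.
  have q_pr : prime p.-1.+1 by rewrite prednK // prime_gt0.
  move: (p.-1) q_pr => q q_pr.
  pose c k := ('C(q.+1, k.+1) %/ q.+1)%N.
  have cE k : (k < q)%N -> (q.+1 * c k = 'C(q.+1, k.+1))%N.
    by move=> kq; rewrite mulnC divnK // prime_dvd_bin.
  have c1 k : (k < q)%N -> (k.+1 * c k = 'C(q, k))%N.
    move=> kq; apply/eqP; rewrite -(eqn_pmul2l (ltn0Sn q)) mulnCA cE //.
    by have := mul_bin_diag q.+1 k; rewrite /= => ->.
  have c2 k : (k < q)%N -> ((q - k) * c k = 'C(q, k.+1))%N.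
    move=> kq; apply/eqP; rewrite -(eqn_pmul2l (ltn0Sn q)) mulnCA cE //.
    by have := mul_bin_down q.+1 k.+1; rewrite /= subSS => ->.
  exists (\sum_(k < q) (u ^+ k.+1 * v ^+ (q - k)) *+ c k).
  have -> : del (\sum_(k < q) (u ^+ k.+1 * v ^+ (q - k)) *+ c k) =
      (\sum_(k < q) v ^+ (q - k) * u ^+ k *+ 'C(q, k)) *: del u +
      (\sum_(k < q) v ^+ (q - k.+1) * u ^+ k.+1 *+ 'C(q, k.+1)) *: del v.
    rewrite !scaler_suml -big_split del_sum; apply: eq_bigr => k _ /=.
    rewrite delMn delM !delX !scalerA mulrnDl addrC !scalerMnl; congr (_ *: _ + _ *: _).
      by rewrite mulrnAr -mulrnA c2 ?ltn_ord // subnS mulrC.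
    by rewrite mulrnAr -mulrnA c1 ?ltn_ord.
  rewrite delD scalerDr; have e1 := exprDn v u q; have e2 := e1.
  rewrite big_ord_recr /= subnn expr0 mul1r binn mulr1n in e1.
  rewrite big_ord_recl /= subn0 expr0 mulr1 bin0 mulr1n in e2.
  rewrite [u + v]addrC {1}e1 e2 !scalerDl [X in X + _ = _]addrC; exact: addrACA.
by rewrite !PsD Ps_del addr0.
Qed.
(** On the PD-ideal u^(p-1) du is the differential of (p-1)! gamma_p(u). Hence [Phi] depends only on
    the classes of the entries in the quotient ring. *)
Lemma PhiJj i a b0 (b : {ffun 'I_i -> pd_ring B}) j u : pd_pi B u = 0 -> Phi a b0 (upd b j u) = 0.
Proof.
move=> u0; rewrite Phi_Ps; have p1 := prime_gt1 p_pr.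
have -> : u ^+ p.-1 *: del u = del (pd_gamma B p u *+ p.-1`!).
  have pE : p.-1.+1 = p by rewrite prednK // prime_gt0.
  by rewrite delMn -[X in pd_gamma B X u]pE delG // pd_exp_gamma // scalerMnl.
exact: Ps_del.
Qed.
Lemma PhiMj i a b0 (b : {ffun 'I_i -> pd_ring B}) j u v : Phi a b0 (upd b j (u * v)) =
  Phi a (b0 * u) (upd b j v) + Phi a (b0 * v) (upd b j u).
Proof.
have PsZ a' b0' c m : Ps a' b0' b j (c *: m) =
    Th i ((f a' * b0' ^+ p * \prod_(l < i | l != j) b l ^+ p.-1 * c) *: w (upd (fmap_ff del b) j m)).
  case: i b j => [|i'] b' j'; first by case: j'.
  pose wu := wupd (fmap_ff del b') j'.
  have wuZ : wu (c *: m) = c *: wu m by apply: linearZ.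
  by rewrite -scalerA -[w _]/(wu m) -wuZ.
rewrite !Phi_Ps delM scalerDr PsD !scalerA !PsZ.
have pE (c : pd_ring B) : c ^+ p = c ^+ p.-1 * c by rewrite -exprSr prednK // prime_gt0.
by congr (Th _ (_ *: _) + Th _ (_ *: _)); rewrite !exprMn ?(pE u) ?(pE v); ring.
Qed.
Lemma PhiCj i a b0 (b : {ffun 'I_i -> pd_ring B}) j c : Phi a b0 (upd b j (f c)) = 0.
Proof.
rewrite Phi_Ps delC scaler0; exact: (raddf0 (mkadd (PsD a b0 b j))).
Qed.
Lemma PhiD0 i a (b : {ffun 'I_i -> pd_ring B}) : {morph (fun b0 => Phi a b0 b) : u v / u + v}.
Proof. by move=> u v; rewrite /Phi /std pd_expD // mulrDr mulrDl scalerDl raddfD. Qed.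
Lemma PhiDa i b0 (b : {ffun 'I_i -> pd_ring B}) : {morph (fun a => Phi a b0 b) : u v / u + v}.
Proof. by move=> u v; rewrite /Phi /std rmorphD !mulrDl scalerDl raddfD. Qed.
Lemma PhiJ0 i a b0 (b : {ffun 'I_i -> pd_ring B}) : pd_pi B b0 = 0 -> Phi a b0 b = 0.
Proof. by move=> h; rewrite /Phi /std pd_ideal_exp // mulr0 mul0r scale0r raddf0. Qed.
Lemma Phi_c0 i a b0 b0' (b : {ffun 'I_i -> pd_ring B}) : pd_pi B b0 = pd_pi B b0' ->
  Phi a b0 b = Phi a b0' b.
Proof.
move=> e; rewrite -[b0](subrK b0') PhiD0 PhiJ0 ?add0r // rmorphB e subrr //.
Qed.
Lemma Phi_cj i a b0 (b : {ffun 'I_i -> pd_ring B}) j u v : pd_pi B u = pd_pi B v ->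
  Phi a b0 (upd b j u) = Phi a b0 (upd b j v).
Proof.
move=> e; rewrite -[u](subrK v) PhiDj PhiJj ?add0r // rmorphB e subrr //.
Qed.
Lemma Phi_congr i a b0 b0' (b b' : {ffun 'I_i -> pd_ring B}) : pd_pi B b0 = pd_pi B b0' ->
  (forall j, pd_pi B (b j) = pd_pi B (b' j)) -> Phi a b0 b = Phi a b0' b'.
Proof.
move=> e0 e; rewrite (Phi_c0 _ _ e0).
by apply: (ff_congr (R := fun u v => pd_pi B u = pd_pi B v)) => // t j u v; apply: Phi_cj.
Qed.

(** The rules for [Phi] make it a datum on the quotient ring, so it factors through [Om]. The
    induced map is the identity on the generators in the variables, by [Th_sec], hence
    everywhere. *)
Theorem cartier_std i a b0 (b : {ffun 'I_i -> pd_ring B}) : Th i (std a b0 b) =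
  om (t := ltriple) a (pd_pi B b0) (fmap_ff (pd_pi B) b).
Proof.
have [la laK] := choice (@pd_surj p B).
pose mu a (c0 : pd_quo B) (c : {ffun 'I_i -> pd_quo B}) := Phi a (la c0) (fmap_ff la c).
have muP : fdatum (tphi ltriple) (tio ltriple) mu.
  split.
  - by move=> c0 c u v; apply: PhiDa.
  - move=> a' c u v; rewrite /mu -PhiD0; apply: Phi_c0; by rewrite rmorphD !laK.
  - move=> c a' c0 c'; rewrite /mu; have [c1 <-] := pd_surj c.
    have e : pd_pi B (la (tio ltriple (pd_pi A c1) * c0)) = pd_pi B (f c1 * la c0).
      by rewrite rmorphM !laK -pm_pi.
    rewrite (Phi_c0 _ _ e).
    rewrite /Phi /std [tphi _ _](pd_frobE p_pr c1) rmorphM rmorphXn exprMn; congr (Th _ (_ *: _)).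
    ring.
  - move=> a' c0 c j u v; rewrite /mu !fmap_upd -PhiDj; apply: Phi_cj.
    by rewrite rmorphD !laK.
  - move=> a' c0 c j u v; rewrite /mu !fmap_upd.
    have e : pd_pi B (la (u * v)) = pd_pi B (la u * la v) by rewrite rmorphM !laK.
    rewrite (Phi_cj _ _ _ _ e).
    by rewrite PhiMj; congr (_ + _); apply: Phi_c0; rewrite rmorphM !laK.
  - move=> a' c0 c j c1; rewrite /mu !fmap_upd; have [c2 <-] := pd_surj c1.
    have e : pd_pi B (la (tio ltriple (pd_pi A c2))) = pd_pi B (f c2) by rewrite laK [LHS]pm_pi.
    rewrite (Phi_cj _ _ _ _ e).
    exact: PhiCj.
  - move=> a' c0 c l m lm e; rewrite /mu /Phi /std (w_alt lm) ?scaler0 ?raddf0 //.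
    by rewrite !ffunE e.
rewrite -[LHS]/(Phi a b0 b).
have -> : Phi a b0 b = om_lift muP (om (t := ltriple) a (pd_pi B b0) (fmap_ff (pd_pi B) b)).
  by rewrite om_liftE; apply: Phi_congr => [|j]; rewrite ?ffunE laK ?ffunE.
apply: (om_poly_ext xb_poly (h' := idfun)) => a' v t.
rewrite om_liftE -[RHS]Th_sec [sec _ _](sec_std a' v t); apply: Phi_congr => [|j].
  rewrite laK /pmon (rmorph_mprod (pd_pi B)); apply: eq_bigr => l _; by rewrite rmorphXn.
by rewrite !ffunE laK.
Qed.

Lemma sec_ext i (N : zmodType) (u u' : {additive Wm i -> N}) :
  (forall a b0 b, u (std a b0 b) = u' (std a b0 b)) -> forall v, u (sec i v) = u' (sec i v).
Proof.
move=> e; apply: (om_poly_ext xb_poly (h := u \o sec i) (h' := u' \o sec i)) => a m t.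
by rewrite /= [sec _ _](sec_std a m t).
Qed.
End Level.

Definition bdy (V : nat -> zmodType) (d : forall j, {additive V j -> V j.+1}) j : V j -> Prop :=
  match j return V j -> Prop with
  | 0%N => fun v => v = 0
  | j'.+1 => fun v => exists u, v = d j' u
  end.

(** The variables are hidden from here on: different simplicial degrees have unrelated variables,
    and only their existence and facts stated without them are passed on. [csec_ext] says that the
    image of [csec] is generated by standard forms. *)
Record cartier_data p (p_pr : prime p) (A B : pdPair p) (f : pdMor A B) (M : lmodType (pd_ring B))
    (del : pd_ring B -> M) (Wm : nat -> lmodType (pd_ring B))
    (w : forall i, {ffun 'I_i -> M} -> Wm i) (d : forall i, {additive Wm i -> Wm i.+1}) := CartierData {
  cth : forall i, {additive Wm i -> Om i (ltriple p_pr f)};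
  csec : forall i, {additive Om i (ltriple p_pr f) -> Wm i};
  cth_d : forall i v, cth i.+1 (d i v) = 0;
  cclosed : forall i v, d i v = 0 -> bdy d (v - csec i (cth i v));
  cth_sec : forall i v, cth i (csec i v) = v;
  cd_sec : forall i v, d i (csec i v) = 0;
  cth_std : forall i a b0 (b : {ffun 'I_i -> pd_ring B}), cth i (std f del w a b0 b) =
    om (t := ltriple p_pr f) a (pd_pi B b0) (fmap_ff (pd_pi B) b);
  csec_ext : forall i (N : zmodType) (u u' : {additive Wm i -> N}),
    (forall a b0 b, u (std f del w a b0 b) = u' (std f del w a b0 b)) ->
    forall v, u (csec i v) = u' (csec i v);
  cpoly : exists (V : choiceType) (x : V -> tE (ltriple p_pr f)), poly_on (tio (ltriple p_pr f)) x }.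

Lemma cartier_exists p (p_pr : prime p) (A B : pdPair p) (f : pdMor A B) (M : lmodType (pd_ring B))
    (del : pd_ring B -> M) (Wm : nat -> lmodType (pd_ring B))
    (w : forall i, {ffun 'I_i -> M} -> Wm i) (d : forall i, {additive Wm i -> Wm i.+1}) :
  is_pd_free A -> is_pd_free_over f -> is_initial_map (@is_pd_derivation p A B f) del ->
  (forall i, is_exterior_power (@w i)) ->
  (forall i b (t : {ffun 'I_i -> pd_ring B}),
    d i (b *: w i (fmap_ff del t)) = w i.+1 (fmap_ff del (ff_cons b t))) ->
  inhabited (cartier_data p_pr f del w d).
Proof.
move=> Af [X0 [Y0 [x [y Bf]]]] delU wU dw.
pose X : choiceType := {classic X0}; pose Y : choiceType := {classic Y0}.
have Bf' : @pd_free_on p A B f X Y x y by exact: Bf.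
constructor; apply: (@CartierData p p_pr A B f M del Wm w d
  (Th p_pr Af Bf' delU wU) (sec p_pr Af Bf' delU wU)).
- by move=> i v; apply: Th_d.
- move=> i v v0; rewrite {1}(Th_closed p_pr Af Bf' delU wU dw v0) addrC addKr.
  by case: i v {v0} => [|i] v //; exists (hh p (gform_universal p_pr Af Bf' delU wU) i v).
- by move=> i v; apply: Th_sec.
- by move=> i v; apply: d_sec.
- by move=> i a b0 b; apply: cartier_std.
- by move=> i N u u'; apply: sec_ext.
- by exists X, (fun s : X => pd_pi B (x s)); exact: (pd_free_quo Bf').
Qed.

(** * Simplicial modules and total complexes *)

Lemma dep_choice (T : Type) (U : T -> Type) (Q : forall x, U x -> Prop) :
  (forall x, exists y, Q x y) -> exists f : forall x, U x, forall x, Q x (f x).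
Proof. by move=> h; exists (fun x => projT1 (cid (h x))) => x; apply: projT2 (cid (h x)). Qed.

Section ChainMorphism.
Variables (X : chain) (n : nat).
Lemma cd_add x y : cd X n (x + y) = cd X n x + cd X n y. Proof. exact: raddfD. Qed.
Lemma cd_opp x : cd X n (- x) = - cd X n x. Proof. exact: raddfN. Qed.
Lemma cd_mulz x z : cd X n (x *~ z) = cd X n x *~ z. Proof. exact: raddfMz. Qed.
End ChainMorphism.

Section SimplicialModules.
Variables (S : sring).

Definition sm_sact (M : smod S) : sact :=
  @SAct (fun n => M n) (fun m n t => mkadd (@sm_mapD S M m n t)) (@sm_map_id S M) (@sm_map_comp S M).

Lemma bdry_altsum (X : sact) n (x : X n.+1) :
  bdry (fun m n t => sac X t) x = cd (sschain (sact_sgrp X)) n x.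
Proof.
by apply: eq_bigr => a _; rewrite /= /cofc inord_val.
Qed.

Definition sm_chain (M : smod S) : chain := sschain (sact_sgrp (sm_sact M)).
Lemma sm_bdry (M : smod S) n (x : M n.+1) : bdry (@sm_map S M) x = cd (sm_chain M) n x.
Proof. exact: (bdry_altsum (X := sm_sact M)). Qed.
End SimplicialModules.

Section Put.
Variables (V : nat -> zmodType) (i : nat).
(** The family with c in degree i and 0 elsewhere; the cast along i = j is confined to this
    definition. *)
Definition put (c : V i) j : V j := match i =P j with ReflectT e => ecast k (V k) e c | ReflectF _ => 0 end.
Lemma put_eq c : put c i = c.
Proof. by rewrite /put; case: eqP => // e; rewrite eq_axiomK. Qed.
Lemma put_ne c j : j <> i -> put c j = 0.
Proof. by rewrite /put; case: eqP => // e /(_ (esym e)). Qed.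
Lemma put0 j : put 0 j = 0.
Proof. by rewrite /put; case: eqP => // e; case: j / e. Qed.
End Put.

Section Total.
Variables (S : sring) (C : scpx S).

(** The incoming differential in degree j, phrased so that the degree j - 1 never has to be
    written. *)
Definition pd_of n (v : forall j, C j n) j : C j n :=
  match j with 0%N => 0 | j'.+1 => sc_d C j' n (v j') end.

Lemma pd_ofD n (v v' : forall j, C j n) j :
  pd_of (fun j => v j + v' j) j = pd_of v j + pd_of v' j.
Proof. by case: j => [|j] /=; rewrite ?addr0 ?linearD. Qed.
Lemma pd_ofB n (v v' : forall j, C j n) j :
  pd_of (fun j => v j - v' j) j = pd_of v j - pd_of v' j.
Proof. by case: j => [|j] /=; rewrite ?subrr ?linearB. Qed.
Lemma pd_of0 n (v : forall j, C j n) j : (forall l, l.+1 = j -> v l = 0) -> pd_of v j = 0.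
Proof. by case: j => [|j] //= h; rewrite h ?linear0. Qed.
Lemma pd_ofz n (v : forall j, C j n) j z : pd_of (fun j => v j *~ z) j = pd_of v j *~ z.
Proof. by case: j => [|j] /=; rewrite ?mul0rz // raddfMz. Qed.
Lemma sc_d_cd j n (x : C j n.+1) :
  sc_d C j n (cd (sm_chain (C j)) n x) = cd (sm_chain (C j.+1)) n (sc_d C j n.+1 x).
Proof.
rewrite -!sm_bdry /bdry raddf_sum; apply: eq_bigr => a _ /=.
by rewrite raddfMz /= sc_d_nat.
Qed.
Lemma pd_of_cd n (v : forall j, C j n.+1) j :
  pd_of (fun j => cd (sm_chain (C j)) n (v j)) j = cd (sm_chain (C j)) n (pd_of v j).
Proof.
case: j => [|j] /=; last exact: sc_d_cd.
by rewrite (raddf0 (cd (sm_chain (C 0%N)) n)).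
Qed.
Lemma tot_dE (x : tot_family C) n j :
  tot_d x n j = cd (sm_chain (C j)) n (x n.+1 j) + pd_of (x n) j *~ (-1) ^+ n.
Proof. by rewrite /tot_d sm_bdry; case: j => [|j] //=; rewrite mul0rz. Qed.
End Total.

Lemma signz_sqr (V : zmodType) (x : V) n : x *~ (-1) ^+ n *~ (-1) ^+ n = x.
Proof. by rewrite -mulrzA -expr2 sqrr_sign mulr1z. Qed.

Section TotalQis.
Variables (S : sring) (C D : scpx S) (F : scMor C D) (i : nat) (O : chain).
Variables (q : chmap (sm_chain (C i)) O) (r : chmap O (sm_chain (D i))).
Hypothesis FE : forall n x, F i n x = r n (q n x).
Hypothesis q_surj : forall n o, exists x, q n x = o.
Hypothesis C0 : forall j n (x : C j n), j <> i -> j.+1 <> i -> x = 0.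
Hypothesis D0 : forall j n (x : D j n), j <> i -> x = 0.
Hypothesis q_pd : forall n (v : forall j, C j n), q n (pd_of v i) = 0.
Hypothesis q_ker : forall n x, q n x = 0 -> exists v : forall j, C j n, x = pd_of v i.
Hypothesis pd_inj : forall n (v : forall j, C j n), pd_of v i = 0 -> forall j, j.+1 = i -> v j = 0.
Hypothesis r_hiso : hiso r.
Local Notation dC j n := (cd (sm_chain (C j)) n).
Local Notation dD j n := (cd (sm_chain (D j)) n).

Lemma pd_ofD0 n (v : forall j, D j n) : pd_of v i = 0.
Proof. by apply: pd_of0 => l li; apply: D0 => e; move: li; rewrite e; lia. Qed.

Lemma ker_lift n x : q n x = 0 -> exists v : forall j, C j n,
  [/\ x = pd_of v i, forall j, j.+1 <> i -> v j = 0 & x = 0 -> forall j, v j = 0].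
Proof.
move=> /q_ker [v xv].
pose v' j : C j n := if j.+1 == i then v j else 0.
have v'0 j : j.+1 <> i -> v' j = 0 by rewrite /v'; case: eqP.
have xv' : x = pd_of v' i.
  by rewrite xv /v'; case: i => [|i'] //=; rewrite eqxx.
exists v'; split=> // x0 j; have [e|e] := eqVneq j.+1 i; last by apply: v'0; apply/eqP.
by apply: pd_inj e; rewrite -xv'.
Qed.

Lemma surj_lift n o : exists x, q n x = o /\ (o = 0 -> x = 0).
Proof.
have [->|o0] := eqVneq o 0; first by exists 0; rewrite raddf0.
by have [x xo] := q_surj o; exists x; split=> // e; rewrite e eqxx in o0.
Qed.

(** C lives in degrees i - 1 and i, and its differential is injective with cokernel O; so the total
    complex of C has the homology of O, which r compares with D. All lifts are chosen to be 0 for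
    the element 0, which keeps the families finitely supported. *)
Theorem total_qis : sc_qis F.
Proof.
split=> [x [[N xN] xc] [z [_ xz]]|y [[N yN] yc]].
- have xci n : dC i n (x n.+1 i) + pd_of (x n) i *~ (-1) ^+ n = 0 by rewrite -tot_dE xc.
  have quc n : cyc (q n (x n i)).
    case: n => // n /=; rewrite -(cmd q).
    have /eqP := xci n; rewrite addr_eq0 => /eqP ->.
    by rewrite raddfN raddfMz /= q_pd mul0rz oppr0.
  have /dep_choice [ut utE] n : exists u : C i n.+1,
      q n (x n i - dC i n u) = 0 /\ (x n i = 0 -> u = 0).
    have [u0|u0] := eqVneq (x n i) 0.
      by exists 0; split=> //; rewrite (raddf0 (dC i n)) u0 subr0 raddf0.
    have [|o oE] := (r_hiso n).1 _ (quc n).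
      exists (z n.+1 i); rewrite -FE xz tot_dE pd_ofD0 mul0rz addr0 //.
    have [u uo] := q_surj o; exists u; split=> [|e]; last by rewrite e eqxx in u0.
    by rewrite raddfB /= (cmd q) [q _ _]uo oE subrr.
  have /dep_choice [V VE] n := ker_lift (utE n).1.
  pose pu n : C i n := match n with 0%N => 0 | m.+1 => ut m end.
  (* The sign cancels the one that [tot_d] puts on the differential of C. *)
  pose z' : tot_family C := fun n j => put (V := fun j => C j n) (pu n) j + V n j *~ (-1) ^+ n.
  exists z'; split.
    exists N.+1 => n j nj; rewrite /z'.
    have -> : V n j = 0.
      have [Nn|Nn] := leqP N n.
        have [_ _ h] := VE n; apply: h; rewrite xN ?Nn // (utE n).2 ?xN ?Nn //.
        by rewrite (raddf0 (dC i n)) subr0.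
      have [e|e] := eqVneq j.+1 i; last by have [_ h _] := VE n; apply: h; apply/eqP.
      have xi : x n i = 0 by apply: xN; apply/orP; right; lia.
      by have [_ _ h] := VE n; apply: h; rewrite xi (utE n).2 // (raddf0 (dC i n)) subr0.
    rewrite mul0rz addr0.
    have [ji|ji] := eqVneq j i; last by apply: put_ne; apply/eqP.
    have -> : pu n = 0; last exact: put0.
    case: n nj => //= n nj; apply: (utE n).2; apply: xN; lia.
  have z'i n : x n i = tot_d z' n i.
    have [h1 h2 _] := VE n; rewrite tot_dE /z' put_eq /=.
    have [_ h2' _] := VE n.+1; rewrite h2'; last lia.
    rewrite mul0rz addr0 pd_ofD pd_ofz pd_of0 ?add0r ?signz_sqr -?h1; last first.
      move=> l li; apply: put_ne; lia.
    by rewrite addrC subrK.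
  move=> n j; have [->|ji] := eqVneq j i; first exact: z'i.
  have [e|e] := eqVneq j.+1 i; last by rewrite [LHS]C0 ?[RHS]C0 //; apply/eqP.
  have pd0 : pd_of (z' n) j = 0.
    apply: pd_of0 => l lj; rewrite /z' put_ne; last lia.
    have [_ h _] := VE n; rewrite h ?mul0rz ?addr0 //; lia.
  rewrite tot_dE pd0 mul0rz addr0.
  apply/eqP; rewrite -subr_eq0; apply/eqP.
  apply: (pd_inj (v := fun j => x n j - dC j n (z' n.+1 j))) e.
  have -> : pd_of (fun j => x n j - dC j n (z' n.+1 j)) i = pd_of (x n) i - dC i n (pd_of (z' n.+1) i).
    by rewrite -pd_of_cd -pd_ofB.
  have h := xci n; rewrite (z'i n.+1) tot_dE cd_add cdd add0r cd_mulz exprS mulN1r mulrNz in h.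
  rewrite addrC -mulrzBl in h; by rewrite -[LHS](signz_sqr _ n) h mul0rz.
- have yci n : cyc (X := sm_chain (D i)) (y n i).
    case: n => // n /=; have := yc n i; rewrite tot_dE pd_ofD0 mul0rz addr0 //.
  have /dep_choice [o oE] n : exists o : O n, [/\ cyc o, exists w, y n i = r n o + dD i n w &
      y n i = 0 -> o = 0].
    have [y0|y0] := eqVneq (y n i) 0.
      exists 0; split=> //; first by case: n {y0} => //= n; rewrite raddf0.
      by exists 0; rewrite y0 raddf0 (raddf0 (dD i n)) addr0.
    have [o [oc ow]] := (r_hiso n).2 _ (yci n); exists o; split=> // e.
    by rewrite e eqxx in y0.
  have /dep_choice [w wE] n : exists w, y n i = r n (o n) + dD i n w /\ (y n i = 0 -> w = 0).
    have [_ [w wE] o0] := oE n; have [y0|y0] := eqVneq (y n i) 0.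
      by exists 0; split=> //; rewrite o0 // y0 raddf0 (raddf0 (dD i n)) addr0.
    by exists w; split=> // e; rewrite e eqxx in y0.
  have /dep_choice [u uE] n := surj_lift (o n).
  have u0 n : (N <= n)%N || (N <= i)%N -> u n = 0.
    move=> h; apply: (uE n).2; have [_ _ h'] := oE n; apply: h'; exact: yN.
  have qdu n : q n (dC i n (u n.+1)) = 0.
    by rewrite (cmd q) (uE n.+1).1; have [h _ _] := oE n.+1.
  have /dep_choice [V VE] n := ker_lift (qdu n).
  pose x : tot_family C := fun n j => put (V := fun j => C j n) (u n) j - V n j *~ (-1) ^+ n.
  have Vi n : V n i = 0 by have [_ h _] := VE n; apply: h; lia.
  exists x; split; [split|].
  + exists N.+1 => n j nj; rewrite /x.
    have -> : V n j = 0.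
      have [e|e] := eqVneq j.+1 i; last by have [_ h _] := VE n; apply: h; apply/eqP.
      have [_ _ h] := VE n; apply: h; rewrite u0 ?(raddf0 (dC i n)) //; lia.
    rewrite mul0rz subr0; have [ji|ji] := eqVneq j i; last by apply: put_ne; apply/eqP.
    by rewrite u0 ?put0 //; lia.
  + have pdx n : pd_of (x n) i = - (pd_of (V n) i *~ (-1) ^+ n).
      rewrite /x pd_ofB pd_ofz pd_of0 ?sub0r // => l li; apply: put_ne; lia.
    move=> n j; rewrite tot_dE.
    have [->|ji] := eqVneq j i.
      rewrite pdx mulNrz signz_sqr {1}/x put_eq Vi mul0rz subr0.
      by have [<- _ _] := VE n; rewrite subrr.
    have [e|e] := eqVneq j.+1 i; last by apply: C0; apply/eqP.
    rewrite pd_of0 => [|l lj]; last first.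
      rewrite /x put_ne; last lia.
      by have [_ h _] := VE n; rewrite h ?mul0rz ?subr0 //; lia.
    rewrite mul0rz addr0; apply: (pd_inj (v := fun j => dC j n (x n.+1 j))) e.
    rewrite pd_of_cd pdx cd_opp cd_mulz.
    by have [<- _ _] := VE n.+1; rewrite cdd mul0rz oppr0.
  pose pw n : D i n := match n with 0%N => 0 | m.+1 => w m end.
  exists (fun n j => put (V := fun j => D j n) (pw n) j); split.
    exists N.+1 => n j nj; have [ji|ji] := eqVneq j i; last by apply: put_ne; apply/eqP.
    have -> : pw n = 0; last exact: put0.
    case: n nj => //= n nj; apply: (wE n).2; apply: yN; lia.
  move=> n j; have [->|ji] := eqVneq j i; last by rewrite [LHS]D0 ?[RHS]D0 //; apply/eqP.
  rewrite tot_dE pd_ofD0 mul0rz addr0 put_eq /x put_eq Vi mul0rz subr0 FE (uE n).1.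
  exact: (wE n).1.
Qed.
End TotalQis.

(** * Simplicial rings, tensor products and Frobenius triples *)

Section SimplicialRings.

Lemma samor_bij_hiso (X Y : sact) (f : samor X Y) :
  (forall n, bijective (f n)) -> hiso (sschmap (samor_smap f)).
Proof. by move=> fb; apply: hiso_bij => n; have [g gK Kg] := fb n; exists g. Qed.

Lemma samor_hiso_conj (X Y X' Y' : sact) (f : samor X Y) (f' : samor X' Y')
    (u : samor X X') (v : samor Y Y') :
  (forall n, bijective (u n)) -> (forall n, bijective (v n)) ->
  (forall n x, v n (f n x) = f' n (u n x)) ->
  hiso (sschmap (samor_smap f')) -> hiso (sschmap (samor_smap f)).
Proof.
move=> ub vb e hf'.
have hN m n (t : simplexMap m n) x : (v m \o f m) (sac X t x) = sac Y' t ((v n \o f n) x).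
  by rewrite /= !samE.
pose h : samor X Y' := @SAMor X Y' (fun n => v n \o f n) hN.
have hh : hiso (sschmap (samor_smap h)).
  by apply: (hiso_comp _ (samor_bij_hiso ub) hf') => n x; apply: e.
exact: (hiso_cancel_l (g := sschmap (samor_smap v)) _ hh (samor_bij_hiso vb)).
Qed.

Definition sr_sact (R : sring) : sact :=
  @SAct (fun n => R n) (fun m n t => sr_map R t) (@sr_map_id R) (@sr_map_comp R).
Definition sr_samor (R R' : sring) (g : srMor R R') : samor (sr_sact R) (sr_sact R') :=
  @SAMor (sr_sact R) (sr_sact R') (fun n => g n) (@srm_nat R R' g).
Definition sr_hiso (R R' : sring) (g : srMor R R') : Prop := hiso (sschmap (samor_smap (sr_samor g))).

Lemma sr_bdry_cd (R : sring) n (x : R n.+1) :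
  sr_bdry x = cd (sschain (sact_sgrp (sr_sact R))) n x.
Proof. exact: (bdry_altsum (X := sr_sact R)). Qed.
Lemma sr_cycle_cyc (R : sring) n (x : R n) :
  sr_cycle x <-> cyc (X := sschain (sact_sgrp (sr_sact R))) x.
Proof. by case: n x => // n x; rewrite /sr_cycle sr_bdry_cd. Qed.
Lemma sr_weq_hiso (R R' : sring) (g : srMor R R') : sr_weq g -> sr_hiso g.
Proof.
move=> h n; have [h1 h2] := h n; split=> [x xc [z zE]|y yc].
  have [|z' ->] := h1 x (proj2 (sr_cycle_cyc _) xc); first by exists z; rewrite sr_bdry_cd -zE.
  by exists z'; rewrite sr_bdry_cd.
have [x [xc [z ->]]] := h2 y (proj2 (sr_cycle_cyc _) yc).
by exists x; split; [apply/sr_cycle_cyc|exists z; rewrite sr_bdry_cd].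
Qed.
End SimplicialRings.

Section TensorGenerators.
Variables (K L M T : comPzRingType) (i : {rmorphism K -> L}) (j : {rmorphism K -> M})
  (u : {rmorphism L -> T}) (v : {rmorphism M -> T}) (uv : is_tensor i j u v).
Variable U : {pred T}.
Hypothesis Uc : subring_closed U.
HB.instance Definition _ := GRing.isSubringClosed.Build T U Uc.
Record tsub := TSub { tsub_val : T; tsub_valP : tsub_val \in U }.
HB.instance Definition _ := [isSub for tsub_val].
HB.instance Definition _ := [Choice of tsub by <:].
HB.instance Definition _ := GRing.SubChoice_isSubComPzRing.Build T _ tsub Uc.

(** The universal property gives a map from T to the subring, and by uniqueness its composite with
    the inclusion is the identity of T. *)
Lemma tensor_generated : (forall x, u x \in U) -> (forall y, v y \in U) -> forall t, t \in U.
Proof.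
move=> Uu Uv; have [uvE uvU] := uv.
pose u' : L -> tsub := fun x => TSub (Uu x); pose v' : M -> tsub := fun x => TSub (Uv x).
have ua : {morph u' : x y / x + y} by move=> x y; apply: val_inj; apply: rmorphD.
have um : {morph u' : x y / x * y} by move=> x y; apply: val_inj; apply: rmorphM.
have u1 : u' 1 = 1 by apply: val_inj; apply: rmorph1.
have va : {morph v' : x y / x + y} by move=> x y; apply: val_inj; apply: rmorphD.
have vm : {morph v' : x y / x * y} by move=> x y; apply: val_inj; apply: rmorphM.
have v1 : v' 1 = 1 by apply: val_inj; apply: rmorph1.
have [c|h [hu hv] _] := uvU tsub (mkrm ua um u1) (mkrm va vm v1).
  by apply: val_inj; apply: uvE.
have [h0 _ hun] := uvU T u v uvE.
have e : (val : tsub -> T) \o h =1 h0.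
  apply: (hun ((val : {rmorphism tsub -> T}) \o h)) => x /=; rewrite ?hu ?hv //.
have e' : idfun =1 h0 by apply: (hun idfun).
by move=> t; rewrite -[t]/(idfun t) e' -e; apply: valP.
Qed.
End TensorGenerators.

Lemma poly_on_base_change (K L M T : comPzRingType) (i : {rmorphism K -> L}) (j : {rmorphism K -> M})
    (u : {rmorphism L -> T}) (v : {rmorphism M -> T}) (X : Type) (x : X -> M) :
  is_tensor i j u v -> poly_on j x -> poly_on u (fun s => v (x s)).
Proof.
move=> [uvE uvU] xP W g y.
have [h0 [h0C h0x] h0U] := xP W (g \o i) y.
have [c|h [hu hv] hU] := uvU W g h0; first by rewrite h0C.
exists h => [|h' h'u h'x]; first by split=> // s; rewrite hv h0x.
apply: hU => // m; apply: (h0U (h' \o v)) => [c|s] /=; last exact: h'x.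
by rewrite -uvE h'u.
Qed.

Section AlternatingMap.
Variables (B : comPzRingType) (M E : lmodType B) (i : nat) (w : {ffun 'I_i -> M} -> E).
Hypothesis wA : is_alternating w.
Lemma alt_updD x k : {morph (fun y => w (upd x k y)) : y z / y + z}.
Proof. by move=> y z; have := wA.1 x k 1 y z; rewrite !scale1r. Qed.
Lemma alt_updZ x k a y : w (upd x k (a *: y)) = a *: w (upd x k y).
Proof.
have w0 : w (upd x k 0) = 0 by exact: (raddf0 (mkadd (alt_updD x k))).
by have := wA.1 x k a y 0; rewrite addr0 => ->; rewrite [w (ff_upd _ _ 0)]w0 addr0.
Qed.
Lemma alt_upd0 x k : w (upd x k 0) = 0.
Proof. exact: (raddf0 (mkadd (alt_updD x k))). Qed.
End AlternatingMap.

Section FrobeniusTriples.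
Variables (p : nat) (p_pr : prime p).

Lemma pd_frob_nat (P P' : pdPair p) (g : pdMor P P') c : g (pd_frob c) = pd_frob (pm_quo g c).
Proof. by have [a <-] := pd_surj c; rewrite pm_pi !pd_frobE // rmorphXn. Qed.

Section Map.
Variables (A B A' B' : pdPair p) (f : pdMor A B) (f' : pdMor A' B') (g : pdMor A A') (h : pdMor B B').
Hypothesis gh : forall c, pm_quo h (pm_quo f c) = pm_quo f' (pm_quo g c).
Definition ltmor : tmor (ltriple p_pr f) (ltriple p_pr f') :=
  @TMor (ltriple p_pr f) (ltriple p_pr f') g (pm_quo g) (pm_quo h) (pd_frob_nat g) gh.
End Map.

Section Simplicial.
Variables (A B : sPDPair p) (f : sPDMor A B).
Definition ltriple_map m n (t : simplexMap m n) : tmor (ltriple p_pr (f n)) (ltriple p_pr (f m)) :=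
  ltmor (f := f n) (f' := f m) (g := sp_map A t) (h := sp_map B t) (fun c => esym (spm_quo_nat f t c)).
Fact ltriple_id n : teq (ltriple_map (simplex_id n)) (tidm _).
Proof. by split=> x; [apply: sp_map_id|apply: sp_quo_id|apply: sp_quo_id]. Qed.
Fact ltriple_comp l m n (t : simplexMap m n) (u : simplexMap l m) :
  teq (ltriple_map (simplex_comp t u)) (tcmp (ltriple_map t) (ltriple_map u)).
Proof. by split=> x; [apply: sp_map_comp|apply: sp_quo_comp|apply: sp_quo_comp]. Qed.
Definition sltriple : striple := STriple ltriple_id ltriple_comp.
End Simplicial.

Section Constant.
Variables (P : pdPair p) (Q : sAlg (pd_quo P)).
Definition ctriple n : triple := Triple (pd_frobm p_pr P) (sa_in Q n).
Definition ctriple_map m n (t : simplexMap m n) : tmor (ctriple n) (ctriple m) :=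
  @TMor (ctriple n) (ctriple m) idfun idfun (sr_map Q t) (fun _ => erefl) (sa_in_nat Q t).
Fact ctriple_id n : teq (ctriple_map (simplex_id n)) (tidm _).
Proof. by split=> x //; apply: sr_map_id. Qed.
Fact ctriple_comp l m n (t : simplexMap m n) (u : simplexMap l m) :
  teq (ctriple_map (simplex_comp t u)) (tcmp (ctriple_map t) (ctriple_map u)).
Proof. by split=> x //; apply: sr_map_comp. Qed.
Definition sctriple : striple := STriple ctriple_id ctriple_comp.
End Constant.
End FrobeniusTriples.

Lemma linear_scale (B : pzRingType) (U V : lmodType B) (h : {linear U -> V}) a x :
  h (a *: x) = a *: h x.
Proof. exact: linearZ. Qed.

(** * The comparison map of the graded piece *)

Section Comparison.
Variables (p : nat) (p_pr : prime p) (P : pdPair p)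
    (R : sAlg (pd_quo P)) (i : nat)
    (Z : crysResolution R)
    (S : frobPullback p_pr (spm_quo (cr_str Z)))
    (psi : frobLinearization S)
    (dR : pdDeRham (cr_str Z) psi)
    (gr : whiteheadGr (pr_cpx dR) (- i%:Z))
    (Q : cotResolution Z)
    (T : frobPullback p_pr (sa_const_mor Q))
    (kappa : frobComparison S T)
    (L : kaehler Q)
    (Lam : extPower L i)
    (phiLam : baseChange (fp_r T) Lam).

Definition dform n j : pr_omega dR j n -> pr_omega dR j.+1 n := fun v => pr_d dR j n v.
Fact dformD n j : {morph @dform n j : u v / u + v}.
Proof. by move=> u v; apply: (raddfD (pr_d dR j n)). Qed.

Lemma level_cartier n : exists _ : cartier_data p_pr (cr_str Z n) (@pr_delta _ _ _ _ _ _ dR n)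
  (fun j => @ep_w _ _ _ (pr_omega dR j) n) (fun j => mkadd (@dformD n j)), True.
Proof.
have [c] := cartier_exists (d := fun j => mkadd (@dformD n j)) p_pr (cr_base_free Z n)
  (cr_tot_free Z n) (@pr_delta_univ _ _ _ _ _ _ dR n) (fun j => ep_univ (pr_omega dR j) n)
  (fun j b t => @pr_dE _ _ _ _ _ _ dR j n b t).
by exists c.
Qed.
Definition ctier n := projT1 (cid (level_cartier n)).

Local Notation Xs := (sltriple p_pr (cr_str Z)).
Local Notation Ys := (sctriple p_pr Q).

Definition cmp_tmor n : tmor (Xs n) (Ys n) :=
  @TMor (Xs n) (Ys n) (cr_base_aug Z n) (pm_quo (cr_base_aug Z n)) (ct_cmp Q n)
    (pd_frob_nat p_pr (cr_base_aug Z n)) (@ct_cmp_in _ _ _ _ Q n).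
Fact cmp_tmor_nat m n (t : simplexMap m n) :
  teq (tcmp (st_map Xs t) (cmp_tmor m)) (tcmp (cmp_tmor n) (st_map Ys t)).
Proof.
by split=> x; [apply: (spm_nat (cr_base_aug Z))|apply: (spm_quo_nat (cr_base_aug Z))|apply: (srm_nat (ct_cmp Q))].
Qed.
Definition cmp_stmor : stmor Xs Ys := STMor cmp_tmor_nat.

Lemma cmp_hisoA : tf_hiso tfA cmp_stmor.
Proof.
have h := sr_weq_hiso (cr_base_weq Z).1.
pose u : samor (tf_sact tfA Xs) (sr_sact (sp_ring (cr_base Z))) :=
  @SAMor (tf_sact tfA Xs) (sr_sact (sp_ring (cr_base Z))) (fun n => idfun) (fun _ _ _ _ => erefl).
pose v : samor (tf_sact tfA Ys) (sr_sact (sp_ring (spd_const P))) :=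
  @SAMor (tf_sact tfA Ys) (sr_sact (sp_ring (spd_const P))) (fun n => idfun) (fun _ _ _ _ => erefl).
by apply: (samor_hiso_conj (u := u) (v := v) _ _ _ h) => // n; exists idfun.
Qed.
Lemma cmp_hisok : tf_hiso tfk cmp_stmor.
Proof.
have h := sr_weq_hiso (cr_base_weq Z).2.
pose u : samor (tf_sact tfk Xs) (sr_sact (sp_quo (cr_base Z))) :=
  @SAMor (tf_sact tfk Xs) (sr_sact (sp_quo (cr_base Z))) (fun n => idfun) (fun _ _ _ _ => erefl).
pose v : samor (tf_sact tfk Ys) (sr_sact (sp_quo (spd_const P))) :=
  @SAMor (tf_sact tfk Ys) (sr_sact (sp_quo (spd_const P))) (fun n => idfun) (fun _ _ _ _ => erefl).
by apply: (samor_hiso_conj (u := u) (v := v) _ _ _ h) => // n; exists idfun.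
Qed.
(** Both algebras are weakly equivalent to R, compatibly with [ct_cmp], so two out of three
    applies. *)
Lemma cmp_hisoE : tf_hiso tfE cmp_stmor.
Proof.
pose h0 : srMor (sp_quo (cr_tot Z)) R :=
  @SRMor (sp_quo (cr_tot Z)) R (fun n => pm_quo (cr_tot_aug Z n)) (@spm_quo_nat _ _ _ (cr_tot_aug Z)).
have h0w : sr_weq h0 by exact: (cr_tot_weq Z).2.
have hc : sr_hiso (ct_cmp Q).
  apply: (hiso_cancel_l _ (sr_weq_hiso h0w) (sr_weq_hiso (ct_weq Q))) => n x.
  exact/esym/ct_cmp_aug.
pose u : samor (tf_sact tfE Xs) (sr_sact (sp_quo (cr_tot Z))) :=
  @SAMor (tf_sact tfE Xs) (sr_sact (sp_quo (cr_tot Z))) (fun n => idfun) (fun _ _ _ _ => erefl).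
pose v : samor (tf_sact tfE Ys) (sr_sact Q) :=
  @SAMor (tf_sact tfE Ys) (sr_sact Q) (fun n => idfun) (fun _ _ _ _ => erefl).
by apply: (samor_hiso_conj (u := u) (v := v) _ _ _ hc) => // n; exists idfun.
Qed.

Lemma cmp_hisoOm : tf_hiso (tfOm i) cmp_stmor.
Proof.
apply: (Om_hiso p_pr _ _ cmp_hisoA cmp_hisok cmp_hisoE) => n.
- by split; [apply: pd_char|apply: quo_char|apply: quo_char].
- split; [exact: pd_char|exact: quo_char|].
  by rewrite -(rmorph_nat (sa_in Q n)) quo_char rmorph0.
- exact: cpoly (ctier n).
- have [X [x xP]] := ct_poly Q n.
  by exists ({classic X} : choiceType), x; exact: xP.
Qed.

Lemma bcZ n a (x : Lam n) : (bc_in phiLam n (a *: x) : phiLam n) = fp_r T n a *: (bc_in phiLam n x : phiLam n).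
Proof. exact: (linear_scale (bc_in phiLam n)). Qed.
Lemma bcD n (x y : Lam n) : (bc_in phiLam n (x + y) : phiLam n) = (bc_in phiLam n x : phiLam n) + bc_in phiLam n y.
Proof. exact: (raddfD (bc_in phiLam n)). Qed.
Lemma bc0 n : (bc_in phiLam n 0 : phiLam n) = 0.
Proof. exact: (raddf0 (bc_in phiLam n)). Qed.

Definition jdat n (a : pd_ring P) (b : Q n) (x : {ffun 'I_i -> Q n}) : phiLam n :=
  (fp_l T n a * fp_r T n b) *: (bc_in phiLam n (ep_w Lam (fmap_ff (@ka_d _ _ L n) x)) : phiLam n).
Lemma jdatP n : fdatum (tphi (Ys n)) (tio (Ys n)) (@jdat n).
Proof.
have wA := (ep_univ Lam n).1; have [[kD kM kC] _] := ka_univ L n.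
split.
- by move=> b x u v; rewrite /jdat rmorphD mulrDl scalerDl.
- by move=> a x u v; rewrite /jdat rmorphD mulrDr scalerDl.
- move=> c a b x; rewrite /jdat; congr (_ *: _); rewrite !rmorphM.
  rewrite [X in X * _ * _](_ : _ = fp_r T n (sa_in Q n c)); last exact: (fp_tensor T n).1.
  by rewrite mulrA [_ * fp_l T n a]mulrC.
- by move=> a b x j u v; rewrite /jdat !fmap_upd kD (alt_updD wA) bcD scalerDr.
- move=> a b x j u v; rewrite /jdat !fmap_upd kM (alt_updD wA) !(alt_updZ wA) bcD !bcZ.
  by rewrite scalerDr !scalerA !rmorphM !mulrA.
- by move=> a b x j c; rewrite /jdat fmap_upd [ka_d _ _]kC (alt_upd0 wA) bc0 scaler0.
- move=> a b x l m lm e; rewrite /jdat (wA.2 _ l m lm) ?bc0 ?scaler0 //.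
  by rewrite !ffunE e.
Qed.
Definition jmap n : {additive Om i (Ys n) -> phiLam n} := om_lift (jdatP n).
Lemma jmapE n a b x : jmap n (om (t := Ys n) a b x) = jdat a b x.
Proof. exact: om_liftE. Qed.

(** Both sides are universal alternating data on the ring of P, the monomials and the variables of
    Q: base change makes the tensor product polynomial over the ring of P on the same variables. *)
Lemma jmap_bij n : bijective (jmap n).
Proof.
have [X0 [x xP]] := ct_poly Q n; pose X : choiceType := {classic X0}.
have xP' : poly_on (X := X) (tio (Ys n)) x by exact: xP.
have yP := poly_on_base_change (fp_tensor T n) xP'.
have bU := alt_universal_datum (poly_on_basis yP)
  (base_change_alt_universal
     (exterior_alt_universal (initial_derivation_free xP' (ka_univ L n)) (ep_univ Lam n))
     (@bc_univ _ _ _ _ phiLam n)).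
have [h hb hE] := alt_datum_universal_bij (om_poly_universal i xP') bU.
suff e : h =1 jmap n.
  have [g hg gh] := hb; exists g => v; first by rewrite -e hg.
  by rewrite -e gh.
apply: (om_poly_ext xP') => a m y; rewrite hE jmapE /jdat fmap_ff_comp.
congr ((_ * _) *: _); rewrite /pmon rmorph_mprod; apply: eq_bigr => s _.
by rewrite rmorphXn.
Qed.

Lemma jmap_nat m n (t : simplexMap m n) o : jmap m (Omap i (st_map Ys t) o) = sm_map t (jmap n o).
Proof.
apply: (om_ext (h := jmap m \o Omap i (st_map Ys t))
  (h' := mkadd (@sm_mapD _ phiLam m n t) \o jmap n)) => a b x.
rewrite /= /mkadd_of OmapE !jmapE /jdat sm_mapZ rmorphM -!srm_nat; congr (_ *: _).
rewrite -bc_nat ep_nat; congr (bc_in _ _ (ep_w _ _)); apply/ffunP => j.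
by rewrite !ffunE ka_nat.
Qed.

Local Notation Wm n j := (pr_omega dR j n : lmodType (pd_ring (cr_tot Z n))).
Local Notation stdf n j a b0 b := (@std p (cr_base Z n) (cr_tot Z n) (cr_str Z n) (pr_omega1 dR n)
  (@pr_delta _ _ _ _ _ _ dR n) (fun j => pr_omega dR j n) (fun j => @ep_w _ _ _ (pr_omega dR j) n) j a b0 b).

Lemma std_nat m n (t : simplexMap m n) j a b0 b :
  sm_map t (stdf n j a b0 b) = stdf m j (sp_map _ t a) (sp_map _ t b0) (fmap_ff (sp_map _ t) b).
Proof.
rewrite /std sm_mapZ; congr (_ *: _).
  rewrite [LHS](rmorphM (sp_map (cr_tot Z) t)) rmorphM /= rmorphXn -spm_nat.
  by congr (_ * _); rewrite rmorph_prod; apply: eq_bigr => l _; rewrite ffunE rmorphXn.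
rewrite ep_nat; congr (ep_w _ _); apply/ffunP => l.
by rewrite !ffunE pr_delta_nat.
Qed.

Lemma cth_bdy n j v : bdy (fun j => mkadd (@dformD n j)) v -> cth (ctier n) j v = 0.
Proof. by case: j v => [|j] v /= => [->|[u ->]]; [exact: raddf0|exact: cth_d]. Qed.

Lemma closed_bdy n j (v : pr_omega dR j n) : dform v = 0 ->
  exists2 u, bdy (fun j => mkadd (@dformD n j)) u & v = csec (ctier n) j (cth (ctier n) j v) + u.
Proof.
by move=> v0; exists (v - csec (ctier n) j (cth (ctier n) j v)); [apply: cclosed|rewrite addrC subrK].
Qed.

(** A closed form is a sum of standard forms plus an exact form. Simplicial maps preserve exactness,
    and on standard forms both sides are given by the same formula without variables. *)
Lemma cth_nat m n (t : simplexMap m n) j (v : pr_omega dR j n) : dform v = 0 ->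
  cth (ctier m) j (sm_map t v) = Omap j (st_map Xs t) (cth (ctier n) j v).
Proof.
move=> /closed_bdy [u ub vE]; rewrite {1}vE sm_mapD raddfD /= [X in _ + X]cth_bdy ?addr0.
  set o := cth _ _ v.
  have := @csec_ext p p_pr _ _ _ _ _ _ _ _ (ctier n) j _
    (cth (ctier m) j \o mkadd (@sm_mapD _ (pr_omega dR j) m n t))
    (Omap j (st_map Xs t) \o cth (ctier n) j) _ o.
  rewrite /= cth_sec; apply=> a b0 b /=.
  rewrite /mkadd_of std_nat !cth_std OmapE /=; congr om; first by rewrite pm_pi.
  by apply/ffunP => l; rewrite !ffunE [RHS]pm_pi.
case: j v u ub vE => [|j] v u /= ub _; first by rewrite ub sm_map0.
have [u' ->] := ub; exists (sm_map t u').
exact: (esym (@pr_d_nat _ _ _ _ _ _ dR j m n t u')).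
Qed.

Definition cartier_cmp n : {additive pr_omega dR i n -> phiLam n} :=
  jmap n \o (Omap i (cmp_tmor n) \o cth (ctier n) i).

(** The scalars for which this holds form a subring, so only the two kinds of generators of the
    tensor product remain. On a standard form the first multiplies a; the second acts through a p-th
    power and multiplies b0. *)
Lemma theta_scale n (s : S n) (v : pr_omega dR i n) : dform v = 0 ->
  cartier_cmp n (psi n s *: v) = kappa n s *: cartier_cmp n v.
Proof.
pose U : {pred S n} := fun s => `[< forall v : pr_omega dR i n, dform v = 0 ->
  cartier_cmp n (psi n s *: v) = kappa n s *: cartier_cmp n v >].
have dZ s' v' : dform (psi n s' *: v' : pr_omega dR i n) = psi n s' *: dform v'.
  exact: (linear_scale (pr_d dR i n) s' v').
have Uc : subring_closed U.
  split=> [|s1 s2|s1 s2].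
  - by apply/asboolP => v' _; rewrite !rmorph1 !scale1r.
  - move=> /asboolP h1 /asboolP h2; apply/asboolP => v' v0.
    by rewrite !rmorphB !scalerBl [LHS](raddfB (cartier_cmp n)) h1 // h2.
  - move=> /asboolP h1 /asboolP h2; apply/asboolP => v' v0.
    rewrite !rmorphM -!scalerA h1 ?h2 //; by rewrite dZ v0 scaler0.
have gen s' : (forall a b0 b, cartier_cmp n (psi n s' *: stdf n i a b0 b) = kappa n s' *: cartier_cmp n (stdf n i a b0 b)) -> s' \in U.
  move=> h; apply/asboolP => v' /closed_bdy [u ub ->].
  have aD : {morph (fun w : pr_omega dR i n => psi n s' *: w) : x y / x + y} by move=> x y; rewrite scalerDr.
  have kD : {morph (fun w : phiLam n => kappa n s' *: w) : x y / x + y} by move=> x y; rewrite scalerDr.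
  have e := @csec_ext p p_pr _ _ _ _ _ _ _ _ (ctier n) i _ (cartier_cmp n \o mkadd aD) (mkadd kD \o cartier_cmp n) h.
  have tD x y : cartier_cmp n (x + y) = cartier_cmp n x + cartier_cmp n y by exact: raddfD.
  rewrite scalerDr !tD scalerDr.
  congr (_ + _); first exact: e.
  rewrite /cartier_cmp /= !cth_bdy ?raddf0 ?scaler0 //.
  case: (i) u ub => [|j] u /= ub; first by rewrite ub scaler0.
  have [u' ->] := ub; exists (psi n s' *: u').
  exact/esym/(linear_scale (pr_d dR j n) s' u').
move=> v0; have : s \in U; last by move/asboolP; apply.
have thE a b0 b : cartier_cmp n (stdf n i a b0 b) = jdat (cr_base_aug Z n a) (ct_cmp Q n (pd_pi _ b0))
    (fmap_ff (ct_cmp Q n) (fmap_ff (pd_pi _) b)).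
  by rewrite /cartier_cmp /= cth_std OmapE jmapE.
apply: (tensor_generated (fp_tensor S n) Uc) => [a'|b'] {s v v0}; apply: gen => a b0 b.
- have -> : psi n (fp_l S n a') *: stdf n i a b0 b = stdf n i (a' * a) b0 b.
    by rewrite fl_l /std scalerA rmorphM !mulrA.
  by rewrite !thE /jdat fc_l scalerA rmorphM (rmorphM (fp_l T n)) !mulrA.
- have [b1 <-] := pd_surj b'.
  have -> : psi n (fp_r S n (pd_pi _ b1)) *: stdf n i a b0 b = stdf n i a (b1 * b0) b.
    rewrite fl_r /std pd_frobE // scalerA exprMn; congr (_ *: _).
    by rewrite !mulrA [b1 ^+ p * _]mulrC.
  rewrite !thE /jdat fc_r scalerA rmorphM (rmorphM (ct_cmp Q n)) (rmorphM (fp_r T n)) !mulrA.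
  by rewrite [fp_l _ _ _ * fp_r _ _ _]mulrC.
Qed.

Lemma whitehead_cases j n (x : pr_omega dR j n) :
  whitehead_pred (C := pr_cpx dR) (- i%:Z) x = [|| (j < i)%N, (j == i) && (dform x == 0) | x == 0].
Proof.
rewrite /whitehead_pred.
have -> : (- i%:Z < - j%:Z) = (j < i)%N by lia.
have -> : (- i%:Z == - j%:Z) = (j == i) by lia.
case: ltngtP => //= _; rewrite orb_idr // => /eqP ->.
by rewrite [X in X == 0](raddf0 (pr_d dR j n)).
Qed.
Lemma whitehead_cases1 j n (x : pr_omega dR j n) :
  whitehead_pred (C := pr_cpx dR) (- i%:Z + 1) x =
  [|| (j.+1 < i)%N, (j.+1 == i) && (dform x == 0) | x == 0].
Proof.
rewrite /whitehead_pred.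
have -> : (- i%:Z + 1 < - j%:Z) = (j.+1 < i)%N by lia.
have -> : (- i%:Z + 1 == - j%:Z) = (j.+1 == i) by lia.
case: ltngtP => //= _; rewrite orb_idr // => /eqP ->.
by rewrite [X in X == 0](raddf0 (pr_d dR j n)).
Qed.

Local Notation sub := (subcpx (whitehead (pr_cpx dR) (- i%:Z))).
Definition wlift j n (y : gr j n) : sub j n := projT1 (cid (wg_surj y)).
Lemma wliftK j n (y : gr j n) : wg_proj gr j n (wlift y) = y.
Proof. exact: projT2 (cid (wg_surj y)). Qed.
Definition wval j n (y : gr j n) : pr_omega dR j n := ss_val (wlift y).
Definition wform n := @wval i n.

Definition welt j n (x : pr_omega dR j n) (h : [|| (j < i)%N, (j == i) && (dform x == 0) | x == 0]) : sub j n :=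
  @SsElt _ _ (whitehead (pr_cpx dR) (- i%:Z)) j n x (etrans (whitehead_cases x) h).

Lemma wker j n (x : sub j n) : wg_proj gr j n x = 0 <->
  [|| (j.+1 < i)%N, (j.+1 == i) && (dform (ss_val x) == 0) | ss_val x == 0 :> pr_omega dR j n].
Proof. by split=> [/wg_ker|h]; [|apply/wg_ker]; rewrite whitehead_cases1. Qed.

Lemma wker_i j n (x : sub j n) : j = i -> wg_proj gr j n x = 0 -> ss_val x = 0.
Proof. by move=> ji /wker => /or3P [|/andP[]|/eqP //]; lia. Qed.

(** In degree i the next step of the Whitehead tower is zero, so the projection to the graded piece
    is injective and the chosen lift is the only one. *)
Lemma wval_proj j n (x : sub j n) : j = i -> wval (wg_proj gr j n x) = ss_val x.
Proof.
move=> ji; have /(wker_i ji) : wg_proj gr j n (wlift (wg_proj gr j n x) - x) = 0.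
  by rewrite raddfB /= wliftK subrr.
by move/eqP; rewrite [ss_val _](raddfB (val : {additive sub j n -> pr_cpx dR j n})) subr_eq0 => /eqP.
Qed.
Lemma wform_proj n (x : sub i n) : wform (wg_proj gr i n x) = ss_val x.
Proof. exact: wval_proj. Qed.

Lemma wform_closed n (y : gr i n) : dform (wform y) = 0.
Proof.
have := ss_valP (wlift y); rewrite [_ \in _]whitehead_cases ltnn eqxx /=.
by case/orP => /eqP // e; rewrite /wform /wval e [LHS](raddf0 (pr_d dR i n)).
Qed.

Lemma wformP n a (y y' : gr i n) : wform (a *: y + y') = psi n a *: wform y + wform y'.
Proof.
by rewrite -{1}[y]wliftK -{1}[y']wliftK -(linearP (wg_proj gr i n)) wform_proj.
Qed.
Lemma wformD n : {morph @wform n : y y' / y + y'}.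
Proof. by move=> y y'; have := wformP 1 y y'; rewrite rmorph1 !scale1r. Qed.
Lemma wform_nat m n (t : simplexMap m n) (y : gr i n) : wform (sm_map t y) = sm_map t (wform y).
Proof. by rewrite -{1}[y]wliftK -scm_nat wform_proj. Qed.

Definition qmap n : {additive gr i n -> Om i (Xs n)} := cth (ctier n) i \o mkadd (@wformD n).
Lemma qmap_nat m n (t : simplexMap m n) (y : gr i n) :
  qmap m (sm_map t y) = Omap i (st_map Xs t) (qmap n y).
Proof. by rewrite /qmap /= /mkadd_of wform_nat cth_nat // wform_closed. Qed.
Definition qsam : samor (sm_sact (gr i)) (tf_sact (tfOm i) Xs) :=
  @SAMor (sm_sact (gr i)) (tf_sact (tfOm i) Xs) qmap qmap_nat.

Lemma qmap_surj n (o : Om i (Xs n)) : exists y, qmap n y = o.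
Proof.
have h : [|| (i < i)%N, (i == i) && (dform (csec (ctier n) i o) == 0) | csec (ctier n) i o == 0].
  by rewrite ltnn eqxx /= [dform _](cd_sec (ctier n)) eqxx.
by exists (wg_proj gr i n (welt h)); rewrite /qmap /= /mkadd_of wform_proj /= cth_sec.
Qed.

(** The graded piece consists of the forms of degree i - 1 modulo closed ones, mapping by d to the
    closed forms of degree i. *)
Lemma gr_zero j n (y : gr j n) : j <> i -> j.+1 <> i -> y = 0.
Proof.
move=> ji ji1; rewrite -[y]wliftK; apply/wker.
have := ss_valP (wlift y); rewrite [_ \in _]whitehead_cases => /or3P [h|/andP[/eqP //]|->]; rewrite ?orbT //.
by rewrite (_ : (j.+1 < i)%N) //; lia.
Qed.

Lemma wval_pd j n (v : forall j, gr j n) : j = i -> bdy (fun j => mkadd (@dformD n j)) (wval (pd_of v j)).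
Proof.
case: j => [|j] ji /=; first by rewrite -(raddf0 (wg_proj gr 0%N n)) wval_proj.
exists (ss_val (wlift (v j))).
by rewrite -[v j in LHS]wliftK -scm_d wval_proj.
Qed.

Lemma bdy_wval j n (y : gr j n) : j = i -> bdy (fun j => mkadd (@dformD n j)) (wval y) ->
  exists v : forall j, gr j n, y = pd_of v j.
Proof.
case: j y => [|j] y ji /= => [y0|[u yu]].
  exists (fun j => 0); rewrite -[y]wliftK (_ : wlift y = 0) ?raddf0 //.
  exact: val_inj.
have h : [|| (j < i)%N, (j == i) && (dform u == 0) | u == 0] by rewrite -ji ltnSn.
exists (put (V := fun j => gr j n) (wg_proj gr j n (welt h))).
by rewrite /= put_eq -scm_d -[y]wliftK; congr (wg_proj _ _ _ _); apply: val_inj.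
Qed.

(** A form of degree i - 1 whose differential vanishes is closed, and closed forms of that degree
    were divided out. *)
Lemma pd_of_inj n (v : forall j, gr j n) : pd_of v i = 0 -> forall j, j.+1 = i -> v j = 0.
Proof.
move=> v0 j ji; have {v0} : pd_of v j.+1 = 0 by move: v0; rewrite ji.
rewrite /= -[v j]wliftK -scm_d => /(wker_i ji) h; apply/wker.
by apply/or3P; apply: Or32; rewrite [dform _]h eqxx andbT; apply/eqP.
Qed.

Local Notation M := (sm_res kappa phiLam).
Definition tmap n : {additive Om i (Xs n) -> phiLam n} := jmap n \o Omap i (cmp_tmor n).
Lemma tmap_nat m n (t : simplexMap m n) o : tmap m (Omap i (st_map Xs t) o) = sm_map t (tmap n o).
Proof. by rewrite /= -jmap_nat (samE (tf_samor (tfOm i) cmp_stmor) t). Qed.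

Definition shsub := SCSub (@shift_closed _ M i) (@shift_map _ M i) (@shift_d _ M i).
Fact shift_at n (x : M n) : @shift_pred _ M i i n x.
Proof. by rewrite /shift_pred eqxx. Qed.
Definition shin n (x : phiLam n) : shift_cpx M i i n := @SsElt _ _ shsub i n x (shift_at x).
Fact shinD n : {morph @shin n : x y / x + y}.
Proof. by move=> x y; apply: val_inj. Qed.

Definition vmap n : {additive Om i (Ys n) -> shift_cpx M i i n} := mkadd (@shinD n) \o jmap n.
Fact vmap_nat m n (t : simplexMap m n) o :
  vmap m (Omap i (st_map Ys t) o) = sm_map t (vmap n o).
Proof. by apply: val_inj; rewrite /= jmap_nat. Qed.
Definition vsam : samor (tf_sact (tfOm i) Ys) (sm_sact (shift_cpx M i i)) :=
  @SAMor (tf_sact (tfOm i) Ys) (sm_sact (shift_cpx M i i)) vmap vmap_nat.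
Lemma vmap_bij n : bijective (vmap n).
Proof.
have [g gK Kg] := jmap_bij n; exists (fun y : shift_cpx M i i n => g (@ss_val _ _ shsub i n y)) => [o|y] /=; first exact: gK.
by apply: val_inj; apply: Kg.
Qed.

Definition rmap n : {additive Om i (Xs n) -> shift_cpx M i i n} := vmap n \o Omap i (cmp_tmor n).
Fact rmap_nat m n (t : simplexMap m n) o : rmap m (Omap i (st_map Xs t) o) = sm_map t (rmap n o).
Proof. by apply: val_inj; apply: tmap_nat. Qed.
Definition rsam : samor (tf_sact (tfOm i) Xs) (sm_sact (shift_cpx M i i)) :=
  @SAMor (tf_sact (tfOm i) Xs) (sm_sact (shift_cpx M i i)) rmap rmap_nat.
Lemma rsam_hiso : hiso (sschmap (samor_smap rsam)).
Proof. exact: (hiso_comp _ cmp_hisoOm (samor_bij_hiso (f := vsam) vmap_bij)). Qed.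

Definition gmap n (y : gr i n) : phiLam n := tmap n (qmap n y).
Lemma gmapP n a (y y' : gr i n) : gmap (a *: y + y') = kappa n a *: gmap y + gmap y'.
Proof.
have tD u v : cartier_cmp n (u + v) = cartier_cmp n u + cartier_cmp n v by exact: raddfD.
rewrite -[gmap (_ + _)]/(cartier_cmp n (wform _)) wformP tD theta_scale //; exact: wform_closed.
Qed.
Lemma gmap0 n : gmap (0 : gr i n) = 0. Proof. exact: (raddf0 (tmap n \o qmap n)). Qed.

(** Through [put] a single formula gives [gmap] in degree i and 0 in all other degrees, without a
    cast in the target. *)
Definition fval j n (y : gr j n) : M n := gmap (put (V := fun j => gr j n) y i).
Lemma fval_ne j n (y : gr j n) : j <> i -> fval y = 0.
Proof. by move=> ji; rewrite /fval put_ne ?gmap0 // => /esym. Qed.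
Lemma fval_eq n (y : gr i n) : fval y = gmap y.
Proof. by rewrite /fval put_eq. Qed.
Fact fval_shift j n (y : gr j n) : @shift_pred _ M i j n (fval y).
Proof.
rewrite /shift_pred; case: eqP => //= ji; by rewrite fval_ne.
Qed.
Definition fgr j n (y : gr j n) : shift_cpx M i j n := @SsElt _ _ shsub j n (fval y) (fval_shift y).
Lemma fgr_linear j n : linear (@fgr j n).
Proof.
move=> a y y'; apply: val_inj; rewrite /=.
have [ji|/eqP ji] := eqVneq j i; last by rewrite !fval_ne // scaler0 addr0.
by subst j; rewrite !fval_eq; apply: gmapP.
Qed.
Lemma fgr_nat j m n (t : simplexMap m n) (y : gr j n) :
  mklin (@fgr_linear j m) (sm_map t y) = sm_map t (mklin (@fgr_linear j n) y).
Proof.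
apply: val_inj; rewrite -[LHS]/(fval (sm_map t y)) -[RHS]/(sm_map t (fval y)).
have [ji|/eqP ji] := eqVneq j i; last by rewrite !fval_ne // sm_map0.
subst j; rewrite !fval_eq /gmap qmap_nat; exact: tmap_nat.
Qed.
Lemma fval_bdy j n (y : gr j n) : j = i -> bdy (fun j => mkadd (@dformD n j)) (wval y) -> fval y = 0.
Proof.
move=> ji yb; subst j.
by rewrite fval_eq /gmap (_ : qmap n y = 0) ?(raddf0 (tmap n)) //; apply: cth_bdy.
Qed.
Lemma fgr_d j n (y : gr j n) :
  mklin (@fgr_linear j.+1 n) (sc_d gr j n y) = sc_d (shift_cpx M i) j n (mklin (@fgr_linear j n) y).
Proof.
apply: val_inj; rewrite -[LHS]/(fval (sc_d gr j n y)) -[RHS]/(0 : M n).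
have [ji|/eqP ji] := eqVneq j.+1 i; last by rewrite fval_ne.
apply: fval_bdy => //.
by have := wval_pd (put (V := fun j => gr j n) y) ji; rewrite /= put_eq.
Qed.
Definition fmor : scMor gr (shift_cpx M i) :=
  @SCMor _ gr (shift_cpx M i) (fun j n => mklin (@fgr_linear j n)) fgr_nat fgr_d.

(** The map factors through the forms of the quotient rings of Z: the Cartier isomorphism identifies
    them with the cokernel of the graded piece, and [cmp_hisoOm] compares them with the forms over
    Q. *)
Theorem fmor_qis : sc_qis fmor.
Proof.
apply: (total_qis (i := i) (q := sschmap (samor_smap qsam)) (r := sschmap (samor_smap rsam))).
- by move=> n x; apply: val_inj; rewrite -[LHS]/(fval x) fval_eq.
- exact: qmap_surj.
- exact: gr_zero.
- move=> j n x ji; apply: val_inj; have := ss_valP x.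
  by rewrite [_ \in _]/(shift_pred _ _) /shift_pred => /orP[/eqP //|/eqP].
- by move=> n v; apply: cth_bdy; apply: wval_pd.
- move=> n x x0; apply: bdy_wval => //.
  have := @cclosed p p_pr _ _ _ _ _ _ _ _ (ctier n) i _ (wform_closed x).
  by rewrite [cth _ _ _]x0 raddf0 subr0.
- exact: pd_of_inj.
- exact: rsam_hiso.
Qed.
End Comparison.

Theorem theorem1p7 (p : nat) (p_pr : prime p) (P : pdPair p)
    (R : sAlg (pd_quo P)) (i : nat)
    (Z : crysResolution R)
    (S : frobPullback p_pr (spm_quo (cr_str Z)))
    (psi : frobLinearization S)
    (dR : pdDeRham (cr_str Z) psi)
    (gr : whiteheadGr (pr_cpx dR) (- i%:Z))
    (Q : cotResolution Z)
    (T : frobPullback p_pr (sa_const_mor Q))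
    (kappa : frobComparison S T)
    (L : kaehler Q)
    (Lam : extPower L i)
    (phiLam : baseChange (fp_r T) Lam) :
  (forall x, pd_frobm p_pr P (pd_pi P x) = x ^+ p) /\
  sc_equiv gr (shift_cpx (sm_res kappa phiLam) i).
Proof.
split=> [x|]; first exact: pd_frobE.
exact: sc_equiv_fwd (fmor_qis gr kappa phiLam) (sc_equiv_refl _).
Qed.
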